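(* Let $d\ge3$ and let $V(x)=\Phi(g(x))$, $x\in\mathbb R^d$, where: (a) $g$ is a real stationary Gaussian field on $\mathbb R^d$ with zero mean and unit variance whose auto-covariance function $R_g(x)=\mathbb E\{g(0)g(x)\}$ satisfies $|R_g(x)|\le C\prod_{i=1}^d\min(1,|x_i|^{-\alpha_i})$ for some constant $C$, with $\alpha_i\in(0,1)$, and $R_g(x)\sim c_d\prod_{i=1}^d|x_i|^{-\alpha_i}$ as $\min_{i}|x_i|\to\infty$ for some constant $c_d>0$; moreover $\alpha:=\sum_{i=1}^d\alpha_i\in(0,2)$; (b) $\Phi:\mathbb R\to\mathbb R$ is a deterministic function of Hermite rank $1$: $\int_{\mathbb R}\Phi^2(x)\frac{1}{\sqrt{2\pi}}e^{-x^2/2}dx<\infty$ and, with $V_k=\mathbb E\{\Phi(g(0))H_k(g(0))\}$, one has $V_0=0$ and $V_1\ne0$. Let $f\in C_b(\mathbb R^d)$ and let $$u_\varepsilon(t,x)=\mathbb E_B\Big\{f(x+B_t)\exp\Big(\frac{i}{\varepsilon^{\alpha/2}}\int_0^tV\Big(\frac{x+B_s}{\varepsilon}\Big)ds\Big)\Big\}$$ be the Feynman-Kac solution of $\partial_tu_\varepsilon=\frac12\Delta u_\varepsilon+\frac{i}{\varepsilon^{\alpha/2}}V(\frac{x}{\varepsilon})u_\varepsilon$, $u_\varepsilon(0,\cdot)=f$. Then, for every $t>0$ and $x\in\mathbb R^d$, $u_\varepsilon(t,x)\to u_{spde}(t,x)$ in distribution as $\varepsilon\to0$, where $u_{spde}$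 is the (Feynman-Kac) solution of the SPDE with multiplicative noise (product in the Stratonovich sense) $$\partial_tu_{spde}=\tfrac12\Delta u_{spde}+iV_1\sqrt{c_d}\,\dot W\,u_{spde},\qquad u_{spde}(0,\cdot)=f,$$ namely $$u_{spde}(t,x)=\mathbb E_B\Big\{f(x+B_t)\exp\Big(iV_1\sqrt{c_d}\int_0^t\int_{\mathbb R^d}\delta(y-x-B_s)W(dy)ds\Big)\Big\},$$ and $\dot W$ is a generalized Gaussian random field with covariance function $\mathbb E\{\dot W(x)\dot W(y)\}=\prod_{i=1}^d|x_i-y_i|^{-\alpha_i}$.
   Context: $H_k(x)=(-1)^ke^{x^2/2}\frac{d^k}{dx^k}e^{-x^2/2}$ is the $k$-th Hermite polynomial. $a\sim b$ means $a/b\to1$. The field $g$ is taken jointly measurable, so that the integrals along Brownian paths make sense. $B$ is a standard $d$-dimensional Brownian motion started at $0$, independent of $g$ and of $W$; $\mathbb E_B$ is expectation with respect to $B$ only. $W(dy)$ (formally $\dot W(y)dy$) is the centered generalized Gaussian field with $\mathbb E\{W(dx)W(dy)\}=\prod_{i=1}^d|x_i-y_i|^{-\alpha_i}dxdy$, i.e. for test functions $\phi,\psi$, $\mathbb E\{W(\phi)W(\psi)\}=\iint\phi(x)\psi(y)\prod_i|x_i-y_i|^{-\alpha_i}dxdy$. The random variable $\int_0^t\int_{\mathbb R^d}\delta(y-x-B_s)W(dy)ds$ is defined as the limit, in $L^2$ of the product probability space of $W$ and $B$, of $\int_0^t\int_{\mathbb R^d}q_\eta(y-x-B_s)W(dy)ds$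 as $\eta\to0$, where $q_\eta$ is the density of the centered Gaussian law on $\mathbb R^d$ with covariance $\eta I_d$ (this limit exists under the assumptions on the $\alpha_i$). The solution of the SPDE is by definition the Feynman-Kac expression given in the claim. *)

(* Defs.v *)
From HB Require Import structures.
From mathcomp Require Import all_boot all_order all_algebra.
From mathcomp Require Import complex.
From mathcomp Require Import all_classical all_reals all_analysis.

Set Implicit Arguments.
Unset Strict Implicit.
Unset Printing Implicit Defensive.

Import Order.TTheory GRing.Theory Num.Theory.
Import numFieldNormedType.Exports.

Local Open Scope classical_set_scope.
Local Open Scope ring_scope.

(* Borel sigma-algebra of R^n, realized as 'rV[R]_n: the one generated by the
   coordinate maps, as for n.-tuple R in the library. *)
Definition measure_rV_display : measure_display -> measure_display.
Proof. exact. Qed.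

Section measurable_rV.
Variables (R : realType) (n : nat).

Let coord : 'I_n -> 'rV[R]_n -> R := fun i x => x 0 i.

Let rV_set0 : g_sigma_preimage coord set0.
Proof. exact: sigma_algebra0. Qed.

Let rV_setC A : g_sigma_preimage coord A -> g_sigma_preimage coord (~` A).
Proof. exact: sigma_algebraC. Qed.

Let rV_bigcup (F : (set 'rV[R]_n)^nat) :
  (forall i, g_sigma_preimage coord (F i)) ->
  g_sigma_preimage coord (\bigcup_i (F i)).
Proof. exact: sigma_algebra_bigcup. Qed.

HB.instance Definition _ := @isMeasurable.Build
  (measure_rV_display R.-ocitv.-measurable.-sigma)
  'rV[R]_n (g_sigma_preimage coord) rV_set0 rV_setC rV_bigcup.

Lemma measurable_rV_coord (i : 'I_n) :
  measurable_fun [set: 'rV[R]_n] (fun x : 'rV[R]_n => x 0 i).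
Proof.
move=> _ Y mY; rewrite setTI; apply: sub_sigma_algebra => /=.
rewrite -bigcup_seq/=; exists i => /=; first by rewrite mem_index_enum.
by exists Y => //; rewrite setTI.
Qed.

Lemma measurable_fun_rV d (T : measurableType d) (h : T -> 'rV[R]_n) :
  (forall i, measurable_fun [set: T] (fun w => h w 0 i)) ->
  measurable_fun [set: T] h.
Proof.
move=> mh; have H : g_sigma_preimage (fun i => coord i \o h) `<=` measurable.
  apply: smallest_sub; first exact: sigma_algebra_measurable.
  rewrite -bigcup_seq/=; apply: bigcup_sub => i _.
  by move=> A [A' mA' <-]; exact: mh.
by rewrite g_sigma_preimage_comp in H => _ A mA; apply: H; exists A.
Qed.

End measurable_rV.

Section lebesgue_rV.
Variable R : realType.

Definition rVcons n (p : R * 'rV[R]_n) : 'rV[R]_n.+1 :=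
  \row_i if unlift ord0 i is Some j then p.2 0 j else p.1.

Definition rVuncons n (x : 'rV[R]_n.+1) : R * 'rV[R]_n :=
  (x 0 ord0, \row_j x 0 (lift ord0 j)).

Lemma rVconsK n : cancel (@rVcons n) (@rVuncons n).
Proof.
case=> r v; rewrite /rVuncons mxE unlift_none; congr pair.
by apply/rowP => j; rewrite !mxE liftK.
Qed.

Lemma measurable_rVcons n : measurable_fun setT (@rVcons n).
Proof.
apply: measurable_fun_rV => i; rewrite /rVcons.
under eq_fun do rewrite mxE.
case: unliftP => [j _|_]; last exact: measurable_fst.
exact: (measurableT_comp (@measurable_rV_coord R n j) measurable_snd).
Qed.

Lemma measurable_rVuncons n : measurable_fun setT (@rVuncons n).
Proof.
apply: measurable_fun_pair; first exact: measurable_rV_coord.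
apply: measurable_fun_rV => j; under eq_fun do rewrite mxE.
exact: measurable_rV_coord.
Qed.

Section step.
Variables (n : nat) (mu : {sigma_finite_measure set 'rV[R]_n -> \bar R}).

Definition lebesgue_step : set 'rV[R]_n.+1 -> \bar R :=
  pushforward (@lebesgue_measure R \x mu)%E (@rVcons n).

Let step0 : lebesgue_step set0 = 0%E.
Proof. by rewrite /lebesgue_step /pushforward preimage_set0 measure0. Qed.

Let step_ge0 A : (0 <= lebesgue_step A)%E.
Proof. by rewrite /lebesgue_step /pushforward measure_ge0. Qed.

Let step_sigma_additive : semi_sigma_additive lebesgue_step.
Proof.
have mpre A : measurable A -> measurable (@rVcons n @^-1` A).
  by move=> mA; rewrite -[X in measurable X]setTI; exact: measurable_rVcons.
move=> F mF tF mUF; rewrite /lebesgue_step /pushforward preimage_bigcup.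
apply: measure_semi_sigma_additive.
- by move=> i; exact: mpre.
- apply/trivIsetP => /= i j _ _ ij; rewrite -preimage_setI.
  by move/trivIsetP : tF => /(_ _ _ _ _ ij) ->//; rewrite preimage_set0.
- by rewrite -preimage_bigcup; exact: mpre.
Qed.

HB.instance Definition _ := isMeasure.Build _ _ _
  lebesgue_step step0 step_ge0 step_sigma_additive.

Lemma lebesgue_step_sigma_finite : sigma_finite setT lebesgue_step.
Proof.
have /sigma_finiteP[F [TF ndF Foo]] := sigma_finiteT (@lebesgue_measure R).
have /sigma_finiteP[G [TG ndG Goo]] := sigma_finiteT mu.
exists (fun k => @rVuncons n @^-1` (F k `*` G k)).
  apply/seteqP; split=> // v _.
  have [k _ Fk] : (\bigcup_k F k) (rVuncons v).1 by rewrite -TF.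
  have [l _ Gl] : (\bigcup_l G l) (rVuncons v).2 by rewrite -TG.
  exists (maxn k l) => //; split.
  - by move: Fk; exact/subsetPset/ndF/leq_maxl.
  - by move: Gl; exact/subsetPset/ndG/leq_maxr.
move=> k; have [[mF Fk] [mG Gk]] := (Foo k, Goo k); split.
  rewrite -[X in measurable X]setTI; apply: measurable_rVuncons => //.
  exact: measurableX.
rewrite /lebesgue_step /pushforward -comp_preimage.
rewrite (_ : _ \o _ = id); last by apply/funext => p; exact: rVconsK.
by rewrite preimage_id product_measure1E// lte_mul_pinfty// ge0_fin_numE.
Qed.

HB.instance Definition _ := Measure_isSigmaFinite.Build _ _ _ lebesgue_step
  lebesgue_step_sigma_finite.

End step.

(* n-dimensional Lebesgue measure: Dirac mass on R^0, then iterated products. *)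
Fixpoint lebesgue_rV n : {sigma_finite_measure set 'rV[R]_n -> \bar R} :=
  match n with
  | 0 => \d_(0 : 'rV[R]_0)
  | m.+1 => lebesgue_step (lebesgue_rV m)
  end.

Lemma measurable_rV_box n (A : 'I_n -> set R) : (forall i, measurable (A i)) ->
  measurable [set x : 'rV[R]_n | forall i, A i (x 0 i)].
Proof.
move=> mA; rewrite [X in measurable X](_ : _ =
    \bigcap_(i : 'I_n) [set x : 'rV[R]_n | A i (x 0 i)]); last first.
  by apply/seteqP; split=> x /= H i; [move=> _|]; exact: H.
apply: fin_bigcap_measurable => [|i _]; first exact: finite_finset.
by rewrite -[X in measurable X]setTI; exact: measurable_rV_coord.
Qed.

Lemma lebesgue_rV_box n (A : 'I_n -> set R) : (forall i, measurable (A i)) ->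
  lebesgue_rV n [set x | forall i, A i (x 0 i)] =
  (\prod_(i < n) lebesgue_measure (A i))%E.
Proof.
elim: n A => [|n IH] A mA /=.
  by rewrite big_ord0 diracE mem_set//=; case.
rewrite /lebesgue_step /pushforward big_ord_recl -IH//.
rewrite [X in _ X = _](_ : _ =
  A ord0 `*` [set x : 'rV[R]_n | forall i, A (lift ord0 i) (x 0 i)]).
  have mB := @measurable_rV_box n (fun i => A (lift ord0 i)) (fun i => mA _).
  by rewrite product_measure1E//; exact: mA.
apply/seteqP; split => -[r v] /=.
  move=> H; split; first by have := H ord0; rewrite mxE unlift_none.
  by move=> i; have := H (lift ord0 i); rewrite mxE liftK.
by case=> H0 H i; rewrite mxE; case: unliftP => [j|] ->.
Qed.

End lebesgue_rV.

Section gaussian.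
Context {d : measure_display} {T : measurableType d} {R : realType}.
Variable P : probability T R.

(* Centered Gaussian law on R; the Dirac mass at 0 is the degenerate case. *)
Definition centered_normal (X : T -> R) :=
  measurable_fun setT X /\
  exists2 s : R, 0 <= s & forall A : set R, measurable A ->
    P (X @^-1` A) = if s == 0 then \d_(0 : R) A else normal_prob 0 s A.

Definition centered_gaussian_process (I : Type) (X : I -> T -> R) :=
  forall (k : nat) (c : 'I_k -> R) (x : 'I_k -> I),
    centered_normal (fun w => \sum_(j < k) c j * X (x j) w).

Definition stationary n (X : 'rV[R]_n -> T -> R) :=
  forall (k : nat) (x : 'I_k -> 'rV[R]_n) (z : 'rV[R]_n) (A : 'I_k -> set R),
    (forall j, measurable (A j)) ->
    P (\bigcap_j [set w | A j (X (x j + z) w)]) =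
    P (\bigcap_j [set w | A j (X (x j) w)]).

Definition autocov n (X : 'rV[R]_n -> T -> R) (x : 'rV[R]_n) : R :=
  fine ('E_P[X 0%R \* X x])%E.

(* Standard n-dimensional Brownian motion started at 0; only times s >= 0
   are meaningful. *)
Record brownian_motion n (B : R -> T -> 'rV[R]_n) : Prop := {
  bm_measurable : forall s, 0 <= s -> measurable_fun setT (B s) ;
  bm_start : forall w, B 0 w = 0 ;
  bm_continuous : forall w, {within `[0, +oo[, continuous (B ^~ w)} ;
  bm_indep : forall (k : nat) (s : nat -> R) (A : nat -> set 'rV[R]_n),
    0 <= s 0 -> {homo s : i j / (i <= j)%N >-> i <= j} ->
    (forall j, measurable (A j)) ->
    P (\bigcap_(j < k) [set w | A j (B (s j.+1) w - B (s j) w)]) =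
    (\prod_(j < k) P [set w | A j (B (s j.+1) w - B (s j) w)%R])%E ;
  bm_normal : forall (r s : R) (A : 'I_n -> set R), 0 <= r -> r < s ->
    (forall i, measurable (A i)) ->
    P (\bigcap_i [set w | A i ((B s w - B r w) 0 i)]) =
    (\prod_(i < n) normal_prob 0 (Num.sqrt (s - r)%R) (A i))%E }.

End gaussian.

Section hermite.
Context {R : realType}.

Definition hermite (k : nat) (x : R) : R :=
  (-1) ^+ k * expR (x ^+ 2 / 2) * derive1n k (fun y : R => expR (- (y ^+ 2 / 2))) x.

Definition hermite_coef {d} {T : measurableType d} (P : probability T R)
    (Phi : R -> R) (X : T -> R) (k : nat) : R :=
  fine ('E_P[(Phi \o X) \* (hermite k \o X)])%E.

Definition hermite_rank_one {d} {T : measurableType d} (P : probability T R)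
    (Phi : R -> R) (X : T -> R) :=
  [/\ measurable_fun setT Phi,
      (\int[lebesgue_measure]_y
        (Phi y ^+ 2 * (Num.sqrt (2 * pi))^-1 * expR (- (y ^+ 2 / 2)))%:E < +oo)%E,
      hermite_coef P Phi X 0 = 0 & hermite_coef P Phi X 1 != 0].

End hermite.

Section noise.
Context {R : realType} {n : nat}.
Variable alpha : 'I_n -> R.

Definition riesz_product (z : 'rV[R]_n) : R :=
  \prod_(i < n) `|z 0 i| `^ (- alpha i).

(* The case z_i = 0 is the convention |0|^(- alpha_i) = +oo, whereas
   0 `^ (- a) = 0 in the library for a > 0.  For riesz_product this does not
   matter: it is only used off the Lebesgue-null set where some z_i = 0. *)
Definition truncated_riesz_product (z : 'rV[R]_n) : R :=
  \prod_(i < n)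
    if z 0 i == 0 then 1 else Num.min 1 (`|z 0 i| `^ (- alpha i)).

Local Notation leb2 := (lebesgue_rV R n \x lebesgue_rV R n)%E.

(* Test functions: those for which the covariance integral converges
   absolutely. *)
Definition noise_test (phi : 'rV[R]_n -> R) :=
  measurable_fun setT phi /\
  (\int[leb2]_p (`|phi p.1 * phi p.2| * riesz_product (p.1 - p.2))%:E < +oo)%E.

Definition noise_covariance (phi psi : 'rV[R]_n -> R) : \bar R :=
  (\int[leb2]_p (phi p.1 * psi p.2 * riesz_product (p.1 - p.2))%:E)%E.

(* Density of N(0, eta I_n); normal_pdf takes the standard deviation. *)
Definition heat_kernel (eta : R) (y : 'rV[R]_n) : R :=
  \prod_(i < n) normal_pdf 0 (Num.sqrt eta) (y 0 i).

(* W phi stands for the integral of phi against W(dy).  The last field selects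
   a version of the field for which integrals along paths make sense. *)
Record gaussian_noise {d} {T : measurableType d} (P : probability T R)
    (W : ('rV[R]_n -> R) -> T -> R) : Prop := {
  noise_gaussian : centered_gaussian_process P
    (fun phi : {phi | noise_test phi} => W (sval phi)) ;
  noise_cov : forall phi psi, noise_test phi -> noise_test psi ->
    'E_P[W phi \* W psi]%E = noise_covariance phi psi ;
  noise_measurable : forall eta, 0 < eta ->
    measurable_fun setT (fun p : 'rV[R]_n * T =>
      W (fun y => heat_kernel eta (y - p.1)) p.2) }.

Section noise_along_path.
Context {dW dB : measure_display}.
Context {TW : measurableType dW} {TB : measurableType dB}.
Variables (PW : probability TW R) (PB : probability TB R).
Variables (W : ('rV[R]_n -> R) -> TW -> R) (B : R -> TB -> 'rV[R]_n).
Variables (t : R) (x : 'rV[R]_n).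

Definition mollified_path_integral (eta : R) (w : TW * TB) : R :=
  \int[lebesgue_measure]_(s in `[0, t])
    W (fun y => heat_kernel eta (y - x - B s w.2)) w.1.

Definition is_path_integral (X : TW * TB -> R) :=
  X \in Lfun (PW \x PB)%E 2%:E /\
  'N[(PW \x PB)%E]_2%:E
    [EFin \o (mollified_path_integral eta \- X)%R]%E
    @[eta --> 0^'+] --> (0 : \bar R).

(* The L^2 limit; the default value is immaterial, since the limit exists. *)
Definition path_integral : TW * TB -> R :=
  xget (fun=> 0) [set X | is_path_integral X].

End noise_along_path.
End noise.

Section solutions.
Context {R : realType} {n : nat} {dB : measure_display} {TB : measurableType dB}.
Variables (PB : probability TB R) (B : R -> TB -> 'rV[R]_n).
Variable f : 'rV[R]_n -> R[i].

Definition expi (a : R) : R[i] := Complex (cos a) (sin a).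

Definition complex_expectation (Z : TB -> R[i]) : R[i] :=
  Complex (fine 'E_PB[fun w => complex.Re (Z w)]%E)
          (fine 'E_PB[fun w => complex.Im (Z w)]%E).

(* V is one realization of the potential. *)
Definition u_eps (a eps : R) (V : 'rV[R]_n -> R) (t : R) (x : 'rV[R]_n) : R[i] :=
  complex_expectation (fun w => f (x + B t w) *
    expi (eps `^ (- (a / 2)) *
      \int[lebesgue_measure]_(s in `[0, t]) V (eps^-1 *: (x + B s w)))).

(* wW is the realization of the noise, lam the coupling constant. *)
Definition u_spde {dW} {TW : measurableType dW} (PW : probability TW R)
    (W : ('rV[R]_n -> R) -> TW -> R) (lam : R) (t : R) (x : 'rV[R]_n)
    (wW : TW) : R[i] :=
  complex_expectation (fun w => f (x + B t w) *
    expi (lam * path_integral PW PB W B t x (wW, w))).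

End solutions.

(* R[i]^o is R[i] with its usual topology, given by the modulus. *)
Definition cvg_in_distribution {R : realType} {d1 d2 : measure_display}
    {T1 : measurableType d1} {T2 : measurableType d2}
    (P1 : probability T1 R) (P2 : probability T2 R)
    (Z : R -> T1 -> R[i]) (F : set_system R) (Z0 : T2 -> R[i]) :=
  forall h : R[i]^o -> R, continuous h -> (exists M, forall z, `|h z| <= M) ->
    'E_P1[h \o Z e]%E @[e --> F] --> 'E_P2[h \o Z0]%E.

(* Main.v *)
Require Import Defs.
From HB Require Import structures.
From mathcomp Require Import all_boot all_order all_algebra.
From mathcomp Require Import complex.
From mathcomp Require Import all_classical all_reals all_analysis.
From mathcomp Require Import measurable_realfun ring lra.

Set Implicit Arguments.
Unset Strict Implicit.
Unset Printing Implicit Defensive.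

Import Order.TTheory GRing.Theory Num.Theory.
Import numFieldNormedType.Exports.

Local Open Scope classical_set_scope.
Local Open Scope ring_scope.

(* Freeze the Brownian paths.  The leading part of the phase of u_eps, and the
   phase of u_spde, are then elements of closed Gaussian spaces, and their
   covariances between independent copies of the path are double time integrals
   of kernels evaluated at path increments.  Mixed moments of the real and
   imaginary parts of the solution are means, over several independent copies
   of B, of cosines and sines of such variables, so they depend on these
   covariances only.  All kernels are dominated by a multiple of the Riesz
   product, which is integrable along Brownian increments because
   0 < alpha < 2; hence dominated convergence gives convergence of all moments,
   and since the solutions are bounded, Bernstein polynomials turn this into
   convergence in distribution.  The remainder Phi(x) - V_1 x has Hermite rank
   at least 2: its two-point correlation is at most R_g^2 times its variance, so
   its contribution to the phase vanishes in L^2.  The same covariance formulas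
   applied to the mollified noise show that the L^2 limit defining the phase of
   u_spde exists and has the expected covariances. *)

(** Moments are the natural tool because the two media live on unrelated probability spaces while
    the paths live on a common one: after averaging over a medium only covariances indexed by paths
    remain, and these can be compared directly. The scaling is
    [rho (z / eps) = eps ^ alpha * rho z], which the square of the prefactor [eps ^ (- alpha / 2)]
    cancels; the second factor [R_g] in the correlation of the remainder leaves a power
    [eps ^ alpha] to spare. A time integral of a Gaussian field is not a finite linear combination
    of its values, so Gaussianity is carried to an L2 closure, by a sampling argument. The
    singularity is treated coordinatewise: over a time gap [h] the kernel has mean at most a
    constant times [h ^ (- alpha / 2)], and [alpha / 2 < 1] makes this integrable in time. The bound
    for rank two avoids the Hermite basis: trigonometric polynomials are dense in L2 of the Gaussian
    law, and their two-point correlations are explicit power series in the correlation with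
    nonnegative coefficients. *)

Lemma eq_cvg_seq (R : realType) (f g : R^nat) (l l' : R) : f =1 g -> l = l' ->
  g @ \oo --> l' -> f @ \oo --> l.
Proof. by move=> /funext-> ->. Qed.

Lemma cvgD_seq (R : realType) (f g : R^nat) (l l' : R) :
  f @ \oo --> l -> g @ \oo --> l' -> (fun k => f k + g k) @ \oo --> l + l'.
Proof. by move=> fl gl; exact: cvgD. Qed.

Lemma cvgZ_seq (R : realType) (c : R) (f : R^nat) (l : R) :
  f @ \oo --> l -> (fun k => c * f k) @ \oo --> c * l.
Proof. by move=> fl; apply: cvgM => //; exact: cvg_cst. Qed.

(** * Integrals and square integrable functions *)

Section real_integral.
Context d (T : measurableType d) (R : realType).
Implicit Types (mu : {measure set T -> \bar R}) (f g h : T -> R).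

Definition L1 mu f := mu.-integrable setT (EFin \o f).
Definition Ex mu f : R := \int[mu]_x f x.

Lemma L1_meas mu f : L1 mu f -> measurable_fun setT f.
Proof. by move=> /measurable_int/measurable_EFinP. Qed.

Lemma Ex_EFin mu f : L1 mu f -> (Ex mu f)%:E = (\int[mu]_x (f x)%:E)%E.
Proof. by move=> lf; rewrite /Ex /Rintegral fineK//; exact: integrable_fin_num. Qed.

Lemma eq_Ex mu f g : f =1 g -> Ex mu f = Ex mu g.
Proof. by move=> /funext->. Qed.

Lemma L1_le mu f g : measurable_fun setT f -> (forall x, `|f x| <= g x) ->
  L1 mu g -> L1 mu f.
Proof.
move=> mf fg lg; apply: (le_integrable _ _ _ lg) => //; first exact/measurable_EFinP.
by move=> x _ /=; rewrite lee_fin (le_trans (fg x))// ler_norm.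
Qed.

Lemma L1D mu f g : L1 mu f -> L1 mu g -> L1 mu (fun x => f x + g x).
Proof. by move=> lf lg; exact: (integrableD _ lf lg). Qed.

Lemma L1B mu f g : L1 mu f -> L1 mu g -> L1 mu (fun x => f x - g x).
Proof. by move=> lf lg; exact: (integrableB _ lf lg). Qed.

Lemma L1Z mu c f : L1 mu f -> L1 mu (fun x => c * f x).
Proof. by move=> lf; exact: (integrableZl _ c lf). Qed.

Lemma L1_norm mu f : L1 mu f -> L1 mu (fun x => `|f x|).
Proof. by move=> lf; exact: (integrable_norm lf). Qed.

Lemma L10 mu : L1 mu (fun=> 0).
Proof. by apply: (@integrable0 _ _ _ mu setT). Qed.

Lemma L1_sum mu I (s : seq I) (F : I -> T -> R) :
  (forall i, L1 mu (F i)) -> L1 mu (fun x => \sum_(i <- s) F i x).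
Proof.
move=> lF; elim: s => [|i s IH].
  by under eq_fun do rewrite big_nil; exact: L10.
by under eq_fun do rewrite big_cons; exact: L1D.
Qed.

Lemma L1_ge0 mu f : measurable_fun setT f -> (forall x, 0 <= f x) ->
  (\int[mu]_x (f x)%:E < +oo)%E -> L1 mu f.
Proof.
move=> mf f0 fi; apply/integrableP; split; first exact/measurable_EFinP.
by under eq_integral do rewrite /= ger0_norm//.
Qed.

Lemma ExD mu f g : L1 mu f -> L1 mu g ->
  Ex mu (fun x => f x + g x) = Ex mu f + Ex mu g.
Proof. exact: RintegralD. Qed.

Lemma ExB mu f g : L1 mu f -> L1 mu g ->
  Ex mu (fun x => f x - g x) = Ex mu f - Ex mu g.
Proof. exact: RintegralB. Qed.

Lemma ExZ mu c f : L1 mu f -> Ex mu (fun x => c * f x) = c * Ex mu f.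
Proof. by move=> lf; exact: RintegralZl. Qed.

Lemma ExN mu f : L1 mu f -> Ex mu (fun x => - f x) = - Ex mu f.
Proof.
move=> lf; rewrite -mulN1r -ExZ//; apply: eq_Ex => x; by rewrite mulN1r.
Qed.

Lemma Ex0 mu : Ex mu (fun=> 0) = 0.
Proof. by rewrite /Ex /Rintegral integral0. Qed.

Lemma Ex_sum mu I (s : seq I) (F : I -> T -> R) :
  (forall i, L1 mu (F i)) ->
  Ex mu (fun x => \sum_(i <- s) F i x) = \sum_(i <- s) Ex mu (F i).
Proof.
move=> lF; elim: s => [|i s IH].
  by rewrite big_nil; under eq_Ex do rewrite big_nil; rewrite Ex0.
by rewrite big_cons -IH -ExD//; [apply: eq_Ex => x; rewrite big_cons|exact: L1_sum].
Qed.

Lemma Ex_le mu f g : L1 mu f -> L1 mu g -> (forall x, f x <= g x) ->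
  Ex mu f <= Ex mu g.
Proof. by move=> lf lg fg; apply: le_Rintegral. Qed.

Lemma Ex_ge0 mu f : (forall x, 0 <= f x) -> 0 <= Ex mu f.
Proof. by move=> f0; apply: Rintegral_ge0 => x _. Qed.

Lemma Ex_norm mu f : L1 mu f -> `|Ex mu f| <= Ex mu (fun x => `|f x|).
Proof. by move=> lf; exact: le_normr_Rintegral. Qed.

Lemma Ex_norm_le mu f g : L1 mu f -> L1 mu g -> (forall x, `|f x| <= g x) ->
  `|Ex mu f| <= Ex mu g.
Proof.
move=> lf lg fg; apply: (le_trans (Ex_norm lf)); apply: Ex_le => //; exact: L1_norm.
Qed.

Lemma Ex_ae_eq mu f g : measurable_fun setT f -> measurable_fun setT g ->
  {ae mu, forall x, f x = g x} -> Ex mu f = Ex mu g.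
Proof.
move=> mf mg fg; congr fine; apply: ae_eq_integral => //; [exact/measurable_EFinP..|].
by apply: filterS fg => x /= ->.
Qed.

Lemma L1_ae_eq mu f g : measurable_fun setT f -> L1 mu g ->
  {ae mu, forall x, f x = g x} -> L1 mu f.
Proof.
move=> mf /[dup] lg /L1_meas mg fg.
apply/integrableP; split; first exact/measurable_EFinP.
move/integrableP : lg => [_]; apply: le_lt_trans.
rewrite le_eqVlt; apply/orP; left; apply/eqP; apply: ge0_ae_eq_integral => //.
- by apply/measurable_EFinP; exact: measurableT_comp.
- by apply/measurable_EFinP; exact: measurableT_comp.
- by apply: filterS fg => x /= ->.
Qed.

Lemma Ex_dom mu (f_ : (T -> R)^nat) f g :
  (forall n, measurable_fun setT (f_ n)) -> measurable_fun setT f ->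
  {ae mu, forall x, f_ n x @[n --> \oo] --> f x} -> L1 mu g ->
  (forall n, {ae mu, forall x, `|f_ n x| <= g x}) ->
  L1 mu f /\ Ex mu (f_ n) @[n --> \oo] --> Ex mu f.
Proof.
move=> mf_ mf fc lg fg.
have [|||||] := @dominated_convergence _ _ R mu setT measurableT
   (fun n => EFin \o f_ n) (EFin \o f) (EFin \o g).
- by move=> n; exact/measurable_EFinP.
- exact/measurable_EFinP.
- apply: filterS fc => x fx _; apply: cvg_EFin; last exact: fx.
  by apply: nearW.
- exact: lg.
- have /ae_foralln := fg; apply: filterS => x h n _ /=; rewrite lee_fin; exact: h.
move=> lf _ cf; split=> //; apply: fine_cvg; rewrite fineK; first exact: cf.
apply: integrable_fin_num => //.
Qed.
End real_integral.

Section L2_functions.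
Context d (T : measurableType d) (R : realType).
Implicit Types (mu : {measure set T -> \bar R}) (f g h : T -> R).

Definition L2 mu f := measurable_fun setT f /\ L1 mu (fun x => f x ^+ 2).

Lemma L2_mul mu f g : L2 mu f -> L2 mu g -> L1 mu (fun x => f x * g x).
Proof.
move=> [mf lf] [mg lg].
apply: (L1_le _ _ (L1D lf lg)); first exact: measurable_funM.
move=> x; rewrite normrM -[f x ^+ 2]real_normK ?num_real//.
rewrite -[g x ^+ 2]real_normK ?num_real//.
by have := sqr_ge0 (`|f x| - `|g x|); nra.
Qed.

Lemma L2Z mu c f : L2 mu f -> L2 mu (fun x => c * f x).
Proof.
move=> [mf lf]; split; first exact: measurable_funM.
by under eq_fun do rewrite exprMn; exact: L1Z.
Qed.

Lemma L2D mu f g : L2 mu f -> L2 mu g -> L2 mu (fun x => f x + g x).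
Proof.
move=> lf lg; have [mf ff] := lf; have [mg gg] := lg.
split; first exact: measurable_funD.
under eq_fun do rewrite sqrrD.
apply: L1D => //; apply: L1D => //.
by under eq_fun do rewrite -mulr_natl; apply: L1Z; exact: L2_mul.
Qed.

Lemma L2N mu f : L2 mu f -> L2 mu (fun x => - f x).
Proof. by under [X in _ -> _ _ X]eq_fun do rewrite -mulN1r; exact: L2Z. Qed.

Lemma L2B mu f g : L2 mu f -> L2 mu g -> L2 mu (fun x => f x - g x).
Proof. by move=> lf lg; apply: L2D => //; exact: L2N. Qed.

Lemma L20 mu : L2 mu (fun=> 0).
Proof.
split; first exact: measurable_cst.
by rewrite expr0n/=; exact: L10.
Qed.

Lemma L2_sum mu I (s : seq I) (F : I -> T -> R) :
  (forall i, L2 mu (F i)) -> L2 mu (fun x => \sum_(i <- s) F i x).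
Proof.
move=> lF; elim: s => [|i s IH].
  by under eq_fun do rewrite big_nil; exact: L20.
by under eq_fun do rewrite big_cons; exact: L2D.
Qed.

Lemma L2_le mu f g : measurable_fun setT f -> (forall x, `|f x| <= `|g x|) ->
  L2 mu g -> L2 mu f.
Proof.
move=> mf fg [mg lg]; split => //; apply: (L1_le _ _ lg); first exact: measurable_funX.
move=> x; rewrite normrX -[leRHS]real_normK ?num_real//.
by rewrite ler_sqr ?nnegrE.
Qed.

(** The quadratic form [Ex mu (u f + v g) ^ 2] in [u], [v] is nonnegative. At [u = c], [v = - b] it
    equals [c (a c - b ^ 2)], which settles the case [c > 0]. *)
Lemma cauchy_schwarz mu f g : L2 mu f -> L2 mu g ->
  (Ex mu (fun x => f x * g x)) ^+ 2 <=
  Ex mu (fun x => f x ^+ 2) * Ex mu (fun x => g x ^+ 2).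
Proof.
move=> lf lg; have [mf ff] := lf; have [mg gg] := lg.
have fg := L2_mul lf lg.
set a := Ex mu (fun x => f x ^+ 2); set b := Ex _ _; set c := Ex mu (fun x => g x ^+ 2).
have a0 : 0 <= a by apply: Ex_ge0 => x; rewrite sqr_ge0.
have c0 : 0 <= c by apply: Ex_ge0 => x; rewrite sqr_ge0.
have H u v : 0 <= u ^+ 2 * a + 2 * u * v * b + v ^+ 2 * c.
  have <- : Ex mu (fun x => (u * f x + v * g x) ^+ 2) =
      u ^+ 2 * a + 2 * u * v * b + v ^+ 2 * c.
    rewrite -!ExZ// -!ExD//; do ?[exact: L1Z]; last by apply: L1D; exact: L1Z.
    by apply: eq_Ex => x; ring.
  by apply: Ex_ge0 => x; rewrite sqr_ge0.
clearbody a b c; have [c_eq0|c_neq0] := eqVneq c 0; last first.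
  have c_gt0 : 0 < c by rewrite lt_neqAle eq_sym c_neq0.
  rewrite -subr_ge0 -(pmulr_rge0 _ c_gt0); have := H c (- b).
  by rewrite (_ : c ^+ 2 * a + _ + _ = c * (a * c - b ^+ 2))//; ring.
(* With [c = 0] and [u = 1] the form is affine in [v]: for a nonzero [b] the choice
   [v = - (a + 1) / b] would make it [- a - 2 < 0]. *)
have [->|b_neq0] := eqVneq b 0; first by rewrite expr0n/= mulr_ge0.
have := H 1 (- (a + 1) / b); rewrite c_eq0 mulr0 addr0 expr1n mul1r mulr1.
by rewrite -mulrA divfK//; nra.
Qed.

Lemma cauchy_schwarz_sqrt mu f g : L2 mu f -> L2 mu g ->
  Ex mu (fun x => `|f x * g x|) <=
  Num.sqrt (Ex mu (fun x => f x ^+ 2)) * Num.sqrt (Ex mu (fun x => g x ^+ 2)).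
Proof.
move=> lf lg.
have labs h : L2 mu h -> L2 mu (fun x => `|h x|).
  move=> [mh lh]; split; first exact: measurableT_comp.
  by under eq_fun do rewrite real_normK ?num_real//.
have := cauchy_schwarz (labs _ lf) (labs _ lg).
under eq_Ex do rewrite -normrM.
under [X in _ <= X * _ -> _]eq_Ex do rewrite real_normK ?num_real//.
under [X in _ <= _ * X -> _]eq_Ex do rewrite real_normK ?num_real//.
move=> h; rewrite -sqrtrM; last by apply: Ex_ge0 => x; rewrite sqr_ge0.
rewrite -[leLHS]ger0_norm; last exact: Ex_ge0.
by rewrite -sqrtr_sqr ler_wsqrtr.
Qed.

(** The triangle inequality, squared up to a factor 2, keeps most L2 estimates free of square roots;
    this is why tolerances are later split as [e / 4]. *)
Lemma minkowski2 mu f g : L2 mu f -> L2 mu g ->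
  Ex mu (fun x => (f x + g x) ^+ 2) <=
  2 * Ex mu (fun x => f x ^+ 2) + 2 * Ex mu (fun x => g x ^+ 2).
Proof.
move=> lf lg; have [mf ff] := lf; have [mg gg] := lg.
rewrite -!ExZ// -ExD; [|exact: L1Z..].
apply: Ex_le; first by have [] := L2D lf lg.
  by apply: L1D; exact: L1Z.
by move=> x; have := sqr_ge0 (f x - g x); nra.
Qed.

End L2_functions.

Section probability_integral.
Context d (T : measurableType d) (R : realType) (P : probability T R).
Implicit Types (f g h : T -> R).

Lemma L1_cst c : L1 P (fun=> c).
Proof. exact: (finite_measure_integrable_cst P c measurableT). Qed.

Lemma L1_bnd f c : measurable_fun setT f -> (forall x, `|f x| <= c) -> L1 P f.
Proof. by move=> mf fc; exact: (L1_le mf fc (L1_cst c)). Qed.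

Lemma Ex_cst c : Ex P (fun=> c) = c.
Proof. by rewrite /Ex Rintegral_cst// [X in fine X](probability_setT P) mulr1. Qed.

Lemma L2_cst c : L2 P (fun=> c).
Proof. by split; [exact: measurable_cst|exact: L1_cst]. Qed.

Lemma L2_bnd f c : measurable_fun setT f -> (forall x, `|f x| <= c) -> L2 P f.
Proof.
move=> mf fc; apply: (@L2_le _ _ _ P f (fun=> c)) => //; last exact: L2_cst.
by move=> x; apply: (le_trans (fc x)); exact: ler_norm.
Qed.

Lemma L2_L1 f : L2 P f -> L1 P f.
Proof.
move=> lf; have := L2_mul lf (L2_cst 1).
by under eq_fun do rewrite mulr1.
Qed.

Lemma Ex_sqr_le f : L2 P f -> (Ex P f) ^+ 2 <= Ex P (fun x => f x ^+ 2).
Proof.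
move=> lf; have := cauchy_schwarz lf (L2_cst 1).
under eq_Ex do rewrite mulr1.
by rewrite Ex_cst expr1n mulr1.
Qed.

Lemma Ex_le_cst f c : L1 P f -> (forall x, f x <= c) -> Ex P f <= c.
Proof. by move=> lf fc; rewrite -[leRHS]Ex_cst; apply: Ex_le => //; exact: L1_cst. Qed.

Lemma Ex_norm_cst f c : measurable_fun setT f -> (forall x, `|f x| <= c) ->
  `|Ex P f| <= c.
Proof.
move=> mf fc; rewrite -[leRHS]Ex_cst; apply: Ex_norm_le => //; last exact: L1_cst.
exact: L1_bnd fc.
Qed.

(** If [f] exceeded [c] everywhere, the positive function [f - c] would have integral 0, hence
    vanish off a null set, and the whole space would be null. This picks the sampling points in
    [pmean_sampling]. *)
Lemma Ex_exists_le f c : L1 P f -> Ex P f <= c -> exists x, f x <= c.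
Proof.
move=> lf fc; apply: contrapT => /forallNP h.
have f_gt x : c < f x by rewrite ltNge; exact/negP/h.
have l := L1B lf (L1_cst c).
have /eqP : Ex P (fun x => f x - c) = 0.
  apply/eqP; rewrite eq_le Ex_ge0 ?andbT => [|x]; last by rewrite subr_ge0 ltW.
  by rewrite ExB// ?Ex_cst ?subr_le0//; exact: L1_cst.
move=> /eqP E0.
have : (\int[P]_x `|(f x - c)%:E|)%E = 0%E.
  under eq_integral do rewrite /= ger0_norm ?subr_ge0 1?ltW//.
  by rewrite -Ex_EFin// E0.
move/ae_eq_integral_abs => /(_ measurableT).
case; first exact/measurable_EFinP/(L1_meas l).
move=> A [mA A0 sA].
suff AT : A = setT.
  by move: A0; rewrite AT [LHS](probability_setT P) => /eqP; rewrite onee_eq0.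
apply/seteqP; split=> // x _; apply: sA => /= /(_ I) /eqP.
by rewrite eqe gt_eqF// subr_gt0.
Qed.

End probability_integral.

(** * Fubini and Tonelli for real-valued means *)

Section fubini_real.
Context d1 d2 (T1 : measurableType d1) (T2 : measurableType d2) (R : realType).
Variables (m1 : {sigma_finite_measure set T1 -> \bar R}).
Variables (m2 : {sigma_finite_measure set T2 -> \bar R}).
Implicit Types f : T1 * T2 -> R.

Lemma measurable_Ex2 f : measurable_fun setT f ->
  measurable_fun setT (fun x => Ex m2 (fun y => f (x, y))).
Proof.
move=> mf; apply: measurableT_comp => //.
pose g := EFin \o f.
have mg : measurable_fun setT g by exact/measurable_EFinP.
rewrite (_ : (fun x => _) =
  (fun x => \int[m2]_y g^\+ (x, y) - \int[m2]_y g^\- (x, y))%E).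
  apply: emeasurable_funB; apply: measurable_fun_fubini_tonelli_F => //.
    exact: measurable_funepos.
  exact: measurable_funeneg.
apply/funext => x; rewrite integralE; congr (_ - _)%E; apply: eq_integral => y _.
  by rewrite !funeposE.
by rewrite !funenegE.
Qed.

Lemma measurable_Ex1 f : measurable_fun setT f ->
  measurable_fun setT (fun y => Ex m1 (fun x => f (x, y))).
Proof.
move=> mf; apply: measurableT_comp => //.
pose g := EFin \o f.
have mg : measurable_fun setT g by exact/measurable_EFinP.
rewrite (_ : (fun x => _) =
  (fun y => \int[m1]_x g^\+ (x, y) - \int[m1]_x g^\- (x, y))%E).
  apply: emeasurable_funB; apply: measurable_fun_fubini_tonelli_G => //.
    exact: measurable_funepos.
  exact: measurable_funeneg.
apply/funext => x; rewrite integralE; congr (_ - _)%E; apply: eq_integral => y _.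
  by rewrite !funeposE.
by rewrite !funenegE.
Qed.

Lemma L1_ae1 f : L1 (m1 \x m2)%E f -> {ae m1, forall x, L1 m2 (fun y => f (x, y))}.
Proof. by move=> lf; exact: (ae_integrable1 lf). Qed.

Lemma L1_ae2 f : L1 (m1 \x m2)%E f -> {ae m2, forall y, L1 m1 (fun x => f (x, y))}.
Proof. by move=> lf; exact: (ae_integrable2 lf). Qed.

Lemma Ex_fubini1 f : L1 (m1 \x m2)%E f ->
  L1 m1 (fun x => Ex m2 (fun y => f (x, y))) /\
  Ex (m1 \x m2)%E f = Ex m1 (fun x => Ex m2 (fun y => f (x, y))).
Proof.
move=> lf; have mf := L1_meas lf; have mF := measurable_Ex2 mf.
have ae1 := L1_ae1 lf.
have lF := integrable_fubini_F lf.
(* [Ex] takes [fine] of the inner integral, so the two sides are only known to agree at those [x]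
   whose section is integrable, which is almost every [x]. *)
have aeE : ae_eq m1 setT (fubini_F m2 (EFin \o f))
    (EFin \o (fun x => Ex m2 (fun y => f (x, y)))).
  by apply: filterS ae1 => x lx _; rewrite /= Ex_EFin.
split; last first.
  rewrite /Ex /Rintegral; congr fine; rewrite -[LHS](integral12_prod_meas1 lf).
  apply: ae_eq_integral => //; last exact/measurable_EFinP.
  exact: measurable_int lF.
apply/integrableP; split; first exact/measurable_EFinP.
move/integrableP : (lF) => [mlF]; apply: le_lt_trans.
rewrite le_eqVlt; apply/orP; left; apply/eqP; apply: ge0_ae_eq_integral => //.
- by apply: measurableT_comp => //; exact/measurable_EFinP.
- exact: measurableT_comp.
- by apply: filterS aeE => x /= /(_ I) ->.
Qed.

Lemma Ex_fubini2 f : L1 (m1 \x m2)%E f ->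
  L1 m2 (fun y => Ex m1 (fun x => f (x, y))) /\
  Ex (m1 \x m2)%E f = Ex m2 (fun y => Ex m1 (fun x => f (x, y))).
Proof.
move=> lf; have mf := L1_meas lf; have mF := measurable_Ex1 mf.
have ae1 := L1_ae2 lf.
have aeE : ae_eq m2 setT (fubini_G m1 (EFin \o f))
    (EFin \o (fun y => Ex m1 (fun x => f (x, y)))).
  by apply: filterS ae1 => x lx _; rewrite /= Ex_EFin.
split; last first.
  rewrite /Ex /Rintegral; congr fine; rewrite -[LHS](integral21_prod_meas1 lf).
  apply: ae_eq_integral => //; last exact/measurable_EFinP.
  exact: measurable_fubini_G lf.
apply/integrableP; split; first exact/measurable_EFinP.
have mef : measurable_fun setT (EFin \o f) by exact/measurable_EFinP.
have := (integrable21ltyP m1 m2 mef).1 lf; apply: le_lt_trans.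
apply: ge0_le_integral => //.
- by apply: measurableT_comp => //; exact/measurable_EFinP.
- apply: (@measurable_fun_fubini_tonelli_G _ _ _ _ _ m1 (abse \o (EFin \o f))) => [|p].
    exact: measurableT_comp.
  by rewrite /= lee_fin.
(* Where the inner integral is infinite [fine] makes it 0, so the bound by the integral of the
   absolute value holds at every [y]. *)
- move=> y _ /=; rewrite /Ex /Rintegral.
  have := @le_abse_integral _ _ _ m1 setT (fun x => (f (x, y))%:E) measurableT.
  move=> /= h; apply: le_trans (h _); last first.
    by apply/measurable_EFinP; exact: measurableT_comp.
  by case: (integral _ _ _) => [r||] /=; rewrite ?normr0 ?leey.
Qed.

(** Integrability is required of every section because [Ex] of a function with infinite integral is
    0; otherwise the hypothesis on the iterated mean would control nothing. *)
Lemma L1_tonelli1 f : measurable_fun setT f ->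
  (forall x, L1 m2 (fun y => f (x, y))) ->
  L1 m1 (fun x => Ex m2 (fun y => `|f (x, y)|)) -> L1 (m1 \x m2)%E f.
Proof.
move=> mf l2 l1; apply/integrable12ltyP; first exact/measurable_EFinP.
move/integrableP : (l1) => [_]; apply: le_lt_trans.
rewrite le_eqVlt; apply/orP; left; apply/eqP; apply: eq_integral => x _ /=.
rewrite ger0_norm; last by apply: Ex_ge0.
by rewrite Ex_EFin//; exact: L1_norm.
Qed.

Lemma L1_tonelli2 f : measurable_fun setT f ->
  (forall y, L1 m1 (fun x => f (x, y))) ->
  L1 m2 (fun y => Ex m1 (fun x => `|f (x, y)|)) -> L1 (m1 \x m2)%E f.
Proof.
move=> mf l2 l1; apply/integrable21ltyP; first exact/measurable_EFinP.
move/integrableP : (l1) => [_]; apply: le_lt_trans.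
rewrite le_eqVlt; apply/orP; left; apply/eqP; apply: eq_integral => x _ /=.
rewrite ger0_norm; last by apply: Ex_ge0.
by rewrite Ex_EFin//; exact: L1_norm.
Qed.

Lemma L1_tensor (a : T1 -> R) (b : T2 -> R) : L1 m1 a -> L1 m2 b ->
  L1 (m1 \x m2)%E (fun p => a p.1 * b p.2).
Proof.
move=> la lb; apply: L1_tonelli1 => [|x|] /=.
- apply: measurable_funM.
    exact: (measurableT_comp (L1_meas la)).
  exact: (measurableT_comp (L1_meas lb)).
- exact: L1Z.
- under eq_fun => x do under eq_Ex do rewrite normrM.
  under eq_fun => x do rewrite (ExZ _ (L1_norm lb)) mulrC.
  exact/L1Z/L1_norm.
Qed.

End fubini_real.

Section product_probability.
Context dD dE (D : measurableType dD) (E : measurableType dE) (R : realType).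

(* Naming the product keeps iterated products inside [probability]. *)
Definition pp (Q : probability D R) (PE : probability E R) :
  probability (D * E)%type R := (Q \x PE)%E.

Variables (Q : probability D R) (PE : probability E R).
Implicit Types f : D * E -> R.

Lemma pp_fubini1 f : L1 (pp Q PE) f ->
  L1 Q (fun x => Ex PE (fun y => f (x, y))) /\
  Ex (pp Q PE) f = Ex Q (fun x => Ex PE (fun y => f (x, y))).
Proof. exact: Ex_fubini1. Qed.

Lemma pp_fubini2 f : L1 (pp Q PE) f ->
  L1 PE (fun y => Ex Q (fun x => f (x, y))) /\
  Ex (pp Q PE) f = Ex PE (fun y => Ex Q (fun x => f (x, y))).
Proof. exact: Ex_fubini2. Qed.

Lemma pp_tonelli1 f : measurable_fun setT f ->
  (forall x, L1 PE (fun y => f (x, y))) ->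
  L1 Q (fun x => Ex PE (fun y => `|f (x, y)|)) -> L1 (pp Q PE) f.
Proof. exact: L1_tonelli1. Qed.

Lemma pp_tonelli2 f : measurable_fun setT f ->
  (forall y, L1 Q (fun x => f (x, y))) ->
  L1 PE (fun y => Ex Q (fun x => `|f (x, y)|)) -> L1 (pp Q PE) f.
Proof. exact: L1_tonelli2. Qed.

Lemma pp_tensor (a : D -> R) (b : E -> R) : L1 Q a -> L1 PE b ->
  L1 (pp Q PE) (fun p => a p.1 * b p.2).
Proof. exact: L1_tensor. Qed.

End product_probability.

(** * Change of variables: densities and image measures *)

Section density.
Context d (T : measurableType d) (R : realType).
Variables (mu nu : {measure set T -> \bar R}) (p : T -> R).
Hypotheses (mp : measurable_fun setT p) (p0 : forall x, 0 <= p x).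
Hypothesis nuE : forall A, measurable A -> nu A = (\int[mu]_(x in A) (p x)%:E)%E.

Import HBNNSimple.

Let nnsfun_density (f : {nnsfun T >-> R}) :
  (\int[nu]_x (f x)%:E = \int[mu]_x ((f x)%:E * (p x)%:E))%E.
Proof.
have EFinf x : ((f x)%:E =
    \sum_(k \in range f) k%:E * (\1_(f @^-1` [set k]) x)%:E)%E.
  by rewrite fsumEFin //= fimfunE.
under eq_integral do rewrite EFinf.
rewrite ge0_integral_fsum//=; last 2 first.
- by move=> r; exact/measurable_EFinP/measurableT_comp.
- by move=> r z _; exact: nnfun_muleindic_ge0.
under [RHS]eq_integral => x _.
  rewrite EFinf ge0_mule_fsuml; last by move=> r; exact: nnfun_muleindic_ge0.
  over.
rewrite ge0_integral_fsum//=; last 2 first.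
- move=> r; apply: emeasurable_funM; last exact/measurable_EFinP.
  exact/measurable_EFinP/measurableT_comp.
- by move=> r z _; rewrite mule_ge0 ?lee_fin//; exact: nnfun_muleindic_ge0.
apply: eq_fsbigr => r; rewrite inE => -[x _ <-].
under [RHS]eq_integral do rewrite -muleA.
rewrite !ge0_integralZl_EFin//.
- rewrite integral_indic// setIT nuE// integral_mkcond; congr (_ * _)%E.
  apply: eq_integral => y _; rewrite patchE indicE.
  by case: (y \in _); rewrite ?mul1e ?mul0e.
- by move=> y _; rewrite mule_ge0 ?lee_fin.
- by apply: emeasurable_funM; exact/measurable_EFinP.
- exact/measurable_EFinP.
Qed.

Lemma ge0_integral_density (h : T -> R) : measurable_fun setT h ->
  (forall x, 0 <= h x) -> (\int[nu]_x (h x)%:E = \int[mu]_x (h x * p x)%:E)%E.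
Proof.
move=> mh h0; have mh' : measurable_fun setT (EFin \o h) by exact/measurable_EFinP.
pose f_ := nnsfun_approx measurableT mh'.
transitivity (lim (\int[nu]_x (f_ n x)%:E @[n --> \oo])%E).
  rewrite -monotone_convergence//=.
  - apply: eq_integral => x _; apply/esym/cvg_lim => //=.
    by apply: cvg_nnsfun_approx => // y _; rewrite lee_fin.
  - by move=> n; exact/measurable_EFinP/measurable_funTS.
  - by move=> n x _; rewrite lee_fin.
  - by move=> x _ m n mn; rewrite lee_fin; exact/lefP/nd_nnsfun_approx.
under eq_fun do rewrite nnsfun_density.
rewrite -monotone_convergence//=.
- apply: eq_integral => x _; apply/cvg_lim => //=.
  rewrite EFinM; apply: cvgeZr => //.
  by apply: cvg_nnsfun_approx => // y _; rewrite lee_fin.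
- by move=> n; apply: emeasurable_funM; exact/measurable_EFinP.
- by move=> n x _; rewrite mule_ge0// lee_fin.
- move=> x _ m n mn; apply: lee_wpmul2r; first by rewrite lee_fin.
  by rewrite lee_fin; exact/lefP/nd_nnsfun_approx.
Qed.

Lemma L1_density (h : T -> R) : measurable_fun setT h ->
  (L1 nu h <-> L1 mu (fun x => h x * p x)).
Proof.
move=> mh; split=> /integrableP[_ hi]; apply/integrableP; split.
- by apply/measurable_EFinP; exact: measurable_funM.
- under eq_integral do rewrite /= normrM [X in _ * X]ger0_norm//.
  by rewrite -ge0_integral_density//; exact: measurableT_comp.
- exact/measurable_EFinP.
- rewrite ge0_integral_density//; last exact: measurableT_comp.
  under eq_integral do rewrite -[p _]ger0_norm// -normrM.
  exact: hi.
Qed.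

(** No integrability is assumed: positive and negative parts are transferred separately, so both
    sides receive the same extended values and the same result of [fine]. *)
Lemma Ex_density (h : T -> R) : measurable_fun setT h ->
  Ex nu h = Ex mu (fun x => h x * p x).
Proof.
move=> mh; rewrite /Ex /Rintegral; congr fine.
rewrite integralE [RHS]integralE; congr (_ - _)%E.
- under eq_integral do rewrite funeposE -EFin_max.
  rewrite ge0_integral_density//; last by move=> x; rewrite le_max lexx orbT.
    by apply: eq_integral => x _; rewrite funeposE -EFin_max maxr_pMl// mul0r.
  exact: measurable_maxr.
- under eq_integral do rewrite funenegE -EFinN -EFin_max.
  rewrite ge0_integral_density//; last by move=> x; rewrite le_max lexx orbT.
    by apply: eq_integral => x _; rewrite funenegE -EFinN -EFin_max maxr_pMl// mul0r mulNr.
  by apply: measurable_maxr => //; exact: measurableT_comp.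
Qed.

End density.

Section image_measure.
Context d d' (T : measurableType d) (U : measurableType d') (R : realType).
Variables (mu : {measure set T -> \bar R}) (nu : {measure set U -> \bar R}).
Variable X : T -> U.
Hypothesis mX : measurable_fun setT X.
Hypothesis nuE : forall A, measurable A -> nu A = mu (X @^-1` A).

Lemma ge0_integral_image (h : U -> R) : measurable_fun setT h ->
  (forall x, 0 <= h x) -> (\int[nu]_x (h x)%:E = \int[mu]_x (h (X x))%:E)%E.
Proof.
move=> mh h0; rewrite (@eq_measure_integral _ _ _ setT (pushforward mu X)); last first.
  by move=> A mA _; rewrite nuE.
rewrite ge0_integral_pushforward//; last by move=> x _; rewrite lee_fin.
exact/measurable_EFinP.
Qed.

Lemma L1_image (h : U -> R) : measurable_fun setT h ->
  (L1 nu h <-> L1 mu (fun x => h (X x))).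
Proof.
move=> mh; split=> /integrableP[_ hi]; apply/integrableP; split.
- by apply/measurable_EFinP; exact: measurableT_comp.
- move: hi; rewrite /= ge0_integral_image//; exact: measurableT_comp.
- exact/measurable_EFinP.
- by rewrite /= ge0_integral_image//; exact: measurableT_comp.
Qed.

Lemma Ex_image (h : U -> R) : measurable_fun setT h ->
  Ex nu h = Ex mu (fun x => h (X x)).
Proof.
move=> mh; rewrite /Ex /Rintegral; congr fine.
rewrite integralE [RHS]integralE; congr (_ - _)%E.
- under eq_integral do rewrite funeposE -EFin_max.
  rewrite ge0_integral_image//; last by move=> x; rewrite le_max lexx orbT.
    by apply: eq_integral => x _; rewrite funeposE -EFin_max.
  exact: measurable_maxr.
- under eq_integral do rewrite funenegE -EFinN -EFin_max.
  rewrite ge0_integral_image//; last by move=> x; rewrite le_max lexx orbT.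
    by apply: eq_integral => x _; rewrite funenegE -EFinN -EFin_max.
  by apply: measurable_maxr => //; exact: measurableT_comp.
Qed.

End image_measure.

(** * Gaussian laws *)

Section normal_law.
Context {R : realType}.
Implicit Types s c x : R.
Local Notation leb := (@lebesgue_measure R).

(** Integration by parts on the whole line, in the form used below: [F] will be a product that
    vanishes at both ends. The fundamental theorem is applied on [[- (n + 1), n + 1]], and dominated
    convergence removes the cutoff. *)
Lemma Ex_derive_eq0 (F f : R -> R) : (forall x, is_derive x 1 F (f x)) ->
  continuous f -> L1 leb f -> F x @[x --> +oo] --> 0 -> F x @[x --> -oo] --> 0 ->
  Ex leb f = 0.
Proof.
move=> dF cf lf Fy FNy.
pose I n : set R := `[- n.+1%:R, n.+1%:R]%classic.
pose g n x := f x * \1_(I n) x.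
have gE n : Ex leb (g n) = F n.+1%:R - F (- n.+1%:R).
  have cF x : {for x, continuous F}.
    by apply/differentiable_continuous/derivable1_diffP; have [] := dF x.
  have -> : Ex leb (g n) = fine (\int[leb]_(x in I n) (f x)%:E)%E.
    rewrite /Ex /Rintegral; congr fine; rewrite [RHS]integral_mkcond.
    apply: eq_integral => x _; rewrite patchE /g indicE.
    by case: (x \in I n); rewrite ?mulr1 ?mulr0.
  rewrite /I (@continuous_FTC2 _ f F)//.
  - by rewrite ltrN2 || rewrite gtrN.
  - exact: continuous_subspaceT.
  - split.
    + by move=> x _; have [] := dF x.
    + exact: (cvg_at_right_filter (cF _)).
    + exact: (cvg_at_left_filter (cF _)).
  - by move=> x _; rewrite derive1E; have [_ ->] := dF x.
have [_ glim] : L1 leb f /\ Ex leb (g n) @[n --> \oo] --> Ex leb f.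
  apply: (@Ex_dom _ _ _ leb g f (fun x => `|f x|)).
  - move=> n; apply: measurable_funM; first exact: L1_meas lf.
    by apply: measurable_indic; exact: measurable_itv.
  - exact: L1_meas lf.
  - apply: nearW => x; apply/cvgrPdist_lt => e e0; near=> n.
    rewrite /g indicE mem_set ?mulr1 ?subrr ?normr0//.
    rewrite /I/= in_itv/= -ler_norml.
    have : (`|x| <= n%:R) by near: n; exact: nbhs_infty_ger.
    by move/le_trans; apply; rewrite ler_nat.
  - exact: L1_norm.
  - move=> n; apply: nearW => x; rewrite /g normrM ler_piMr//.
    by rewrite indicE; case: (_ \in _); rewrite ?normr1 ?normr0.
have glim0 : Ex leb (g n) @[n --> \oo] --> (0 : R).
  rewrite (funext gE); rewrite -[X in _ --> X](subrr 0).
  have cy : (n.+1%:R : R) @[n --> \oo] --> +oo.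
    apply/cvgryPge => A; near=> n; apply: (@le_trans _ _ n%:R); last by rewrite ler_nat.
    by near: n; exact: nbhs_infty_ger.
  apply: cvgB; first exact: (cvg_comp _ _ cy Fy).
  by apply: (cvg_comp (fun n => - n.+1%:R) F _ FNy); apply/cvgNrNy.
exact: (cvg_unique _ glim glim0).
Unshelve. all: by end_near. Qed.

Definition npdf s x := normal_pdf 0 s x.

Lemma npdfE s x : s != 0 ->
  npdf s x = normal_peak s * expR (- (x ^+ 2 / (s ^+ 2 *+ 2))).
Proof. by move=> s0; rewrite /npdf normal_pdfE// /normal_fun subr0 mulNr. Qed.

Lemma npdf_ge0 s x : 0 <= npdf s x. Proof. exact: normal_pdf_ge0. Qed.

Lemma measurable_npdf s : measurable_fun setT (npdf s).
Proof. exact: measurable_normal_pdf. Qed.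

Lemma L1_npdf s : L1 leb (npdf s). Proof. exact: integrable_normal_pdf. Qed.

Lemma Ex_npdf s : Ex leb (npdf s) = 1.
Proof. by apply: EFin_inj; rewrite Ex_EFin ?integral_normal_pdf//; exact: L1_npdf. Qed.

Lemma continuous_npdf s : s != 0 -> continuous (npdf s).
Proof. exact: continuous_normal_pdf. Qed.

Lemma is_derive_npdf s x : s != 0 ->
  is_derive x 1 (npdf s) (- (x / s ^+ 2) * npdf s x).
Proof.
move=> s0.
have -> : npdf s = (fun x => normal_peak s * expR (- (x ^+ 2 / (s ^+ 2 *+ 2)))).
  by apply/funext => y; rewrite npdfE.
have d1 : is_derive x 1 (fun y : R => - (y ^+ 2 / (s ^+ 2 *+ 2)))
    (- (x / s ^+ 2)).
  apply: is_derive_eq.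
  by rewrite /GRing.scale/= mulr0 add0r mulr1 -[s ^+ 2 *+ 2]mulr_natr; field.
have d2 := is_derive1_comp (is_derive_expR _) d1.
have d3 := is_deriveZ (normal_peak s) d2.
by apply: is_derive_eq d3 _; rewrite /GRing.scale/=; ring.
Qed.

(** Half of the exponential absorbs the factor: [(u / 2) exp (- u / 2) <= 1] follows from
    [1 + v <= exp v]. *)
Let expR_sq (u : R) : 0 <= u -> u * expR (- u) <= 2 * expR (- (u / 2)).
Proof.
move=> u0; rewrite {1 2}[u]splitr opprD expRD.
have h : u / 2 * expR (- (u / 2)) <= 1.
  rewrite expRN ler_pdivrMr ?expR_gt0// mul1r.
  by apply: le_trans (expR_ge1Dx _); rewrite lerDr.
have e0 := expR_ge0 (- (u / 2)).
by have := ler_wpM2r e0 h; lra.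
Qed.

(** By [expR_sq] with [u = x ^ 2 / (2 s ^ 2)], the integrand is at most a multiple of the Gaussian
    density of standard deviation [sqrt 2 * s]. *)
Lemma L1_sqr_npdf s : s != 0 -> L1 leb (fun x => x ^+ 2 * npdf s x).
Proof.
move=> s0; pose r := Num.sqrt 2 * s.
have r0 : r != 0 by rewrite mulf_neq0// gt_eqF// sqrtr_gt0.
have pk s' : s' != 0 -> normal_peak s' != 0 by move=> ?; rewrite gt_eqF// normal_peak_gt0.
pose C := normal_peak s / normal_peak r * 4 * s ^+ 2.
apply: (L1_le _ _ (L1Z C (L1_npdf r))).
  by apply: measurable_funM; [exact: measurable_funX|exact: measurable_npdf].
have fld (y v : R) : v != 0 -> y / (2 * v *+ 2) = y / (v *+ 2) / 2.
  by move=> v0; field.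
have fld2 (y v : R) : v != 0 -> y = y / (v *+ 2) * 2 * v.
  by move=> v0; field.
move=> x; rewrite ger0_norm; last by rewrite mulr_ge0 ?sqr_ge0 ?npdf_ge0.
rewrite !npdfE//; set u := x ^+ 2 / (s ^+ 2 *+ 2).
have s2 : s ^+ 2 != 0 by rewrite expf_neq0.
have -> : x ^+ 2 / (r ^+ 2 *+ 2) = u / 2.
  by rewrite /r /u exprMn sqr_sqrtr//; exact: fld.
have -> : x ^+ 2 = u * 2 * s ^+ 2 by rewrite /u; exact: fld2.
have u0 : 0 <= u by rewrite divr_ge0 ?mulrn_wge0 ?sqr_ge0.
have -> : C * (normal_peak r * expR (- (u / 2))) =
    (normal_peak s * s ^+ 2 * 2) * (2 * expR (- (u / 2))).
  have fld3 (a b c e : R) : b != 0 -> a / b * 4 * c * (b * e) = a * c * 2 * (2 * e).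
    by move=> b0; field.
  exact/fld3/pk.
have -> : u * 2 * s ^+ 2 * (normal_peak s * expR (- u)) =
    (normal_peak s * s ^+ 2 * 2) * (u * expR (- u)) by ring.
apply: ler_wpM2l; last exact: expR_sq.
apply: mulr_ge0 => //; apply: mulr_ge0; [exact: normal_peak_ge0|exact: sqr_ge0].
Qed.

Lemma L1_id_npdf s : s != 0 -> L1 leb (fun x => `|x| * npdf s x).
Proof.
move=> s0; apply: (L1_le _ _ (L1D (L1_npdf s) (L1_sqr_npdf s0))).
  by apply: measurable_funM; [exact: normr_measurable|exact: measurable_npdf].
move=> x; rewrite ger0_norm ?mulr_ge0 ?npdf_ge0//.
rewrite -[X in _ <= X + _]mul1r -mulrDl ler_wpM2r ?npdf_ge0//.
by rewrite -[x ^+ 2]real_normK ?num_real//; have := sqr_ge0 (`|x| - 1); nra.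
Qed.

Lemma id_npdf_bound s x : s != 0 -> x != 0 -> `|x * npdf s x| <= normal_peak s * 2 * s ^+ 2 / `|x|.
Proof.
move=> s0 x0; rewrite npdfE//; set u := x ^+ 2 / (s ^+ 2 *+ 2).
have s2 : s ^+ 2 != 0 by rewrite expf_neq0.
have u0 : 0 <= u by rewrite divr_ge0 ?mulrn_wge0 ?sqr_ge0.
have xn : 0 < `|x| by rewrite normr_gt0.
have h : u * expR (- u) <= 1.
  rewrite expRN ler_pdivrMr ?expR_gt0// mul1r.
  by apply: le_trans (expR_ge1Dx _); rewrite lerDr.
rewrite ler_pdivlMr// normrM [`|normal_peak s * _|]ger0_norm; last first.
  by apply: mulr_ge0; [exact: normal_peak_ge0|exact: expR_ge0].
have -> : `|x| * (normal_peak s * expR (- u)) * `|x| =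
    normal_peak s * 2 * s ^+ 2 * (u * expR (- u)).
  have -> : u = `|x| ^+ 2 / (s ^+ 2 *+ 2) by rewrite /u real_normK ?num_real.
  have fld (y a b v : R) : v != 0 ->
      y * (a * b) * y = a * 2 * v * (y ^+ 2 / (v *+ 2) * b).
    by move=> v0; field.
  exact: fld.
rewrite ler_piMr//; apply: mulr_ge0; last exact: sqr_ge0.
by apply: mulr_ge0 => //; exact: normal_peak_ge0.
Qed.

(** Disposes of the boundary terms in the integrations by parts: [x * npdf s x] is of order
    [1 / |x|], again because [u exp (- u) <= 1]. *)
Lemma id_npdf_cvg0 s (h : R -> R) C : s != 0 ->
  (forall x, 1 <= `|x| -> `|h x| <= C * `|x * npdf s x|) ->
  h x @[x --> +oo] --> 0 /\ h x @[x --> -oo] --> 0.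
Proof.
move=> s0 hC; pose K := `|C| * (normal_peak s * 2 * s ^+ 2).
have K0 : 0 <= K.
  apply: mulr_ge0 => //; apply: mulr_ge0; last exact: sqr_ge0.
  by apply: mulr_ge0 => //; exact: normal_peak_ge0.
have hK x : 1 <= `|x| -> `|h x| <= K / `|x|.
  move=> x1; apply: (le_trans (hC _ x1)).
  have x0 : x != 0 by rewrite -normr_gt0 (lt_le_trans _ x1).
  apply: (le_trans (ler_wpM2r (normr_ge0 _) (ler_norm C))).
  by rewrite /K -mulrA ler_wpM2l// id_npdf_bound.
split; apply/cvgrPdist_le => e e0; near=> x; rewrite sub0r normrN;
  have xb : 1 + K / e <= `|x|.
- by rewrite (le_trans _ (ler_norm x))//; near: x; exact: nbhs_pinfty_ge.
- apply: (le_trans (hK _ _)); first by rewrite (le_trans _ xb)// lerDl divr_ge0// ltW.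
  have x0 : 0 < `|x| by rewrite (lt_le_trans _ xb)// ltr_pwDl// divr_ge0// ltW.
  rewrite ler_pdivrMr// -ler_pdivrMl// mulrC (le_trans _ xb)//.
  by rewrite lerDr.
- rewrite -normrN (le_trans _ (ler_norm (- x)))// lerNr.
  by near: x; apply: nbhs_ninfty_le; rewrite num_real.
- apply: (le_trans (hK _ _)); first by rewrite (le_trans _ xb)// lerDl divr_ge0// ltW.
  have x0 : 0 < `|x| by rewrite (lt_le_trans _ xb)// ltr_pwDl// divr_ge0// ltW.
  rewrite ler_pdivrMr// -ler_pdivrMl// mulrC (le_trans _ xb)//.
  by rewrite lerDr.
Unshelve. all: by end_near. Qed.

(** The function [x * npdf s x] vanishes at both ends and has derivative
    [npdf s x - s ^ (-2) x ^ 2 npdf s x], whose integral is therefore 0. *)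
Lemma Ex_sqr_npdf s : s != 0 -> Ex leb (fun x => x ^+ 2 * npdf s x) = s ^+ 2.
Proof.
move=> s0; have s2 : s ^+ 2 != 0 by rewrite expf_neq0.
have lq := L1_sqr_npdf s0.
have lf : L1 leb (fun x => npdf s x - (s ^+ 2)^-1 * (x ^+ 2 * npdf s x)).
  by apply: L1B; [exact: L1_npdf|exact: L1Z].
have [Fy FNy] : (fun x => x * npdf s x) x @[x --> +oo] --> 0 /\
    (fun x => x * npdf s x) x @[x --> -oo] --> 0.
  by apply: (@id_npdf_cvg0 s _ 1) => // x _; rewrite mul1r.
have cid : continuous (fun x : R => x) by move=> x; exact: cvg_id.
have E0 := @Ex_derive_eq0 (fun x => x * npdf s x) _ _ _ lf Fy FNy.
have := E0; rewrite ExB ?ExZ ?Ex_npdf//; [|exact: L1_npdf|exact: L1Z].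
move=> h; have {h} : 1 - (s ^+ 2)^-1 * Ex leb (fun x => x ^+ 2 * npdf s x) = 0.
  apply: h => x.
    apply: is_derive_eq; first exact: is_deriveM (is_derive_npdf x s0).
    by rewrite /GRing.scale/=; field.
  apply: cvgB; first exact: continuous_npdf.
  apply: cvgM; first exact: cvg_cst.
  apply: cvgM; last exact: continuous_npdf.
  exact: exprn_continuous.
by move/eqP; rewrite subr_eq0 => /eqP h; apply: (mulfI (invr_neq0 s2)); rewrite -h mulVf.
Qed.

Lemma L1_bnd_npdf s (h : R -> R) C : measurable_fun setT h ->
  (forall x, `|h x| <= C) -> L1 leb (fun x => h x * npdf s x).
Proof.
move=> mh hC; apply: (L1_le _ _ (L1Z C (L1_npdf s))).
  by apply: measurable_funM => //; exact: measurable_npdf.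
move=> x; rewrite normrM [X in _ * X]ger0_norm ?npdf_ge0//.
by rewrite ler_wpM2r// npdf_ge0.
Qed.

Lemma measurable_sin_affine c a : measurable_fun setT (fun x : R => sin (c * x + a)).
Proof.
have m : measurable_fun setT (@sin R).
  by apply: continuous_measurable_fun; exact: continuous_sin.
apply: (measurableT_comp m).
by apply: measurable_funD => //; exact: measurable_funM.
Qed.

Lemma measurable_cos_affine c a : measurable_fun setT (fun x : R => cos (c * x + a)).
Proof.
have m : measurable_fun setT (@cos R).
  by apply: continuous_measurable_fun; exact: continuous_cos.
apply: (measurableT_comp m).
by apply: measurable_funD => //; exact: measurable_funM.
Qed.

Lemma is_derive_comp_fun (f g : R -> R) x (u v w : R) :
  is_derive (g x) 1 f u -> is_derive x 1 g v -> u * v = w ->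
  is_derive x 1 (fun y => f (g y)) w.
Proof. by move=> df dg <-; exact: (is_derive1_comp df dg). Qed.

(** Integration by parts with the primitive [npdf s x * sin (c x + a)]. It feeds the differential
    equation behind [Ex_cos_npdf], and special values of [c] and [a] yield first moments and Hermite
    coefficients. *)
Lemma Ex_id_sin_npdf s c a : s != 0 ->
  Ex leb (fun x => x * sin (c * x + a) * npdf s x) =
  c * s ^+ 2 * Ex leb (fun x => cos (c * x + a) * npdf s x).
Proof.
move=> s0; have s2 : s ^+ 2 != 0 by rewrite expf_neq0.
have lc : L1 leb (fun x => cos (c * x + a) * npdf s x).
  by apply: (@L1_bnd_npdf _ _ 1) => [|x]; [exact: measurable_cos_affine|exact: cos_max].
have ls : L1 leb (fun x => x * sin (c * x + a) * npdf s x).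
  apply: (L1_le _ _ (L1_id_npdf s0)).
    apply: measurable_funM; last exact: measurable_npdf.
    by apply: measurable_funM => //; exact: measurable_sin_affine.
  move=> x; rewrite !normrM [X in _ * X <= _]ger0_norm ?npdf_ge0//.
  by rewrite ler_wpM2r ?npdf_ge0// ler_piMr// sin_max.
have dsin x : is_derive x 1 (fun x => sin (c * x + a)) (c * cos (c * x + a)).
  have d1 : is_derive x 1 (fun x => c * x + a) c.
    by apply: is_derive_eq; rewrite /GRing.scale/=; ring.
  exact: (@is_derive_comp_fun sin (fun x => c * x + a) x _ _ _
    (is_derive_sin (c * x + a)) d1 (mulrC _ _)).
pose F x := npdf s x * sin (c * x + a).
pose f x := c * (cos (c * x + a) * npdf s x) -
  (s ^+ 2)^-1 * (x * sin (c * x + a) * npdf s x).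
have lf : L1 leb f by apply: L1B; exact: L1Z.
have [Fy FNy] : F x @[x --> +oo] --> 0 /\ F x @[x --> -oo] --> 0.
  apply: (@id_npdf_cvg0 s _ 1) => // x x1; rewrite mul1r /F mulrC normrM [leRHS]normrM.
  by rewrite ler_wpM2r// (le_trans (sin_max _)).
have cM : continuous (fun x : R => c * x + a).
  move=> x; apply: cvgD; last exact: cvg_cst.
  by apply: cvgM; [exact: cvg_cst|exact: cvg_id].
have E0 : Ex leb f = 0.
  apply: (@Ex_derive_eq0 F) => // x.
    apply: is_derive_eq; first exact: is_deriveM (is_derive_npdf x s0) (dsin x).
    by rewrite /GRing.scale/= /f; field.
  apply: cvgB; apply: cvgM; [exact: cvg_cst| |exact: cvg_cst|].
    apply: cvgM; last exact: continuous_npdf.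
    by apply: (continuous_comp (cM x)); exact: continuous_cos.
  apply: cvgM; last exact: continuous_npdf.
  apply: cvgM; first exact: cvg_id.
  by apply: (continuous_comp (cM x)); exact: continuous_sin.
move: E0; rewrite /f ExB ?ExZ//; [|exact: L1Z..].
move/eqP; rewrite subr_eq0 => /eqP h.
by apply: (mulfI (invr_neq0 s2)); rewrite -h; field.
Qed.

(** As a function [phi] of [c] the left side satisfies [phi' = - c s ^ 2 phi], by differentiation
    under the integral and [Ex_id_sin_npdf]; so [phi c * exp (c ^ 2 s ^ 2 / 2)] is constant. The
    free phase [a] lets the same statement cover sines. *)
Lemma Ex_cos_npdf s c a : s != 0 ->
  Ex leb (fun x => cos (c * x + a) * npdf s x) =
  cos a * expR (- (c ^+ 2 * s ^+ 2 / 2)).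
Proof.
move=> s0; pose phi c := Ex leb (fun x => cos (c * x + a) * npdf s x).
pose f (c x : R) := cos (c * x + a) * npdf s x.
have lc c' : L1 leb (f c').
  by apply: (@L1_bnd_npdf _ _ 1) => [|x]; [exact: measurable_cos_affine|exact: cos_max].
have df c' x : is_derive c' 1 (f ^~ x) (- (x * sin (c' * x + a) * npdf s x)).
  have d1 : is_derive c' 1 (fun c => c * x + a) x.
    by apply: is_derive_eq; rewrite /GRing.scale/=; ring.
  have d2 := @is_derive_comp_fun cos (fun c => c * x + a) c' _ _ _
    (is_derive_cos (c' * x + a)) d1 erefl.
  have d3 := is_deriveZ (npdf s x) d2.
  rewrite /f; under eq_fun do rewrite mulrC.
  by apply: is_derive_eq d3 _; rewrite /GRing.scale/=; ring.
have dphi c' : is_derive c' 1 phi (- (c' * s ^+ 2 * phi c')).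
  have Ic : (`]c' - 1, c' + 1[%classic : set R) c'.
    by rewrite /= in_itv/= ltrBlDr !ltrDl ltr01.
  have H1 : forall x y, (`]c' - 1, c' + 1[%classic : set R) x ->
    (setT : set (measurableTypeR R)) y -> derivable (f ^~ y) x 1.
    by move=> x y _ _; have [] := df x y.
  have H2 : forall x y, (`]c' - 1, c' + 1[%classic : set R) x ->
    (setT : set (measurableTypeR R)) y -> `|partial1of2 f x y| <= `|y| * npdf s y.
    move=> x y _ _; rewrite partial1of2E; have [_ ->] := df x y.
    rewrite normrN !normrM [X in _ * X <= _]ger0_norm ?npdf_ge0//.
    by rewrite ler_wpM2r ?npdf_ge0// ler_piMr// sin_max.
  have H0 y : 0 <= `|y| * npdf s y by rewrite mulr_ge0// npdf_ge0.
  split.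
    exact: (derivable_under_integral measurableT Ic (fun x _ => lc x) H1 H0 (L1_id_npdf s0) H2).
  rewrite -derive1E.
  have -> := differentiation_under_integral measurableT Ic (fun x _ => lc x) H1 H0 (L1_id_npdf s0) H2.
  transitivity (Ex leb (fun x => - (x * sin (c' * x + a) * npdf s x))).
    by apply: eq_Ex => x; rewrite partial1of2E; have [_ ->] := df c' x.
  rewrite ExN ?Ex_id_sin_npdf//.
  apply: (L1_le _ _ (L1_id_npdf s0)).
    apply: measurable_funM; last exact: measurable_npdf.
    by apply: measurable_funM => //; exact: measurable_sin_affine.
  move=> x; rewrite !normrM [X in _ * X <= _]ger0_norm ?npdf_ge0//.
  by rewrite ler_wpM2r ?npdf_ge0// ler_piMr// sin_max.
pose psi c := phi c * expR (c ^+ 2 * s ^+ 2 / 2).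
have dpsi c' : is_derive c' 1 psi 0.
  have d1 : is_derive c' 1 (fun c => c ^+ 2 * s ^+ 2 / 2) (c' * s ^+ 2).
    by apply: is_derive_eq; rewrite /GRing.scale/=; field.
  have d2 := @is_derive_comp_fun expR (fun c => c ^+ 2 * s ^+ 2 / 2) c' _ _ _
    (is_derive_expR _) d1 erefl.
  apply: is_derive_eq (is_deriveM (dphi c') d2) _.
  by rewrite /GRing.scale/=; ring.
have := is_derive_0_is_cst c 0 dpsi; rewrite /psi expr0n/= !mul0r expR0 mulr1.
rewrite [phi 0](_ : _ = cos a) => [h|]; last first.
  rewrite /phi; under eq_Ex do rewrite mul0r add0r.
  by rewrite ExZ ?Ex_npdf ?mulr1//; exact: L1_npdf.
by rewrite -h -mulrA expRxMexpNx_1 mulr1.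
Qed.

Lemma Ex_sin_npdf s c : s != 0 -> Ex leb (fun x => sin (c * x) * npdf s x) = 0.
Proof.
move=> s0; have := Ex_cos_npdf c (- (pi / 2)) s0.
rewrite cosN cos_pihalf mul0r => <-.
by apply: eq_Ex => x; rewrite cosBpihalf.
Qed.

Lemma normal_probE s A : normal_prob 0 s A = (\int[leb]_(x in A) (npdf s x)%:E)%E.
Proof. by []. Qed.

End normal_law.

Section centered_normal_facts.
Context d (T : measurableType d) (R : realType) (P : probability T R).
Local Notation leb := (@lebesgue_measure R).

Lemma normal_image_Ex (X : T -> R) s (h : R -> R) :
  measurable_fun setT X -> measurable_fun setT h ->
  (forall A, measurable A -> P (X @^-1` A) = normal_prob 0 s A) ->
  (L1 P (fun w => h (X w)) <-> L1 leb (fun x => h x * npdf s x)) /\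
  Ex P (fun w => h (X w)) = Ex leb (fun x => h x * npdf s x).
Proof.
move=> mX mh PX.
have nuE A : measurable A -> normal_prob 0 s A = P (X @^-1` A) by move=> mA; rewrite PX.
have de := @Ex_density _ _ _ leb (normal_prob 0 s) (npdf s) (measurable_npdf s)
  (npdf_ge0 s) (fun A _ => normal_probE s A) h mh.
have dl := @L1_density _ _ _ leb (normal_prob 0 s) (npdf s) (measurable_npdf s)
  (npdf_ge0 s) (fun A _ => normal_probE s A) h mh.
have ie := @Ex_image _ _ _ _ _ P (normal_prob 0 s) X mX nuE h mh.
have il := @L1_image _ _ _ _ _ P (normal_prob 0 s) X mX nuE h mh.
by split; [rewrite -il dl|rewrite -ie de].
Qed.

Lemma normal0_ae0 (X : T -> R) : measurable_fun setT X ->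
  (forall A, measurable A -> P (X @^-1` A) = \d_(0 : R) A) ->
  {ae P, forall w, X w = 0}.
Proof.
move=> mX PX; exists (X @^-1` (~` [set 0])); split.
- rewrite -[X in measurable X]setTI; apply: mX => //.
  by apply: measurableC; exact: measurable_set1.
- rewrite [LHS]PX; last by apply: measurableC; exact: measurable_set1.
  by rewrite diracE memNset//= => /(_ erefl).
- by move=> w /= h; exact: h.
Qed.

Lemma centered_normalP (X : T -> R) : centered_normal P X ->
  [/\ L2 P X, Ex P X = 0, Ex P (fun w => cos (X w)) = expR (- (Ex P (fun w => X w ^+ 2) / 2))
    & Ex P (fun w => sin (X w)) = 0].
Proof.
move=> [mX [s s0 PX]].
have mc : measurable_fun setT (@cos R).
  by apply: continuous_measurable_fun; exact: continuous_cos.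
have ms : measurable_fun setT (@sin R).
  by apply: continuous_measurable_fun; exact: continuous_sin.
(* The Dirac mass at 0 counts as a centered normal law, so the four facts are first checked for an
   almost surely zero variable. *)
have [s_eq0|s_neq0] := eqVneq s 0.
  have ae0 : {ae P, forall w, X w = 0}.
    by apply: normal0_ae0 => // A mA; rewrite PX// s_eq0 eqxx.
  have E0 (h : R -> R) : measurable_fun setT h -> Ex P (fun w => h (X w)) = h 0.
    move=> mh; rewrite -[RHS](Ex_cst P); apply: Ex_ae_eq => //.
    - exact: measurableT_comp.
    - by apply: filterS ae0 => w ->.
  split.
  - split => //; apply: (L1_ae_eq (g := fun=> 0)) => //; first exact: measurable_funX.
      exact: L10.
    by apply: filterS ae0 => w ->; rewrite expr0n.
  - exact: (E0 id).
  - rewrite (E0 _ mc) (E0 (fun x => x ^+ 2)) ?expr0n/= ?mul0r ?oppr0 ?expR0 ?cos0//.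
  - by rewrite (E0 _ ms) sin0.
have PX' A : measurable A -> P (X @^-1` A) = normal_prob 0 s A.
  by move=> mA; rewrite PX// (negbTE s_neq0).
have NI h mh := @normal_image_Ex X s h mX mh PX'.
have [lX2 eX2] := NI (fun x => x ^+ 2) (measurable_funX 2 (@measurable_id _ _ setT)).
have l2 : L2 P X by split => //; apply/lX2; exact: L1_sqr_npdf.
split => //.
- have [lX1 ->] := NI id (@measurable_id _ _ setT).
  have lid : L1 leb (fun x => x * npdf s x).
    apply: (L1_le _ _ (L1_id_npdf s_neq0)).
      by apply: measurable_funM => //; exact: measurable_npdf.
    by move=> x; rewrite normrM [X in _ * X <= _]ger0_norm ?npdf_ge0.
  (* With [c = 0] and [a = pi / 2] the sine is 1, and the right side carries the factor [c = 0]: the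
     mean vanishes. *)
  have := Ex_id_sin_npdf 0 (pi / 2) s_neq0.
  by under eq_Ex do rewrite mul0r add0r sin_pihalf mulr1; rewrite !mul0r.
- have [_ ->] := NI _ mc; rewrite eX2 Ex_sqr_npdf//.
  have := Ex_cos_npdf 1 0 s_neq0; rewrite cos0 expr1n !mul1r => <-.
  by apply: eq_Ex => x; rewrite mul1r addr0.
- have [_ ->] := NI _ ms; rewrite -(Ex_sin_npdf 1 s_neq0).
  by apply: eq_Ex => x; rewrite mul1r.
Qed.

End centered_normal_facts.

(** * Means of cosines and sines over independent replicas *)

Section second_moments.
Context d dD (T : measurableType d) (D : measurableType dD).
Context (R : realType) (P : probability T R) (Q : probability D R).

(* The realization [u] of the path is frozen: [vr] and [cv] below average over
   the random medium only. *)
Definition vr (Y : T * D -> R) u := Ex P (fun t => Y (t, u) ^+ 2).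

Lemma measurable_section (Y : T * D -> R) u : measurable_fun setT Y ->
  measurable_fun setT (fun t => Y (t, u)).
Proof. by move=> mY; apply: (measurableT_comp mY); exact: measurable_pair2. Qed.

Lemma measurable_sectionr (Y : T * D -> R) t : measurable_fun setT Y ->
  measurable_fun setT (fun u => Y (t, u)).
Proof. by move=> mY; apply: (measurableT_comp mY); exact: measurable_pair1. Qed.

Lemma L1_vr Y : L2 (pp P Q) Y -> L1 Q (vr Y).
Proof. by move=> [mY lY]; have [] := pp_fubini2 lY. Qed.

Lemma measurable_vr Y : measurable_fun setT Y -> measurable_fun setT (vr Y).
Proof.
by move=> mY; apply: (@measurable_Ex1 _ _ _ _ _ P (fun p => Y p ^+ 2)); exact: measurable_funX.
Qed.

Lemma vr_ge0 Y u : 0 <= vr Y u.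
Proof. by apply: Ex_ge0 => t; exact: sqr_ge0. Qed.

End second_moments.

Section mixed_moments.
Context d dD dE (T : measurableType d) (D : measurableType dD) (E : measurableType dE).
Context (R : realType) (P : probability T R) (Q : probability D R) (PE : probability E R).

Definition cv (Y : T * D -> R) (X : T * E -> R) p :=
  Ex P (fun t => Y (t, p.1) * X (t, p.2)).

Lemma measurable_cv Y X : measurable_fun setT Y -> measurable_fun setT X ->
  measurable_fun setT (cv Y X).
Proof.
move=> mY mX.
apply: (@measurable_Ex1 _ _ _ _ _ P (fun p => Y (p.1, p.2.1) * X (p.1, p.2.2))).
apply: measurable_funM.
  apply: (measurableT_comp mY); apply: measurable_fun_pair => //=.
  exact: measurableT_comp.
apply: (measurableT_comp mX); apply: measurable_fun_pair => //=.
exact: measurableT_comp.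
Qed.

Lemma L1_cv Y X : L2 (pp P Q) Y -> L2 (pp P PE) X ->
  (forall u, L2 P (fun t => Y (t, u))) -> (forall w, L2 P (fun t => X (t, w))) ->
  L1 (pp Q PE) (cv Y X).
Proof.
move=> lY lX sY sX; have [mY _] := lY; have [mX _] := lX.
have lv : L1 (pp Q PE) (fun p => vr P Y p.1 * 1 + 1 * vr P X p.2).
  exact: L1D (pp_tensor (L1_vr lY) (L1_cst PE 1)) (pp_tensor (L1_cst Q 1) (L1_vr lX)).
apply: (L1_le _ _ lv); first exact: measurable_cv.
move=> p; rewrite mulr1 mul1r /cv /vr -ExD; [|by have [] := sY p.1|by have [] := sX p.2].
apply: Ex_norm_le; first exact: L2_mul.
  by apply: L1D; [have [] := sY p.1|have [] := sX p.2].
move=> t; rewrite normrM -[Y _ ^+ 2]real_normK ?num_real//.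
rewrite -[X _ ^+ 2]real_normK ?num_real//.
by have := sqr_ge0 (`|Y (t, p.1)| - `|X (t, p.2)|); nra.
Qed.

End mixed_moments.

Section gaussian_spaces.
Context d (T : measurableType d) (R : realType) (P : probability T R).

(** Characteristic functions are recorded only at the argument 1, in real form. This is enough
    because products of trigonometric means combine the phases by sums and differences, under which
    the set is closed. *)
Record gaussian_space (G : set (T -> R)) : Prop := {
  gs_add : forall f g, G f -> G g -> G (fun t => f t + g t) ;
  gs_opp : forall f, G f -> G (fun t => - f t) ;
  gs_zero : G (fun=> 0) ;
  gs_L2 : forall f, G f -> L2 P f ;
  gs_cos : forall f, G f ->
    Ex P (fun t => cos (f t)) = expR (- (Ex P (fun t => f t ^+ 2) / 2)) ;
  gs_sin : forall f, G f -> Ex P (fun t => sin (f t)) = 0 }.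

End gaussian_spaces.

Section trig_mean.
Context d dD (T : measurableType d) (D : measurableType dD).
Context (R : realType) (P : probability T R) (Q : probability D R).
Implicit Types (A B : D -> R) (Y : T * D -> R).

(** Real form of a complex Feynman-Kac mean: for [F = A + i B], the real and imaginary parts of the
    mean of [F exp (i Y)] over [Q] are the cases [c = (A, - B)] and [c = (B, A)]. *)
Definition trig_mean Y (c : (D -> R) * (D -> R)) (t : T) :=
  Ex Q (fun u => c.1 u * cos (Y (t, u)) + c.2 u * sin (Y (t, u))).

Definition bounded_mfun (A : D -> R) :=
  measurable_fun setT A /\ exists M : R, forall u, `|A u| <= M.

Lemma measurable_cosR : measurable_fun setT (@cos R).
Proof. by apply: continuous_measurable_fun; exact: continuous_cos. Qed.

Lemma measurable_sinR : measurable_fun setT (@sin R).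
Proof. by apply: continuous_measurable_fun; exact: continuous_sin. Qed.

Lemma trig_integrand_bound Y A B : measurable_fun setT Y ->
  bounded_mfun A -> bounded_mfun B ->
  measurable_fun setT (fun p => A p.2 * cos (Y p) + B p.2 * sin (Y p)) /\
  exists M : R, forall p, `|A p.2 * cos (Y p) + B p.2 * sin (Y p)| <= M.
Proof.
move=> mY [mA [M hM]] [mB [N hN]]; split.
  apply: measurable_funD; apply: measurable_funM.
  - exact: measurableT_comp.
  - exact: (measurableT_comp measurable_cosR).
  - exact: measurableT_comp.
  - exact: (measurableT_comp measurable_sinR).
exists (M + N) => p; apply: (le_trans (ler_normD _ _)); rewrite !normrM lerD//.
  by rewrite (le_trans _ (hM p.2))// ler_piMr// cos_max.
by rewrite (le_trans _ (hN p.2))// ler_piMr// sin_max.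
Qed.

Lemma trig_mean_bound Y A B : measurable_fun setT Y ->
  bounded_mfun A -> bounded_mfun B ->
  measurable_fun setT (trig_mean Y (A, B)) /\
  exists M : R, forall t, `|trig_mean Y (A, B) t| <= M.
Proof.
move=> mY bA bB; have [mF [M hM]] := trig_integrand_bound mY bA bB.
split; first exact: (@measurable_Ex2 _ _ _ _ _ Q _ mF).
exists M => t; apply: Ex_norm_cst; first exact: measurable_sectionr mF.
by move=> u; exact: (hM (t, u)).
Qed.

(** The two means are exchanged by Fubini; at frozen [u] the sine averages to 0 and the cosine to
    the exponential of minus half the variance. *)
Lemma Ex_trig_mean (G : set (T -> R)) Y A B : gaussian_space P G ->
  measurable_fun setT Y -> (forall u, G (fun t => Y (t, u))) ->
  bounded_mfun A -> bounded_mfun B ->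
  Ex P (trig_mean Y (A, B)) = Ex Q (fun u => A u * expR (- (vr P Y u / 2))).
Proof.
move=> gG mY GY bA bB; have [mF [M hM]] := trig_integrand_bound mY bA bB.
have lF : L1 (pp P Q) (fun p => A p.2 * cos (Y p) + B p.2 * sin (Y p)).
  exact: (@L1_bnd _ _ _ (pp P Q) _ M).
have [_ e1] := pp_fubini1 lF; have [_ e2] := pp_fubini2 lF.
rewrite /trig_mean -e1 e2; apply: eq_Ex => u /=.
have lc : L1 P (fun t => cos (Y (t, u))).
  apply: (@L1_bnd _ _ _ P _ 1) => [|t]; last exact: cos_max.
  by apply: (measurableT_comp measurable_cosR); exact: measurable_section.
have ls : L1 P (fun t => sin (Y (t, u))).
  apply: (@L1_bnd _ _ _ P _ 1) => [|t]; last exact: sin_max.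
  by apply: (measurableT_comp measurable_sinR); exact: measurable_section.
rewrite ExD ?ExZ//; [|exact: L1Z..].
by rewrite (gs_cos gG (GY u)) (gs_sin gG (GY u)) mulr0 addr0.
Qed.

End trig_mean.

Section trig_mean_product.
Context d dD dE (T : measurableType d) (D : measurableType dD) (E : measurableType dE).
Context (R : realType) (Q : probability D R) (PE : probability E R).
Variables (Y : T * D -> R) (X : T * E -> R).
Hypotheses (mY : measurable_fun setT Y) (mX : measurable_fun setT X).
Variables (A B : D -> R) (a b : E -> R).
Hypotheses (bA : bounded_mfun A) (bB : bounded_mfun B).
Hypotheses (ba : bounded_mfun a) (bb : bounded_mfun b).

(** Adjoins one replica: the medium [q.1] is shared, while the index becomes a pair of independent
    points. [Yadd] and [Ysub] are the phases produced by the product-to-sum formulas. *)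
Definition Yadd (q : T * (D * E)) := Y (q.1, q.2.1) + X (q.1, q.2.2).
Definition Ysub (q : T * (D * E)) := Y (q.1, q.2.1) - X (q.1, q.2.2).

Lemma measurable_Yadd : measurable_fun setT Yadd.
Proof.
apply: measurable_funD.
  apply: (measurableT_comp mY); apply: measurable_fun_pair => //=.
  exact: measurableT_comp.
apply: (measurableT_comp mX); apply: measurable_fun_pair => //=.
exact: measurableT_comp.
Qed.

Lemma measurable_Ysub : measurable_fun setT Ysub.
Proof.
apply: measurable_funB.
  apply: (measurableT_comp mY); apply: measurable_fun_pair => //=.
  exact: measurableT_comp.
apply: (measurableT_comp mX); apply: measurable_fun_pair => //=.
exact: measurableT_comp.
Qed.

Definition tprod (f : D -> R) (g : E -> R) (p : D * E) := f p.1 * g p.2.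

Lemma bounded_tprod f g : bounded_mfun f -> bounded_mfun g -> bounded_mfun (tprod f g).
Proof.
move=> [mf [M hM]] [mg [N hN]]; split.
  by apply: measurable_funM; exact: measurableT_comp.
by exists (M * N) => p; rewrite normrM ler_pM.
Qed.

Lemma bounded_comb (f g : D * E -> R) u v : bounded_mfun f -> bounded_mfun g ->
  bounded_mfun (fun p => u * f p + v * g p).
Proof.
move=> [mf [M hM]] [mg [N hN]]; split.
  by apply: measurable_funD; exact: measurable_funM.
exists (`|u| * M + `|v| * N) => p.
by rewrite (le_trans (ler_normD _ _))// !normrM lerD// ler_wpM2l.
Qed.

(** Coefficients of the cosine and sine of the sum, and in [csub] of the difference, when
    [(A cos Y + B sin Y) (a cos X + b sin X)] is linearized. *)
Definition cadd : (D * E -> R) * (D * E -> R) :=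
  (fun p => 2^-1 * tprod A a p + (- 2^-1) * tprod B b p,
   fun p => 2^-1 * tprod A b p + 2^-1 * tprod B a p).
Definition csub : (D * E -> R) * (D * E -> R) :=
  (fun p => 2^-1 * tprod A a p + 2^-1 * tprod B b p,
   fun p => - 2^-1 * tprod A b p + 2^-1 * tprod B a p).

(** A product of two means is one mean over the product law, that is, over two independent replicas;
    its integrand is then linearized pointwise. *)
Lemma trig_meanM t :
  trig_mean Q Y (A, B) t * trig_mean PE X (a, b) t =
  trig_mean (pp Q PE) Yadd cadd t + trig_mean (pp Q PE) Ysub csub t.
Proof.
have b1 : bounded_mfun cadd.1 by apply: bounded_comb; exact: bounded_tprod.
have b2 : bounded_mfun cadd.2 by apply: bounded_comb; exact: bounded_tprod.
have b3 : bounded_mfun csub.1 by apply: bounded_comb; exact: bounded_tprod.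
have b4 : bounded_mfun csub.2 by apply: bounded_comb; exact: bounded_tprod.
have [mF [M hM]] := trig_integrand_bound measurable_Yadd b1 b2.
have [mG [N hN]] := trig_integrand_bound measurable_Ysub b3 b4.
rewrite /trig_mean -ExD; first last.
- apply: (@L1_bnd _ _ _ (pp Q PE) _ N); first exact: measurable_sectionr mG.
  by move=> p; exact: (hN (t, p)).
- apply: (@L1_bnd _ _ _ (pp Q PE) _ M); first exact: measurable_sectionr mF.
  by move=> p; exact: (hM (t, p)).
have [mYAB [K hK]] := trig_integrand_bound mY bA bB.
have [mXab [L hL]] := trig_integrand_bound mX ba bb.
have lY : L1 Q (fun u => A u * cos (Y (t, u)) + B u * sin (Y (t, u))).
  apply: (@L1_bnd _ _ _ Q _ K); first exact: measurable_sectionr mYAB.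
  by move=> u; exact: (hK (t, u)).
have lX : L1 PE (fun u => a u * cos (X (t, u)) + b u * sin (X (t, u))).
  apply: (@L1_bnd _ _ _ PE _ L); first exact: measurable_sectionr mXab.
  by move=> u; exact: (hL (t, u)).
have [_ e] := pp_fubini1 (pp_tensor lY lX).
transitivity (Ex (pp Q PE) (fun p : D * E =>
   (A p.1 * cos (Y (t, p.1)) + B p.1 * sin (Y (t, p.1))) *
   (a p.2 * cos (X (t, p.2)) + b p.2 * sin (X (t, p.2))))).
  rewrite e/= mulrC -ExZ//; apply: eq_Ex => u.
  by rewrite ExZ// mulrC.
apply: eq_Ex => p; rewrite /cadd /csub /tprod /Yadd /Ysub /=.
by rewrite cosD cosB sinD sinB; field.
Qed.

End trig_mean_product.

Section replica_step.
Context d dD dE (T : measurableType d) (D : measurableType dD) (E : measurableType dE).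
Context (R : realType) (P : probability T R) (Q : probability D R) (PE : probability E R).
Variable G : set (T -> R).
Hypothesis gG : gaussian_space P G.

Record gaussian_family (Y : T * D -> R) : Prop := {
  gf_meas : measurable_fun setT Y ;
  gf_in : forall u, G (fun t => Y (t, u)) ;
  gf_L2 : L2 (pp P Q) Y }.

End replica_step.

Section replica_sum.
Context d dD dE (T : measurableType d) (D : measurableType dD) (E : measurableType dE).
Context (R : realType) (P : probability T R) (Q : probability D R) (PE : probability E R).
Variable G : set (T -> R).
Hypothesis gG : gaussian_space P G.
Variables (Y : T * D -> R) (X : T * E -> R).
Hypotheses (gY : gaussian_family P Q G Y) (gX : gaussian_family P PE G X).

Lemma L2_pullback_fst : L2 (pp P (pp Q PE)) (fun q => Y (q.1, q.2.1)).
Proof.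
have [mY iY [_ lY]] := gY.
have mZ : measurable_fun setT (fun q : T * (D * E) => Y (q.1, q.2.1)).
  apply: (measurableT_comp mY); apply: measurable_fun_pair => //=.
  exact: measurableT_comp.
split => //; apply: pp_tonelli2 => /=.
- exact: measurable_funX.
- by move=> p; have [] := gs_L2 gG (iY p.1).
- under eq_fun => p do under eq_Ex do rewrite ger0_norm ?sqr_ge0//.
  have := pp_tensor (L1_vr gY.(gf_L2)) (L1_cst PE 1).
  by under eq_fun do rewrite mulr1.
Qed.

Lemma L2_pullback_snd : L2 (pp P (pp Q PE)) (fun q => X (q.1, q.2.2)).
Proof.
have [mX iX [_ lX]] := gX.
have mZ : measurable_fun setT (fun q : T * (D * E) => X (q.1, q.2.2)).
  apply: (measurableT_comp mX); apply: measurable_fun_pair => //=.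
  exact: measurableT_comp.
split => //; apply: pp_tonelli2 => /=.
- exact: measurable_funX.
- by move=> p; have [] := gs_L2 gG (iX p.2).
- under eq_fun => p do under eq_Ex do rewrite ger0_norm ?sqr_ge0//.
  have := pp_tensor (L1_cst Q 1) (L1_vr gX.(gf_L2)).
  by under eq_fun do rewrite mul1r.
Qed.

Lemma gaussian_Yadd : gaussian_family P (pp Q PE) G (Yadd Y X).
Proof.
split; first by apply: measurable_Yadd; [exact: gf_meas gY|exact: gf_meas gX].
  by move=> p; apply: (gs_add gG); [exact: (gf_in gY)|exact: (gf_in gX)].
exact: L2D L2_pullback_fst L2_pullback_snd.
Qed.

Lemma gaussian_Ysub : gaussian_family P (pp Q PE) G (Ysub Y X).
Proof.
split; first by apply: measurable_Ysub; [exact: gf_meas gY|exact: gf_meas gX].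
  move=> p; apply: (gs_add gG); first exact: (gf_in gY).
  by apply: (gs_opp gG); exact: (gf_in gX).
exact: L2B L2_pullback_fst L2_pullback_snd.
Qed.

Lemma vr_Yadd p : vr P (Yadd Y X) p = vr P Y p.1 + 2 * cv P Y X p + vr P X p.2.
Proof.
have lY := gs_L2 gG (gf_in gY p.1); have lX := gs_L2 gG (gf_in gX p.2).
have [_ l1] := lY; have [_ l2] := lX; have l3 := L1Z 2 (L2_mul lY lX).
rewrite /vr /cv -ExZ -?ExD//; [|exact: L1D|exact: L2_mul].
by apply: eq_Ex => t; rewrite /Yadd /=; ring.
Qed.

Lemma vr_Ysub p : vr P (Ysub Y X) p = vr P Y p.1 - 2 * cv P Y X p + vr P X p.2.
Proof.
have lY := gs_L2 gG (gf_in gY p.1); have lX := gs_L2 gG (gf_in gX p.2).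
have [_ l1] := lY; have [_ l2] := lX; have l3 := L1Z 2 (L2_mul lY lX).
rewrite /vr /cv -ExZ -?ExB -?ExD//; [|exact: L1B|exact: L2_mul].
by apply: eq_Ex => t; rewrite /Ysub /=; ring.
Qed.

Lemma cv_Yadd q : cv P (Yadd Y X) X q = cv P Y X (q.1.1, q.2) + cv P X X (q.1.2, q.2).
Proof.
have lY := gs_L2 gG (gf_in gY q.1.1); have lX := gs_L2 gG (gf_in gX q.1.2).
have lX' := gs_L2 gG (gf_in gX q.2).
by rewrite /cv -ExD; [apply: eq_Ex => t; rewrite /Yadd /=; ring|exact: L2_mul..].
Qed.

Lemma cv_Ysub q : cv P (Ysub Y X) X q = cv P Y X (q.1.1, q.2) - cv P X X (q.1.2, q.2).
Proof.
have lY := gs_L2 gG (gf_in gY q.1.1); have lX := gs_L2 gG (gf_in gX q.1.2).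
have lX' := gs_L2 gG (gf_in gX q.2).
by rewrite /cv -ExB; [apply: eq_Ex => t; rewrite /Ysub /=; ring|exact: L2_mul..].
Qed.

End replica_sum.

Section marginals.
Context dD dE dF (D : measurableType dD) (E : measurableType dE) (F : measurableType dF).
Context (R : realType) (Q : probability D R) (PE : probability E R) (PF : probability F R).

Lemma Ex_fst (f : D -> R) : L1 Q f ->
  L1 (pp Q PE) (fun p => f p.1) /\ Ex (pp Q PE) (fun p => f p.1) = Ex Q f.
Proof.
move=> lf; have := pp_tensor lf (L1_cst PE 1).
under eq_fun do rewrite mulr1.
move=> l; split => //; have [_ ->] := pp_fubini1 l.
by apply: eq_Ex => u /=; rewrite Ex_cst.
Qed.

Lemma Ex_snd (f : E -> R) : L1 PE f ->
  L1 (pp Q PE) (fun p => f p.2) /\ Ex (pp Q PE) (fun p => f p.2) = Ex PE f.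
Proof.
move=> lf; have := pp_tensor (L1_cst Q 1) lf.
under eq_fun do rewrite mul1r.
move=> l; split => //; have [_ ->] := pp_fubini2 l.
by apply: eq_Ex => u /=; rewrite Ex_cst.
Qed.

Lemma Ex_marginal13 (f : D * F -> R) : (forall p, 0 <= f p) -> L1 (pp Q PF) f ->
  L1 (pp (pp Q PE) PF) (fun q => f (q.1.1, q.2)) /\
  Ex (pp (pp Q PE) PF) (fun q => f (q.1.1, q.2)) = Ex (pp Q PF) f.
Proof.
move=> f0 lf; have [lF eF] := pp_fubini1 lf.
have mf : measurable_fun setT (fun q : (D * E) * F => f (q.1.1, q.2)).
  apply: (measurableT_comp (L1_meas lf)); apply: measurable_fun_pair => //=.
  exact: measurableT_comp.
have lG : L1 (pp (pp Q PE) PF) (fun q => f (q.1.1, q.2)).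
  apply/integrable12ltyP; first exact/measurable_EFinP.
  have /integrableP[_] := lf; apply: le_lt_trans.
  rewrite (@fubini_tonelli1 _ _ _ _ _ Q PF (fun p => `|(EFin \o f) p|%E)).
  - rewrite (@fubini_tonelli1 _ _ _ _ _ Q PE
      (fun p => \int[PF]_z `|(f (p.1, z))%:E|)%E) /fubini_F/=.
    + rewrite le_eqVlt; apply/orP; left; apply/eqP; apply: eq_integral => x _.
      rewrite integral_cst// [X in (_ * X)%E](probability_setT PE) mule1.
      by [].
    + apply: (@measurable_fun_fubini_tonelli_F _ _ _ _ _ PF
         (fun q : (D * E) * F => `|(f (q.1.1, q.2))%:E|)%E) => //.
        apply: measurableT_comp => //; exact/measurable_EFinP.
    + by move=> p; exact: integral_ge0.
  - apply: measurableT_comp => //; apply/measurable_EFinP; exact: L1_meas lf.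
  - by [].
split => //.
have [lG1 ->] := pp_fubini1 lG; rewrite eF.
by have [_ <-] := Ex_fst lF.
Qed.

Lemma Ex_marginal23 (f : E * F -> R) : (forall p, 0 <= f p) -> L1 (pp PE PF) f ->
  L1 (pp (pp Q PE) PF) (fun q => f (q.1.2, q.2)) /\
  Ex (pp (pp Q PE) PF) (fun q => f (q.1.2, q.2)) = Ex (pp PE PF) f.
Proof.
move=> f0 lf; have [lF eF] := pp_fubini1 lf.
have mf : measurable_fun setT (fun q : (D * E) * F => f (q.1.2, q.2)).
  apply: (measurableT_comp (L1_meas lf)); apply: measurable_fun_pair => //=.
  exact: measurableT_comp.
have lG : L1 (pp (pp Q PE) PF) (fun q => f (q.1.2, q.2)).
  apply/integrable12ltyP; first exact/measurable_EFinP.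
  have /integrableP[_] := lf; apply: le_lt_trans.
  rewrite (@fubini_tonelli1 _ _ _ _ _ PE PF (fun p => `|(EFin \o f) p|%E)).
  - rewrite (@fubini_tonelli2 _ _ _ _ _ Q PE
      (fun p => \int[PF]_z `|(f (p.2, z))%:E|)%E) /fubini_F/=.
    + rewrite /fubini_G le_eqVlt; apply/orP; left; apply/eqP; apply: eq_integral => x _ /=.
      by rewrite integral_cst// [X in (_ * X)%E](probability_setT Q) mule1.
    + apply: (@measurable_fun_fubini_tonelli_F _ _ _ _ _ PF
         (fun q : (D * E) * F => `|(f (q.1.2, q.2))%:E|)%E) => //.
        apply: measurableT_comp => //; exact/measurable_EFinP.
    + by move=> p; exact: integral_ge0.
  - apply: measurableT_comp => //; apply/measurable_EFinP; exact: L1_meas lf.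
  - by [].
split => //.
have [lG1 ->] := pp_fubini1 lG; rewrite eF.
by have [_ <-] := Ex_snd lF.
Qed.

End marginals.

Section replicas.
Context d1 d2 dE (T1 : measurableType d1) (T2 : measurableType d2) (E : measurableType dE).
Context (R : realType) (P1 : probability T1 R) (P2 : probability T2 R) (PE : probability E R).
Variables (G1 : set (T1 -> R)) (G2 : set (T2 -> R)).
Hypotheses (gG1 : gaussian_space P1 G1) (gG2 : gaussian_space P2 G2).

(** The sequence and its limit live on different media but share the index law [Q]. Frozen variances
    can therefore be compared in [L1 Q], whereas a difference of the phases themselves would make no
    sense. *)
Record cvg_family dD (D : measurableType dD) (Q : probability D R)
  (Y : (T1 * D -> R)^nat) (Y0 : T2 * D -> R) : Prop := {
  cf_fam : forall k, gaussian_family P1 Q G1 (Y k) ;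
  cf_fam0 : gaussian_family P2 Q G2 Y0 ;
  cf_var : Ex Q (fun u => `|vr P1 (Y k) u - vr P2 Y0 u|) @[k --> \oo] --> 0 }.

Definition cvg_cov dD (D : measurableType dD) (Q : probability D R)
    (Y : (T1 * D -> R)^nat) (Y0 : T2 * D -> R)
    (X : (T1 * E -> R)^nat) (X0 : T2 * E -> R) :=
  Ex (pp Q PE) (fun p => `|cv P1 (Y k) (X k) p - cv P2 Y0 X0 p|) @[k --> \oo] --> 0.

Lemma expRN_lipschitz (u v : R) : 0 <= u -> 0 <= v ->
  `|expR (- u) - expR (- v)| <= `|u - v|.
Proof.
wlog uv : u v / u <= v => [H u0 v0|u0 v0].
  by have [/H->//|/ltW/H h] := leP u v; rewrite distrC (distrC u) h.
have h1 : expR (- v) <= expR (- u) by rewrite ler_expR lerN2.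
rewrite ger0_norm ?subr_ge0// ler0_norm ?subr_le0// opprB.
have h2 : 1 - (v - u) <= expR (- (v - u)) by exact: expR_ge1Dx.
have -> : expR (- v) = expR (- u) * expR (- (v - u)) by rewrite -expRD; congr expR; ring.
have : expR (- u) <= 1 by rewrite -expR0 ler_expR oppr_le0.
have := expR_ge0 (- u); nra.
Qed.

(** By [Ex_trig_mean] only variances enter, and [v -> exp (- v / 2)] is Lipschitz on [v >= 0]; hence
    L1 convergence of the variances suffices. *)
Lemma cvg_Ex_trig_mean dD (D : measurableType dD) (Q : probability D R) Y Y0 A B :
  cvg_family Q Y Y0 -> bounded_mfun A -> bounded_mfun B ->
  Ex P1 (trig_mean Q (Y k) (A, B)) @[k --> \oo] --> Ex P2 (trig_mean Q Y0 (A, B)).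
Proof.
move=> [gY gY0 vY] bA bB; have [mA [M hM]] := bA.
have M0 : 0 <= M by apply: (le_trans (normr_ge0 (A point))).
rewrite (Ex_trig_mean Q gG2 (gf_meas gY0) (gf_in gY0))//.
under eq_cvg => k do rewrite (Ex_trig_mean Q gG1 (gf_meas (gY k)) (gf_in (gY k)))//.
have bexp dT (T : measurableType dT) (P : probability T R) (Z : T * D -> R) :
    measurable_fun setT Z -> L1 Q (fun u => A u * expR (- (vr P Z u / 2))).
  move=> mZ; apply: (@L1_bnd _ _ _ Q _ M) => [|u].
    apply: measurable_funM => //; apply: measurableT_comp => //.
    apply: measurableT_comp => //; apply: measurable_funM => //.
    exact: measurable_vr.
  rewrite normrM (le_trans _ (hM u))// ler_piMr// ger0_norm ?expR_ge0//.
  by rewrite -expR0 ler_expR oppr_le0 divr_ge0// vr_ge0.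
apply/cvgrPdist_le => e e0.
(* [M + 1] replaces [M] because the bound [M] on [A] may be 0. *)
have /cvgrPdist_le/(_ (e / (M + 1))) := vY.
rewrite divr_gt0 ?ltr_wpDl// => /(_ isT); apply: filterS => k.
rewrite sub0r normrN ger0_norm; last by apply: Ex_ge0.
have l1 := bexp _ _ P1 _ (gf_meas (gY k)); have l2 := bexp _ _ P2 _ (gf_meas gY0).
move=> h; rewrite distrC -ExB//.
have lv : L1 Q (fun u => `|vr P1 (Y k) u - vr P2 Y0 u|).
  by apply: L1_norm; apply: L1B; apply: L1_vr; [exact: gf_L2 (gY k)|exact: gf_L2 gY0].
apply: (le_trans (Ex_norm_le (L1B l1 l2) (L1Z (M + 1) lv) _)).
  move=> u; rewrite -mulrBr normrM ler_pM//.
    by rewrite (le_trans (hM u))// lerDl.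
  rewrite (le_trans (expRN_lipschitz _ _)) ?divr_ge0 ?vr_ge0//.
  by rewrite -mulrBl normrM ler_piMr// ger0_norm ?invr_ge0// invf_le1// ler1n.
rewrite ExZ// mulrC -ler_pdivlMr// ltr_wpDl//.
Qed.

Variables (X : (T1 * E -> R)^nat) (X0 : T2 * E -> R).
Hypotheses (fX : cvg_family PE X X0) (cX : cvg_cov PE X X0 X X0).

Lemma cvg_norm_comb dD (D : measurableType dD) (Q : probability D R) (f g : (D -> R)^nat) (a b : R) :
  (forall k, L1 Q (f k)) -> (forall k, L1 Q (g k)) ->
  Ex Q (fun u => `|f k u|) @[k --> \oo] --> 0 ->
  Ex Q (fun u => `|g k u|) @[k --> \oo] --> 0 ->
  Ex Q (fun u => `|a * f k u + b * g k u|) @[k --> \oo] --> 0.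
Proof.
move=> lf lg hf hg; apply: (@squeeze_cvgr _ _ _ _ (fun=> 0)
    (fun k => `|a| * Ex Q (fun u => `|f k u|) + `|b| * Ex Q (fun u => `|g k u|))).
- apply: nearW => k; rewrite Ex_ge0//= -!ExZ -?ExD; try (exact: L1_norm || exact/L1Z/L1_norm).
  apply: Ex_le.
  + by apply/L1_norm/L1D; exact: L1Z.
  + by apply: L1D; apply/L1Z/L1_norm.
  + by move=> u; rewrite -!normrM ler_normD.
- exact: cvg_cst.
- have -> : (0 : R) = `|a| * 0 + `|b| * 0 by rewrite !mulr0 addr0.
  by apply: cvgD; apply: cvgM => //; exact: cvg_cst.
Qed.

Section step.
Context dD (D : measurableType dD) (Q : probability D R).
Variables (Y : (T1 * D -> R)^nat) (Y0 : T2 * D -> R).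
Hypotheses (fY : cvg_family Q Y Y0) (cY : cvg_cov Q Y Y0 X X0).

Let lcY k : L1 (pp Q PE) (fun p => cv P1 (Y k) (X k) p - cv P2 Y0 X0 p).
Proof.
have gY := cf_fam fY k; have gX := cf_fam fX k.
have gY0 := cf_fam0 fY; have gX0 := cf_fam0 fX.
apply: L1B; apply: L1_cv.
- exact: gf_L2 gY.
- exact: gf_L2 gX.
- by move=> u; exact: (gs_L2 gG1 (gf_in gY u)).
- by move=> u; exact: (gs_L2 gG1 (gf_in gX u)).
- exact: gf_L2 gY0.
- exact: gf_L2 gX0.
- by move=> u; exact: (gs_L2 gG2 (gf_in gY0 u)).
- by move=> u; exact: (gs_L2 gG2 (gf_in gX0 u)).
Qed.

Let lcX k : L1 (pp PE PE) (fun p => cv P1 (X k) (X k) p - cv P2 X0 X0 p).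
Proof.
have gX := cf_fam fX k; have gX0 := cf_fam0 fX.
apply: L1B; apply: L1_cv.
- exact: gf_L2 gX.
- exact: gf_L2 gX.
- by move=> u; exact: (gs_L2 gG1 (gf_in gX u)).
- by move=> u; exact: (gs_L2 gG1 (gf_in gX u)).
- exact: gf_L2 gX0.
- exact: gf_L2 gX0.
- by move=> u; exact: (gs_L2 gG2 (gf_in gX0 u)).
- by move=> u; exact: (gs_L2 gG2 (gf_in gX0 u)).
Qed.

Let lvY k : L1 Q (fun u => vr P1 (Y k) u - vr P2 Y0 u).
Proof. by apply: L1B; apply: L1_vr; [exact: gf_L2 (cf_fam fY k)|exact: gf_L2 (cf_fam0 fY)]. Qed.

Let lvX k : L1 PE (fun u => vr P1 (X k) u - vr P2 X0 u).
Proof. by apply: L1B; apply: L1_vr; [exact: gf_L2 (cf_fam fX k)|exact: gf_L2 (cf_fam0 fX)]. Qed.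

(** Applied with [s = 2] and [s = - 2], the coefficient of the covariance in the variance of a sum
    or of a difference. *)
Let var_step (s : R) :
  Ex (pp Q PE) (fun p => `|(vr P1 (Y k) p.1 + s * cv P1 (Y k) (X k) p + vr P1 (X k) p.2)
     - (vr P2 Y0 p.1 + s * cv P2 Y0 X0 p + vr P2 X0 p.2)|) @[k --> \oo] --> 0.
Proof.
pose f k (p : D * E) := vr P1 (Y k) p.1 - vr P2 Y0 p.1.
pose g k (p : D * E) := vr P1 (X k) p.2 - vr P2 X0 p.2.
pose h k (p : D * E) := cv P1 (Y k) (X k) p - cv P2 Y0 X0 p.
have lf k : L1 (pp Q PE) (f k) by have [] := Ex_fst PE (lvY k).
have lg k : L1 (pp Q PE) (g k) by have [] := Ex_snd Q (lvX k).
have hf : Ex (pp Q PE) (fun u => `|f k u|) @[k --> \oo] --> 0.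
  under eq_cvg => k do rewrite (Ex_fst PE (L1_norm (lvY k))).2.
  exact: cf_var fY.
have hg : Ex (pp Q PE) (fun u => `|g k u|) @[k --> \oo] --> 0.
  under eq_cvg => k do rewrite (Ex_snd Q (L1_norm (lvX k))).2.
  exact: cf_var fX.
have hfg := cvg_norm_comb 1 1 lf lg hf hg.
have lfg k : L1 (pp Q PE) (fun u => 1 * f k u + 1 * g k u) by apply: L1D; exact: L1Z.
have := cvg_norm_comb 1 s lfg lcY hfg cY.
apply: cvg_trans; apply: near_eq_cvg; apply: nearW => k; apply: eq_Ex => p.
by congr `| _ |; rewrite /f /g; ring.
Qed.

Lemma cvg_family_add : cvg_family (pp Q PE) (fun k => Yadd (Y k) (X k)) (Yadd Y0 X0).
Proof.
split.
- by move=> k; apply: (gaussian_Yadd gG1); [exact: cf_fam fY k|exact: cf_fam fX k].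
- by apply: (gaussian_Yadd gG2); [exact: cf_fam0 fY|exact: cf_fam0 fX].
- have := var_step 2; apply: cvg_trans; apply: near_eq_cvg; apply: nearW => k.
  apply: eq_Ex => p; rewrite (vr_Yadd gG1 (cf_fam fY k) (cf_fam fX k)).
  by rewrite (vr_Yadd gG2 (cf_fam0 fY) (cf_fam0 fX)).
Qed.

Lemma cvg_family_sub : cvg_family (pp Q PE) (fun k => Ysub (Y k) (X k)) (Ysub Y0 X0).
Proof.
split.
- by move=> k; apply: (gaussian_Ysub gG1); [exact: cf_fam fY k|exact: cf_fam fX k].
- by apply: (gaussian_Ysub gG2); [exact: cf_fam0 fY|exact: cf_fam0 fX].
- have := var_step (- 2); apply: cvg_trans; apply: near_eq_cvg; apply: nearW => k.
  apply: eq_Ex => p; rewrite (vr_Ysub gG1 (cf_fam fY k) (cf_fam fX k)).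
  by rewrite (vr_Ysub gG2 (cf_fam0 fY) (cf_fam0 fX)); congr `| _ |; ring.
Qed.

Let cov_step (s : R) :
  Ex (pp (pp Q PE) PE) (fun q =>
     `|(cv P1 (Y k) (X k) (q.1.1, q.2) + s * cv P1 (X k) (X k) (q.1.2, q.2))
     - (cv P2 Y0 X0 (q.1.1, q.2) + s * cv P2 X0 X0 (q.1.2, q.2))|) @[k --> \oo] --> 0.
Proof.
pose f k (q : (D * E) * E) := cv P1 (Y k) (X k) (q.1.1, q.2) - cv P2 Y0 X0 (q.1.1, q.2).
pose g k (q : (D * E) * E) := cv P1 (X k) (X k) (q.1.2, q.2) - cv P2 X0 X0 (q.1.2, q.2).
have mf k : measurable_fun setT (f k).
  apply: (measurableT_comp (L1_meas (lcY k))); apply: measurable_fun_pair => //=.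
  exact: measurableT_comp.
have mg k : measurable_fun setT (g k).
  apply: (measurableT_comp (L1_meas (lcX k))); apply: measurable_fun_pair => //=.
  exact: measurableT_comp.
have [lf ef] : (forall k, L1 (pp (pp Q PE) PE) (f k)) /\ forall k,
    Ex (pp (pp Q PE) PE) (fun q => `|f k q|) =
    Ex (pp Q PE) (fun p => `|cv P1 (Y k) (X k) p - cv P2 Y0 X0 p|).
  split=> k; have [l e] := Ex_marginal13 PE (fun p => normr_ge0 _) (L1_norm (lcY k)).
    exact: L1_le (mf k) (fun q => lexx _) l.
  exact: e.
have [lg eg] : (forall k, L1 (pp (pp Q PE) PE) (g k)) /\ forall k,
    Ex (pp (pp Q PE) PE) (fun q => `|g k q|) =
    Ex (pp PE PE) (fun p => `|cv P1 (X k) (X k) p - cv P2 X0 X0 p|).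
  split=> k; have [l e] := Ex_marginal23 Q (fun p => normr_ge0 _) (L1_norm (lcX k)).
    exact: L1_le (mg k) (fun q => lexx _) l.
  exact: e.
have hf : Ex (pp (pp Q PE) PE) (fun u => `|f k u|) @[k --> \oo] --> 0.
  by under eq_cvg => k do rewrite ef; exact: cY.
have hg : Ex (pp (pp Q PE) PE) (fun u => `|g k u|) @[k --> \oo] --> 0.
  by under eq_cvg => k do rewrite eg; exact: cX.
have := cvg_norm_comb 1 s lf lg hf hg.
apply: cvg_trans; apply: near_eq_cvg; apply: nearW => k; apply: eq_Ex => p.
by congr `| _ |; rewrite /f /g; ring.
Qed.

Lemma cvg_cov_add :
  cvg_cov (pp Q PE) (fun k => Yadd (Y k) (X k)) (Yadd Y0 X0) X X0.
Proof.
have := cov_step 1; apply: cvg_trans; apply: near_eq_cvg; apply: nearW => k.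
apply: eq_Ex => q; rewrite (cv_Yadd gG1 (cf_fam fY k) (cf_fam fX k)).
by rewrite (cv_Yadd gG2 (cf_fam0 fY) (cf_fam0 fX)); congr `| _ |; ring.
Qed.

Lemma cvg_cov_sub :
  cvg_cov (pp Q PE) (fun k => Ysub (Y k) (X k)) (Ysub Y0 X0) X X0.
Proof.
have := cov_step (- 1); apply: cvg_trans; apply: near_eq_cvg; apply: nearW => k.
apply: eq_Ex => q; rewrite (cv_Ysub gG1 (cf_fam fY k) (cf_fam fX k)).
by rewrite (cv_Ysub gG2 (cf_fam0 fY) (cf_fam0 fX)); congr `| _ |; ring.
Qed.

End step.

Definition bounded_pair (c : (E -> R) * (E -> R)) := bounded_mfun c.1 /\ bounded_mfun c.2.

(* A product of means is a mean over independent replicas of the index [E];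
   the factors already merged live on the auxiliary space [D]. *)
Lemma cvg_Ex_prod_trig_mean_aux (s : seq ((E -> R) * (E -> R))) :
  (forall i, (i < size s)%N -> bounded_pair (nth (fun=> 0, fun=> 0) s i)) ->
  forall dD (D : measurableType dD) (Q : probability D R)
    (Y : (T1 * D -> R)^nat) (Y0 : T2 * D -> R) A B,
  cvg_family Q Y Y0 -> cvg_cov Q Y Y0 X X0 ->
  bounded_mfun A -> bounded_mfun B ->
  Ex P1 (fun t => trig_mean Q (Y k) (A, B) t *
                  \prod_(c <- s) trig_mean PE (X k) c t) @[k --> \oo] -->
  Ex P2 (fun t => trig_mean Q Y0 (A, B) t * \prod_(c <- s) trig_mean PE X0 c t).
Proof.
have bprod d (T : measurableType d) (Z : T * E -> R) s' : measurable_fun setT Z ->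
    (forall i, (i < size s')%N -> bounded_pair (nth (fun=> 0, fun=> 0) s' i)) ->
    measurable_fun setT (fun t => \prod_(c <- s') trig_mean PE Z c t) /\
    exists M : R, forall t, `|\prod_(c <- s') trig_mean PE Z c t| <= M.
  move=> mZ; elim: s' => [|[a b] s' IH] bs.
    under eq_fun do rewrite big_nil.
    by split; [exact: measurable_cst|exists 1 => t; rewrite big_nil normr1].
  under eq_fun do rewrite big_cons.
  have [ba bb] := bs 0%N isT.
  have [m1 [M hM]] := trig_mean_bound PE mZ ba bb.
  have [m2 [N hN]] := IH (fun i hi => bs i.+1 hi).
  split; first exact: measurable_funM.
  by exists (M * N) => t; rewrite big_cons normrM ler_pM.
elim: s => [|[a b] s IH] bs dD D Q Y Y0 A B fY cY bA bB.
  apply: eq_cvg_seq (cvg_Ex_trig_mean fY bA bB) => [k|];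
    by apply: eq_Ex => t; rewrite big_nil mulr1.
have [ba bb] := bs 0%N isT; have bs' i hi := bs i.+1 hi.
have b1 : bounded_mfun (cadd A B a b).1 by apply: bounded_comb; exact: bounded_tprod.
have b2 : bounded_mfun (cadd A B a b).2 by apply: bounded_comb; exact: bounded_tprod.
have b3 : bounded_mfun (csub A B a b).1 by apply: bounded_comb; exact: bounded_tprod.
have b4 : bounded_mfun (csub A B a b).2 by apply: bounded_comb; exact: bounded_tprod.
have split_step d (T : measurableType d) (P : probability T R) (U : T * D -> R) (V : T * E -> R) :
  measurable_fun setT U -> measurable_fun setT V ->
  Ex P (fun t => trig_mean Q U (A, B) t * \prod_(c <- (a, b) :: s) trig_mean PE V c t) =
  Ex P (fun t => trig_mean (pp Q PE) (Yadd U V) (cadd A B a b) t *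
     \prod_(c <- s) trig_mean PE V c t) +
  Ex P (fun t => trig_mean (pp Q PE) (Ysub U V) (csub A B a b) t *
     \prod_(c <- s) trig_mean PE V c t).
  move=> mU mV.
  have [mp [K hK]] := bprod _ _ V s mV bs'.
  have [m1 [M hM]] := trig_mean_bound (pp Q PE) (measurable_Yadd mU mV) b1 b2.
  have [m2 [N hN]] := trig_mean_bound (pp Q PE) (measurable_Ysub mU mV) b3 b4.
  rewrite -ExD.
  - apply: eq_Ex => t; rewrite big_cons mulrA -mulrDl; congr (_ * _).
    exact: trig_meanM.
  - apply: (@L1_bnd _ _ _ P _ (M * K)) => [|t]; first exact: measurable_funM.
    by rewrite normrM ler_pM.
  - apply: (@L1_bnd _ _ _ P _ (N * K)) => [|t]; first exact: measurable_funM.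
    by rewrite normrM ler_pM.
have c1 := IH bs' _ _ _ _ _ _ _ (cvg_family_add fY cY) (cvg_cov_add fY cY) b1 b2.
have c2 := IH bs' _ _ _ _ _ _ _ (cvg_family_sub fY cY) (cvg_cov_sub fY cY) b3 b4.
apply: eq_cvg_seq (cvgD c1 c2) => [k|].
  by rewrite split_step; [|exact: gf_meas (cf_fam fY k)|exact: gf_meas (cf_fam fX k)].
by rewrite split_step; [|exact: gf_meas (cf_fam0 fY)|exact: gf_meas (cf_fam0 fX)].
Qed.

Lemma cvg_Ex_prod_trig_mean (s : seq ((E -> R) * (E -> R))) :
  (forall i, (i < size s)%N -> bounded_pair (nth (fun=> 0, fun=> 0) s i)) ->
  Ex P1 (fun t => \prod_(c <- s) trig_mean PE (X k) c t) @[k --> \oo] -->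
  Ex P2 (fun t => \prod_(c <- s) trig_mean PE X0 c t).
Proof.
(* The induction starts from a trivial replica: the phase 0 with coefficients [(1, 0)] has mean 1,
   and its variances and covariances vanish. *)
move=> bs; pose Y (k : nat) (p : T1 * E) : R := 0; pose Y0 (p : T2 * E) : R := 0.
have fY : cvg_family PE Y Y0.
  split => [k||].
  - split; [exact: measurable_cst|by move=> u; exact: gs_zero gG1|exact: L20].
  - split; [exact: measurable_cst|by move=> u; exact: gs_zero gG2|exact: L20].
  - apply: (eq_cvg_seq _ erefl (cvg_cst 0)) => k; rewrite -[RHS](Ex0 PE).
    apply: eq_Ex => u; rewrite /vr /Y /Y0 expr0n/=.
    by rewrite !Ex0 subrr normr0.
have cY : cvg_cov PE Y Y0 X X0.
  apply: (eq_cvg_seq _ erefl (cvg_cst 0)) => k; rewrite -[RHS](Ex0 (pp PE PE)).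
  apply: eq_Ex => p; rewrite /cv /Y /Y0.
  have e1 : Ex P1 (fun t => 0 * X k (t, p.2)) = 0.
    by rewrite -[RHS](Ex0 P1); apply: eq_Ex => t; rewrite mul0r.
  have e2 : Ex P2 (fun t => 0 * X0 (t, p.2)) = 0.
    by rewrite -[RHS](Ex0 P2); apply: eq_Ex => t; rewrite mul0r.
  by rewrite [X in `|X - _|]e1 [X in `|_ - X|]e2 subrr normr0.
have b1 : bounded_mfun (fun=> 1 : R) (D := E).
  by split; [exact: measurable_cst|exists 1 => u; rewrite normr1].
have b0 : bounded_mfun (fun=> 0 : R) (D := E).
  by split; [exact: measurable_cst|exists 0 => u; rewrite normr0].
have head1 d (T : measurableType d) (t : T) :
    trig_mean PE (fun _ : T * E => 0) (fun=> 1, fun=> 0) t = 1.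
  rewrite -[RHS](Ex_cst PE); apply: eq_Ex => u /=.
  by rewrite cos0 sin0 mulr1 mulr0 addr0.
apply: eq_cvg_seq (cvg_Ex_prod_trig_mean_aux bs fY cY b1 b0) => [k|];
  by apply: eq_Ex => t; rewrite head1 mul1r.
Qed.

End replicas.

(** * Closed Gaussian spaces *)

Section mean_of_process.
Context d dS (T : measurableType d) (S : measurableType dS) (R : realType).
Context (P : probability T R) (U : probability S R).

Lemma L1_le_ae (f g : T -> R) : measurable_fun setT f ->
  {ae P, forall t, `|f t| <= g t} -> L1 P g -> L1 P f.
Proof.
move=> mf fg lg; have mg := L1_meas lg.
apply/integrableP; split; first exact/measurable_EFinP.
have /integrableP[_] := L1_norm lg; apply: le_lt_trans.
apply: ae_ge0_le_integral => //.
- by apply/measurable_EFinP; exact: measurableT_comp.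
- by apply/measurable_EFinP; do 2 apply: measurableT_comp => //.
- apply: filterS fg => t h _ /=; rewrite lee_fin normr_id.
  by rewrite (le_trans h)// ler_norm.
Qed.

Lemma Ex_le_ae (f g : T -> R) : L1 P f -> L1 P g ->
  {ae P, forall t, f t <= g t} -> Ex P f <= Ex P g.
Proof.
move=> lf lg fg; rewrite -lee_fin !Ex_EFin// -subre_ge0; last exact: integrable_fin_num.
rewrite -integralB_EFin//; rewrite -Ex_EFin; last exact: L1B.
have mfg : measurable_fun setT (fun t => g t - f t).
  by apply: measurable_funB; [exact: L1_meas lg|exact: L1_meas lf].
rewrite lee_fin (_ : Ex P _ = Ex P (fun t => `|g t - f t|)).
  by apply: Ex_ge0.
apply: Ex_ae_eq => //; first exact: measurableT_comp.
by apply: filterS fg => t h; rewrite ger0_norm// subr_ge0.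
Qed.

Variables (H : T * S -> R) (c : R).
Hypotheses (mH : measurable_fun setT H).
Hypotheses (lH : forall s, L2 P (fun t => H (t, s))).
Hypotheses (cH : forall s, Ex P (fun t => H (t, s) ^+ 2) <= c).

Definition pmean t := Ex U (fun s => H (t, s)).

Lemma measurable_pmean : measurable_fun setT pmean.
Proof. exact: measurable_Ex2. Qed.

Let c0 : 0 <= c.
Proof. by apply: le_trans (cH point); apply: Ex_ge0 => t; exact: sqr_ge0. Qed.

Lemma L1_sqr_process : L1 (pp P U) (fun p => H p ^+ 2).
Proof.
apply: pp_tonelli2; first exact: measurable_funX.
  by move=> s; have [] := lH s.
apply: (@L1_bnd _ _ _ U _ c) => [|s].
  under eq_fun => s do under eq_Ex do rewrite ger0_norm ?sqr_ge0//.
  apply: (@measurable_Ex1 _ _ _ _ _ P (fun p => H p ^+ 2)).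
  exact: measurable_funX.
rewrite ger0_norm ?Ex_ge0//.
by under eq_Ex do rewrite ger0_norm ?sqr_ge0//.
Qed.

(** Jensen's inequality for the law [U], applied at those [t] where the trajectory is square
    integrable. *)
Lemma pmean_sqr_ae : {ae P, forall t, pmean t ^+ 2 <= Ex U (fun s => H (t, s) ^+ 2)}.
Proof.
have := @L1_ae1 _ _ _ _ _ P U _ L1_sqr_process; apply: filterS => t lt.
apply: Ex_sqr_le; split => //; apply: (measurableT_comp mH).
exact: measurable_pair1.
Qed.

Lemma L2_pmean : L2 P pmean /\ Ex P (fun t => pmean t ^+ 2) <= c.
Proof.
have [l1 e1] := pp_fubini1 L1_sqr_process.
have [l2 e2] := pp_fubini2 L1_sqr_process.
have lp : L1 P (fun t => pmean t ^+ 2).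
  apply: (L1_le_ae _ _ l1); first by apply: measurable_funX; exact: measurable_pmean.
  by apply: filterS pmean_sqr_ae => t; rewrite ger0_norm// sqr_ge0.
split; first by split => //; exact: measurable_pmean.
apply: (le_trans (Ex_le_ae lp l1 pmean_sqr_ae)).
by rewrite -e1 e2; exact: Ex_le_cst.
Qed.

Lemma pmean_inner (Z : T -> R) : L2 P Z ->
  L1 U (fun s => Ex P (fun t => Z t * H (t, s))) /\
  Ex P (fun t => Z t * pmean t) = Ex U (fun s => Ex P (fun t => Z t * H (t, s))).
Proof.
move=> lZ; have [mZ lZ2] := lZ.
have mZH : measurable_fun setT (fun p : T * S => Z p.1 * H p).
  by apply: measurable_funM => //; exact: measurableT_comp.
have lZH : L1 (pp P U) (fun p => Z p.1 * H p).
  apply: pp_tonelli2 => // [s|]; first exact: L2_mul.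
  apply: (@L1_bnd _ _ _ U _ (Ex P (fun t => Z t ^+ 2) + c)) => [|s].
    apply: (@measurable_Ex1 _ _ _ _ _ P (fun p => `|Z p.1 * H p|)).
    exact: measurableT_comp.
  rewrite ger0_norm ?Ex_ge0//.
  have [_ lHs] := lH s.
  apply: (@le_trans _ _ (Ex P (fun t => Z t ^+ 2 + H (t, s) ^+ 2))).
    apply: Ex_le; [exact/L1_norm/L2_mul|exact: L1D|].
    move=> t /=; rewrite normrM -[Z t ^+ 2]real_normK ?num_real//.
    rewrite -[H (t, s) ^+ 2]real_normK ?num_real//.
    by have := sqr_ge0 (`|Z t| - `|H (t, s)|); nra.
  by rewrite ExD// lerD2l.
have [l1 e1] := pp_fubini1 lZH; have [l2 e2] := pp_fubini2 lZH.
split; first exact: l2.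
rewrite -e2 e1; apply: Ex_ae_eq.
- by apply: measurable_funM => //; exact: measurable_pmean.
- exact: L1_meas l1.
- have := @L1_ae1 _ _ _ _ _ P U _ L1_sqr_process; apply: filterS => t lt /=.
  rewrite ExZ//; apply: L2_L1; split => //.
  by apply: (measurableT_comp mH); exact: measurable_pair1.
Qed.

(* Greedy choice of sampling points: each new point may be taken so that the
   cross term does not increase the error, so [K] points are within
   [4 c K] of [K * pmean] in squared [L2] norm. *)
Lemma pmean_sampling (K : nat) : exists s : 'I_K -> S,
  Ex P (fun t => (\sum_(j < K) H (t, s j) - K%:R * pmean t) ^+ 2) <= 4 * c * K%:R.
Proof.
have [lp cp] := L2_pmean.
elim: K => [|K [s hs]].
  exists (fun=> point); rewrite mulr0 le_eqVlt; apply/orP; left; apply/eqP.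
  rewrite -[RHS](Ex0 P); apply: eq_Ex => t.
  by rewrite big_ord0 mul0r subrr expr0n.
set D := fun t => \sum_(j < K) H (t, s j) - K%:R * pmean t.
have lD : L2 P D by apply: L2B; [exact: L2_sum|exact: L2Z].
have [lDH eDH] := pmean_inner lD.
have [r hr] : exists r, Ex P (fun t => D t * H (t, r)) <= Ex P (fun t => D t * pmean t).
  by apply: (Ex_exists_le lDH); rewrite eDH.
exists (fun j => oapp s r (unlift ord_max j)).
have -> : Ex P (fun t => (\sum_(j < K.+1) H (t, oapp s r (unlift ord_max j)) -
    K.+1%:R * pmean t) ^+ 2) = Ex P (fun t => (D t + (H (t, r) - pmean t)) ^+ 2).
  apply: eq_Ex => t; rewrite big_ord_recr/= unlift_none/=.
  under eq_bigr => j _.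
    have -> : widen_ord (leqnSn K) j = lift ord_max j.
      by apply/val_inj; rewrite /= /bump leqNgt ltn_ord add0n.
    rewrite liftK/=; over.
  by rewrite /D -natr1; ring.
have lE : L2 P (fun t => H (t, r) - pmean t) by exact: L2B.
have e : Ex P (fun t => (D t + (H (t, r) - pmean t)) ^+ 2) =
    Ex P (fun t => D t ^+ 2) + 2 * (Ex P (fun t => D t * H (t, r)) -
    Ex P (fun t => D t * pmean t)) + Ex P (fun t => (H (t, r) - pmean t) ^+ 2).
  have l1 := L2_mul lD (lH r); have l2 := L2_mul lD lp.
  have [_ l3] := lE; have [_ l4] := lD.
  have l5 := L1Z 2 (L1B l1 l2).
  rewrite -ExB// -ExZ; last exact: L1B.
  rewrite -ExD// -ExD//; last exact: L1D.
  by apply: eq_Ex => t; ring.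
rewrite e; have [_ lHr2] := lH r; have [_ lp2] := lp.
have h3 : Ex P (fun t => (H (t, r) - pmean t) ^+ 2) <= 4 * c.
  have := minkowski2 (lH r) (L2N lp); under [X in _ <= _ + 2 * X -> _]eq_Ex do rewrite sqrrN.
  by move/le_trans; apply; have := cH r; lra.
by move: hs hr; rewrite -natr1; lra.
Qed.

End mean_of_process.

Section gaussian_closure.
Context d (T : measurableType d) (R : realType) (P : probability T R) (I : Type).
Variable X : I -> T -> R.
Hypothesis gX : centered_gaussian_process P X.

Definition lin_span : set (T -> R) :=
  [set f | exists k (c : 'I_k -> R) (x : 'I_k -> I),
     f = fun w => \sum_(j < k) c j * X (x j) w].

Definition L2_closure (A : set (T -> R)) : set (T -> R) :=
  [set f | L2 P f /\ forall e, 0 < e ->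
     exists2 g, A g & Ex P (fun t => (f t - g t) ^+ 2) <= e].

Definition gauss_cl := L2_closure lin_span.

Lemma lin_span_normal f : lin_span f -> centered_normal P f.
Proof. by case=> k [c [x ->]]; exact: gX. Qed.

Lemma lin_span_L2 f : lin_span f -> L2 P f.
Proof. by move=> /lin_span_normal /centered_normalP[]. Qed.

Lemma lin_spanD f g : lin_span f -> lin_span g -> lin_span (fun t => f t + g t).
Proof.
move=> [k [c [x ->]]] [l [c' [x' ->]]].
exists (k + l)%N, (fun i => match fintype.split i with inl j => c j | inr j => c' j end),
  (fun i => match fintype.split i with inl j => x j | inr j => x' j end).
apply/funext => t; rewrite big_split_ord/=; congr (_ + _); apply: eq_bigr => j _.
  by rewrite (unsplitK (inl j)).
by rewrite (unsplitK (inr j)).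
Qed.

Lemma lin_spanZ a f : lin_span f -> lin_span (fun t => a * f t).
Proof.
move=> [k [c [x ->]]]; exists k, (fun j => a * c j), x.
by apply/funext => t; rewrite mulr_sumr; apply: eq_bigr => j _; rewrite mulrA.
Qed.

Lemma gauss_clD f g : gauss_cl f -> gauss_cl g -> gauss_cl (fun t => f t + g t).
Proof.
move=> [lf hf] [lg hg]; split; first exact: L2D.
move=> e e0; have e4 : 0 < e / 4 by rewrite divr_gt0.
have [f' sf' ef'] := hf _ e4; have [g' sg' eg'] := hg _ e4.
exists (fun t => f' t + g' t); first exact: lin_spanD.
have := minkowski2 (L2B lf (lin_span_L2 sf')) (L2B lg (lin_span_L2 sg')).
under eq_Ex do rewrite addrACA -opprD.
by move/le_trans; apply; lra.
Qed.

Lemma gauss_clZ a f : gauss_cl f -> gauss_cl (fun t => a * f t).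
Proof.
move=> [lf hf]; split; first exact: L2Z.
move=> e e0; have a0 : 0 < a ^+ 2 + 1 by rewrite ltr_wpDl// sqr_ge0.
have [g sg eg] := hf (e / (a ^+ 2 + 1)) (divr_gt0 e0 a0).
exists (fun t => a * g t); first exact: lin_spanZ.
under eq_Ex do rewrite -mulrBr exprMn.
rewrite ExZ; last by have [] := L2B lf (lin_span_L2 sg).
apply: (le_trans (ler_wpM2l (sqr_ge0 a) eg)).
by rewrite mulrA ler_pdivrMr// mulrC; apply: ler_wpM2l; [exact: ltW|rewrite lerDl].
Qed.

Lemma gauss_cl_span f : lin_span f -> gauss_cl f.
Proof.
move=> sf; split; first exact: lin_span_L2.
move=> e e0; exists f => //; apply: (le_trans _ (ltW e0)).
rewrite le_eqVlt; apply/orP; left; apply/eqP; rewrite -[RHS](Ex0 P).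
by apply: eq_Ex => t; rewrite subrr expr0n.
Qed.

Lemma gauss_cl_process i : gauss_cl (X i).
Proof.
apply: gauss_cl_span; exists 1%N, (fun=> 1), (fun=> i).
by apply/funext => t; rewrite big_ord1 mul1r.
Qed.

Lemma gauss_cl0 : gauss_cl (fun=> 0).
Proof.
apply: gauss_cl_span; exists 0%N, (fun=> 0), (ffun0 (card_ord 0) : {ffun 'I_0 -> I}).
by apply/funext => t; rewrite big_ord0.
Qed.

Lemma gauss_cl_sum K (F : 'I_K -> T -> R) : (forall j, gauss_cl (F j)) ->
  gauss_cl (fun t => \sum_(j < K) F j t).
Proof.
elim: K F => [|K IH] F hF; first by under eq_fun do rewrite big_ord0; exact: gauss_cl0.
by under eq_fun do rewrite big_ord_recr; apply: gauss_clD => //; exact: IH.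
Qed.

Lemma gauss_cl_closed f : L2 P f ->
  (forall e, 0 < e -> exists2 g, gauss_cl g & Ex P (fun t => (f t - g t) ^+ 2) <= e) ->
  gauss_cl f.
Proof.
move=> lf hf; split => // e e0; have e4 : 0 < e / 4 by rewrite divr_gt0.
have [g [lg hg] eg] := hf _ e4; have [h sh eh] := hg _ e4.
exists h => //.
have := minkowski2 (L2B lf lg) (L2B lg (lin_span_L2 sh)).
under eq_Ex do rewrite subrKA.
by move/le_trans; apply; lra.
Qed.

Lemma le_small_eq0 (a C : R) : 0 <= a -> (forall r, 0 < r -> r <= 1 -> a <= C * r) -> a = 0.
Proof.
move=> a0 h; apply/eqP; rewrite eq_le a0 andbT; apply/ler_addgt0Pl => e e0; rewrite addr0.
pose D := `|C| + 1; have D0 : 0 < D by rewrite ltr_wpDl.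
pose r := Num.min 1 (e / D).
have r0 : 0 < r by rewrite lt_min ltr01 divr_gt0.
apply: (le_trans (h r r0 _)); first by rewrite ge_min lexx.
apply: (@le_trans _ _ (D * r)).
  apply: ler_wpM2r; [exact: ltW|].
  by rewrite /D (le_trans (ler_norm C))// lerDl.
by rewrite -ler_pdivlMl// mulrC ge_min lexx orbT.
Qed.

Lemma lipschitz1 (f f' : R -> R) (u v : R) : 
  (forall x : R, is_derive x (1 : R) f (f' x)) -> (forall x, `|f' x| <= 1) -> `|f u - f v| <= `|u - v|.
Proof.
move=> df bf; wlog uv : u v / u <= v => [W|].
  by have [/W//|/ltW/W] := leP u v; rewrite distrC (distrC v).
have cf : {within `[u, v], continuous f}.
  apply: continuous_subspaceT => x.
  by apply/differentiable_continuous/derivable1_diffP; have [] := df x.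
have [x _ fx] := MVT_segment uv (fun x _ => df x) cf.
by rewrite distrC fx normrM (distrC u) ler_piMl.
Qed.

Lemma lipschitz_cos (u v : R) : `|cos u - cos v| <= `|u - v|.
Proof.
apply: (@lipschitz1 cos (fun x => - sin x)) => x.
by rewrite normrN sin_max.
Qed.

Lemma lipschitz_sin (u v : R) : `|sin u - sin v| <= `|u - v|.
Proof. by apply: (@lipschitz1 sin cos) => x; exact: cos_max. Qed.

Lemma Ex_lipschitz (h : R -> R) (f g : T -> R) r : measurable_fun setT h ->
  (forall x, `|h x| <= 1) -> (forall u v, `|h u - h v| <= `|u - v|) ->
  L2 P f -> L2 P g -> 0 <= r -> Ex P (fun t => (f t - g t) ^+ 2) <= r ^+ 2 ->
  `|Ex P (fun t => h (f t)) - Ex P (fun t => h (g t))| <= r.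
Proof.
move=> mh bh hL lf lg r0 fg; have [mf _] := lf; have [mg _] := lg.
have lhf : L1 P (fun t => h (f t)).
  by apply: (@L1_bnd _ _ _ P _ 1) => //; exact: measurableT_comp.
have lhg : L1 P (fun t => h (g t)).
  by apply: (@L1_bnd _ _ _ P _ 1) => //; exact: measurableT_comp.
have lB := L2B lf lg; have [mB lB2] := lB.
rewrite -ExB//; apply: (le_trans (Ex_norm_le (L1B lhf lhg) (L1_norm (L2_L1 lB)) _)).
  by move=> t; exact: hL.
have lN : L2 P (fun t => `|f t - g t|).
  split; first exact: measurableT_comp.
  by under eq_fun do rewrite real_normK ?num_real//.
have := Ex_sqr_le lN; under [X in _ <= X -> _]eq_Ex do rewrite real_normK ?num_real//.
move=> h1; rewrite -(@ler_pXn2r _ 2) ?nnegrE//; last exact: Ex_ge0.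
exact: le_trans h1 fg.
Qed.

(** Means of bounded 1-Lipschitz functions and second moments are continuous in L2, and
    [v -> exp (- v / 2)] is continuous; so the identities known for finite linear combinations pass
    to the closure. *)
Lemma gaussian_space_cl : gaussian_space P gauss_cl.
Proof.
split.
- exact: gauss_clD.
- by move=> f /(gauss_clZ (-1)); under eq_fun do rewrite mulN1r.
- exact: gauss_cl0.
- by move=> f [].
- move=> f [lf hf]; pose v := Ex P (fun t => f t ^+ 2).
  have v0 : 0 <= v by apply: Ex_ge0 => t; exact: sqr_ge0.
  apply/eqP; rewrite -subr_eq0 -normr_eq0; apply/eqP.
  (* An approximation within [r] in L2 norm costs [r] for the cosine and half of [(2 + 2 v) r] for
     the exponential of the variance, in total [(2 + v) r]. *)
  apply: (@le_small_eq0 _ (2 + v)) => // r r0 r1.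
  have [g sg eg] := hf _ (exprn_gt0 2 r0).
  have lg := lin_span_L2 sg; have [_ _ cg _] := centered_normalP (lin_span_normal sg).
  have [_ lf2] := lf; have [_ lg2] := lg; have [_ lB2] := L2B lf lg.
  have h1 := Ex_lipschitz (@measurable_cosR R) (@cos_max R) lipschitz_cos lf lg (ltW r0) eg.
  have gv0 : 0 <= Ex P (fun t => g t ^+ 2) by apply: Ex_ge0 => t; exact: sqr_ge0.
  have h2 : `|Ex P (fun t => f t ^+ 2) - Ex P (fun t => g t ^+ 2)| <= (2 + 2 * v) * r.
    have la := L1Z r lf2; have lb := L1Z (1 + r^-1) lB2.
    rewrite -ExB//; apply: (le_trans (Ex_norm_le (L1B lf2 lg2) (L1D la lb) _)).
      move=> t; have -> : f t ^+ 2 - g t ^+ 2 = 2 * f t * (f t - g t) - (f t - g t) ^+ 2 by ring.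
      apply: (le_trans (ler_normB _ _)); rewrite [X in _ + X]ger0_norm ?sqr_ge0//.
      rewrite [X in _ <= _ + X]mulrDl mul1r.
      (* Young's inequality [2 |f| |f - g| <= r f ^ 2 + (f - g) ^ 2 / r]; since the mean of
         [(f - g) ^ 2] is at most [r ^ 2], both terms are of order [r]. *)
      have : 0 <= r * (`|f t| - r^-1 * `|f t - g t|) ^+ 2 by rewrite mulr_ge0 ?sqr_ge0// ltW.
      have -> : r * (`|f t| - r^-1 * `|f t - g t|) ^+ 2 =
         r * `|f t| ^+ 2 - 2 * (`|f t| * `|f t - g t|) + r^-1 * `|f t - g t| ^+ 2.
        by field; rewrite gt_eqF.
      rewrite !real_normK ?num_real// !normrM [`|2|]ger0_norm//.
      by move: (f t ^+ 2) ((f t - g t) ^+ 2) => a b; lra.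
    rewrite ExD// !ExZ// -/v.
    have h : (1 + r^-1) * Ex P (fun t => (f t - g t) ^+ 2) <= (1 + r^-1) * r ^+ 2.
      by rewrite ler_wpM2l// addr_ge0// invr_ge0 ltW.
    have e1 : (1 + r^-1) * r ^+ 2 = r ^+ 2 + r by field; rewrite gt_eqF.
    by move: h; rewrite e1; nra.
  have h3 := expRN_lipschitz (divr_ge0 gv0 (ler0n _ 2)) (divr_ge0 v0 (ler0n _ 2)).
  rewrite -mulrBl normrM [`|2^-1|]ger0_norm ?invr_ge0// in h3.
  rewrite distrC in h2; rewrite cg in h1.
  have -> : Ex P (fun t => cos (f t)) - expR (- (v / 2)) =
     (Ex P (fun t => cos (f t)) - expR (- (Ex P (fun t => g t ^+ 2) / 2))) +
     (expR (- (Ex P (fun t => g t ^+ 2) / 2)) - expR (- (v / 2))) by ring.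
  by apply: (le_trans (ler_normD _ _)); move: h1 h2 h3; rewrite -/v; lra.
- move=> f [lf hf]; apply/eqP; rewrite -normr_eq0; apply/eqP.
  apply: (@le_small_eq0 _ 1) => // r r0 r1; rewrite mul1r.
  have [g sg eg] := hf _ (exprn_gt0 2 r0).
  have lg := lin_span_L2 sg; have [_ _ _ sg0] := centered_normalP (lin_span_normal sg).
  have := Ex_lipschitz (@measurable_sinR R) (@sin_max R) lipschitz_sin lf lg (ltW r0) eg.
  by rewrite sg0 subr0.
Qed.

(** Averages over [K] sampled points lie in the closed space, and [pmean_sampling] puts them within
    [4 c / K] of the mean in squared L2 norm. Joint measurability and a uniform second moment are
    all that this asks of the process. *)
Lemma gauss_cl_pmean dS (S : measurableType dS) (U : probability S R) (H : T * S -> R) c :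
  measurable_fun setT H -> (forall s, gauss_cl (fun t => H (t, s))) ->
  (forall s, Ex P (fun t => H (t, s) ^+ 2) <= c) -> gauss_cl (pmean U H).
Proof.
move=> mH gH cH; have lH s : L2 P (fun t => H (t, s)) by have [] := gH s.
have [lp _] := L2_pmean U mH lH cH.
apply: gauss_cl_closed => // e e0.
have c0 : 0 <= c by apply: le_trans (cH point); apply: Ex_ge0 => t; exact: sqr_ge0.
pose K := (Num.truncn (4 * c / e)).+1.
have K0 : (0 : R) < K%:R by rewrite ltr0n.
have [s hs] := pmean_sampling U mH lH cH K.
exists (fun t => K%:R^-1 * \sum_(j < K) H (t, s j)).
  by apply: gauss_clZ; exact: gauss_cl_sum.
have lS : L2 P (fun t => \sum_(j < K) H (t, s j) - K%:R * pmean U H t).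
  by apply: L2B; [exact: L2_sum|exact: L2Z].
have [_ lS2] := lS.
have -> : Ex P (fun t => (pmean U H t - K%:R^-1 * \sum_(j < K) H (t, s j)) ^+ 2) =
   Ex P (fun t => K%:R^-1 ^+ 2 * (\sum_(j < K) H (t, s j) - K%:R * pmean U H t) ^+ 2).
  by apply: eq_Ex => t; field; rewrite gt_eqF.
rewrite ExZ//; apply: (le_trans (ler_wpM2l (sqr_ge0 _) hs)).
have -> : K%:R^-1 ^+ 2 * (4 * c * K%:R) = (4 * c) / (K%:R : R) by field; rewrite gt_eqF.
rewrite ler_pdivrMr// [leRHS]mulrC -ler_pdivrMr//.
by apply/ltW; rewrite /K; exact: truncnS_gt.
Qed.

End gaussian_closure.

(** * Convergence of moments of bounded variables *)

Section uniform_continuity.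
Variable R : realType.

(** Heine's theorem, by two applications of the near-covering form of compactness: first in [y]
    around a fixed [x0], then in [x]. Only the point [(x, y)] is confined to the square. *)
Lemma unif_cont2 (h : R -> R -> R) (a b : R) :
  (forall x y e, 0 < e -> exists2 r, 0 < r & forall x' y', `|x - x'| < r -> `|y - y'| < r ->
     `|h x y - h x' y'| <= e) ->
  forall e, 0 < e -> exists2 r, 0 < r & forall x y x' y',
    a <= x <= b -> a <= y <= b -> `|x - x'| < r -> `|y - y'| < r ->
    `|h x y - h x' y'| <= e.
Proof.
move=> ch e e0.
pose Q (d x y : R) := forall x' y', `|x - x'| < d -> `|y - y'| < d ->
    `|h x y - h x' y'| <= e.
have loc x0 y0 : exists2 r, 0 < r & forall x y d, `|x0 - x| < r -> `|y0 - y| < r ->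
    d < r -> Q d x y.
  have e2 : 0 < e / 2 by rewrite divr_gt0.
  have [r r0 hr] := ch x0 y0 (e / 2) e2.
  exists (r / 2); first by rewrite divr_gt0.
  move=> x y d hx hy hd x' y' hx' hy'.
  have -> : h x y - h x' y' = (h x0 y0 - h x' y') - (h x0 y0 - h x y) by ring.
  apply: (le_trans (ler_normB _ _)); rewrite [e]splitr; apply: lerD; apply: hr.
  - rewrite -(subrKA x); apply: (le_lt_trans (ler_normD _ _)).
    by rewrite [r]splitr; apply: ltrD => //; exact: lt_trans hx' hd.
  - rewrite -(subrKA y); apply: (le_lt_trans (ler_normD _ _)).
    by rewrite [r]splitr; apply: ltrD => //; exact: lt_trans hy' hd.
  - by apply: (lt_trans hx); rewrite ltr_pdivrMr// ltr_pMr// ltr1n.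
  - by apply: (lt_trans hy); rewrite ltr_pdivrMr// ltr_pMr// ltr1n.
have cov := (compact_near_coveringP `[a, b]%classic).1 (@segment_compact R a b).
have near_d r : 0 < r -> (0 : R)^'+ [set d | d < r].
  by move=> r0; exact: nbhs_right_lt.
have step1 (x0 : R) : \forall x \near x0 & d \near 0^'+, `[a, b]%classic `<=` Q d x.
  have := cov _ (filter_prod (nbhs x0) (0 : R)^'+) (fun i y => Q i.2 i.1 y) _.
  apply => y0 _; have [r r0 hr] := loc x0 y0.
  exists ([set y | `|y0 - y| < r], [set i | `|x0 - i.1| < r /\ i.2 < r]).
    split => /=; first by apply/nbhs_ballP; exists r.
    exists ([set x | `|x0 - x| < r], [set d | d < r]) => /=.
      by split; [apply/nbhs_ballP; exists r|exact: near_d].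
    by case=> x d /= [].
  by case=> y [x d] /= [hy [hx hd]]; exact: hr.
have H : \forall d \near (0 : R)^'+, `[a, b]%classic `<=`
    (fun x => `[a, b]%classic `<=` Q d x).
  by apply: cov => x _; exact: step1.
near (0 : R)^'+ => d; exists d => [|x y x' y' hx hy].
  by near: d; exact: nbhs_right_gt.
have Hd : `[a, b]%classic `<=` (fun x => `[a, b]%classic `<=` Q d x).
  by near: d; exact: H.
by apply: Hd; rewrite /= in_itv.
Unshelve. all: by end_near. Qed.

End uniform_continuity.

Section bernstein.
Variable R : realType.
Implicit Types (x y : R) (F G : nat -> R).

Definition bern m x i := 'C(m, i)%:R * x ^+ i * (1 - x) ^+ (m - i).

Let S m x F := \sum_(i < m.+1) bern m x i * F i.

Lemma bern_ge0 m x i : 0 <= x <= 1 -> 0 <= bern m x i.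
Proof.
by move=> /andP[x0 x1]; rewrite mulr_ge0 ?exprn_ge0 ?subr_ge0// mulr_ge0// exprn_ge0.
Qed.

Let S1 m x : S m x (fun=> 1) = 1.
Proof.
rewrite -[RHS](expr1n R m) -[in RHS](subrK x 1) exprDn.
by apply: eq_bigr => i _; rewrite mulr1 /bern -mulr_natl; ring.
Qed.

(** From [i C(m + 1, i) = (m + 1) C(m, i - 1)]: a factor [i] lowers the degree by one, so the first
    two binomial moments reduce to [S1]. *)
Let SS m x F : S m.+1 x (fun i => i%:R * F i) = m.+1%:R * x * S m x (fun i => F i.+1).
Proof.
rewrite /S big_ord_recl/= mul0r mulr0 add0r mulr_sumr; apply: eq_bigr => i _.
rewrite /bern /bump leq0n add1n subSS exprS.
have e : (i.+1%:R * 'C(m.+1, i.+1)%:R = m.+1%:R * 'C(m, i)%:R :> R).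
  by rewrite -!natrM -mul_bin_diag.
by transitivity ((i.+1%:R * 'C(m.+1, i.+1)%:R) * x * x ^+ i * (1 - x) ^+ (m - i) * F i.+1);
  [ring|rewrite e; ring].
Qed.

Let SD m x F G : S m x (fun i => F i + G i) = S m x F + S m x G.
Proof. by rewrite /S -big_split; apply: eq_bigr => i _; rewrite /= mulrDr. Qed.

Let SZ m x c F : S m x (fun i => c * F i) = c * S m x F.
Proof. by rewrite /S mulr_sumr; apply: eq_bigr => i _; ring. Qed.

Let eq_S m x F G : F =1 G -> S m x F = S m x G.
Proof. by move=> FG; apply: eq_bigr => i _; rewrite FG. Qed.

Let S_var m x : S m.+1 x (fun i => (i%:R - m.+1%:R * x) ^+ 2) = m.+1%:R * x * (1 - x).
Proof.
have e1 : S m.+1 x (fun i => i%:R) = m.+1%:R * x.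
  have := SS m x (fun=> 1); rewrite S1 mulr1 => <-.
  by apply: eq_S => i; rewrite mulr1.
have e2 : S m.+1 x (fun i => i%:R * i%:R) = m.+1%:R * x * (m%:R * x + 1).
  rewrite SS; congr (_ * _); case: m {e1} => [|m].
    rewrite mul0r add0r; transitivity (S 0 x (fun=> 1)); last exact: S1.
    by rewrite /S !big_ord_recl !big_ord0.
  transitivity (S m.+1 x (fun i => i%:R * 1 + 1)).
    by apply: eq_S => i; rewrite mulr1 natr1.
  by rewrite SD S1 (SS m x (fun=> 1)) S1 mulr1.
transitivity (S m.+1 x (fun i => (i%:R * i%:R + (- 2 * (m.+1%:R * x)) * i%:R) +
   (m.+1%:R * x) ^+ 2 * 1)).
  by apply: eq_S => i; ring.
by rewrite !SD !SZ e1 e2 S1 -[m.+1%:R]natr1; ring.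
Qed.

Lemma bern_sum1 m x : \sum_(i < m.+1) bern m x i = 1.
Proof. by rewrite -(S1 m x); apply: eq_bigr => i _; rewrite mulr1. Qed.

Lemma bern_var m x : 0 <= x <= 1 ->
  \sum_(i < m.+2) bern m.+1 x i * (i%:R / m.+1%:R - x) ^+ 2 <= m.+1%:R^-1.
Proof.
move=> /andP[x0 x1]; have m0 : (m.+1%:R : R) != 0 by rewrite pnatr_eq0.
have -> : \sum_(i < m.+2) bern m.+1 x i * (i%:R / m.+1%:R - x) ^+ 2 =
    m.+1%:R ^- 2 * (m.+1%:R * x * (1 - x)).
  rewrite -S_var /S mulr_sumr; apply: eq_bigr => i _.
  have -> : i%:R / m.+1%:R - x = m.+1%:R^-1 * (i%:R - m.+1%:R * x) by field.
  by rewrite exprMn exprVn; ring.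
have -> : m.+1%:R ^- 2 * (m.+1%:R * x * (1 - x)) = m.+1%:R^-1 * (x * (1 - x)) by field.
by rewrite ler_piMr ?invr_ge0//; nra.
Qed.

(** Bernstein's probabilistic proof in two variables: the polynomial is the mean of [h] at two
    independent binomial frequencies, whose deviation from [(x, y)] is controlled by [bern_var]. *)
Lemma bernstein2 (h : R -> R -> R) (M : R) : (forall x y, `|h x y| <= M) ->
  (forall x y e, 0 < e -> exists2 r, 0 < r & forall x' y', `|x - x'| < r -> `|y - y'| < r ->
     `|h x y - h x' y'| <= e) ->
  forall e, 0 < e -> exists m : nat, forall x y, 0 <= x <= 1 -> 0 <= y <= 1 ->
   `|h x y - \sum_(i < m.+2) \sum_(j < m.+2)
       h (i%:R / m.+1%:R) (j%:R / m.+1%:R) * bern m.+1 x i * bern m.+1 y j| <= e.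
Proof.
move=> hM /(@unif_cont2 _ _ 0 1) hu e e0.
have e2 : 0 < e / 2 by rewrite divr_gt0.
have [r r0 hr] := hu _ e2.
have M0 : 0 <= M by apply: le_trans (hM 0 0).
(* Chosen so that [(K / 2) (u - x) ^ 2 >= 2 M] as soon as [|u - x| >= r]; the trivial bound [2 M] on
   the oscillation of [h] is then absorbed by the quadratic term. *)
pose K := 4 * M / r ^+ 2.
have K0 : 0 <= K by apply: divr_ge0; [exact: mulr_ge0|exact: sqr_ge0].
have K2 : 0 <= 2^-1 * K by apply: mulr_ge0.
pose m := Num.truncn (2 * K / e); exists m => x y hx hy.
have mK : K * m.+1%:R^-1 <= e / 2.
  rewrite ler_pdivrMr ?ltr0n// mulrAC ler_pdivlMr// mulrC [leRHS]mulrC -ler_pdivrMr//.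
  exact/ltW/truncnS_gt.
pose p (i : nat) := i%:R / m.+1%:R : R.
have pt u v : `|h x y - h u v| <= e / 2 + 2^-1 * K * ((u - x) ^+ 2 + (v - y) ^+ 2).
  have [hxu|hxu] := ltP `|x - u| r; last first.
    apply: (@le_trans _ _ (2 * M)).
      by rewrite (le_trans (ler_normB _ _))// mulr2n mulrDl !mul1r lerD.
    have : 2 * M <= 2^-1 * K * (u - x) ^+ 2.
      rewrite /K -[(u - x) ^+ 2]real_normK ?num_real// distrC.
      have -> : 2^-1 * (4 * M / r ^+ 2) * `|x - u| ^+ 2 = 2 * M * (`|x - u| / r) ^+ 2.
        by field; rewrite gt_eqF.
      rewrite ler_peMr ?mulr_ge0// exprn_ege1// ler_pdivlMr// mul1r//.
    have : 0 <= 2^-1 * K * (v - y) ^+ 2 by apply: mulr_ge0 => //; exact: sqr_ge0.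
    by rewrite [X in _ -> _ -> _ <= _ + X]mulrDr; lra.
  have [hyv|hyv] := ltP `|y - v| r; last first.
    apply: (@le_trans _ _ (2 * M)).
      by rewrite (le_trans (ler_normB _ _))// mulr2n mulrDl !mul1r lerD.
    have : 2 * M <= 2^-1 * K * (v - y) ^+ 2.
      rewrite /K -[(v - y) ^+ 2]real_normK ?num_real// distrC.
      have -> : 2^-1 * (4 * M / r ^+ 2) * `|y - v| ^+ 2 = 2 * M * (`|y - v| / r) ^+ 2.
        by field; rewrite gt_eqF.
      rewrite ler_peMr ?mulr_ge0// exprn_ege1// ler_pdivlMr// mul1r//.
    have : 0 <= 2^-1 * K * (u - x) ^+ 2 by apply: mulr_ge0 => //; exact: sqr_ge0.
    by rewrite [X in _ -> _ -> _ <= _ + X]mulrDr; lra.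
  apply: (le_trans (hr _ _ _ _ hx hy hxu hyv)); rewrite lerDl.
  by apply: mulr_ge0 => //; apply: addr_ge0; exact: sqr_ge0.
have b0 z i : 0 <= z <= 1 -> 0 <= bern m.+1 z i by exact: bern_ge0.
have -> : h x y - \sum_(i < m.+2) \sum_(j < m.+2)
    h (i%:R / m.+1%:R) (j%:R / m.+1%:R) * bern m.+1 x i * bern m.+1 y j =
  \sum_(i < m.+2) \sum_(j < m.+2) (h x y - h (p i) (p j)) * (bern m.+1 x i * bern m.+1 y j).
  have {1}-> : h x y = \sum_(i < m.+2) \sum_(j < m.+2) h x y * (bern m.+1 x i * bern m.+1 y j).
    under eq_bigr do rewrite -mulr_sumr -mulr_sumr bern_sum1 mulr1.
    by rewrite -mulr_sumr bern_sum1 mulr1.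
  rewrite -sumrB; apply: eq_bigr => i _; rewrite -sumrB; apply: eq_bigr => j _.
  by rewrite /p; ring.
apply: (le_trans (ler_norm_sum _ _ _)).
pose T i j := (e / 2 + 2^-1 * K * ((p i - x) ^+ 2 + (p j - y) ^+ 2)) *
   (bern m.+1 x i * bern m.+1 y j).
apply: (@le_trans _ _ (\sum_(i < m.+2) \sum_(j < m.+2) T i j)).
  apply: ler_sum => i _; apply: (le_trans (ler_norm_sum _ _ _)).
  apply: ler_sum => j _; have bb : 0 <= bern m.+1 x i * bern m.+1 y j by apply: mulr_ge0; exact: b0.
  by rewrite normrM [X in _ * X]ger0_norm// ler_wpM2r.
have -> : \sum_(i < m.+2) \sum_(j < m.+2) T i j = e / 2 + 2^-1 * K *
   (\sum_(i < m.+2) bern m.+1 x i * (p i - x) ^+ 2 +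
    \sum_(j < m.+2) bern m.+1 y j * (p j - y) ^+ 2).
  transitivity (\sum_(i < m.+2) (bern m.+1 x i * (e / 2 + 2^-1 * K * (p i - x) ^+ 2) +
     bern m.+1 x i * (2^-1 * K * \sum_(j < m.+2) bern m.+1 y j * (p j - y) ^+ 2))).
    apply: eq_bigr => i _.
    transitivity (bern m.+1 x i * (e / 2 + 2^-1 * K * (p i - x) ^+ 2) *
        (\sum_(j < m.+2) bern m.+1 y j) +
      bern m.+1 x i * (2^-1 * K * \sum_(j < m.+2) bern m.+1 y j * (p j - y) ^+ 2)).
      rewrite !mulr_sumr -big_split; apply: eq_bigr => j _ /=.
      by rewrite /T; ring.
    by rewrite bern_sum1 mulr1.
  rewrite big_split/= -mulr_suml bern_sum1 mul1r mulrDr addrA; congr (_ + _).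
  transitivity (e / 2 * (\sum_(i < m.+2) bern m.+1 x i) +
      2^-1 * K * \sum_(i < m.+2) bern m.+1 x i * (p i - x) ^+ 2).
    by rewrite !mulr_sumr -big_split; apply: eq_bigr => i _ /=; ring.
  by rewrite bern_sum1 mulr1.
have := bern_var m hx; have := bern_var m hy; rewrite -/(p _) => h1 h2.
have : 2^-1 * K * (\sum_(i < m.+2) bern m.+1 x i * (p i - x) ^+ 2 +
    \sum_(j < m.+2) bern m.+1 y j * (p j - y) ^+ 2) <= 2^-1 * K * (m.+1%:R^-1 + m.+1%:R^-1).
  by apply: ler_wpM2l => //; exact: lerD.
have -> : 2^-1 * K * (m.+1%:R^-1 + m.+1%:R^-1) = K * m.+1%:R^-1.
  by move: (m.+1%:R^-1) => z; field.
move=> h3; rewrite [leRHS]splitr; apply: lerD => //; exact: le_trans h3 mK.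
Qed.

End bernstein.

(** * From mixed moments to bounded continuous functions *)

Section moments.
Context d1 d2 (T1 : measurableType d1) (T2 : measurableType d2) (R : realType).
Context (P1 : probability T1 R) (P2 : probability T2 R).
Variables (U V : (T1 -> R)^nat) (U0 V0 : T2 -> R) (M : R).
Hypotheses (mU : forall k, measurable_fun setT (U k)) (mV : forall k, measurable_fun setT (V k)).
Hypotheses (mU0 : measurable_fun setT U0) (mV0 : measurable_fun setT V0).
Hypotheses (bU : forall k t, `|U k t| <= M) (bV : forall k t, `|V k t| <= M).
Hypotheses (bU0 : forall t, `|U0 t| <= M) (bV0 : forall t, `|V0 t| <= M).
Hypothesis cUV : forall p q : nat,
  Ex P1 (fun t => U k t ^+ p * V k t ^+ q) @[k --> \oo] --> Ex P2 (fun t => U0 t ^+ p * V0 t ^+ q).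

(** The extra monomial in [mf_cvg] makes the class stable under multiplication by a coordinate,
    which merely raises an exponent. All polynomials are then reached from the constants. *)
Record moment_fun (F : R -> R -> R) : Prop := {
  mf_meas : forall k, measurable_fun setT (fun t => F (U k t) (V k t)) ;
  mf_meas0 : measurable_fun setT (fun t => F (U0 t) (V0 t)) ;
  mf_bnd : exists K : R, forall x y, `|x| <= M -> `|y| <= M -> `|F x y| <= K ;
  mf_cvg : forall p q : nat,
    Ex P1 (fun t => U k t ^+ p * V k t ^+ q * F (U k t) (V k t)) @[k --> \oo] -->
    Ex P2 (fun t => U0 t ^+ p * V0 t ^+ q * F (U0 t) (V0 t)) }.

Let monom_bnd x y p q : `|x| <= M -> `|y| <= M -> `|x ^+ p * y ^+ q| <= M ^+ p * M ^+ q.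
Proof. by move=> hx hy; rewrite normrM !normrX ler_pM// lerXn2r// nnegrE (le_trans _ hx). Qed.

Let mf_L1 F p q k : moment_fun F ->
  L1 P1 (fun t => U k t ^+ p * V k t ^+ q * F (U k t) (V k t)).
Proof.
move=> [mF _ [K hK] _]; apply: (@L1_bnd _ _ _ P1 _ (M ^+ p * M ^+ q * K)) => [|t].
  by apply: measurable_funM => //; apply: measurable_funM; exact: measurable_funX.
by rewrite normrM ler_pM//; [exact: monom_bnd|exact: hK].
Qed.

Let mf_L10 F p q : moment_fun F ->
  L1 P2 (fun t => U0 t ^+ p * V0 t ^+ q * F (U0 t) (V0 t)).
Proof.
move=> [_ mF [K hK] _]; apply: (@L1_bnd _ _ _ P2 _ (M ^+ p * M ^+ q * K)) => [|t].
  by apply: measurable_funM => //; apply: measurable_funM; exact: measurable_funX.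
by rewrite normrM ler_pM//; [exact: monom_bnd|exact: hK].
Qed.

Lemma moment_fun_cst c : moment_fun (fun _ _ => c).
Proof.
split => [k|||p q]; [exact: measurable_cst|exact: measurable_cst|by exists `|c| |].
have l1 k : L1 P1 (fun t => U k t ^+ p * V k t ^+ q).
  apply: (@L1_bnd _ _ _ P1 _ (M ^+ p * M ^+ q)) => [|t]; last exact: monom_bnd.
  by apply: measurable_funM; exact: measurable_funX.
have l2 : L1 P2 (fun t => U0 t ^+ p * V0 t ^+ q).
  apply: (@L1_bnd _ _ _ P2 _ (M ^+ p * M ^+ q)) => [|t]; last exact: monom_bnd.
  by apply: measurable_funM; exact: measurable_funX.
apply: eq_cvg_seq (@cvgZ_seq _ c _ _ (@cUV p q)) => [k|].
  by rewrite /= -ExZ//; apply: eq_Ex => t; rewrite mulrC.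
by rewrite /= -ExZ//; apply: eq_Ex => t; rewrite mulrC.
Qed.

Lemma moment_funD F G : moment_fun F -> moment_fun G -> moment_fun (fun x y => F x y + G x y).
Proof.
move=> mF mG; split.
- by move=> k; apply: measurable_funD; exact: mf_meas.
- by apply: measurable_funD; exact: mf_meas0.
- have [K hK] := mf_bnd mF; have [L hL] := mf_bnd mG; exists (K + L) => x y hx hy.
  by rewrite (le_trans (ler_normD _ _))// lerD; [|exact: hK|exact: hL].
- move=> p q; apply: eq_cvg_seq (cvgD_seq (@mf_cvg _ mF p q) (@mf_cvg _ mG p q)) => [k|].
    by rewrite /= -ExD; [apply: eq_Ex => t; rewrite mulrDr|exact: mf_L1..].
  by rewrite /= -ExD; [apply: eq_Ex => t; rewrite mulrDr|exact: mf_L10..].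
Qed.

Lemma moment_funZ c F : moment_fun F -> moment_fun (fun x y => c * F x y).
Proof.
move=> mF; split.
- by move=> k; apply: measurable_funM => //; exact: mf_meas.
- by apply: measurable_funM => //; exact: mf_meas0.
- have [K hK] := mf_bnd mF; exists (`|c| * K) => x y hx hy.
  by rewrite normrM ler_wpM2l//; exact: hK.
- move=> p q; apply: eq_cvg_seq (@cvgZ_seq _ c _ _ (@mf_cvg _ mF p q)) => [k|].
    by rewrite /= -ExZ; [apply: eq_Ex => t; ring|exact: mf_L1].
  by rewrite /= -ExZ; [apply: eq_Ex => t; ring|exact: mf_L10].
Qed.

Lemma moment_funX F : moment_fun F -> moment_fun (fun x y => x * F x y).
Proof.
move=> mF; split.
- by move=> k; apply: measurable_funM => //; exact: mf_meas.
- by apply: measurable_funM => //; exact: mf_meas0.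
- have [K hK] := mf_bnd mF; exists (M * K) => x y hx hy.
  by rewrite normrM ler_pM//; exact: hK.
- move=> p q; apply: eq_cvg_seq (@mf_cvg _ mF p.+1 q) => [k|];
    by apply: eq_Ex => t; rewrite exprS; ring.
Qed.

Lemma moment_funY F : moment_fun F -> moment_fun (fun x y => y * F x y).
Proof.
move=> mF; split.
- by move=> k; apply: measurable_funM => //; exact: mf_meas.
- by apply: measurable_funM => //; exact: mf_meas0.
- have [K hK] := mf_bnd mF; exists (M * K) => x y hx hy.
  by rewrite normrM ler_pM//; exact: hK.
- move=> p q; apply: eq_cvg_seq (@mf_cvg _ mF p q.+1) => [k|];
    by apply: eq_Ex => t; rewrite exprS; ring.
Qed.

Lemma moment_fun_eq F G : (forall x y, F x y = G x y) -> moment_fun F -> moment_fun G.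
Proof. by move=> FG; have -> : F = G by apply/funext => x; apply/funext => y. Qed.

Lemma moment_fun_affX a b i F : moment_fun F ->
  moment_fun (fun x y => (a * x + b) ^+ i * F x y).
Proof.
move=> mF; elim: i => [|i IH].
  by apply: moment_fun_eq mF => x y; rewrite expr0 mul1r.
apply: (moment_fun_eq _ (moment_funD (moment_funZ a (moment_funX IH)) (moment_funZ b IH))).
by move=> x y; rewrite exprS; ring.
Qed.

Lemma moment_fun_affY a b i F : moment_fun F ->
  moment_fun (fun x y => (a * y + b) ^+ i * F x y).
Proof.
move=> mF; elim: i => [|i IH].
  by apply: moment_fun_eq mF => x y; rewrite expr0 mul1r.
apply: (moment_fun_eq _ (moment_funD (moment_funZ a (moment_funY IH)) (moment_funZ b IH))).
by move=> x y; rewrite exprS; ring.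
Qed.

Lemma moment_fun_sum I (s : seq I) (F : I -> R -> R -> R) : (forall i, moment_fun (F i)) ->
  moment_fun (fun x y => \sum_(i <- s) F i x y).
Proof.
move=> mF; elim: s => [|i s IH].
  by apply: (moment_fun_eq _ (moment_fun_cst 0)) => x y; rewrite big_nil.
by apply: (moment_fun_eq _ (moment_funD (mF i) IH)) => x y; rewrite big_cons.
Qed.

Lemma moment_cvg (h : R -> R -> R) K : 0 < M -> (forall x y, `|h x y| <= K) ->
  (forall x y e, 0 < e -> exists2 r, 0 < r & forall x' y', `|x - x'| < r -> `|y - y'| < r ->
     `|h x y - h x' y'| <= e) ->
  Ex P1 (fun t => h (U k t) (V k t)) @[k --> \oo] --> Ex P2 (fun t => h (U0 t) (V0 t)).
Proof.
move=> M0 hK hc.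
(* This affine map sends [[- M, M]], where the variables take their values, onto the unit interval
   of the Bernstein polynomials. *)
pose aff x := x / (2 * M) + 2^-1; pose ffa x := 2 * M * (x - 2^-1).
have affK x : ffa (aff x) = x by rewrite /aff /ffa; field; rewrite gt_eqF.
have aff01 x : `|x| <= M -> 0 <= aff x <= 1.
  rewrite ler_norml => /andP[h1 h2].
  have -> : aff x = (x + M) / (2 * M) by rewrite /aff; field; rewrite gt_eqF.
  by rewrite divr_ge0/= ?ler_pdivrMr ?mulr_gt0//; [lra|lra|exact: mulr_ge0 (ltW _)].
pose H x y := h (ffa x) (ffa y).
have Hc x y e : 0 < e -> exists2 r, 0 < r & forall x' y', `|x - x'| < r -> `|y - y'| < r ->
     `|H x y - H x' y'| <= e.
  move=> e0; have [r r0 hr] := hc (ffa x) (ffa y) e e0.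
  have M2 : 0 < 2 * M by rewrite mulr_gt0.
  exists (r / (2 * M)); first by rewrite divr_gt0.
  have ff u v : ffa u - ffa v = 2 * M * (u - v) by rewrite /ffa; ring.
  by move=> x' y' hx hy; apply: hr; rewrite ff normrM gtr0_norm// mulrC -ltr_pdivlMr.
have Bp e : 0 < e -> exists2 F, moment_fun F &
    forall x y, `|x| <= M -> `|y| <= M -> `|h x y - F x y| <= e.
  move=> e0; have [m hm] := bernstein2 (fun x y => hK (ffa x) (ffa y)) Hc e0.
  exists (fun x y => \sum_(i < m.+2) \sum_(j < m.+2)
    H (i%:R / m.+1%:R) (j%:R / m.+1%:R) * bern m.+1 (aff x) i * bern m.+1 (aff y) j).
    apply: moment_fun_sum => i; apply: moment_fun_sum => j.
    have h1 := moment_fun_affY (2 * M)^-1 2^-1 j (moment_fun_affY (- (2 * M)^-1) 2^-1 (m.+1 - j) (moment_fun_cst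
      (H (i%:R / m.+1%:R) (j%:R / m.+1%:R) * 'C(m.+1, i)%:R * 'C(m.+1, j)%:R))).
    have h2 := moment_fun_affX (2 * M)^-1 2^-1 i (moment_fun_affX (- (2 * M)^-1) 2^-1 (m.+1 - i) h1).
    apply: moment_fun_eq h2 => x y; rewrite /bern.
    have e1 z : 1 - aff z = - (2 * M)^-1 * z + 2^-1 by rewrite /aff; field; rewrite gt_eqF.
    have e2 z : (2 * M)^-1 * z + 2^-1 = aff z by rewrite /aff mulrC.
    by rewrite !e1 !e2; ring.
  move=> x y hx hy; have := hm (aff x) (aff y) (aff01 x hx) (aff01 y hy).
  by rewrite /H !affK.
(* Composed with the variables, [h] is measurable as a pointwise limit of polynomials in them, with
   error at most [1 / (k + 1)]. *)
have mh d (T : measurableType d) (A B : T -> R) : (forall F, moment_fun F ->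
      measurable_fun setT (fun t => F (A t) (B t))) -> (forall t, `|A t| <= M) ->
    (forall t, `|B t| <= M) -> measurable_fun setT (fun t => h (A t) (B t)).
  move=> mF bA bB.
  have ex (k : nat) : exists F : R -> R -> R, moment_fun F /\
      forall x y, `|x| <= M -> `|y| <= M -> `|h x y - F x y| <= k.+1%:R^-1.
    have k0 : (0 : R) < k.+1%:R^-1 by rewrite invr_gt0.
    by have [F mF' bF] := Bp _ k0; exists F.
  have [F hF] := choice ex.
  apply: (@measurable_fun_cvg _ _ _ setT (fun k t => F k (A t) (B t))) => //.
    by move=> k; apply: mF; have [] := hF k.
  move=> t _; apply/cvgrPdist_le => e e0; near=> k.
  have [_ hk] := hF k; apply: (le_trans (hk _ _ (bA t) (bB t))).
  by apply/ltW; near: k; exact: (near_infty_natSinv_lt (PosNum e0)).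
have mh1 k : measurable_fun setT (fun t => h (U k t) (V k t)).
  by apply: mh => // F mF; exact: mf_meas.
have mh2 : measurable_fun setT (fun t => h (U0 t) (V0 t)).
  by apply: mh => // F mF; exact: mf_meas0.
have lh1 k : L1 P1 (fun t => h (U k t) (V k t)) by apply: (@L1_bnd _ _ _ P1 _ K).
have lh2 : L1 P2 (fun t => h (U0 t) (V0 t)) by apply: (@L1_bnd _ _ _ P2 _ K).
apply/cvgrPdist_le => e e0.
have e4 : 0 < e / 3 by rewrite divr_gt0.
have [F mF hF] := Bp _ e4.
have F1 k : L1 P1 (fun t => F (U k t) (V k t)).
  by have := mf_L1 0 0 k mF; under eq_fun do rewrite !expr0 !mul1r.
have F2 : L1 P2 (fun t => F (U0 t) (V0 t)).
  by have := mf_L10 0 0 mF; under eq_fun do rewrite !expr0 !mul1r.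
have := @mf_cvg _ mF 0%N 0%N => /cvgrPdist_le /(_ _ e4); apply: filterS => k.
under [X in `|X - _| <= _ -> _]eq_Ex do rewrite !expr0 !mul1r.
under [X in `|_ - X| <= _ -> _]eq_Ex do rewrite !expr0 !mul1r.
move=> hk.
have d1' : `|Ex P2 (fun t => h (U0 t) (V0 t)) - Ex P2 (fun t => F (U0 t) (V0 t))| <= e / 3.
  rewrite -ExB//; apply: Ex_norm_cst => [|t]; last exact: hF.
  exact: L1_meas (L1B lh2 F2).
have d2' : `|Ex P1 (fun t => h (U k t) (V k t)) - Ex P1 (fun t => F (U k t) (V k t))| <= e / 3.
  rewrite -ExB//; apply: Ex_norm_cst => [|t]; last exact: hF.
  exact: L1_meas (L1B (lh1 k) (F1 k)).
have -> : Ex P2 (fun t => h (U0 t) (V0 t)) - Ex P1 (fun t => h (U k t) (V k t)) =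
  (Ex P2 (fun t => h (U0 t) (V0 t)) - Ex P2 (fun t => F (U0 t) (V0 t))) +
  (Ex P2 (fun t => F (U0 t) (V0 t)) - Ex P1 (fun t => F (U k t) (V k t))) -
  (Ex P1 (fun t => h (U k t) (V k t)) - Ex P1 (fun t => F (U k t) (V k t))) by ring.
apply: (le_trans (ler_normB _ _)); have := ler_normD
  (Ex P2 (fun t => h (U0 t) (V0 t)) - Ex P2 (fun t => F (U0 t) (V0 t)))
  (Ex P2 (fun t => F (U0 t) (V0 t)) - Ex P1 (fun t => F (U k t) (V k t))).
by move: d1' d2' hk; lra.
Unshelve. all: by end_near. Qed.

End moments.

Lemma ae_impl d (T : measurableType d) (R : realType) (mu : {measure set T -> \bar R})
    (P Q : T -> Prop) : {ae mu, forall x, P x} -> (forall x, P x -> Q x) ->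
  {ae mu, forall x, Q x}.
Proof. by move=> aP PQ; apply: filterS aP. Qed.

(** * Riesz kernels *)

Section riesz_kernel.
Context {R : realType}.
Local Notation leb := (@lebesgue_measure R).

Definition pw (a y : R) := `|y| `^ (- a).

Lemma pw_ge0 a y : 0 <= pw a y. Proof. exact: powR_ge0. Qed.

Lemma measurable_pw a : measurable_fun setT (pw a).
Proof.
exact: (measurableT_comp (measurable_powR (- a)) (@normr_measurable R setT)).
Qed.

Lemma powRN_le (a x y : R) : 0 <= a -> 0 < x -> x <= y -> y `^ (- a) <= x `^ (- a).
Proof.
move=> a0 x0 xy; rewrite !powRN lef_pV2 ?posrE ?powR_gt0//; last exact: lt_le_trans xy.
by apply: ge0_ler_powR => //; rewrite nnegrE; [exact: ltW|exact: le_trans (ltW x0) xy].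
Qed.

(** Dyadic layers around the singularity: the height is the value of the power at the inner radius
    [r 2 ^ (- k) / 4] of the layer whose outer radius is [r 2 ^ (- k) / 2]. *)
Definition shell (a r y : R) (k : nat) : R :=
  (r * 2^-1 ^+ k / 4) `^ (- a) * (`|y| <= r * 2^-1 ^+ k / 2)%R%:R.

Lemma shell_ge0 a r y k : 0 <= shell a r y k.
Proof. by rewrite /shell mulr_ge0 ?powR_ge0// ler0n. Qed.

Lemma measurable_shell a r z k : measurable_fun setT (fun u : R => shell a r (u + z) k).
Proof.
apply: measurable_funM; first exact: measurable_cst.
have mn : measurable_fun setT (fun u : R => `|u + z|).
  apply: (measurableT_comp (@normr_measurable R setT)).
  by apply: measurable_funD => //; exact: measurable_cst.
have := measurable_fun_ler mn (@measurable_cst _ _ R R setT (r * 2^-1 ^+ k / 2)).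
move=> mb; rewrite (_ : (fun _ => _) = (fun u => if `|u + z| <= r * 2^-1 ^+ k / 2 then 1 else 0)).
  by apply: measurable_fun_ifT => //; exact: measurable_cst.
by apply/funext => u; case: ifP.
Qed.

Lemma pw_shells (a r y : R) : 0 < a -> 0 < r ->
  ((pw a y)%:E <= ((r / 2) `^ (- a))%:E + \sum_(0 <= k <oo) (shell a r y k)%:E)%E.
Proof.
move=> a0 r0.
have s0 : (0 <= \sum_(0 <= k <oo) (shell a r y k)%:E)%E.
  by apply: nneseries_ge0 => k _ _; rewrite lee_fin shell_ge0.
have [ry|yr] := ltP (r / 2) `|y|.
  rewrite -[leLHS]adde0 leeD// lee_fin /pw.
  by apply: powRN_le; [exact: ltW|rewrite divr_gt0|exact: ltW].
have [y0|y0] := eqVneq y 0.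
  by rewrite [pw a y]/pw [X in `|X|]y0 normr0 powR0 ?oppr_eq0 ?gt_eqF// adde_ge0// lee_fin powR_ge0.
have yp : 0 < `|y| by rewrite normr_gt0.
have ex : exists k : nat, r * 2^-1 ^+ k / 4 < `|y|.
  have := @cvg_geometric R r 2^-1; rewrite normfV normr_nat invf_lt1// ltr1n => /(_ isT).
  move=> /cvgr_lt /(_ `|y| yp)[N _ /(_ N (leqnn N)) /= H].
  exists N; apply: le_lt_trans H.
  have : 0 <= r * 2^-1 ^+ N by rewrite mulr_ge0 ?exprn_ge0 ?invr_ge0// ltW.
  by rewrite /geometric /=; move: (r * _) => v; lra.
(* The least [k] with [r 2 ^ (- k) / 4 < |y|] is the layer of [y]: minimality gives
   [|y| <= r 2 ^ (- k) / 2]. *)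
case: (ex_minnP ex) => k hk kmin.
have ky : `|y| <= r * 2^-1 ^+ k / 2.
  case: k hk kmin => [|j] hk kmin; first by rewrite expr0 mulr1.
  rewrite leNgt; apply/negP => hj; suff : (j.+1 <= j)%N by rewrite ltnn.
  apply: kmin; apply: le_lt_trans hj; rewrite exprS.
  by rewrite [leRHS](_ : _ = r * 2^-1 ^+ j / 4)//; field.
have kk : ((pw a y)%:E <= (shell a r y k)%:E)%E.
  rewrite lee_fin /shell ky mulr1 /pw; apply: powRN_le; [exact: ltW| |exact: ltW].
  by rewrite divr_gt0// mulr_gt0// exprn_gt0// invr_gt0.
rewrite (le_trans kk)//; rewrite -[leLHS]add0e leeD//; first by rewrite lee_fin powR_ge0.
apply: le_trans (@nneseries_lim_ge _ _ _ 0%N k.+1 _); last first.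
  by move=> j _ _; rewrite lee_fin shell_ge0.
rewrite big_nat_recr//= -[leLHS]add0e leeD// sume_ge0// => j _.
by rewrite lee_fin shell_ge0.
Qed.

(** The first term comes from the region beyond distance [r / 2] of the singularity; the second sums
    the geometric series of the layers, of ratio [2 ^ (- (1 - a))], for a density bounded by [D / r]
    near the singularity. *)
Definition pw_const (a D : R) : R :=
  2 `^ a + D * 4 `^ a / (1 - 2^-1 `^ (1 - a)).

Lemma half_powR_lt1 (b : R) : 0 < b -> 2^-1 `^ b < 1.
Proof.
move=> b0; have : 2^-1 `^ b < 1 `^ b :> R; last by rewrite powR1.
by rewrite gt0_ltr_powR ?nnegrE ?invr_ge0// invf_lt1// ltr1n.
Qed.

Lemma pw_const_ge0 a D : 0 < a -> a < 1 -> 0 <= D -> 0 <= pw_const a D.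
Proof.
move=> a0 a1 D0; rewrite addr_ge0 ?powR_ge0// !mulr_ge0 ?powR_ge0// invr_ge0 subr_ge0.
by apply/ltW/half_powR_lt1; rewrite subr_gt0.
Qed.

(** Only the total mass and the size of the density near the singularity matter. The radius [r] is
    free: the standard deviation gives a bound uniform in [z], while [r = |z|] compares the mean
    with [pw a z] itself. *)
Lemma Ex_pw_le (p : R -> R) (a r D z : R) : 0 < a -> a < 1 -> 0 < r -> 0 <= D ->
  (forall u, 0 <= p u) -> L1 leb p -> Ex leb p = 1 ->
  (forall u, `|u + z| <= r / 2 -> p u <= D / r) ->
  L1 leb (fun u => p u * pw a (u + z)) /\
  Ex leb (fun u => p u * pw a (u + z)) <= r `^ (- a) * pw_const a D.
Proof.
move=> a0 a1 r0 D0 p0 Lp Ep pD.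
have mp := L1_meas Lp.
have msp : measurable_fun setT (fun u => p u * pw a (u + z)).
  apply: measurable_funM => //; apply: (measurableT_comp (measurable_pw a)).
  by apply: measurable_funD => //; exact: measurable_cst.
pose q : R := 2^-1 `^ (1 - a).
have q0 : 0 < q by rewrite powR_gt0// invr_gt0.
have q1 : q < 1.
  by apply: half_powR_lt1; rewrite subr_gt0.
(* The [k]-th layer has height [(r 2 ^ (- k) / 4) ^ (- a)], width [r 2 ^ (- k)] and density at most
   [D / r]. *)
have Esh k : (\int[leb]_u (p u * shell a r (u + z) k)%:E
    <= (r `^ (- a) * (D * 4 `^ a) * q ^+ k)%:E)%E.
  pose c := (r * 2^-1 ^+ k / 4) `^ (- a).
  pose h := r * 2^-1 ^+ k / 2.
  have hr : h <= r / 2.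
    by rewrite /h ler_pM2r ?invr_gt0// ger_pMr// exprn_ile1 ?invr_ge0// invf_le1// ler1n.
  apply: (@le_trans _ _ (\int[leb]_u ((c * (D / r))%:E * (\1_(`[- z - h, - z + h]%classic) u)%:E))%E).
    apply: ge0_le_integral => //.
    - by move=> u _; rewrite lee_fin mulr_ge0// shell_ge0.
    - by apply/measurable_EFinP; apply: measurable_funM => //; exact: measurable_shell.
    - apply: measurable_funeM; apply/measurable_EFinP; exact: measurable_indic.
    move=> u _; rewrite -EFinM lee_fin /shell -/c -/h indicE mem_setE in_itv /=.
    have -> : (- z - h <= u <= - z + h) = (`|u + z| <= h).
      by rewrite ler_norml; apply/andP/andP => -[]; lra.
    have [uz|_] := boolP (`|u + z| <= h); last by rewrite !mulr0.
    rewrite !mulr1 mulrC ler_wpM2l ?powR_ge0//.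
    by apply: pD; exact: le_trans hr.
  rewrite ge0_integralZl//; last 2 first.
    by apply/measurable_EFinP; exact: measurable_indic.
    by rewrite lee_fin !mulr_ge0 ?powR_ge0 ?invr_ge0// ltW//.
  have h0 : 0 < h by rewrite divr_gt0// mulr_gt0// exprn_gt0// invr_gt0.
  have lebE : lebesgue_measure `[- z - h, - z + h]%classic = (h * 2)%:E :> \bar R.
    rewrite lebesgue_measure_itv /= lte_fin ifT; last by lra.
    by rewrite -EFinB; congr EFin; ring.
  have -> : (\int[leb]_x (\1_(`[- z - h, - z + h]%classic) x)%:E = (h * 2)%:E)%E.
    by rewrite -lebE -[in RHS](setIT `[_, _]%classic); apply: integral_indic.
  rewrite -EFinM lee_fin.
  have -> : c = r `^ (- a) * (2^-1 `^ (- a)) ^+ k * 4 `^ a.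
    rewrite /c powRM ?mulr_ge0 ?exprn_ge0 ?invr_ge0 ?ltW// powRM ?exprn_ge0 ?invr_ge0 ?ltW//.
    rewrite -!powR_mulrn ?invr_ge0 ?powR_ge0// -!powRrM [k%:R * _]mulrC.
    by congr (_ * _); rewrite -powR_inv1 // -powRrM mulN1r opprK.
  have -> : q ^+ k = (2^-1 `^ (- a)) ^+ k * 2^-1 ^+ k.
    by rewrite -exprMn /q powRD ?powRr1 ?invr_ge0 ?invr_eq0 ?pnatr_eq0 ?implybT// mulrC.
  rewrite /h le_eqVlt; apply/orP; left; apply/eqP; field.
  by rewrite gt_eqF.
have key : (\int[leb]_u (p u * pw a (u + z))%:E <= (r `^ (- a) * pw_const a D)%:E)%E.
  apply: (@le_trans _ _ (\int[leb]_u (((r / 2) `^ (- a))%:E * (p u)%:E +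
      \sum_(0 <= k <oo) (p u * shell a r (u + z) k)%:E))%E).
    apply: ge0_le_integral => //.
    - by move=> u _; rewrite lee_fin mulr_ge0// pw_ge0.
    - exact/measurable_EFinP.
    - apply: emeasurable_funD; first by apply: measurable_funeM; exact/measurable_EFinP.
      apply: ge0_emeasurable_sum => [k x _ _|k _].
        by rewrite lee_fin mulr_ge0// shell_ge0.
      by apply/measurable_EFinP; apply: measurable_funM => //; exact: measurable_shell.
    move=> u _; rewrite EFinM.
    have -> : (\sum_(0 <= k <oo) (p u * shell a r (u + z) k)%:E =
       (p u)%:E * \sum_(0 <= k <oo) (shell a r (u + z) k)%:E)%E.
      rewrite -nneseriesZl// => k _.
      by rewrite lee_fin shell_ge0.
    rewrite [(((r / 2) `^ (- a))%:E * _)%E]muleC -ge0_muleDr ?lee_fin ?powR_ge0//.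
      by rewrite lee_wpmul2l ?lee_fin// pw_shells.
    by apply: nneseries_ge0 => k _ _; rewrite lee_fin shell_ge0.
  rewrite ge0_integralD//; last 4 first.
    by move=> u _; rewrite -EFinM lee_fin mulr_ge0// powR_ge0.
    by apply: measurable_funeM; exact/measurable_EFinP.
    by move=> u _; apply: nneseries_ge0 => k _ _; rewrite lee_fin mulr_ge0// shell_ge0.
    apply: ge0_emeasurable_sum => [k x _ _|k _].
      by rewrite lee_fin mulr_ge0// shell_ge0.
    by apply/measurable_EFinP; apply: measurable_funM => //; exact: measurable_shell.
  rewrite ge0_integralZl//; last 3 first.
    exact/measurable_EFinP.
    by move=> u _; rewrite lee_fin.
    by rewrite lee_fin powR_ge0.
  rewrite -Ex_EFin// Ep mule1 integral_nneseries//; last 2 first.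
    by move=> k; apply/measurable_EFinP; apply: measurable_funM => //; exact: measurable_shell.
    by move=> k u _; rewrite lee_fin mulr_ge0// shell_ge0.
  rewrite /pw_const mulrDr EFinD leeD//.
    have -> : (r / 2) `^ (- a) = r `^ (- a) * 2 `^ a; last exact: lexx.
    rewrite powRM; [|exact: ltW|by rewrite invr_ge0].
    by congr (_ * _); rewrite -powR_inv1 // -powRrM mulN1r opprK.
  apply: lime_le.
    by apply: is_cvg_nneseries => k _ _; apply: integral_ge0 => u _; rewrite lee_fin mulr_ge0// shell_ge0.
  apply: nearW => N.
  apply: (@le_trans _ _ (\sum_(0 <= k < N) (r `^ (- a) * (D * 4 `^ a) * q ^+ k)%:E)%E).
    by apply: lee_sum => k _; exact: Esh.
  rewrite sumEFin lee_fin -mulr_sumr [leRHS]mulrA.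
  apply: ler_wpM2l; first by rewrite !mulr_ge0 ?powR_ge0.
  have := @geometric_le_lim R N 1 q ler01 q0; rewrite (ger0_norm (ltW q0)) => /(_ q1).
  rewrite /series /= mul1r; apply: le_trans; rewrite le_eqVlt; apply/orP; left.
  by apply/eqP; apply: eq_bigr => i _; rewrite /geometric /= mul1r.
have L : L1 leb (fun u => p u * pw a (u + z)).
  apply: L1_ge0 => // [u|]; first by rewrite mulr_ge0// pw_ge0.
  by apply: le_lt_trans key _; rewrite ltry.
split => //; by rewrite -lee_fin Ex_EFin.
Qed.

Lemma npdf_peak_le (s u : R) : 0 < s -> npdf s u <= 1 / s.
Proof.
move=> s0; have sn : s != 0 by rewrite gt_eqF.
rewrite npdfE// mul1r /normal_peak.
apply: (@le_trans _ _ ((Num.sqrt (s ^+ 2 * pi *+ 2))^-1)).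
  rewrite ger_pMr ?invr_gt0 ?sqrtr_gt0 ?mulrn_wgt0 ?mulr_gt0 ?exprn_gt0 ?pi_gt0//.
  by rewrite -[X in _ <= X]expR0 ler_expR oppr_le0 divr_ge0// ?mulrn_wge0// sqr_ge0.
rewrite lef_pV2 ?posrE ?sqrtr_gt0 ?mulrn_wgt0 ?mulr_gt0 ?exprn_gt0 ?pi_gt0//.
rewrite -[leLHS](ger0_norm (ltW s0)) -sqrtr_sqr ler_sqrt.
  rewrite -mulrnAr ler_peMr ?sqr_ge0//.
  by have := @pi_ge2 R; rewrite -mulr_natr; lra.
by rewrite mulrn_wge0// mulr_ge0 ?sqr_ge0// pi_ge0.
Qed.

(** With [v = |u| / s] it reduces to [v <= exp (v ^ 2 / 2)], which follows from
    [v <= 1 + v ^ 2 / 2]. Being uniform in [s], it bounds the density away from 0 even when [s] is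
    small. *)
Lemma npdf_inv_le (s u : R) : 0 < s -> `|u| * npdf s u <= 1.
Proof.
move=> s0; have sn : s != 0 by rewrite gt_eqF.
rewrite npdfE// /normal_peak.
have pk : (Num.sqrt (s ^+ 2 * pi *+ 2))^-1 <= s^-1.
  rewrite lef_pV2 ?posrE ?sqrtr_gt0 ?mulrn_wgt0 ?mulr_gt0 ?exprn_gt0 ?pi_gt0//.
  rewrite -[leLHS](ger0_norm (ltW s0)) -sqrtr_sqr ler_sqrt.
    rewrite -mulrnAr ler_peMr ?sqr_ge0//.
    by have := @pi_ge2 R; rewrite -mulr_natr; lra.
  by rewrite mulrn_wge0// mulr_ge0 ?sqr_ge0// pi_ge0.
pose v := `|u| / s.
have v0 : 0 <= v by rewrite divr_ge0// ltW.
have -> : u ^+ 2 / (s ^+ 2 *+ 2) = v ^+ 2 / 2.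
  by rewrite /v exprMn real_normK ?num_real// exprVn -mulr_natr; field.
apply: (@le_trans _ _ (`|u| * (s^-1 * expR (- (v ^+ 2 / 2))))).
  by rewrite ler_wpM2l// ler_wpM2r// expR_ge0.
rewrite mulrA -/v expRN ler_pdivrMr ?expR_gt0// mul1r.
apply: le_trans (expR_ge1Dx _); have := sqr_ge0 (v - 1); rewrite sqrrB1.
by clearbody v; nra.
Qed.

Lemma Ex_pw_npdf (s a z : R) : 0 < a -> a < 1 -> 0 < s ->
  [/\ L1 leb (fun u => npdf s u * pw a (u + z)),
      Ex leb (fun u => npdf s u * pw a (u + z)) <= s `^ (- a) * pw_const a 2 &
      z != 0 -> Ex leb (fun u => npdf s u * pw a (u + z)) <= pw a z * pw_const a 2].
Proof.
move=> a0 a1 s0.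
have h1 : forall u, `|u + z| <= s / 2 -> npdf s u <= 2 / s.
  move=> u _; apply: (le_trans (npdf_peak_le u s0)).
  by rewrite ler_pM2r ?invr_gt0// ler1n.
have [l1 e1] := Ex_pw_le a0 a1 s0 (ler0n _ 2) (@npdf_ge0 R s) (@L1_npdf R s) (@Ex_npdf R s) h1.
split=> // z0.
have z1 : 0 < `|z| by rewrite normr_gt0.
(* Near the singularity [- z] one has [|u| >= |z| / 2], so [|u| npdf s u <= 1] gives the density
   bound [2 / |z|], independent of [s]. *)
have h2 : forall u, `|u + z| <= `|z| / 2 -> npdf s u <= 2 / `|z|.
  move=> u uz; have zu : `|z| / 2 <= `|u|.
    have := ler_normB (u + z) u; rewrite addrAC subrr add0r; lra.
  rewrite ler_pdivlMr//; have := npdf_inv_le u s0; have := npdf_ge0 s u.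
  by move: (npdf s u) => p p0 pu; nra.
by have [_] := Ex_pw_le a0 a1 z1 (ler0n _ 2) (@npdf_ge0 R s) (@L1_npdf R s) (@Ex_npdf R s) h2.
Qed.

Lemma pwN a y : pw a (- y) = pw a y. Proof. by rewrite /pw normrN. Qed.

Lemma lebesgue_shift (a : R) (A : set R) : measurable A ->
  leb A = leb ((fun u => u + a) @^-1` A).
Proof.
move=> mA; pose T := fun u : measurableTypeR R => (u + a) : measurableTypeR R.
have mT : measurable_fun setT T.
  by apply: measurable_funD => //; exact: measurable_cst.
pose nu := [the measure _ _ of pushforward leb T].
suff H : leb A = nu mT A by [].
apply: lebesgue_measure_unique mA => // _ [[x y] /= _ <-].
rewrite /nu /= /pushforward.
rewrite (_ : (fun u => u + a) @^-1` _ = `](x - a), (y - a)]%classic); last first.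
  by apply/seteqP; split => u /=; rewrite !in_itv /= ltrBlDr lerBrDr.
rewrite !lebesgue_measure_itv /= !lte_fin ltrD2r; case: ifP => // _.
by rewrite -!EFinB; congr EFin; ring.
Qed.

Definition nl (s : R) : probability (measurableTypeR R) R := @normal_prob R 0 s.

Lemma nl_Ex s (h : R -> R) : measurable_fun setT h ->
  (L1 (nl s) h <-> L1 leb (fun u => npdf s u * h u)) /\
  Ex (nl s) h = Ex leb (fun u => npdf s u * h u).
Proof.
move=> mh.
have H := @normal_probE R s.
have -> : (fun u => npdf s u * h u) = (fun u => h u * npdf s u).
  by apply/funext => u; rewrite mulrC.
split.
  by apply: (@L1_density _ _ _ leb (nl s) (npdf s)) => //; [exact: measurable_npdf|exact: npdf_ge0].
by apply: (@Ex_density _ _ _ leb (nl s) (npdf s)) => //; [exact: measurable_npdf|exact: npdf_ge0].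
Qed.

Lemma measurable_pw_shift a z : measurable_fun setT (fun u : R => pw a (u + z)).
Proof.
apply: (measurableT_comp (measurable_pw a)).
by apply: measurable_funD => //; exact: measurable_cst.
Qed.

Lemma nl_pw (s a z : R) : 0 < a -> a < 1 -> 0 < s ->
  [/\ L1 (nl s) (fun u => pw a (u + z)),
      Ex (nl s) (fun u => pw a (u + z)) <= s `^ (- a) * pw_const a 2 &
      z != 0 -> Ex (nl s) (fun u => pw a (u + z)) <= pw a z * pw_const a 2].
Proof.
move=> a0 a1 s0; have [i e] := nl_Ex s (measurable_pw_shift a z).
by have [l b c] := Ex_pw_npdf z a0 a1 s0; split; [apply/i|rewrite e|rewrite e].
Qed.

Lemma nl_ae_neq (s z : R) : {ae nl s, forall u, u != z}.
Proof.
exists [set z]; split => //; last by move=> u /= /negP; rewrite negbK => /eqP.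
apply: (@normal_prob_dominates R 0 s [set z]) => //.
by apply/measure0_null_setP => //; exact: lebesgue_measure_set1.
Qed.

Lemma nl_sqr s : 0 < s -> L1 (nl s) (fun u => u ^+ 2) /\ Ex (nl s) (fun u => u ^+ 2) = s ^+ 2.
Proof.
move=> s0; have sn : s != 0 by rewrite gt_eqF.
have m2 : measurable_fun setT (fun u : R => u ^+ 2) by exact: exprn_measurable.
have [i e] := nl_Ex s m2.
have E : (fun u => npdf s u * u ^+ 2) = (fun u => u ^+ 2 * npdf s u).
  by apply/funext => u; rewrite mulrC.
by rewrite e i E; split; [exact: L1_sqr_npdf|exact: Ex_sqr_npdf].
Qed.

(** One coordinate of the covariance of the noise tested against two heat kernels: the Riesz kernel
    smoothed by two independent centered normal variables. *)
Definition kap a s s' z := Ex (pp (nl s) (nl s')) (fun p => pw a (p.1 - p.2 + z)).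

Lemma measurable_kap_integrand a z :
  measurable_fun setT (fun p : R * R => pw a (p.1 - p.2 + z)).
Proof.
apply: (measurableT_comp (measurable_pw a)).
by apply: measurable_funD => //; exact: measurable_funB.
Qed.

Lemma L1_kap a s s' z : 0 < a -> a < 1 -> 0 < s ->
  L1 (pp (nl s) (nl s')) (fun p => pw a (p.1 - p.2 + z)) /\
  kap a s s' z <= s `^ (- a) * pw_const a 2.
Proof.
move=> a0 a1 s0.
have E v : (fun u => pw a (u - v + z)) = (fun u => pw a (u + (z - v))).
  by apply/funext => u; congr pw; ring.
have L v : L1 (nl s) (fun u => pw a (u - v + z)).
  by rewrite E; have [] := nl_pw (z - v) a0 a1 s0.
have B v : Ex (nl s) (fun u => pw a (u - v + z)) <= s `^ (- a) * pw_const a 2.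
  by rewrite E; have [] := nl_pw (z - v) a0 a1 s0.
have I : L1 (pp (nl s) (nl s')) (fun p => pw a (p.1 - p.2 + z)).
  apply: pp_tonelli2 => //; first exact: measurable_kap_integrand.
  apply: (@L1_bnd _ _ _ (nl s') _ (s `^ (- a) * pw_const a 2)) => [|v].
    have mk := measurableT_comp (@normr_measurable R setT) (measurable_kap_integrand a z).
    exact: (measurable_Ex1 (nl s) mk).
  rewrite ger0_norm; last by apply: Ex_ge0 => u; rewrite normr_ge0.
  apply: le_trans (B v); apply: Ex_le (L1_norm (L v)) (L v) _ => u.
  by rewrite ger0_norm// pw_ge0.
split => //; rewrite /kap; have [l ->] := pp_fubini2 I.
by apply: Ex_le_cst.
Qed.

(** The comparison with [pw a z] is applied once for each normal variable, whence the squared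
    constant; it does not depend on [s] and [s'], as domination requires. The exceptional value
    [v = z] of the second variable is null. *)
Lemma kap_le a s s' z : 0 < a -> a < 1 -> 0 < s -> 0 < s' -> z != 0 ->
  kap a s s' z <= pw a z * pw_const a 2 ^+ 2.
Proof.
move=> a0 a1 s0 s0' z0; have [I _] := L1_kap s' z a0 a1 s0.
rewrite /kap; have [l ->] := pp_fubini2 I.
have [l1 _ b1] := nl_pw (- z) a0 a1 s0'.
apply: (@le_trans _ _ (Ex (nl s') (fun v => pw_const a 2 * pw a (v + - z)))).
  apply: Ex_le_ae => //; first exact: L1Z.
  apply: (ae_impl (nl_ae_neq s' z)) => v vz.
  have -> : (fun u => pw a (u - v + z)) = (fun u => pw a (u + (z - v))).
    by apply/funext => u; congr pw; ring.
  have [_ _] := nl_pw (z - v) a0 a1 s0.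
  rewrite subr_eq0 eq_sym vz => /(_ isT) /le_trans; apply.
  by rewrite mulrC -[pw a (v - z)]pwN opprB.
rewrite ExZ// expr2 mulrA mulrC ler_wpM2r ?pw_const_ge0//.
by have := b1; rewrite oppr_eq0 pwN; apply.
Qed.

Lemma kap_ge0 a s s' z : 0 <= kap a s s' z.
Proof. by apply: Ex_ge0 => p; exact: pw_ge0. Qed.

(** Uniform integrability in pointwise form: within distance [tau] of 0, the singularity of order
    [a] is at most the multiple [tau ^ (b - a)] of the stronger one of order [b]. *)
Lemma pw_tail (a b tau y : R) : a <= b -> 0 < tau -> 0 < a ->
  pw a y <= tau `^ (- a) + tau `^ (b - a) * pw b y.
Proof.
move=> ab t0 a0; have [ty|yt] := leP tau `|y|.
  apply: (@le_trans _ _ (tau `^ (- a))).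
    by rewrite /pw; apply: powRN_le => //; exact: ltW.
  by rewrite lerDl mulr_ge0 ?powR_ge0.
have [y0|y0] := eqVneq y 0.
  rewrite [pw a y]/pw [X in `|X|]y0 normr0 powR0 ?oppr_eq0 ?gt_eqF//.
  by rewrite addr_ge0 ?mulr_ge0 ?powR_ge0.
apply: (@le_trans _ _ (tau `^ (b - a) * pw b y)); last by rewrite lerDr powR_ge0.
have yp : 0 < `|y| by rewrite normr_gt0.
have -> : pw a y = `|y| `^ (b - a) * pw b y.
  by rewrite /pw -powRD ?normr_eq0 ?y0 ?implybT//; congr (_ `^ _); ring.
rewrite ler_wpM2r ?pw_ge0// ge0_ler_powR ?nnegrE ?subr_ge0//; exact: ltW.
Qed.

Lemma pw_continuous a z : z != 0 -> {for z, continuous (pw a)}.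
Proof.
move=> z0.
have H : {for `|z|, continuous (fun x : R => x `^ (- a))}.
  apply: differentiable_continuous; apply/derivable1_diffP.
  have d := @is_derive1_powR R (- a) `|z|; rewrite normr_gt0 z0 in d.
  exact: (@ex_derive _ _ _ _ _ _ _ (d isT)).
exact: (@continuous_comp _ _ _ (fun x : R => `|x|) (fun x : R => x `^ (- a)) z (@norm_continuous _ _ z) H).
Qed.

(** The smoothing variables concentrate at 0 and [pw a] is continuous at [z]. Large deviations cost
    a variance, by Chebyshev, and the singularity costs a small multiple of the mean of [pw b],
    which [kap_le] bounds. *)
Lemma kap_cvg a (s s' : R^nat) z : 0 < a -> a < 1 ->
  (forall k, 0 < s k) -> (forall k, 0 < s' k) ->
  s @ \oo --> 0 -> s' @ \oo --> 0 -> z != 0 ->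
  kap a (s k) (s' k) z @[k --> \oo] --> pw a z.
Proof.
move=> a0 a1 s0 s0' cs cs' z0.
apply/cvgrPdist_le => e e0.
(* An exponent strictly between [a] and 1: larger than [a] for [pw_tail], smaller than 1 for
   integrability. *)
pose b := (1 + a) / 2.
have b0 : 0 < b by rewrite /b; lra.
have b1 : b < 1 by rewrite /b; lra.
have ab : a < b by rewrite /b; lra.
pose Cb := pw b z * pw_const b 2 ^+ 2.
have Cb0 : 0 <= Cb by rewrite mulr_ge0 ?pw_ge0// sqr_ge0.
have e3 : 0 < e / 3 by rewrite divr_gt0.
pose h := e / 3 / (Cb + 1).
have h0 : 0 < h by rewrite divr_gt0// ltr_wpDl.
(* Makes [tau ^ (b - a) = h], where [h] was chosen so that [h] times the bound [Cb] on the mean of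
   [pw b] is at most [e / 3]. *)
pose tau := h `^ (b - a)^-1.
have t0 : 0 < tau by rewrite powR_gt0.
have tE : tau `^ (b - a) = h.
  by rewrite /tau -powRrM mulVf ?powRr1 ?ltW// subr_eq0 gt_eqF.
have /cvgrPdist_le /(_ _ e3) := @pw_continuous a z z0.
move=> /nbhs_ballP[d /= d0 dP].
pose K := (tau `^ (- a) + pw a z) * (2 / d ^+ 2).
have K0 : 0 <= K by rewrite !mulr_ge0 ?addr_ge0 ?powR_ge0 ?invr_ge0 ?sqr_ge0.
have pt (u v : R) : `|pw a z - pw a (u - v + z)| <=
    e / 3 + (K * (u ^+ 2 + v ^+ 2) + h * pw b (u - v + z)).
  have [uv|uv] := ltP `|u - v| d.
    apply: (@le_trans _ _ (e / 3)).
      by apply: dP; rewrite /ball /= opprD addrCA subrr addr0 normrN.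
    by rewrite lerDl addr_ge0// mulr_ge0 ?powR_ge0 ?addr_ge0 ?sqr_ge0// ltW.
  have tl := @pw_tail a b tau (u - v + z) (ltW ab) t0 a0; rewrite tE in tl.
  have n1 : `|pw a z - pw a (u - v + z)| <= pw a z + pw a (u - v + z).
    by apply: (le_trans (ler_normB _ _)); rewrite !ger0_norm ?pw_ge0.
  have n2 : tau `^ (- a) + pw a z <= K * (u ^+ 2 + v ^+ 2).
    rewrite /K -mulrA ler_peMr ?addr_ge0 ?powR_ge0//.
    have d2 : 0 < d ^+ 2 by rewrite exprn_gt0.
    rewrite mulrAC ler_pdivlMr// mul1r.
    have : d ^+ 2 <= (u - v) ^+ 2.
      by rewrite -[leRHS]real_normK ?num_real// lerXn2r// ?nnegrE ?normr_ge0// ltW.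
    have := sqr_ge0 (u + v); rewrite sqrrD sqrrB; move: (d ^+ 2) => dd.
    rewrite (_ : u ^+ 2 - _ + _ = 2 * (u ^+ 2 + v ^+ 2) - (u ^+ 2 + u * v *+ 2 + v ^+ 2)); last by ring.
    by move: (u ^+ 2 + u * v *+ 2 + v ^+ 2) (2 * _) => A B'; lra.
  have aux (x A B' t p q r : R) : x <= p + q -> t + p <= A -> q <= t + B' -> 0 < r ->
    x <= r + (A + B') by lra.
  exact: aux n1 n2 tl e3.
have mI := measurable_kap_integrand a z.
have bnd k : `|pw a z - kap a (s k) (s' k) z| <=
    e / 3 + (K * ((s k) ^+ 2 + (s' k) ^+ 2) + h * Cb).
  pose P := pp (nl (s k)) (nl (s' k)).
  have [la _] := L1_kap (s' k) z a0 a1 (s0 k).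
  have [lb _] := L1_kap (s' k) z b0 b1 (s0 k).
  have lb' := kap_le b0 b1 (s0 k) (s0' k) z0.
  have [l1 x1] := nl_sqr (s0 k); have [l2 x2] := nl_sqr (s0' k).
  have [f1 g1] := @Ex_fst _ _ _ _ _ (nl (s k)) (nl (s' k)) _ l1.
  have [f2 g2] := @Ex_snd _ _ _ _ _ (nl (s k)) (nl (s' k)) _ l2.
  have lc : L1 P (fun _ => pw a z) by exact: L1_cst.
  have -> : pw a z - kap a (s k) (s' k) z =
      Ex P (fun p => pw a z - pw a (p.1 - p.2 + z)).
    by rewrite /kap (ExB lc la) Ex_cst.
  have lS : L1 P (fun p => K * (p.1 ^+ 2 + p.2 ^+ 2)) by apply: L1Z; exact: L1D.
  have lT : L1 P (fun p => h * pw b (p.1 - p.2 + z)) by exact: L1Z.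
  have lU : L1 P (fun p => e / 3 + (K * (p.1 ^+ 2 + p.2 ^+ 2) + h * pw b (p.1 - p.2 + z))).
    by apply: L1D; [exact: L1_cst|exact: L1D].
  apply: (@le_trans _ _ (Ex P (fun p => e / 3 +
      (K * (p.1 ^+ 2 + p.2 ^+ 2) + h * pw b (p.1 - p.2 + z))))).
    by apply: Ex_norm_le (L1B lc la) lU _ => p; exact: pt.
  rewrite (ExD (L1_cst P _) (L1D lS lT)) Ex_cst lerD2l (ExD lS lT).
  rewrite (ExZ K (L1D f1 f2)) (ExD f1 f2) g1 g2 x1 x2 lerD2l (ExZ h lb).
  by rewrite ler_wpM2l// ltW.
have hC : h * Cb <= e / 3.
  by rewrite /h -mulrA ler_piMr ?(ltW e3)// ler_pdivrMl ?mulr1 ?lerDl// ltr_wpDl.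
have cK : (fun k => K * ((s k) ^+ 2 + (s' k) ^+ 2)) @ \oo --> 0.
  apply: eq_cvg_seq (@cvgZ_seq _ K _ _ (cvgD_seq (cvgM cs cs) (cvgM cs' cs'))) => [k|].
    by rewrite !expr2.
  by rewrite !mulr0 addr0 mulr0.
move/cvgr_lt : cK => /(_ _ e3); apply: filterS => k hk.
apply: le_trans (bnd k) _; move: hC hk; move: (h * Cb) (K * _) => A B'; lra.
Qed.
End riesz_kernel.

(** * Product integrals on row vectors and covariances of heat kernels *)

Section lebesgue_product.
Context {R : realType}.
Local Notation leb := (@lebesgue_measure R).

Lemma emeasurable_prod d (T : measurableType d) (I : Type) (s : seq I) (h : I -> T -> \bar R) :
  (forall i, measurable_fun setT (h i)) ->
  measurable_fun setT (fun x => (\prod_(i <- s) h i x)%E).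
Proof.
move=> mh; elim: s => [|i s IH].
  by under eq_fun do rewrite big_nil; exact: measurable_cst.
by under eq_fun do rewrite big_cons; exact: emeasurable_funM.
Qed.

Lemma measurable_prodR d (T : measurableType d) (I : Type) (s : seq I) (h : I -> T -> R) :
  (forall i, measurable_fun setT (h i)) ->
  measurable_fun setT (fun x => \prod_(i <- s) h i x).
Proof.
move=> mh; elim: s => [|i s IH].
  by under eq_fun do rewrite big_nil; exact: measurable_cst.
by under eq_fun do rewrite big_cons; exact: measurable_funM.
Qed.

Lemma prode_ge0 (I : Type) (s : seq I) (h : I -> \bar R) :
  (forall i, 0 <= h i)%E -> (0 <= \prod_(i <- s) h i)%E.
Proof. by move=> h0; elim/big_ind : _ => // x y x0 y0; exact: mule_ge0. Qed.

Lemma prod_EFin (I : Type) (s : seq I) (h : I -> R) :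
  (\prod_(i <- s) (h i)%:E)%E = (\prod_(i <- s) h i)%:E.
Proof. by elim: s => [|i s IH]; rewrite ?big_nil// !big_cons IH EFinM. Qed.

(** Induction along the recursive definition of [lebesgue_rV]: [rVcons] transports the product
    measure and Tonelli splits off the first coordinate. *)
Lemma integral_rV_prod n (h : 'I_n -> R -> \bar R) :
  (forall i, measurable_fun setT (h i)) -> (forall i u, 0 <= h i u)%E ->
  (\int[lebesgue_rV R n]_x \prod_(i < n) h i (x 0%R i) = \prod_(i < n) \int[leb]_u h i u)%E.
Proof.
elim: n h => [|n IH] h mh h0 /=.
  under eq_integral do rewrite big_ord0.
  by rewrite big_ord0 integral_cst//= diracT mule1.
pose mu := lebesgue_rV R n.
have mprod : measurable_fun setT (fun x : 'rV[R]_n.+1 => \prod_(i < n.+1) h i (x 0%R i))%E.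
  by apply: emeasurable_prod => i; apply: (measurableT_comp (mh i)); exact: measurable_rV_coord.
have mtail : measurable_fun setT (fun v : 'rV[R]_n => \prod_(i < n) h (lift ord0 i) (v 0%R i))%E.
  by apply: emeasurable_prod => i; apply: (measurableT_comp (mh _)); exact: measurable_rV_coord.
have E := @ge0_integral_pushforward _ _ (measurableTypeR R * 'rV[R]_n)%type _ R (@rVcons R n) (@measurable_rVcons R n)
  (leb \x mu)%E setT _ measurableT mprod (fun y _ => prode_ge0 _ (fun i => h0 i _)).
rewrite preimage_setT in E; rewrite [LHS]E fubini_tonelli1//=; last 2 first.
  by apply: (measurableT_comp mprod); exact: measurable_rVcons.
  by move=> p; exact: prode_ge0.
rewrite /fubini_F big_ord_recl /= -(IH (fun i => h (lift ord0 i)))//.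
have c0 : (0 <= \int[mu]_v \prod_(i < n) h (lift ord0 i) (v 0%R i))%E.
  by apply: integral_ge0 => v _; exact: prode_ge0.
rewrite muleC -ge0_integralZl//.
apply: eq_integral => u _.
rewrite muleC -ge0_integralZl//; last by move=> v _; exact: prode_ge0.
apply: eq_integral => v _; rewrite big_ord_recl /=; congr (_ * _)%E.
  by rewrite /rVcons mxE unlift_none.
by apply: eq_bigr => i _; rewrite /rVcons mxE liftK.
exact: mh.
Qed.

Lemma integral2_rV_prod n (F : 'I_n -> R * R -> R) :
  (forall i, measurable_fun setT (F i)) -> (forall i p, 0 <= F i p) ->
  (\int[lebesgue_rV R n \x lebesgue_rV R n]_p
     (\prod_(i < n) F i (p.1 0%R i, p.2 0%R i))%:E =
   \prod_(i < n) \int[leb]_u \int[leb]_v (F i (u, v))%:E)%E.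
Proof.
move=> mF F0.
have mp : measurable_fun setT (fun p : 'rV[R]_n * 'rV[R]_n => \prod_(i < n) F i (p.1 0%R i, p.2 0%R i)).
  apply: measurable_prodR => i; apply: (measurableT_comp (mF i)).
  apply: measurable_fun_pair.
    by apply: (measurableT_comp (@measurable_rV_coord R n i)); exact: measurable_fst.
  by apply: (measurableT_comp (@measurable_rV_coord R n i)); exact: measurable_snd.
rewrite fubini_tonelli1//=; last 2 first.
  exact/measurable_EFinP.
  by move=> p; rewrite lee_fin; apply: prodr_ge0 => i _.
have mS i u : measurable_fun setT (fun v => F i (u, v)).
  by apply: (measurableT_comp (mF i)); exact: measurable_pair1.
rewrite -(integral_rV_prod (h := fun i u => \int[leb]_v (F i (u, v))%:E))%E; last 2 first.
- move=> i; have mFE : measurable_fun setT (EFin \o F i) by exact/measurable_EFinP.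
  have F0E (p : R * R) : (0 <= (EFin \o F i) p)%E by rewrite /= lee_fin.
  exact: (@measurable_fun_fubini_tonelli_F _ _ (measurableTypeR R) (measurableTypeR R) R leb _ mFE F0E).
- by move=> i u; apply: integral_ge0 => v _; rewrite lee_fin.
apply: eq_integral => x _; rewrite /fubini_F /=.
rewrite -(integral_rV_prod (h := fun i v => (F i (x 0%R i, v))%:E)).
- by apply: eq_integral => v _; rewrite prod_EFin.
- by move=> i; exact/measurable_EFinP.
- by move=> i u; rewrite lee_fin.
Qed.
End lebesgue_product.

Section heat_kernels.
Context {R : realType} {n : nat}.
Variable alpha : 'I_n -> R.
Hypothesis al : forall i, 0 < alpha i < 1.
Local Notation leb := (@lebesgue_measure R).

(* Covariance of the noise tested against two heat kernels at distance [z]. *)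
Definition Kap (eta eta' : R) (z : 'rV[R]_n) :=
  \prod_(i < n) kap (alpha i) (Num.sqrt eta) (Num.sqrt eta') (z 0 i).

Let hk (eta : R) (a y : 'rV[R]_n) := heat_kernel eta (y - a).

Lemma measurable_hk eta a : measurable_fun setT (hk eta a).
Proof.
apply: measurable_prodR => i; apply: (measurableT_comp (measurable_normal_pdf 0 _)).
under eq_fun do rewrite !mxE.
by apply: measurable_funB; [exact: measurable_rV_coord|exact: measurable_cst].
Qed.

Lemma hk_ge0 eta a y : 0 <= hk eta a y.
Proof. by apply: prodr_ge0 => i _; exact: normal_pdf_ge0. Qed.

Lemma riesz_productE (z : 'rV[R]_n) : riesz_product alpha z = \prod_(i < n) pw (alpha i) (z 0 i).
Proof. by []. Qed.

Lemma ge0_integral_shift (a : R) (h : R -> R) : measurable_fun setT h -> (forall u, 0 <= h u) ->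
  (\int[leb]_u (h u)%:E = \int[leb]_u (h (u + a))%:E)%E.
Proof.
move=> mh h0.
apply: (@ge0_integral_image _ _ _ _ _ leb leb (fun u : R => u + a)) => //.
  by apply: measurable_funD => //; exact: measurable_cst.
by move=> A mA; exact: lebesgue_shift.
Qed.

Lemma ge0_integral_nl (s : R) (h : R -> R) : measurable_fun setT h -> (forall u, 0 <= h u) ->
  (\int[leb]_u (npdf s u * h u)%:E = \int[nl s]_u (h u)%:E)%E.
Proof.
move=> mh h0.
rewrite (@ge0_integral_density _ _ _ leb (nl s) (npdf s))//.
- by apply: eq_integral => u _; rewrite mulrC.
- exact: measurable_npdf.
- by move=> u; exact: npdf_ge0.
Qed.

Lemma measurable_pw_sub a (c : R) : measurable_fun setT (fun p : R * R => pw a (p.1 - (p.2 + c))).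
Proof.
apply: (measurableT_comp (measurable_pw a)); apply: measurable_funB => //.
by apply: measurable_funD => //; exact: measurable_cst.
Qed.

(** Translation invariance recentres each variable, which turns the two densities into the laws
    [nl s] and [nl s'] and leaves only the difference [b - c] of the centres. *)
Lemma integral_kap (s s' a b c : R) : 0 < s -> 0 < s' -> 0 < a < 1 ->
  (\int[leb]_u \int[leb]_v
     (normal_pdf 0 s (u - b) * normal_pdf 0 s' (v - c) * pw a (u - v))%:E)%E =
  (kap a s s' (b - c))%:E.
Proof.
move=> s0 s0' /andP[a0 a1].
have [I _] := L1_kap s' (b - c) a0 a1 s0.
pose g u := Ex (nl s') (fun v => pw a (u - (v + c))).
have mq := measurable_pw_sub a c.
have mg : measurable_fun setT g := measurable_Ex2 (nl s') mq.
have mq1 (u : R) : measurable_fun setT (fun v : R => pw a (u - (v + c))).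
  exact: (measurableT_comp mq (measurable_pair1 u)).
have g0 u : 0 <= g u by apply: Ex_ge0 => v; exact: pw_ge0.
have gE u : g u = Ex (nl s') (fun v => pw a (u - (v + c))) by [].
clearbody g.
have Eu u : (\int[leb]_v (normal_pdf 0 s (u - b) * normal_pdf 0 s' (v - c) * pw a (u - v))%:E
   = (normal_pdf 0 s (u - b) * g u)%:E)%E.
  have ms : measurable_fun setT (fun v : R => normal_pdf 0 s (u - b) * normal_pdf 0 s' (v - c) * pw a (u - v)).
    apply: measurable_funM.
      apply: measurable_funM; first exact: measurable_cst.
      apply: (measurableT_comp (measurable_normal_pdf 0 s')).
      by apply: measurable_funB => //; exact: measurable_cst.
    by apply: (measurableT_comp (measurable_pw a)); apply: measurable_funB => //; exact: measurable_cst.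
  rewrite (ge0_integral_shift c)//; last by move=> v; rewrite !mulr_ge0 ?normal_pdf_ge0 ?pw_ge0.
  have L : L1 (nl s') (fun v => pw a (u - (v + c))).
    have [L _ _] := nl_pw (c - u) a0 a1 s0'.
    rewrite (_ : (fun v => pw a _) = (fun v => pw a (v + (c - u))))//.
    by apply/funext => v; rewrite -pwN; congr pw; ring.
  rewrite EFinM gE Ex_EFin// -ge0_integral_nl//; last by move=> v; exact: pw_ge0.
  rewrite -ge0_integralZl//; last 3 first.
  - apply/measurable_EFinP.
    have mm := measurable_funM (measurable_npdf s') (mq1 u); exact: mm.
  - by move=> v _; rewrite lee_fin mulr_ge0 ?npdf_ge0 ?pw_ge0.
  - by rewrite lee_fin normal_pdf_ge0.
  by apply: eq_integral => v _; rewrite -EFinM addrK mulrA.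
under eq_integral do rewrite Eu.
have mgb : measurable_fun setT (fun u : R => g (u + b)).
  by apply: (measurableT_comp mg); apply: measurable_funD => //; exact: measurable_cst.
rewrite (ge0_integral_shift b); last 2 first.
- apply: measurable_funM => //; apply: (measurableT_comp (measurable_normal_pdf 0 s)).
  by apply: measurable_funB => //; exact: measurable_cst.
- by move=> u; rewrite mulr_ge0 ?normal_pdf_ge0.
under eq_integral do rewrite addrK.
rewrite (ge0_integral_nl s mgb)// /kap; have [l ->] := pp_fubini1 I.
rewrite Ex_EFin//; apply: eq_integral => u _; rewrite gE; congr EFin.
by apply: eq_Ex => v /=; congr pw; ring.
Qed.

Lemma integral_hk eta eta' a b : 0 < eta -> 0 < eta' ->
  (\int[lebesgue_rV R n \x lebesgue_rV R n]_p
    (hk eta a p.1 * hk eta' b p.2 * riesz_product alpha (p.1 - p.2))%:E)%E =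
  (Kap eta eta' (a - b))%:E.
Proof.
move=> e0 e0'.
pose F i (p : R * R) := normal_pdf 0 (Num.sqrt eta) (p.1 - a 0 i) *
   normal_pdf 0 (Num.sqrt eta') (p.2 - b 0 i) * pw (alpha i) (p.1 - p.2).
transitivity (\int[lebesgue_rV R n \x lebesgue_rV R n]_p
    (\prod_(i < n) F i (p.1 0%R i, p.2 0%R i))%:E)%E.
  apply: eq_integral => p _; congr EFin.
  rewrite /hk /heat_kernel riesz_productE -!big_split /=.
  by apply: eq_bigr => i _; rewrite /F !mxE.
rewrite integral2_rV_prod; last 2 first.
- move=> i; apply: measurable_funM; last first.
    by apply: (measurableT_comp (measurable_pw _)); exact: measurable_funB.
  apply: measurable_funM; apply: (measurableT_comp (measurable_normal_pdf 0 _)).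
    by apply: measurable_funB => //; exact: measurable_cst.
  by apply: measurable_funB => //; exact: measurable_cst.
- by move=> i p; rewrite !mulr_ge0 ?normal_pdf_ge0 ?pw_ge0.
rewrite /Kap -prod_EFin; apply: eq_bigr => i _.
have s0 : 0 < Num.sqrt eta by rewrite sqrtr_gt0.
have s0' : 0 < Num.sqrt eta' by rewrite sqrtr_gt0.
have -> : (a - b) 0 i = a 0 i - b 0 i by rewrite !mxE.
exact: (integral_kap (a 0 i) (b 0 i) s0 s0' (al i)).
Qed.

Lemma noise_test_hk eta a : 0 < eta -> noise_test alpha (fun y => heat_kernel eta (y - a)).
Proof.
move=> e0; split; first exact: measurable_hk.
rewrite (_ : (\int[_]_p _)%E = (Kap eta eta (a - a))%:E) ?ltry//.
rewrite -integral_hk//; apply: eq_integral => p _.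
by rewrite ger0_norm// mulr_ge0// hk_ge0.
Qed.

Lemma noise_covariance_hk eta eta' a b : 0 < eta -> 0 < eta' ->
  noise_covariance alpha (fun y => heat_kernel eta (y - a)) (fun y => heat_kernel eta' (y - b))
  = (Kap eta eta' (a - b))%:E.
Proof. exact: integral_hk. Qed.

Lemma Kap_ge0 eta eta' z : 0 <= Kap eta eta' z.
Proof. by apply: prodr_ge0 => i _; exact: kap_ge0. Qed.

(** The constant is independent of the smoothing parameters, so a single multiple of the Riesz
    product dominates all smoothed kernels at once. *)
Lemma Kap_le_riesz : exists2 C : R, 0 <= C & forall eta eta' (z : 'rV[R]_n), 0 < eta -> 0 < eta' ->
  (forall i, z 0 i != 0) -> Kap eta eta' z <= C * riesz_product alpha z.
Proof.
exists (\prod_(i < n) pw_const (alpha i) 2 ^+ 2); first by apply: prodr_ge0 => i _; exact: sqr_ge0.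
move=> eta eta' z e0 e0' z0; rewrite riesz_productE -big_split /=.
apply: ler_prod => i _; rewrite kap_ge0 /= mulrC.
by have /andP[? ?] := al i; apply: kap_le; rewrite ?sqrtr_gt0.
Qed.

Lemma cvg_prod_seq (I : Type) (s : seq I) (u : I -> R^nat) (l : I -> R) :
  (forall i, u i @ \oo --> l i) ->
  (fun k => \prod_(i <- s) u i k) @ \oo --> \prod_(i <- s) l i.
Proof.
move=> ul; elim: s => [|i s IH].
  by under eq_fun do rewrite big_nil; rewrite big_nil; exact: cvg_cst.
under eq_fun do rewrite big_cons; rewrite big_cons; exact: cvgM.
Qed.

Lemma Kap_cvg (eta eta' : R^nat) (z : 'rV[R]_n) : (forall k, 0 < eta k) -> (forall k, 0 < eta' k) ->
  eta @ \oo --> 0 -> eta' @ \oo --> 0 -> (forall i, z 0 i != 0) ->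
  Kap (eta k) (eta' k) z @[k --> \oo] --> riesz_product alpha z.
Proof.
move=> e0 e0' ce ce' z0; rewrite riesz_productE; apply: cvg_prod_seq => i.
have /andP[a0 a1] := al i.
have sq (u : R^nat) : u @ \oo --> 0 -> Num.sqrt (u k) @[k --> \oo] --> 0.
  move=> cu; have := continuous_cvg _ (@sqrt_continuous R 0) cu.
  by rewrite sqrtr0; apply.
by apply: kap_cvg => //; [move=> k; rewrite sqrtr_gt0|move=> k; rewrite sqrtr_gt0|exact: sq|exact: sq].
Qed.

Lemma measurable_Kap eta eta' : measurable_fun setT (Kap eta eta').
Proof.
apply: measurable_prodR => i.
suff mk : measurable_fun setT (kap (alpha i) (Num.sqrt eta) (Num.sqrt eta')).
  by apply: (measurableT_comp mk); exact: measurable_rV_coord.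
have m3 : measurable_fun setT (fun p : R * (R * R) => pw (alpha i) (p.2.1 - p.2.2 + p.1)).
  apply: (measurableT_comp (measurable_pw _)); apply: measurable_funD; last exact: measurable_fst.
  apply: measurable_funB.
    exact: (measurableT_comp measurable_fst measurable_snd).
  exact: (measurableT_comp measurable_snd measurable_snd).
exact: (measurable_Ex2 (pp (nl (Num.sqrt eta)) (nl (Num.sqrt eta'))) m3).
Qed.

Lemma measurable_riesz : measurable_fun setT (@riesz_product R n alpha).
Proof.
apply: measurable_prodR => i; apply: (measurableT_comp (measurable_pw (alpha i))).
exact: measurable_rV_coord.
Qed.

Lemma riesz_ge0 (z : 'rV[R]_n) : 0 <= riesz_product alpha z.
Proof. by apply: prodr_ge0 => i _; exact: powR_ge0. Qed.
End heat_kernels.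

(** * Completeness of L2 and limits of inner products *)

Section L2_limits.
Context d (T : measurableType d) (R : realType) (P : probability T R).

Lemma cvg_sqrt0 (u : R^nat) : u @ \oo --> 0 -> Num.sqrt (u k) @[k --> \oo] --> 0.
Proof.
by move=> cu; have := continuous_cvg _ (@sqrt_continuous R 0) cu; rewrite sqrtr0; apply.
Qed.

Lemma cvg0_le (u v : R^nat) : (forall k, 0 <= u k) -> (forall k, u k <= v k) ->
  v @ \oo --> 0 -> u @ \oo --> 0.
Proof.
move=> u0 uv cv; apply: (@squeeze_cvgr _ _ _ _ (fun=> 0) v) => //; last exact: cvg_cst.
by apply: nearW => k; rewrite u0 uv.
Qed.

Lemma Ex_normM_le (f g : T -> R) : L2 P f -> L2 P g ->
  `|Ex P (fun x => f x * g x)| <=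
  Num.sqrt (Ex P (fun x => f x ^+ 2)) * Num.sqrt (Ex P (fun x => g x ^+ 2)).
Proof.
move=> lf lg; apply: le_trans (cauchy_schwarz_sqrt lf lg).
by apply: Ex_norm; exact: L2_mul.
Qed.

Lemma Ex_norm_sqrt (f : T -> R) : L2 P f ->
  Ex P (fun x => `|f x|) <= Num.sqrt (Ex P (fun x => f x ^+ 2)).
Proof.
move=> lf; have := cauchy_schwarz_sqrt (L2_cst P 1) lf.
rewrite (@eq_Ex _ _ _ P (fun x => `|1 * f x|) (fun x => `|f x|)); last by move=> x; rewrite mul1r.
by rewrite expr1n Ex_cst sqrtr1 mul1r.
Qed.

(* Riesz-Fischer: the rapidly converging subsequence is dominated termwise by a summable series. *)
Lemma L2_complete (f : (T -> R)^nat) : (forall k, L2 P (f k)) ->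
  (forall e, 0 < e -> exists N, forall k l, (N <= k)%N -> (N <= l)%N ->
     Ex P (fun x => (f k x - f l x) ^+ 2) <= e) ->
  exists F, L2 P F /\ Ex P (fun x => (f k x - F x) ^+ 2) @[k --> \oo] --> 0.
Proof.
move=> lf cau.
have ex (j : nat) : exists N, forall k l, (N <= k)%N -> (N <= l)%N ->
     Ex P (fun x => (f k x - f l x) ^+ 2) <= ((2^-1 : R) ^+ j) ^+ 2.
  by apply: cau; rewrite !exprn_gt0// invr_gt0.
have [N0 hN0] := choice ex.
(* Running maxima make the indices of the subsequence nondecreasing. *)
pose N (j : nat) := (\max_(i < j.+1) N0 i + j)%N.
have N_N0 j : (N0 j <= N j)%N.
  exact: leq_trans (@leq_bigmax _ (fun i : 'I_j.+1 => N0 i) ord_max) (leq_addr _ _).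
have N_S j : (N j <= N j.+1)%N by rewrite /N [X in (_ <= X + _)%N]big_ord_recr /= leq_add// leq_maxl.
have hN j k l : (N j <= k)%N -> (N j <= l)%N ->
     Ex P (fun x => (f k x - f l x) ^+ 2) <= ((2^-1 : R) ^+ j) ^+ 2.
  by move=> hk hl; apply: hN0; exact: leq_trans (N_N0 j) _.
pose h j x := f (N j) x.
have lh j : L2 P (h j) by exact: lf.
pose D j x := `|h j.+1 x - h j x|.
have lD j : L1 P (D j) by apply: L1_norm; apply: L2_L1; exact: L2B.
have ED j : Ex P (D j) <= 2^-1 ^+ j.
  apply: le_trans (Ex_norm_sqrt (L2B (lh j.+1) (lh j))) _.
  rewrite -[leRHS]ger0_norm ?exprn_ge0 ?invr_ge0// -sqrtr_sqr ler_wsqrtr//.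
  by apply: hN => //; exact: N_S.
have mD j : measurable_fun setT (fun x => (D j x)%:E) by apply/measurable_EFinP; exact: L1_meas (lD j).
have fin : (\int[P]_x \sum_(0 <= j <oo) (D j x)%:E < +oo)%E.
  rewrite integral_nneseries//; last by move=> j x _; rewrite lee_fin normr_ge0.
  apply: (@le_lt_trans _ _ 2%:E); last exact: ltry.
  apply: lime_le.
    by apply: is_cvg_nneseries => k _ _; apply: integral_ge0 => x _; rewrite lee_fin normr_ge0.
  apply: nearW => m.
  apply: (@le_trans _ _ (\sum_(0 <= j < m) (2^-1 ^+ j)%:E)%E).
    by apply: lee_sum => j _; rewrite -Ex_EFin// lee_fin.
  rewrite sumEFin lee_fin.
  have i1 : `|2^-1 : R| < 1 by rewrite ger0_norm ?invr_ge0// invf_lt1// ltr1n.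
  have := @geometric_le_lim R m 1 2^-1 ler01 _ i1; rewrite invr_gt0 => /(_ (ltr0n _ 2)).
  rewrite (_ : 1 / (1 - 2^-1) = 2 :> R); last by field.
  apply: le_trans; rewrite /series /= le_eqVlt; apply/orP; left; apply/eqP.
  by apply: eq_bigr => i _; rewrite mul1r.
have s0 x : (0 <= \sum_(0 <= j <oo) (D j x)%:E)%E.
  by apply: nneseries_ge0 => j _ _; rewrite lee_fin normr_ge0.
have mS : measurable_fun setT (fun x => \sum_(0 <= j <oo) (D j x)%:E)%E.
  by apply: ge0_emeasurable_sum => // j x _ _; rewrite lee_fin normr_ge0.
pose A := [set x | (\sum_(0 <= j <oo) (D j x)%:E < +oo)%E].
have aefin : {ae P, forall x, A x}.
  have I : P.-integrable setT (fun x => \sum_(0 <= j <oo) (D j x)%:E)%E.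
    apply/integrableP; split => //; apply: le_lt_trans fin.
    by under eq_integral do rewrite gee0_abs//.
  have := integrable_ae measurableT I.
  by apply: filterS => x /(_ Logic.I); rewrite ge0_fin_numE.
have mA : measurable A.
  by rewrite -[A]setTI; apply: emeasurable_fun_infty_o.
(* Cut off outside the full set where the increments are summable, so that the sequence converges at
   every point and its limit is measurable. *)
pose h' j x := \1_A x * h j x.
have mh' j : measurable_fun setT (h' j).
  by apply: measurable_funM; [exact: measurable_indic|exact: (lh j).1].
have h'cvg x : cvgn (fun j => h' j x).
  have [Ax|nAx] := pselect (A x); last first.
    rewrite (_ : (fun j => h' j x) = fun=> 0); first exact: is_cvg_cst.
    by apply/funext => j; rewrite /h' indicE memNset// mul0r.
  have cs : cvgn (series (fun j => h j.+1 x - h j x)).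
    exact: (normed_cvg (@nnseries_is_cvg R (fun j => D j x) (fun j => normr_ge0 _) Ax)).
  rewrite (_ : (fun j => h' j x) = (fun j => h 0%N x + series (fun j => h j.+1 x - h j x) j)).
    by apply: is_cvgD => //; exact: is_cvg_cst.
  apply/funext => j; rewrite /series /= telescope_sumr// addrC subrK.
  by rewrite /h' indicE mem_set// mul1r.
pose F x := limn (fun j => h' j x).
have mF : measurable_fun setT F.
  by apply: (@measurable_fun_cvg _ _ _ _ h') => // x _; exact: h'cvg.
(* Fatou's lemma along the subsequence: the distance from [f k] to the limit is at most the bound on
   its distances to later elements. The shift by [i] starts the subsequence at rank [i]. *)
have key k i : (N i <= k)%N ->
    (\int[P]_x ((f k x - F x) ^+ 2)%:E <= (((2^-1 : R) ^+ i) ^+ 2)%:E)%E.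
  move=> ki.
  pose g j x := (((f k x - h' (j + i)%N x) ^+ 2)%:E : \bar R).
  have mg j : measurable_fun setT (g j).
    apply/measurable_EFinP; apply: measurable_funX; apply: measurable_funB => //.
    exact: (lf k).1.
  have := @fatou _ _ _ P setT measurableT g mg.
  have g0 : forall j x, setT x -> (0 <= g j x)%E by move=> j x _; rewrite lee_fin sqr_ge0.
  move=> /(_ g0).
  have -> : (fun x => limn_einf (g ^~ x)) = (fun x => ((f k x - F x) ^+ 2)%:E).
    apply/funext => x.
    have c1 : (fun j => f k x - h' (j + i)%N x) @ \oo --> f k x - F x.
      apply: cvgB; first exact: cvg_cst.
      have H : (fun j => h' j x) @ \oo --> F x by exact: h'cvg.
      by rewrite -(cvg_shiftn i (fun j => h' j x)) in H.
    have c2 : g ^~ x @ \oo --> ((f k x - F x) ^+ 2)%:E.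
      by apply: cvg_EFin; [exact: nearW|apply: cvgM].
    rewrite is_cvg_limn_einfE; last by apply/cvg_ex; eexists; exact: c2.
    exact/cvg_lim.
  move=> /le_trans; apply.
  have ub j : (\int[P]_x g j x <= (((2^-1 : R) ^+ i) ^+ 2)%:E)%E.
    have lg : L1 P (fun x => (f k x - h (j + i)%N x) ^+ 2) by have [] := L2B (lf k) (lh (j + i)%N).
    have ae : {ae P, forall x, (f k x - h' (j + i)%N x) ^+ 2 = (f k x - h (j + i)%N x) ^+ 2}.
      by apply: filterS aefin => x Ax; rewrite /h' indicE mem_set// mul1r.
    have mg' : measurable_fun setT (fun x => (f k x - h' (j + i)%N x) ^+ 2).
      by have /measurable_EFinP := mg j.
    rewrite -Ex_EFin; last exact: L1_ae_eq mg' lg ae.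
    rewrite lee_fin (Ex_ae_eq mg' (L1_meas lg) ae); apply: hN => //.
    by rewrite /N; elim: (j) => [|m IH]; [exact: leqnn|exact: leq_trans IH (N_S _)].
  rewrite limn_einf_lim; apply: lime_le; first exact: is_cvg_einfs.
  apply: nearW => m; apply: le_trans (ub m).
  by apply: ereal_inf_lbound; exists m => //=.
have mfF k : measurable_fun setT (fun x => (f k x - F x) ^+ 2).
  by apply: measurable_funX; apply: measurable_funB => //; exact: (lf k).1.
have LfF k i : (N i <= k)%N -> L1 P (fun x => (f k x - F x) ^+ 2) /\
    Ex P (fun x => (f k x - F x) ^+ 2) <= ((2^-1 : R) ^+ i) ^+ 2.
  move=> ki; have L : L1 P (fun x => (f k x - F x) ^+ 2).
    apply: L1_ge0 => // [x|]; first exact: sqr_ge0.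
    by apply: le_lt_trans (key _ _ ki) _; rewrite ltry.
  by split => //; rewrite -lee_fin Ex_EFin//; exact: key.
exists F; split.
  have [l0 _] := LfF (N 0%N) 0%N (leqnn _).
  have l2 : L2 P (fun x => f (N 0%N) x - F x).
    by split => //; apply: measurable_funB => //; exact: (lf _).1.
  have := L2B (lf (N 0%N)) l2; congr L2.
  by apply/funext => x; rewrite opprB addrCA subrr addr0.
apply/cvgrPdist_le => e e0.
have i1 : `|2^-1 : R| < 1 by rewrite ger0_norm ?invr_ge0// invf_lt1// ltr1n.
have /cvgr_le /(_ e) := @cvg_expr R 2^-1 i1.
move=> /(_ e0)[i _ /(_ i (leqnn i)) hi].
exists (N i) => // k /= ki; rewrite sub0r normrN ger0_norm; last by apply: Ex_ge0 => x; exact: sqr_ge0.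
apply: le_trans (LfF _ _ ki).2 _; apply: le_trans hi.
rewrite expr2 ler_piMr ?exprn_ge0 ?invr_ge0// exprn_ile1 ?invr_ge0// invf_le1// ?ler1n//.
Qed.

Lemma cvg_L2_inner (f g : (T -> R)^nat) (F G : T -> R) :
  (forall k, L2 P (f k)) -> (forall k, L2 P (g k)) -> L2 P F -> L2 P G ->
  Ex P (fun x => (f k x - F x) ^+ 2) @[k --> \oo] --> 0 ->
  Ex P (fun x => (g k x - G x) ^+ 2) @[k --> \oo] --> 0 ->
  Ex P (fun x => f k x * g k x) @[k --> \oo] --> Ex P (fun x => F x * G x).
Proof.
move=> lf lg lF lG cf cg.
pose A k := Num.sqrt (Ex P (fun x => (f k x - F x) ^+ 2)).
pose B k := Num.sqrt (Ex P (fun x => (g k x - G x) ^+ 2)).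
pose a := Num.sqrt (Ex P (fun x => F x ^+ 2)).
pose b := Num.sqrt (Ex P (fun x => G x ^+ 2)).
have cA : A @ \oo --> 0 by exact: cvg_sqrt0.
have cB : B @ \oo --> 0 by exact: cvg_sqrt0.
have bnd k : `|Ex P (fun x => F x * G x) - Ex P (fun x => f k x * g k x)| <=
    A k * B k + A k * b + a * B k.
  have l1 := L2B (lf k) lF; have l2 := L2B (lg k) lG.
  have E : Ex P (fun x => f k x * g k x) - Ex P (fun x => F x * G x) =
     Ex P (fun x => (f k x - F x) * (g k x - G x)) + Ex P (fun x => (f k x - F x) * G x)
     + Ex P (fun x => F x * (g k x - G x)).
    rewrite -(ExB (L2_mul (lf k) (lg k)) (L2_mul lF lG)).
    rewrite -(ExD (L2_mul l1 l2) (L2_mul l1 lG)) -(ExD (L1D (L2_mul l1 l2) (L2_mul l1 lG)) (L2_mul lF l2)).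
    by apply: eq_Ex => x; ring.
  rewrite distrC E; apply: (le_trans (ler_normD _ _)); apply: lerD; last exact: Ex_normM_le.
  by apply: (le_trans (ler_normD _ _)); apply: lerD; exact: Ex_normM_le.
have cU : (fun k => A k * B k + A k * b + a * B k) @ \oo --> 0.
  apply: eq_cvg_seq (cvgD_seq (cvgD_seq (cvgM cA cB) (cvgM cA (cvg_cst b))) (@cvgZ_seq _ a _ _ cB)) => [k|] //.
  by rewrite !mul0r mulr0 !addr0.
apply/cvgrPdist_le => e e0.
move/cvgr_le : cU => /(_ _ e0); apply: filterS => k; exact: le_trans (bnd k).
Qed.
End L2_limits.

Lemma cvgB_seq (R : realType) (f g : R^nat) (l l' : R) :
  f @ \oo --> l -> g @ \oo --> l' -> (fun k => f k - g k) @ \oo --> l - l'.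
Proof. by move=> fl gl; exact: cvgB. Qed.

Lemma cvg_norm_seq (R : realType) (f : R^nat) (l : R) :
  f @ \oo --> l -> (fun k => `|f k|) @ \oo --> `|l|.
Proof. by move=> fl; exact: cvg_norm. Qed.

(** * Correlation of functionals of Hermite rank two *)

Section trig_polynomials.
Context {R : realType}.
Local Notation gam := (@nl R 1).

(** Each triple holds the coefficient of the cosine, that of the sine and the frequency. *)
Definition tpoly (s : seq (R * R * R)) (x : R) : R :=
  \sum_(c <- s) (c.1.1 * cos (c.2 * x) + c.1.2 * sin (c.2 * x)).

Definition trigpol : set (R -> R) := [set f | exists s, f = tpoly s].

Lemma trigpolD f g : trigpol f -> trigpol g -> trigpol (fun x => f x + g x).
Proof.
move=> [s ->] [s' ->]; exists (s ++ s'); apply/funext => x.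
by rewrite /tpoly big_cat.
Qed.

Lemma trigpolZ a f : trigpol f -> trigpol (fun x => a * f x).
Proof.
move=> [s ->]; exists [seq (a * c.1.1, a * c.1.2, c.2) | c <- s]; apply/funext => x.
by rewrite /tpoly big_map mulr_sumr; apply: eq_bigr => c _ /=; ring.
Qed.

Lemma trigpol_cos l : trigpol (fun x => cos (l * x)).
Proof. by exists [:: (1, 0, l)]; apply/funext => x; rewrite /tpoly big_seq1 /=; ring. Qed.

Lemma trigpol_sin l : trigpol (fun x => sin (l * x)).
Proof. by exists [:: (0, 1, l)]; apply/funext => x; rewrite /tpoly big_seq1 /=; ring. Qed.

Lemma trigpol_cst a : trigpol (fun=> a).
Proof.
have := trigpolZ a (trigpol_cos 0); congr trigpol.
by apply/funext => x; rewrite mul0r cos0 mulr1.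
Qed.

Lemma trigpol_sum I (s : seq I) (F : I -> R -> R) : (forall i, trigpol (F i)) ->
  trigpol (fun x => \sum_(i <- s) F i x).
Proof.
move=> tF; elim: s => [|i s IH].
  by have := trigpol_cst 0; congr trigpol; apply/funext => x; rewrite big_nil.
by have := trigpolD (tF i) IH; congr trigpol; apply/funext => x; rewrite big_cons.
Qed.

Lemma trigpolM_cos m f : trigpol f -> trigpol (fun x => cos (m * x) * f x).
Proof.
move=> [s ->].
have -> : (fun x => cos (m * x) * tpoly s x) = (fun x => \sum_(c <- s)
   ((c.1.1 / 2 * cos ((c.2 + m) * x) + c.1.1 / 2 * cos ((c.2 - m) * x))
   + (c.1.2 / 2 * sin ((c.2 + m) * x) + c.1.2 / 2 * sin ((c.2 - m) * x)))).
  apply/funext => x; rewrite /tpoly mulr_sumr; apply: eq_bigr => c _.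
  by rewrite !mulrDl !mulNr cosD cosB sinD sinB; field.
apply: trigpol_sum => c; apply: trigpolD; apply: trigpolD; apply: trigpolZ;
  by [exact: trigpol_cos|exact: trigpol_sin].
Qed.

Lemma trigpolM_sin m f : trigpol f -> trigpol (fun x => sin (m * x) * f x).
Proof.
move=> [s ->].
have -> : (fun x => sin (m * x) * tpoly s x) = (fun x => \sum_(c <- s)
   ((c.1.1 / 2 * sin ((c.2 + m) * x) + (- c.1.1 / 2) * sin ((c.2 - m) * x))
   + ((- c.1.2 / 2) * cos ((c.2 + m) * x) + c.1.2 / 2 * cos ((c.2 - m) * x)))).
  apply/funext => x; rewrite /tpoly mulr_sumr; apply: eq_bigr => c _.
  by rewrite !mulrDl !mulNr cosD cosB sinD sinB; field.
apply: trigpol_sum => c; apply: trigpolD; apply: trigpolD; apply: trigpolZ;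
  by [exact: trigpol_cos|exact: trigpol_sin].
Qed.

(** Bernstein polynomials evaluated at [1/2 + sin (c x + d) / 2] are sums of products of such
    factors, hence trigonometric polynomials. *)
Lemma trigpolM_affine u v m d f : trigpol f ->
  trigpol (fun x => (u + v * sin (m * x + d)) * f x).
Proof.
move=> tf.
have -> : (fun x => (u + v * sin (m * x + d)) * f x) = (fun x => u * f x +
   (v * cos d * (sin (m * x) * f x) + v * sin d * (cos (m * x) * f x))).
  by apply/funext => x; rewrite sinD; ring.
apply: trigpolD; first exact: trigpolZ.
by apply: trigpolD; apply: trigpolZ; [exact: trigpolM_sin|exact: trigpolM_cos].
Qed.

Lemma trigpolM_affineX u v m d k f : trigpol f ->
  trigpol (fun x => (u + v * sin (m * x + d)) ^+ k * f x).
Proof.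
move=> tf; elim: k => [|k IH].
  by move: tf; congr trigpol; apply/funext => x; rewrite expr0 mul1r.
have := trigpolM_affine u v m d IH; congr trigpol.
by apply/funext => x; rewrite exprS mulrA.
Qed.

Lemma measurable_trigpol f : trigpol f -> measurable_fun setT f.
Proof.
move=> [s ->]; apply: measurable_sum => c.
apply: measurable_funD; apply: measurable_funM; try exact: measurable_cst.
  by have := measurable_cos_affine (R := R) c.2 0; under eq_fun do rewrite addr0.
by have := measurable_sin_affine (R := R) c.2 0; under eq_fun do rewrite addr0.
Qed.

Lemma trigpol_bounded f : trigpol f -> exists M : R, forall x, `|f x| <= M.
Proof.
move=> [s ->]; exists (\sum_(c <- s) (`|c.1.1| + `|c.1.2|)) => x.
apply: (le_trans (ler_norm_sum _ _ _)); apply: ler_sum => c _.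
apply: (le_trans (ler_normD _ _)); rewrite !normrM.
apply: lerD; rewrite ler_piMr//.
  by rewrite ler_norml cos_geN1 cos_le1.
by rewrite ler_norml sin_geN1 sin_le1.
Qed.

Lemma L2_trigpol f : trigpol f -> L2 gam f.
Proof.
move=> tf; have [M bM] := trigpol_bounded tf.
exact: (@L2_bnd _ (measurableTypeR R) R gam f M (measurable_trigpol tf) bM).
Qed.

Definition clamp (y : R) : R := Num.min 1 (Num.max 0 y).

Lemma clamp_bnd y : 0 <= clamp y <= 1.
Proof. by rewrite /clamp ge_min lexx /= le_min ler01 /= le_max lexx. Qed.

Lemma clamp_lipschitz x y : `|clamp x - clamp y| <= `|x - y|.
Proof.
have C z : [\/ z <= 0 /\ clamp z = 0, 0 <= z <= 1 /\ clamp z = z | 1 <= z /\ clamp z = 1].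
  rewrite /clamp; have [z0|z0] := leP z 0.
    by apply: Or31; split=> //; rewrite min_r.
  have [z1|z1] := leP z 1; first by apply: Or32; split => //; rewrite (ltW z0).
  by apply: Or33; split=> //; exact: ltW.
have h1 := ler_norm (x - y); have h2 := ler_norm (- (x - y)); rewrite normrN in h2.
rewrite ler_norml; move: h1 h2; move: `|x - y| => w h1 h2.
by case: (C x) => -[xx ->]; case: (C y) => -[yy ->]; lra.
Qed.

Lemma sin_ge_half (x : R) : 0 <= x -> x <= 2^-1 -> x / 2 <= sin x.
Proof.
move=> x0 x1; have [->|xn0] := eqVneq x 0; first by rewrite sin0 mul0r.
have xp : 0 < x by rewrite lt_neqAle eq_sym xn0.
have [c] := @MVT R sin cos 0 x xp (fun x _ => is_derive_sin x)
  (continuous_subspaceT (@continuous_sin R)).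
rewrite in_itv /= sin0 !subr0 => /andP[c0 cx] ->.
have := @lipschitz_cos R c 0; rewrite cos0 subr0 (ger0_norm (ltW c0)) => /ler_normlP[h _].
by rewrite mulrC ler_wpM2r//; lra.
Qed.

(** With [u = x - a], the argument of [clamp] behaves like [(n + 1) u]: it ends up above 1 if
    [u > 0], below 0 if [u < 0], and stays 0 if [u = 0]. Step functions are thus limits of functions
    of a sine of small frequency. *)
Lemma ramp_cvg (a x : R) :
  clamp (n.+1%:R ^+ 2 * sin (n.+1%:R^-1 * x + - (n.+1%:R^-1 * a))) @[n --> \oo] -->
  ((a < x)%R%:R : R).
Proof.
pose u := x - a.
(* Beyond [K] the angle [|u| / (n + 1)] is at most [1/2], where [sin v >= v / 2], and, for [u <> 0],
   [(n + 1) |u| / 2 >= 1]. *)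
pose K := Num.truncn (2 * `|u| + 2 / `|u|).
have big n : (K <= n)%N -> 2 * `|u| <= n.+1%:R /\ 2 / `|u| <= n.+1%:R.
  move=> Kn.
  have h : 2 * `|u| + 2 / `|u| < n.+1%:R.
    by apply: lt_le_trans (truncnS_gt _) _; rewrite ler_nat.
  have h1 : 0 <= 2 * `|u| by rewrite mulr_ge0.
  have h2 : 0 <= 2 / `|u| by rewrite divr_ge0.
  by split; move: h h1 h2; move: (2 * _) (2 / _) => A B; lra.
have Es n : n.+1%:R^-1 * x + - (n.+1%:R^-1 * a) = n.+1%:R^-1 * u by rewrite /u; ring.
have pos (v : R) n : 0 < v -> v = `|u| -> (K <= n)%N ->
    0 <= n.+1%:R^-1 * v /\ 1 <= n.+1%:R ^+ 2 * sin (n.+1%:R^-1 * v).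
  move=> v0 vu Kn; have [b1 b2] := big n Kn; rewrite -vu in b1 b2.
  have n0 : (0 : R) < n.+1%:R by rewrite ltr0n.
  have m0 : 0 <= n.+1%:R^-1 * v by rewrite mulr_ge0 ?invr_ge0 ?ltW.
  split => //.
  have h : n.+1%:R^-1 * v <= 2^-1.
    by rewrite mulrC ler_pdivrMr// mulrC ler_pdivlMr// mulrC.
  apply: (@le_trans _ _ (n.+1%:R ^+ 2 * (n.+1%:R^-1 * v / 2))).
    rewrite (_ : _ * _ = n.+1%:R * (v / 2)); last by field; rewrite gt_eqF.
    move: b2; rewrite ler_pdivrMr// => b2; lra.
  by rewrite ler_wpM2l ?sqr_ge0// sin_ge_half.
apply: (@cvg_near_cst _ _ _ _).
exists K => // n /= Kn; rewrite Es.
have [ax|xa] := ltP a x.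
  have u0 : 0 < u by rewrite subr_gt0.
  have [_ h] := pos u n u0 (esym (gtr0_norm u0)) Kn.
  by rewrite /clamp /Num.max ifT ?(lt_le_trans ltr01 h)// min_l.
move: xa; rewrite le_eqVlt => /orP[/eqP xa|xa].
  by rewrite /u xa subrr mulr0 sin0 mulr0 /clamp /Num.max ltxx min_r.
have u0 : 0 < - u by rewrite oppr_gt0 subr_lt0.
have un : - u = `|u| by rewrite ltr0_norm// -oppr_gt0.
have [_] := pos (- u) n u0 un Kn; rewrite mulrN sinN mulrN => h.
by rewrite /clamp max_l ?min_r//; lra.
Qed.

(** The ramp is a continuous function of a sine, so a Bernstein polynomial in that sine approximates
    it uniformly on the whole line. *)
Lemma trigpol_ramp (a : R) (n : nat) : exists2 f, trigpol f &
  forall x, `|clamp (n.+1%:R ^+ 2 * sin (n.+1%:R^-1 * x + - (n.+1%:R^-1 * a))) - f x| <= n.+1%:R^-1.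
Proof.
pose N : R := n.+1%:R ^+ 2.
have N0 : 0 < N by rewrite exprn_gt0// ltr0n.
(* The sine is mapped to [[0, 1]] by [x = (1 + sin) / 2]. The two-variable approximation is used
   with a dummy second variable, later evaluated at 0. *)
pose h (x y : R) := clamp (N * (2 * x - 1)).
have hb x y : `|h x y| <= 1.
  by have /andP[c0 c1] := clamp_bnd (N * (2 * x - 1)); rewrite ger0_norm.
have hc x y e : 0 < e -> exists2 r, 0 < r & forall x' y', `|x - x'| < r -> `|y - y'| < r ->
    `|h x y - h x' y'| <= e.
  move=> e0; exists (e / (2 * N)); first by rewrite divr_gt0// mulr_gt0.
  move=> x' y' xx _; apply: (le_trans (clamp_lipschitz _ _)).
  rewrite (_ : _ - _ = 2 * N * (x - x')); last by ring.
  rewrite normrM gtr0_norm ?mulr_gt0// mulrC -ler_pdivlMr ?mulr_gt0//; exact: ltW.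
have n0 : (0 : R) < n.+1%:R^-1 by rewrite invr_gt0 ltr0n.
have [m hm] := bernstein2 hb hc n0.
pose c := n.+1%:R^-1 : R; pose d := - (c * a).
exists (fun x => \sum_(i < m.+2) \sum_(j < m.+2)
       h (i%:R / m.+1%:R) (j%:R / m.+1%:R) * bern m.+1 (2^-1 + 2^-1 * sin (c * x + d)) i * bern m.+1 0 j).
  apply: trigpol_sum => i; apply: trigpol_sum => j.
  pose k1 : R := h (i%:R / m.+1%:R) (j%:R / m.+1%:R) * bern m.+1 0 j * 'C(m.+1, i)%:R.
  have := trigpolM_affineX 2^-1 2^-1 c d i
    (trigpolM_affineX 2^-1 (- 2^-1) c d (m.+1 - i) (trigpol_cst k1)); congr trigpol.
  apply/funext => x; rewrite /k1 /bern.
  rewrite (_ : 1 - (2^-1 + 2^-1 * sin (c * x + d)) = 2^-1 + - 2^-1 * sin (c * x + d)); last by field.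
  by ring.
move=> x; pose y := 2^-1 + 2^-1 * sin (c * x + d).
have y01 : 0 <= y <= 1.
  have := @sin_geN1 R (c * x + d); have := @sin_le1 R (c * x + d).
  by rewrite /y; move: (sin _) => v; lra.
have := hm y 0 y01; rewrite lexx ler01 => /(_ isT).
rewrite {1}/h (_ : N * (2 * y - 1) = N * sin (c * x + d))//.
by rewrite /y; field.
Qed.
End trig_polynomials.

(** * Density of trigonometric polynomials in L2 of the Gaussian law *)

Section trig_density.
Import HBNNSimple.
Context {R : realType}.
Local Notation gam := (@nl R 1).
Local Notation leb := (@lebesgue_measure R).

Let V : set (R -> R) := @L2_closure _ (measurableTypeR R) R gam trigpol.

Lemma trig_cl_trigpol f : trigpol f -> V f.
Proof.
move=> tf; split; first exact: L2_trigpol.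
move=> e e0; exists f => //.
rewrite (@eq_Ex _ _ _ gam _ (fun=> 0)) ?Ex0 ?ltW// => x.
by rewrite subrr expr0n.
Qed.

Lemma trig_clD f g : V f -> V g -> V (fun x => f x + g x).
Proof.
move=> [lf cf] [lg cg]; split; first exact: L2D.
move=> e e0; have e4 : 0 < e / 4 by rewrite divr_gt0.
have [f' tf hf] := cf _ e4; have [g' tg hg] := cg _ e4.
exists (fun x => f' x + g' x); first exact: trigpolD.
have lf' := L2_trigpol tf; have lg' := L2_trigpol tg.
have := minkowski2 (L2B lf lf') (L2B lg lg').
rewrite (@eq_Ex _ _ _ gam _ (fun x => (f x + g x - (f' x + g' x)) ^+ 2)); last by move=> x; ring.
by move: hf hg; move: (Ex _ _) (Ex _ _) (Ex _ _) => A B C; lra.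
Qed.

Lemma trig_clZ a f : V f -> V (fun x => a * f x).
Proof.
move=> [lf cf]; split; first exact: L2Z.
move=> e e0; have e4 : 0 < e / (a ^+ 2 + 1) by rewrite divr_gt0// ltr_wpDl// sqr_ge0.
have [f' tf hf] := cf _ e4.
exists (fun x => a * f' x); first exact: trigpolZ.
have lB := (L2B lf (L2_trigpol tf)).2.
rewrite (@eq_Ex _ _ _ gam _ (fun x => a ^+ 2 * (f x - f' x) ^+ 2)); last by move=> x; ring.
rewrite ExZ//; apply: (@le_trans _ _ (a ^+ 2 * (e / (a ^+ 2 + 1)))).
  by rewrite ler_wpM2l// sqr_ge0.
by rewrite mulrCA ler_piMr ?(ltW e0)// ler_pdivrMr ?mul1r ?lerDl// ltr_wpDl// sqr_ge0.
Qed.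

Lemma trig_cl_closed f : L2 gam f ->
  (forall e, 0 < e -> exists2 g, V g & Ex gam (fun x => (f x - g x) ^+ 2) <= e) -> V f.
Proof.
move=> lf cf; split => // e e0; have e4 : 0 < e / 4 by rewrite divr_gt0.
have [g [lg cg] hg] := cf _ e4; have [h th hh] := cg _ e4.
exists h => //.
have := minkowski2 (L2B lf lg) (L2B lg (L2_trigpol th)).
rewrite (@eq_Ex _ _ _ gam _ (fun x => (f x - h x) ^+ 2)); last by move=> x; ring.
by move: hg hh; move: (Ex _ _) (Ex _ _) (Ex _ _) => A B C; lra.
Qed.

Lemma trig_cl_cvg (f : R -> R) (g : (R -> R)^nat) (h : R -> R) : measurable_fun setT f ->
  L1 gam h -> (forall n, V (g n)) ->
  (forall x, g n x @[n --> \oo] --> f x) -> (forall n x, (f x - g n x) ^+ 2 <= h x) ->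
  L2 gam f -> V f.
Proof.
move=> mf lh vg cg bg lf; apply: trig_cl_closed => // e e0.
have mg n : measurable_fun setT (fun x : measurableTypeR R => (f x - g n x) ^+ 2).
  by apply: measurable_funX; apply: measurable_funB => //; exact: (vg n).1.1.
have := @Ex_dom _ (measurableTypeR R) R gam (fun n x => (f x - g n x) ^+ 2) (fun=> 0) h mg.
move=> /(_ (measurable_cst (0 : R))).
case=> //.
- apply: aeW => x.
  have c : (fun n => f x - g n x) @ \oo --> 0.
    by rewrite -(subrr (f x)); apply: cvgB; [exact: cvg_cst|exact: cg].
  by apply: eq_cvg_seq (cvgM c c) => [k|]; rewrite ?mulr0// expr2.
- by move=> n; apply: aeW => x; rewrite ger0_norm ?sqr_ge0.
move=> _; rewrite Ex0 => /cvgr_le /(_ _ e0)[N _ /(_ N (leqnn N)) H].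
by exists (g N).
Qed.

Lemma L2_indic (A : set R) : measurable A -> L2 gam (\1_A).
Proof.
move=> mA; apply: (@L2_bnd _ (measurableTypeR R) R gam _ 1); first exact: measurable_indic.
by move=> x; rewrite indicE; case: (_ \in _); rewrite ?normr1// normr0.
Qed.

Lemma trig_cl_ray (a : R) : V (\1_(`]a, +oo[%classic : set R)).
Proof.
have ex n : exists f, trigpol f /\
  forall x, `|clamp (n.+1%:R ^+ 2 * sin (n.+1%:R^-1 * x + - (n.+1%:R^-1 * a))) - f x| <= n.+1%:R^-1.
  by have [f tf hf] := trigpol_ramp a n; exists f.
have [F hF] := choice ex.
have E x : \1_(`]a, +oo[%classic : set R) x = ((a < x)%R%:R : R).
  by rewrite indicE mem_setE in_itv /= andbT.
(* Each [F n] stays within 1 of a number in [[0, 1]], so its distance to the indicator is below 3;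
   the constant 9 is a crude bound on the square. *)
apply: (@trig_cl_cvg _ F (fun=> 9)) => //.
- exact: (@L1_cst _ (measurableTypeR R) R gam 9).
- by move=> n; apply: trig_cl_trigpol; exact: (hF n).1.
- move=> x; rewrite E.
  have c1 := @ramp_cvg R a x.
  apply/cvgrPdist_le => e e0; have e2 : 0 < e / 2 by rewrite divr_gt0.
  have := @cvg_harmonic R; move=> /cvgr_le /(_ _ e2) h1.
  move: c1 => /cvgrPdist_le /(_ _ e2) h2.
  near=> n.
  have := (hF n).2 x.
  have H1 : n.+1%:R^-1 <= e / 2 by near: n.
  have H2 : `|(a < x)%R%:R - clamp (n.+1%:R ^+ 2 * sin (n.+1%:R^-1 * x + - (n.+1%:R^-1 * a)))| <= e / 2.
    by near: n.
  move=> H3; rewrite [e]splitr.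
  by apply: le_trans (ler_distD (clamp (n.+1%:R ^+ 2 * sin (n.+1%:R^-1 * x + - (n.+1%:R^-1 * a)))) _ _) _; apply: lerD => //; exact: le_trans H1.
- move=> n x; rewrite E.
  have := (hF n).2 x; have := clamp_bnd (n.+1%:R ^+ 2 * sin (n.+1%:R^-1 * x + - (n.+1%:R^-1 * a))).
  move: (clamp _) => c /andP[c0 c1].
  have n1 : n.+1%:R^-1 <= 1 :> R by rewrite invf_le1 ?ler1n ?ltr0n.
  move=> /le_trans /(_ n1) /ler_normlP[h1 h2].
  have : 0 <= ((a < x)%R%:R : R) <= 1 by case: (a < x); rewrite ?lexx ?ler01.
  move: (_ %:R) (F n x) h1 h2 => b y h1 h2 /andP[b0 b1].
  by rewrite (_ : 9 = 3 ^+ 2); [rewrite -(real_normK (num_real (b - y))) lerXn2r ?nnegrE// ler_norml; lra|ring].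
- exact: L2_indic.
Unshelve. all: by end_near.
Qed.

(** Dynkin's argument: open rays are stable under intersection and generate the Borel sets, while
    the sets with indicator in the closure are stable under complements and countable disjoint
    unions. *)
Lemma trig_cl_indic (A : set R) : measurable A -> V (\1_A).
Proof.
move=> mA.
have mE : @measurable _ (measurableTypeR R) = <<s @RGenOInfty.G R >> := RGenOInfty.measurableE R.
suff H : forall S, <<s @RGenOInfty.G R >> S -> V (\1_S) by apply: H; rewrite -mE.
apply: (@dynkin_induction _ (measurableTypeR R) (@RGenOInfty.G R) (fun S => V (\1_S)) mE).
- move=> _ _ [a ->] [b ->]; exists (Num.max a b).
  by apply/seteqP; split => x /=; rewrite !in_itv /= !andbT gt_max => /andP.
- have := trig_cl_trigpol (trigpol_cst 1); congr V.
  by apply/funext => x; rewrite indicE in_setT.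
- by move=> _ [a ->]; exact: trig_cl_ray.
- move=> S mS VS.
  have := trig_clD (trig_cl_trigpol (trigpol_cst 1)) (trig_clZ (-1) VS); congr V.
  by apply/funext => x; rewrite !indicE in_setC; case: (x \in S) => /=; ring.
- move=> F mF tF VF.
  have mU : measurable (\bigcup_k F k) by exact: bigcup_measurable.
  pose g n x := \sum_(k < n) \1_(F k) x : R.
  have gE n x : g n x = \1_(\bigcup_(k < n) F k) x.
    rewrite /g indicE; have [/set_mem[k /= kn Fkx]|nx] := boolP (x \in _).
      rewrite (bigD1 (Ordinal kn))//= indicE mem_set// big1 ?addr0// => j jk.
      rewrite indicE memNset// => Fj; move/negP: jk; apply.
      by apply/eqP/val_inj => /=; apply: (tF j k) => //; exists x.
    rewrite big1// => j _; rewrite indicE memNset// => Fj.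
    by move/negP: nx; apply; apply/mem_set; exists j => //=.
  apply: (@trig_cl_cvg _ g (fun=> 1)) => //.
  + exact: (@L1_cst _ (measurableTypeR R) R gam 1).
  + move=> n; rewrite /g; elim: n => [|n IH].
      have := trig_cl_trigpol (trigpol_cst 0); congr V; apply/funext => x; by rewrite big_ord0.
    have := trig_clD IH (VF n); congr V; apply/funext => x; by rewrite big_ord_recr.
  + move=> x; apply: cvg_near_cst; have [[k _ Fk]|nx] := pselect ((\bigcup_k F k) x).
      exists k.+1 => // n /= kn; rewrite gE !indicE mem_set; last by exists k.
      by rewrite mem_set//; exists k.
    exists 0%N => // n _; rewrite gE !indicE !memNset// => -[k _ Fk].
    by apply: nx; exists k.
  + move=> n x; rewrite gE !indicE.
    by do 2! case: (_ \in _); rewrite ?subrr ?subr0 ?sub0r ?sqrrN ?expr1n ?expr0n /= ?ler01 ?lexx.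
  + exact: L2_indic.
Qed.

Lemma trig_cl_ge0 (f : R -> R) : (forall x, 0 <= f x) -> L2 gam f -> V f.
Proof.
move=> f0 lf; have mf : measurable_fun setT (EFin \o f : measurableTypeR R -> \bar R).
  by apply/measurable_EFinP; exact: lf.1.
have fE0 : forall x : measurableTypeR R, setT x -> (0 <= (EFin \o f) x)%E.
  by move=> x _; rewrite lee_fin.
pose G n := nnsfun_approx measurableT mf n.
pose g (n : nat) (x : measurableTypeR R) : R := G n x.
have gcvg (x : R) : g n x @[n --> \oo] --> f x.
  by have /fine_cvgP[_] := cvg_nnsfun_approx measurableT mf fE0 (x := x) Logic.I.
have gle (n : nat) (x : R) : g n x <= f x.
  rewrite -(cvg_lim _ (gcvg x))//.
  apply: (@nondecreasing_cvgn_le R (fun n => g n x)); last by apply/cvg_ex; exists (f x); exact: gcvg.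
  by move=> m k mk; have /lefP := nd_nnsfun_approx measurableT mf mk; apply.
apply: (@trig_cl_cvg _ (fun n => g n) (fun x => f x ^+ 2)) => //; [exact: lf.1|exact: lf.2| |].
- move=> n.
  have -> : (g n : R -> R) = (fun x => \sum_(y <- finmap.enum_fset (fset_set (range (G n)))) y * \1_(G n @^-1` [set y]) x).
    by apply/funext => x; rewrite /g fimfunE fsbig_finite.
  elim: (finmap.enum_fset _) => [|y s IH].
    have := trig_cl_trigpol (trigpol_cst 0); congr V; apply/funext => x; by rewrite big_nil.
  have mp : measurable (G n @^-1` [set y]) by exact: measurable_sfunP.
  have := trig_clD (trig_clZ y (trig_cl_indic mp)) IH; congr V.
  by apply/funext => x; rewrite big_cons.
- move=> n x; rewrite lerXn2r ?nnegrE ?subr_ge0// lerBlDr lerDl.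
  by rewrite /g; apply: fun_ge0.
Qed.

Lemma trig_dense (f : R -> R) : L2 gam f -> V f.
Proof.
move=> lf.
have mfp : measurable_fun setT (fun x : measurableTypeR R => Num.max (f x) 0).
  by apply: measurable_maxr; [exact: lf.1|exact: measurable_cst].
have mfn : measurable_fun setT (fun x : measurableTypeR R => Num.max (- f x) 0).
  by apply: measurable_maxr; [apply: measurable_funN; exact: lf.1|exact: measurable_cst].
have n1 (y : R) : `|Num.max y 0| <= `|y|.
  by rewrite /Num.max; case: ifP => // _; rewrite normr0.
have lp := @L2_le _ (measurableTypeR R) R gam (fun x => Num.max (f x) 0) f mfp (fun x => n1 (f x)) lf.
have ln := @L2_le _ (measurableTypeR R) R gam (fun x => Num.max (- f x) 0) (fun x => - f x) mfn
   (fun x => n1 (- f x)) (L2N lf).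
have vp : V (fun x => Num.max (f x) 0) by apply: trig_cl_ge0 => // x; rewrite le_max lexx orbT.
have vn : V (fun x => Num.max (- f x) 0) by apply: trig_cl_ge0 => // x; rewrite le_max lexx orbT.
have := trig_clD vp (trig_clZ (-1) vn); congr V; apply/funext => x.
by rewrite /Num.max oppr_lt0; case: (ltgtP (f x) 0) => h; lra.
Qed.
End trig_density.

(** * Two-point correlations of trigonometric polynomials as power series *)

Section two_point_bound.
Context {R : realType}.
Local Notation gam := (@nl R 1).
Implicit Types (s : seq (R * R * R)) (c : R * R * R).

(** The factor [exp (- l ^ 2 / 2)] is the Gaussian mean of [cos (l x)]; it turns the coefficients of
    a trigonometric polynomial into those of its correlations. *)
Let al c := c.1.1 * expR (- (c.2 ^+ 2 / 2)).
Let be c := c.1.2 * expR (- (c.2 ^+ 2 / 2)).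

(** Correlation of [tpoly s] at two standard normal variables with correlation [r], as
    [Ex_tpoly_pair] shows. *)
Definition pair_corr s (r : R) := \sum_(c <- s) \sum_(c' <- s)
  ((al c * al c' + be c * be c') / 2 * expR (r * (c.2 * c'.2)) +
   (al c * al c' - be c * be c') / 2 * expR (- (r * (c.2 * c'.2)))).

(** Square of the [k]-th Hermite coefficient of [tpoly s]: even orders see only the cosines, odd
    orders only the sines. Expanding [pair_corr] in powers of [r] with these coefficients is
    Mehler's formula. *)
Definition pair_coef s (k : nat) :=
  (\sum_(c <- s) (if odd k then be c else al c) * c.2 ^+ k) ^+ 2.

Let part s (r : R) (n : nat) := \sum_(k < n) r ^+ k / k`!%:R * pair_coef s k.

Let part_cvg s r : part s r @ \oo --> pair_corr s r.
Proof.
have E n : part s r n = \sum_(c <- s) \sum_(c' <- s)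
  ((al c * al c' + be c * be c') / 2 * series (exp_coeff (r * (c.2 * c'.2))) n +
   (al c * al c' - be c * be c') / 2 * series (exp_coeff (- (r * (c.2 * c'.2)))) n).
  transitivity (\sum_(k < n) \sum_(c <- s) \sum_(c' <- s)
     ((al c * al c' + be c * be c') / 2 * exp_coeff (r * (c.2 * c'.2)) k +
      (al c * al c' - be c * be c') / 2 * exp_coeff (- (r * (c.2 * c'.2))) k)).
    apply: eq_bigr => k _; rewrite /pair_coef expr2 mulr_suml mulr_sumr.
    apply: eq_bigr => c _; rewrite mulr_sumr mulr_sumr; apply: eq_bigr => c' _.
    rewrite /exp_coeff /= exprNn !exprMn -signr_odd; case: (odd k); rewrite ?expr1 ?expr0 /=;
      set f := (k`!%:R : R)^-1; set x := c.2 ^+ k; set y := c'.2 ^+ k; set z := r ^+ k; by field.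
  rewrite exchange_big; apply: eq_bigr => c _; rewrite exchange_big; apply: eq_bigr => c' _.
  by rewrite big_split /= -!mulr_sumr /series /= !big_mkord.
apply: (eq_cvg_seq E erefl).
have cs I (q : seq I) (u : I -> R^nat) (l : I -> R) : (forall i, u i @ \oo --> l i) ->
    (fun n => \sum_(i <- q) u i n) @ \oo --> \sum_(i <- q) l i.
  move=> ul; elim: q => [|i q IH].
    by under eq_fun do rewrite big_nil; rewrite big_nil; exact: cvg_cst.
  by under eq_fun do rewrite big_cons; rewrite big_cons; exact: cvgD_seq.
have ce (x : R) : series (exp_coeff x) @ \oo --> expR x by exact: is_cvg_series_exp_coeff.
apply: (cs _ s (fun c n => \sum_(c' <- s) _)) => c.
apply: (cs _ s (fun c' n => _ + _)) => c'.
by apply: cvgD_seq; apply: cvgZ_seq.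
Qed.

Let coef_ge0 s k : 0 <= pair_coef s k. Proof. exact: sqr_ge0. Qed.

(** The coefficients of the expansion are nonnegative. Beyond the first two terms
    [|r ^ k| <= r ^ 2], and the remaining sum is at most the value of the series at [r = 1]. The
    inequality is proved for partial sums and passed to the limit. *)
Lemma pair_corr_bound s r : `|r| <= 1 ->
  `|pair_corr s r - pair_coef s 0 - r * pair_coef s 1| <= r ^+ 2 * pair_corr s 1.
Proof.
move=> r1; rewrite -subr_ge0.
have c1 : (fun n => r ^+ 2 * part s 1 n - `|part s r n - pair_coef s 0 - r * pair_coef s 1|) @ \oo -->
   r ^+ 2 * pair_corr s 1 - `|pair_corr s r - pair_coef s 0 - r * pair_coef s 1|.
  have cA := @cvgZ_seq _ (r ^+ 2) _ _ (@part_cvg s 1).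
  have cB := cvgB_seq (cvgB_seq (@part_cvg s r) (cvg_cst (pair_coef s 0))) (cvg_cst (r * pair_coef s 1)).
  exact: (cvgB_seq cA (cvg_norm_seq (cB _ _))).
rewrite -(cvg_lim _ c1)//; apply: limr_ge; first by apply/cvg_ex; eexists; exact: c1.
exists 2%N => // n /= n2; rewrite subr_ge0.
case: n n2 => [|[|n]]// _.
have part2 x : part s x n.+2 = pair_coef s 0 + (x * pair_coef s 1 +
    \sum_(i < n) x ^+ (1 + (1 + i)) / (1 + (1 + i))`!%:R * pair_coef s (1 + (1 + i))).
  rewrite /part big_ord_recl big_ord_recl; congr (_ + (_ + _)).
    by rewrite /= expr0 fact0 invr1 !mul1r.
  by rewrite /= /bump /= addn0 expr1 (_ : 1`! = 1%N)// invr1 mulr1.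
rewrite !part2 [pair_coef s 0 + _ - _]addrC addKr [r * _ + _ - _]addrC addKr.
apply: (le_trans (ler_norm_sum _ _ _)).
apply: (@le_trans _ _ (r ^+ 2 * \sum_(i < n)
   1 ^+ (1 + (1 + i)) / (1 + (1 + i))`!%:R * pair_coef s (1 + (1 + i)))); last first.
  by apply: ler_wpM2l; rewrite ?sqr_ge0// mul1r addrA lerDr addr_ge0.
rewrite mulr_sumr; apply: ler_sum => i _.
have := coef_ge0 s (1 + (1 + i)); move: (pair_coef _ _) => w w0.
rewrite normrM (ger0_norm w0) mulrA ler_wpM2r// expr1n mul1r.
rewrite normrM normfV normr_nat normrX ler_wpM2r ?invr_ge0//.
rewrite -[in leRHS](real_normK (num_real r)) addnA exprD /= -[leRHS]mulr1 ler_wpM2l ?sqr_ge0//.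
by rewrite exprn_ile1.
Qed.

Section law.
Context d (T : measurableType d) (P : probability T R) (X Y : T -> R) (rho : R).
Hypotheses (mX : measurable_fun setT X) (mY : measurable_fun setT Y).
Hypothesis hcos : forall a b, Ex P (fun w => cos (a * X w + b * Y w)) =
  expR (- ((a ^+ 2 + b ^+ 2 + 2 * rho * a * b) / 2)).
Hypothesis hsin : forall a b, Ex P (fun w => sin (a * X w + b * Y w)) = 0.

Let L1c a b : L1 P (fun w => cos (a * X w + b * Y w)).
Proof.
apply: (@L1_bnd _ _ _ P _ 1) => [|w]; last by rewrite ler_norml cos_geN1 cos_le1.
apply: (measurableT_comp (@measurable_cosR R)).
by apply: measurable_funD; apply: measurable_funM.
Qed.

Let L1s a b : L1 P (fun w => sin (a * X w + b * Y w)).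
Proof.
apply: (@L1_bnd _ _ _ P _ 1) => [|w]; last by rewrite ler_norml sin_geN1 sin_le1.
apply: (measurableT_comp (@measurable_sinR R)).
by apply: measurable_funD; apply: measurable_funM.
Qed.

Let pairE c c' w : (c.1.1 * cos (c.2 * X w) + c.1.2 * sin (c.2 * X w)) *
   (c'.1.1 * cos (c'.2 * Y w) + c'.1.2 * sin (c'.2 * Y w)) =
  ((c.1.1 * c'.1.1 - c.1.2 * c'.1.2) / 2 * cos (c.2 * X w + c'.2 * Y w) +
   (c.1.1 * c'.1.1 + c.1.2 * c'.1.2) / 2 * cos (c.2 * X w + (- c'.2) * Y w)) +
  ((c.1.1 * c'.1.2 + c.1.2 * c'.1.1) / 2 * sin (c.2 * X w + c'.2 * Y w) +
   (c.1.2 * c'.1.1 - c.1.1 * c'.1.2) / 2 * sin (c.2 * X w + (- c'.2) * Y w)).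
Proof. by rewrite !mulNr cosD cosB sinD sinB; field. Qed.

Lemma Ex_tpoly_pair s : Ex P (fun w => tpoly s (X w) * tpoly s (Y w)) = pair_corr s rho.
Proof.
have L c c' : L1 P (fun w => (c.1.1 * cos (c.2 * X w) + c.1.2 * sin (c.2 * X w)) *
   (c'.1.1 * cos (c'.2 * Y w) + c'.1.2 * sin (c'.2 * Y w))).
  by rewrite (funext (pairE c c')); apply: L1D; apply: L1D; apply: L1Z.
rewrite (@eq_Ex _ _ _ P _ (fun w => \sum_(c <- s) \sum_(c' <- s)
   (c.1.1 * cos (c.2 * X w) + c.1.2 * sin (c.2 * X w)) *
   (c'.1.1 * cos (c'.2 * Y w) + c'.1.2 * sin (c'.2 * Y w)))); last first.
  by move=> w; rewrite /tpoly mulr_suml; apply: eq_bigr => c _; rewrite mulr_sumr.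
rewrite Ex_sum; last by move=> c; exact: L1_sum.
apply: eq_bigr => c _; rewrite Ex_sum//; apply: eq_bigr => c' _.
rewrite (eq_Ex P (pairE c c')).
rewrite ExD; [|by apply: L1D; apply: L1Z|by apply: L1D; apply: L1Z].
rewrite ExD ?ExD; try by apply: L1Z.
rewrite !ExZ// !hcos !hsin !mulr0 !addr0 addrC /al /be.
have e1 : expR (- ((c.2 ^+ 2 + c'.2 ^+ 2 + 2 * rho * c.2 * c'.2) / 2)) =
    expR (- (c.2 ^+ 2 / 2)) * expR (- (c'.2 ^+ 2 / 2)) * expR (- (rho * (c.2 * c'.2))).
  by rewrite -!expRD; congr expR; field.
have e2 : expR (- ((c.2 ^+ 2 + (- c'.2) ^+ 2 + 2 * rho * c.2 * (- c'.2)) / 2)) =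
    expR (- (c.2 ^+ 2 / 2)) * expR (- (c'.2 ^+ 2 / 2)) * expR (rho * (c.2 * c'.2)).
  by rewrite -!expRD; congr expR; field.
by rewrite e1 e2; field.
Qed.
End law.

Let cosE (a b : R) : Ex gam (fun x => cos (a * x + b * x)) = expR (- ((a ^+ 2 + b ^+ 2 + 2 * 1 * a * b) / 2)).
Proof.
have m : measurable_fun setT (fun x : R => cos (a * x + b * x)).
  by have := measurable_cos_affine (a + b) 0; congr measurable_fun; apply/funext => x; congr cos; ring.
have [_ ->] := nl_Ex 1 m.
transitivity (Ex lebesgue_measure (fun x => cos ((a + b) * x + 0) * npdf 1 x)).
  by apply: eq_Ex => x; rewrite mulrC; congr (cos _ * _); ring.
by rewrite Ex_cos_npdf ?oner_neq0// cos0 mul1r; congr expR; field.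
Qed.

Let sinE (a b : R) : Ex gam (fun x => sin (a * x + b * x)) = 0.
Proof.
have m : measurable_fun setT (fun x : R => sin (a * x + b * x)).
  by have := measurable_sin_affine (a + b) 0; congr measurable_fun; apply/funext => x; congr sin; ring.
have [_ ->] := nl_Ex 1 m.
transitivity (Ex lebesgue_measure (fun x => sin ((a + b) * x) * npdf 1 x)).
  by apply: eq_Ex => x; rewrite mulrC; congr (sin _ * _); ring.
by rewrite Ex_sin_npdf ?oner_neq0.
Qed.

Lemma Ex_tpoly_sqr s : Ex gam (fun x => tpoly s x ^+ 2) = pair_corr s 1.
Proof.
have mid : measurable_fun setT (@id (measurableTypeR R)) by exact: measurable_id.
rewrite -(@Ex_tpoly_pair _ (measurableTypeR R) gam id id 1 mid mid cosE sinE s).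
by apply: eq_Ex => x; rewrite expr2.
Qed.

Lemma Ex_tpoly s : (Ex gam (tpoly s)) ^+ 2 = pair_coef s 0.
Proof.
rewrite /pair_coef /=; congr (_ ^+ 2).
have mc (l : R) : L1 gam (fun x => cos (l * x)) by apply: L2_L1; apply: L2_trigpol; exact: trigpol_cos.
have ms (l : R) : L1 gam (fun x => sin (l * x)) by apply: L2_L1; apply: L2_trigpol; exact: trigpol_sin.
rewrite /tpoly Ex_sum; last by move=> c; apply: L1D; exact: L1Z.
apply: eq_bigr => c _; rewrite expr0 mulr1 ExD; [|exact: L1Z|exact: L1Z].
rewrite !ExZ//.
have -> : Ex gam (fun x => cos (c.2 * x)) = expR (- (c.2 ^+ 2 / 2)).
  have := cosE c.2 0; rewrite expr0n /= mulr0 !addr0 => <-; apply: eq_Ex => x.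
  by rewrite mul0r addr0.
have -> : Ex gam (fun x => sin (c.2 * x)) = 0.
  by have := sinE c.2 0 => <-; apply: eq_Ex => x; rewrite mul0r addr0.
by rewrite mulr0 addr0.
Qed.

Lemma L2_id_gam : L2 gam id.
Proof. by split => //; have [] := @nl_sqr R 1 ltr01. Qed.

(** By integration by parts only the sines contribute: the Gaussian mean of [x sin (l x)] is
    [l exp (- l ^ 2 / 2)]. *)
Lemma Ex_id_tpoly s : (Ex gam (fun x => x * tpoly s x)) ^+ 2 = pair_coef s 1.
Proof.
rewrite /pair_coef /=; congr (_ ^+ 2).
have mc (l : R) : L1 gam (fun x => x * cos (l * x)).
  by apply: (L2_mul L2_id_gam); apply: L2_trigpol; exact: trigpol_cos.
have ms (l : R) : L1 gam (fun x => x * sin (l * x)).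
  by apply: (L2_mul L2_id_gam); apply: L2_trigpol; exact: trigpol_sin.
rewrite (@eq_Ex _ _ _ gam _ (fun x => \sum_(c <- s) (c.1.1 * (x * cos (c.2 * x)) + c.1.2 * (x * sin (c.2 * x))))); last first.
  by move=> x; rewrite /tpoly mulr_sumr; apply: eq_bigr => c _; ring.
rewrite Ex_sum; last by move=> c; apply: L1D; exact: L1Z.
apply: eq_bigr => c _; rewrite expr1 ExD; [|exact: L1Z|exact: L1Z].
rewrite !ExZ//.
have [_ ->] := nl_Ex 1 (L1_meas (mc c.2)); have [_ ->] := nl_Ex 1 (L1_meas (ms c.2)).
have n1 : (1 : R) != 0 by exact: oner_neq0.
have -> : Ex lebesgue_measure (fun u => npdf 1 u * (u * cos (c.2 * u))) = 0.
  have := @Ex_id_sin_npdf R 1 c.2 (pi / 2) n1.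
  rewrite Ex_cos_npdf// cos_pihalf mul0r mulr0 => <-; apply: eq_Ex => u.
  by rewrite sinDpihalf mulrC.
have -> : Ex lebesgue_measure (fun u => npdf 1 u * (u * sin (c.2 * u))) = c.2 * expR (- (c.2 ^+ 2 / 2)).
  have := @Ex_id_sin_npdf R 1 c.2 0 n1.
  rewrite Ex_cos_npdf// cos0 expr1n !mulr1 mul1r => <-; apply: eq_Ex => u.
  by rewrite addr0 mulrC.
by rewrite mulr0 add0r /be mulrA mulrAC.
Qed.
End two_point_bound.

Section rank_two_bound.
Context {R : realType}.
Local Notation gam := (@nl R 1).
Context d (T : measurableType d) (P : probability T R) (X Y : T -> R) (rho : R).
Hypotheses (mX : measurable_fun setT X) (mY : measurable_fun setT Y).
Hypothesis lawX : forall A, measurable A -> gam A = P (X @^-1` A).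
Hypothesis lawY : forall A, measurable A -> gam A = P (Y @^-1` A).
Hypothesis rho1 : `|rho| <= 1.
Hypothesis hcos : forall a b, Ex P (fun w => cos (a * X w + b * Y w)) =
  expR (- ((a ^+ 2 + b ^+ 2 + 2 * rho * a * b) / 2)).
Hypothesis hsin : forall a b, Ex P (fun w => sin (a * X w + b * Y w)) = 0.

Lemma L2_law (Z : T -> R) (F : R -> R) : measurable_fun setT Z ->
  (forall A, measurable A -> gam A = P (Z @^-1` A)) -> L2 gam F ->
  L2 P (fun w => F (Z w)) /\ Ex P (fun w => F (Z w) ^+ 2) = Ex gam (fun x => F x ^+ 2).
Proof.
move=> mZ lZ [mF lF].
have mF2 : measurable_fun setT (fun x : measurableTypeR R => F x ^+ 2) by exact: measurable_funX.
have i := @L1_image _ _ T (measurableTypeR R) R P gam Z mZ lZ _ mF2.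
have e := @Ex_image _ _ T (measurableTypeR R) R P gam Z mZ lZ _ mF2.
split; last by rewrite e.
by split; [exact: (measurableT_comp mF mZ)|apply/i].
Qed.

(** For trigonometric polynomials [pair_corr_bound] gives the inequality up to the terms of order 0
    and 1. Along an L2 approximation of [F] these tend to the squares of its mean and first Hermite
    coefficient, which are 0. *)
Theorem rank_two_correlation (F : R -> R) : L2 gam F -> Ex gam F = 0 ->
  Ex gam (fun x => x * F x) = 0 ->
  L1 P (fun w => F (X w) * F (Y w)) /\
  `|Ex P (fun w => F (X w) * F (Y w))| <= rho ^+ 2 * Ex gam (fun x => F x ^+ 2).
Proof.
move=> lF F0 F1.
have [lFX _] := L2_law mX lawX lF; have [lFY _] := L2_law mY lawY lF.
split; first exact: L2_mul.
have [_ dF] := trig_dense lF.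
have ex (k : nat) : exists s, Ex gam (fun x => (F x - tpoly s x) ^+ 2) <= k.+1%:R^-1.
  have k0 : (0 : R) < k.+1%:R^-1 by rewrite invr_gt0 ltr0n.
  by have [_ [s ->] h] := dF _ k0; exists s.
have [s hs] := choice ex.
have lt k : L2 gam (tpoly (s k)) by apply: L2_trigpol; exists (s k).
have c0 : Ex gam (fun x => (tpoly (s k) x - F x) ^+ 2) @[k --> \oo] --> 0.
  apply: (@cvg0_le _ _ (fun k => k.+1%:R^-1)); last exact: cvg_harmonic.
    by move=> k; apply: Ex_ge0 => x; exact: sqr_ge0.
  move=> k; apply: le_trans (hs k); rewrite le_eqVlt; apply/orP; left; apply/eqP.
  by apply: eq_Ex => x; rewrite -sqrrN opprB.
have cz (H : R -> R) : L2 gam H ->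
    Ex gam (fun x => H x * tpoly (s k) x) @[k --> \oo] --> Ex gam (fun x => H x * F x).
  move=> lH; apply: cvg_L2_inner => //.
  apply: eq_cvg_seq (cvg_cst 0) => // k.
  by rewrite (@eq_Ex _ _ _ gam _ (fun=> 0)) ?Ex0// => x; rewrite subrr expr0n.
have w0 : pair_coef (s k) 0 @[k --> \oo] --> 0.
  have l1 : L2 gam (fun=> 1) by exact: (@L2_cst _ (measurableTypeR R) R gam 1).
  have := cz _ l1; rewrite (@eq_Ex _ _ _ gam (fun x => 1 * F x) F); last by move=> x; rewrite mul1r.
  rewrite F0 => c; apply: eq_cvg_seq (cvgM c c) => [k|]; last by rewrite mulr0.
  rewrite -Ex_tpoly expr2; congr (_ * _); apply: eq_Ex => x; by rewrite mul1r.
have w1 : pair_coef (s k) 1 @[k --> \oo] --> 0.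
  have := cz _ L2_id_gam; rewrite F1 => c.
  by apply: eq_cvg_seq (cvgM c c) => [k|]; [rewrite -Ex_id_tpoly expr2|rewrite mulr0].
have cF : pair_corr (s k) 1 @[k --> \oo] --> Ex gam (fun x => F x ^+ 2).
  have c := cvg_L2_inner lt lt lF lF c0 c0.
  apply: eq_cvg_seq c => [k|]; first by rewrite -Ex_tpoly_sqr; apply: eq_Ex => x; rewrite expr2.
  by apply: eq_Ex => x; rewrite expr2.
have cc (Z : T -> R) : measurable_fun setT Z ->
   (forall A, measurable A -> gam A = P (Z @^-1` A)) ->
   Ex P (fun w => (tpoly (s k) (Z w) - F (Z w)) ^+ 2) @[k --> \oo] --> 0.
  move=> mZ lZ; apply: eq_cvg_seq c0 => // k.
  by have [_ ->] := L2_law mZ lZ (L2B (lt k) lF).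
have lX k := (L2_law mX lawX (lt k)).1; have lY k := (L2_law mY lawY (lt k)).1.
have cXY := cvg_L2_inner lX lY lFX lFY (cc _ mX lawX) (cc _ mY lawY).
have B k : `|Ex P (fun w => tpoly (s k) (X w) * tpoly (s k) (Y w)) - pair_coef (s k) 0
    - rho * pair_coef (s k) 1| <= rho ^+ 2 * pair_corr (s k) 1.
  by rewrite (Ex_tpoly_pair mX mY hcos hsin); exact: pair_corr_bound.
rewrite -subr_ge0.
have cA := @cvgZ_seq _ (rho ^+ 2) _ _ cF.
have cB := cvgB_seq (cvgB_seq cXY w0) (@cvgZ_seq _ rho _ _ w1).
have cC := cvgB_seq cA (cvg_norm_seq cB).
rewrite mulr0 !subr0 in cC.
rewrite -(cvg_lim _ cC)//; apply: limr_ge; first by apply/cvg_ex; eexists; exact: cC.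
by apply: nearW => k; rewrite subr_ge0.
Qed.
End rank_two_bound.

(** * Null sets of product measures and measures with a density *)

Section null_sections.
Context d1 d2 (T1 : measurableType d1) (T2 : measurableType d2) (R : realType).
Context (P1 : probability T1 R) (P2 : probability T2 R).

Lemma null_product (A : set (T1 * T2)) : measurable A ->
  {ae P1, forall x, P2 (xsection A x) = 0%E} -> pp P1 P2 A = 0%E.
Proof.
move=> mA aeA; rewrite /pp /= /product_measure1.
rewrite (@ae_eq_integral _ _ _ P1 setT (cst 0%E))//.
- by rewrite integral0_eq.
- exact: measurable_fun_xsection.
- by apply: filterS aeA => x h _.
Qed.

Lemma ae_product (Q : T1 * T2 -> Prop) : measurable [set p | Q p] ->
  {ae P1, forall x, {ae P2, forall y, Q (x, y)}} -> {ae pp P1 P2, forall p, Q p}.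
Proof.
move=> mQ aeQ; exists (~` [set p | Q p]); split => //; first exact: measurableC.
apply: null_product; first exact: measurableC.
apply: filterS aeQ => x [N [mN N0 sN]].
apply/eqP; rewrite eq_le measure_ge0 andbT -N0 le_measure ?inE//.
  by apply: measurable_xsection; exact: measurableC.
by move=> y; rewrite /xsection /= inE => h; apply: sN.
Qed.
End null_sections.

Section density_measure.
Context d (T : measurableType d) (R : realType) (mu : {measure set T -> \bar R}).
Context (p : T -> \bar R) (mp : measurable_fun setT p) (p0 : forall x, (0 <= p x)%E).

(** Measurability and sign of the density are arguments so that the instance of measure declared
    below can refer to them. *)
Definition dens of measurable_fun setT p & (forall x, (0 <= p x)%E) :=
  fun A : set T => (\int[mu]_(x in A) p x)%E.

Let dens0 : dens mp p0 set0 = 0%E. Proof. exact: integral_set0. Qed.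
Let dens_ge0 A : (0 <= dens mp p0 A)%E. Proof. by apply: integral_ge0. Qed.
Let dens_sigma : semi_sigma_additive (dens mp p0).
Proof. exact: semi_sigma_additive_nng_induced. Qed.

HB.instance Definition _ := isMeasure.Build _ _ _ (dens mp p0) dens0 dens_ge0 dens_sigma.

Definition dens_measure : {measure set T -> \bar R} := [the measure _ _ of dens mp p0].
End density_measure.

(** * Brownian increments and time averages of kernels *)

Section rV_laws.
Context {R : realType} {n : nat}.
Local Notation leb := (@lebesgue_measure R).

Let box (A : 'I_n -> set R) : set 'rV[R]_n := [set x | forall i, A i (x 0 i)].

(** Boxes are stable under intersection, so their probabilities determine a law on row vectors; this
    is the form in which [bm_normal] gives the law of increments. *)
Lemma measurable_rV_boxes : @measurable _ 'rV[R]_n =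
  <<s [set B | exists2 A : 'I_n -> set R, (forall i, measurable (A i)) & B = box A] >>.
Proof.
apply/seteqP; split.
  apply: smallest_sub; first exact: smallest_sigma_algebra.
  rewrite -bigcup_seq/=; apply: bigcup_sub => i _ _ [Y mY <-].
  apply: sub_sigma_algebra; exists (fun j => if j == i then Y else setT).
    by move=> j; case: ifP.
  apply/seteqP; split => x /=.
    by move=> [_ Yx] j; case: eqP => // ->.
  by move=> H; split => //; have := H i; rewrite eqxx.
apply: smallest_sub; first exact: sigma_algebra_measurable.
by move=> _ [A mA ->]; exact: measurable_rV_box.
Qed.

Context d (T : measurableType d) (P : probability T R) (Z : T -> 'rV[R]_n) (s : R).
Hypothesis mZ : measurable_fun setT Z.
Hypothesis lawZ : forall A : 'I_n -> set R, (forall i, measurable (A i)) ->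
  P (\bigcap_i [set w | A i (Z w 0 i)]) = (\prod_(i < n) normal_prob 0 s (A i))%E.

Let q (x : 'rV[R]_n) : R := \prod_(i < n) npdf s (x 0 i).

Let mq : measurable_fun setT q.
Proof.
apply: measurable_prodR => i; apply: (measurableT_comp (measurable_npdf s)).
exact: measurable_rV_coord.
Qed.

Let q0 x : 0 <= q x. Proof. by apply: prodr_ge0 => i _; exact: npdf_ge0. Qed.

Let mqE : measurable_fun setT (fun x => (q x)%:E). Proof. exact/measurable_EFinP. Qed.
Let q0E x : (0 <= (q x)%:E)%E. Proof. by rewrite lee_fin. Qed.

Let nu := dens_measure (lebesgue_rV R n) mqE q0E.

Let nu_box (A : 'I_n -> set R) : (forall i, measurable (A i)) ->
  nu (box A) = (\prod_(i < n) normal_prob 0 s (A i))%E.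
Proof.
move=> mA; rewrite /nu /= /dens integral_mkcond.
transitivity (\int[lebesgue_rV R n]_x \prod_(i < n)
    ((\1_(A i) (x 0%R i)) * npdf s (x 0%R i))%:E)%E.
  apply: eq_integral => x _; rewrite patchE prod_EFin big_split /=.
  case: ifPn => [/set_mem Ax|nAx].
    by rewrite [X in (X * _)%R]big1 ?mul1r// => i _; rewrite indicE mem_set.
  have [i nA] : exists i, ~ A i (x 0 i).
    by apply: contrapT => /forallNP h; move/negP: nAx; apply; apply/mem_set => i; apply: contrapT.
  by rewrite (bigD1 i)//= indicE memNset// !mul0r.
rewrite (@integral_rV_prod _ n (fun i u => (\1_(A i) u * npdf s u)%:E)).
- apply: eq_bigr => i _; rewrite normal_probE [RHS]integral_mkcond.
  apply: eq_integral => u _; rewrite patchE indicE.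
  by case: (_ \in _); rewrite ?mul1r// mul0r.
- move=> i; apply/measurable_EFinP; apply: measurable_funM; last exact: measurable_npdf.
  exact: measurable_indic.
- by move=> i u; rewrite lee_fin mulr_ge0// npdf_ge0.
Qed.

Let law_nu A : measurable A -> nu A = P (Z @^-1` A).
Proof.
move=> mA; pose P' := [the measure _ _ of pushforward P Z].
have H : forall B, [set B | exists2 A : 'I_n -> set R, (forall i, measurable (A i)) & B = box A] B ->
    nu B = P' mZ B.
  move=> _ [C mC ->]; rewrite nu_box// -lawZ// /P' /= /pushforward; congr (P _).
  by apply/seteqP; split => w /= h i; [exact: (h i Logic.I)|move=> _; exact: h].
have bT : box (fun=> setT) = setT by apply/seteqP; split.
apply: (@measure_unique _ R 'rV[R]_n _ (fun=> setT) measurable_rV_boxes _ _ _ nu (P' mZ) H _ A mA).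
- move=> _ _ [A1 mA1 ->] [A2 mA2 ->]; exists (fun i => A1 i `&` A2 i).
    by move=> i; exact: measurableI.
  apply/seteqP; split => x; first by move=> [h1 h2] i; split; [exact: h1|exact: h2].
  by move=> h; split => i; have [] := h i.
- by move=> _; exists (fun=> setT).
- by rewrite bigcup_const//; exists 0%N.
- move=> _; rewrite H; last by exists (fun=> setT).
  by rewrite /P' /= /pushforward preimage_setT probability_setT ltry.
Qed.

(** The law of [Z] agrees on boxes with the measure whose density is the product of the normal
    densities, hence equals it; integrals of products then factorize. *)
Lemma ge0_expect_rV_prod (h : 'I_n -> R -> R) : (forall i, measurable_fun setT (h i)) ->
  (forall i u, 0 <= h i u) ->
  (\int[P]_w (\prod_(i < n) h i (Z w 0%R i))%:E = \prod_(i < n) \int[nl s]_u (h i u)%:E)%E.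
Proof.
move=> mh h0.
pose hh (x : 'rV[R]_n) := \prod_(i < n) h i (x 0 i).
have mhh : measurable_fun setT hh.
  by apply: measurable_prodR => i; apply: (measurableT_comp (mh i)); exact: measurable_rV_coord.
have hh0 x : 0 <= hh x by exact: prodr_ge0.
rewrite -(@ge0_integral_image _ _ _ _ _ P nu Z mZ law_nu hh mhh hh0).
rewrite (@ge0_integral_density _ _ _ (lebesgue_rV R n) nu q mq q0 _ hh mhh hh0); last by [].
transitivity (\int[lebesgue_rV R n]_x \prod_(i < n) (npdf s (x 0%R i) * h i (x 0%R i))%:E)%E.
  by apply: eq_integral => x _; rewrite prod_EFin -big_split /=; congr EFin; apply: eq_bigr => i _; rewrite mulrC.
rewrite (@integral_rV_prod _ n (fun i u => (npdf s u * h i u)%:E)).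
- by apply: eq_bigr => i _; rewrite ge0_integral_nl.
- by move=> i; apply/measurable_EFinP; apply: measurable_funM => //; exact: measurable_npdf.
- by move=> i u; rewrite lee_fin mulr_ge0// npdf_ge0.
Qed.
End rV_laws.

Section brownian.
Context {R : realType} {n : nat} {dB : measure_display} {TB : measurableType dB}.
Variables (PB : probability TB R) (B : R -> TB -> 'rV[R]_n).
Hypothesis bm : brownian_motion PB B.
Variable alpha : 'I_n -> R.
Hypothesis al : forall i, 0 < alpha i < 1.
Local Notation rho := (riesz_product alpha).
Let sal := \sum_(i < n) alpha i.

Lemma measurable_nat_index d (S : measurableType d) (N : S -> nat) (F : nat -> TB -> R) :
  (forall k, measurable (N @^-1` [set k])) -> (forall k, measurable_fun setT (F k)) ->
  measurable_fun setT (fun p : S * TB => F (N p.1) p.2).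
Proof.
move=> mN mF _ Y mY; rewrite setTI.
rewrite (_ : _ @^-1` _ = \bigcup_k ((N @^-1` [set k]) `*` (F k @^-1` Y))); last first.
  apply/seteqP; split => [[x y] /= h|[x y] /= [k _ [/= <-]]//].
  by exists (N x).
apply: bigcup_measurable => k _; apply: measurableX => //.
by rewrite -[X in measurable X]setTI; exact: mF.
Qed.

Lemma brownian_cvg (w : TB) (u : R^nat) (s : R) i : (forall k, 0 <= u k) -> 0 <= s ->
  u @ \oo --> s -> B (u k) w 0 i @[k --> \oo] --> B s w 0 i.
Proof.
move=> u0 s0 us.
have /subspace_continuousP c := @bm_continuous _ _ _ _ _ _ bm w.
have cs : B^~ w x @[x --> within `[0, +oo[%classic (nbhs s)] --> B s w.
  by apply: c; rewrite /= in_itv /= s0.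
have uw : u @ \oo --> within `[0, +oo[%classic (nbhs s).
  move=> A; rewrite /within /= => hA.
  have H : \forall k \near \oo, `[0, +oo[%classic (u k) -> A (u k) := us _ hA.
  suff : \forall k \near \oo, A (u k) by [].
  by apply: filterS H => k; apply; rewrite /= in_itv /= u0.
have cv := cvg_comp _ _ uw cs.
exact: (cvg_comp _ _ cv (@coord_continuous _ _ _ 0 i (B s w))).
Qed.

(** Joint measurability from continuity of paths: time is rounded down to the grid of mesh
    [1 / (m + 1)], where only countably many variables occur. The absolute value keeps the time in
    the range where the path is meaningful. *)
Lemma measurable_brownian : measurable_fun setT (fun p : R * TB => B `|p.1| p.2).
Proof.
apply: measurable_fun_rV => i.
pose N (m : nat) (s : R) := Num.truncn (`|s| * m.+1%:R).
pose D m (p : R * TB) := B ((N m p.1)%:R / m.+1%:R) p.2 0 i.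
apply: (@measurable_fun_cvg _ _ _ _ D) => [m|p _].
  apply: (@measurable_nat_index _ R (N m) (fun k w => B (k%:R / m.+1%:R) w 0 i)).
    move=> k; rewrite (_ : _ @^-1` _ = (fun s : R => `|s| * m.+1%:R) @^-1` `[k%:R, k.+1%:R[%classic).
      have mf : measurable_fun setT (fun s : R => `|s| * m.+1%:R).
        by apply: measurable_funM; [exact: normr_measurable|exact: measurable_cst].
      by rewrite -[X in measurable X]setTI; apply: mf.
    apply/seteqP; split => s /=; rewrite in_itv /= -truncn_eq ?mulr_ge0//.
      by move=> <-; rewrite eqxx.
    by move/eqP.
  move=> k; apply: (measurableT_comp (@measurable_rV_coord R n i)).
  by apply: (bm_measurable bm); rewrite divr_ge0.
apply: (@brownian_cvg p.2 (fun m => (N m p.1)%:R / m.+1%:R) `|p.1| i) => //.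
apply: (@squeeze_cvgr _ _ _ _ (fun m => `|p.1| - m.+1%:R^-1) (fun=> `|p.1|)).
- apply: nearW => m; have /andP[h1 h2] := truncn_itv (mulr_ge0 (normr_ge0 p.1) (ler0n R m.+1)).
  rewrite /N ler_pdivrMr ?ltr0n// h1 andbT ler_pdivlMr ?ltr0n// mulrBl mulVf ?pnatr_eq0//.
  by rewrite lerBlDr natr1; exact: ltW.
- by rewrite -[X in _ --> X]subr0; apply: cvgB; [exact: cvg_cst|exact: cvg_harmonic].
- exact: cvg_cst.
Qed.

Let Cst := \prod_(i < n) pw_const (alpha i) 2.
Let Cst_ge0 : 0 <= Cst.
Proof. by apply: prodr_ge0 => i _; have /andP[? ?] := al i; exact: pw_const_ge0. Qed.

(** The coordinates of an increment are independent normals of variance [s - r], and each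
    contributes at most a multiple of [(s - r) ^ (- alpha_i / 2)], uniformly in the centre [y]; the
    exponents add up. *)
Lemma increment_riesz (s r : R) (y : 'rV[R]_n) : 0 <= r -> r < s ->
  L1 PB (fun w => rho (B s w - B r w - y)) /\
  Ex PB (fun w => rho (B s w - B r w - y)) <= Cst * (s - r) `^ (- (sal / 2)).
Proof.
move=> r0 rs; have s0 : 0 <= s by apply: ltW; exact: le_lt_trans rs.
pose sg := Num.sqrt (s - r).
have sg0 : 0 < sg by rewrite sqrtr_gt0 subr_gt0.
have mB u : 0 <= u -> measurable_fun setT (B u) := bm_measurable bm (s := u).
have mZ : measurable_fun setT (fun w => B s w - B r w).
  apply: measurable_fun_rV => i; under eq_fun do rewrite !mxE.
  by apply: measurable_funB; apply: (measurableT_comp (@measurable_rV_coord R n i)); exact: mB.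
have lZ := fun A mA => @bm_normal _ _ _ _ _ _ bm r s A r0 rs mA.
have mm : measurable_fun setT (fun w => rho (B s w - B r w - y)).
  apply: (measurableT_comp (measurable_riesz alpha)).
  apply: measurable_fun_rV => i; under eq_fun do rewrite !mxE.
  apply: measurable_funB; last exact: measurable_cst.
  by apply: measurable_funB; apply: (measurableT_comp (@measurable_rV_coord R n i)); exact: mB.
have E : (\int[PB]_w (rho (B s w - B r w - y))%:E <= (Cst * (s - r) `^ (- (sal / 2)))%:E)%E.
  rewrite (_ : (\int[PB]_w _)%E = (\int[PB]_w (\prod_(i < n) pw (alpha i) ((B s w - B r w) 0%R i + - y 0%R i))%:E)%E); last first.
    by apply: eq_integral => w _; rewrite riesz_productE; congr EFin; apply: eq_bigr => i _; rewrite !mxE.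
  rewrite (@ge0_expect_rV_prod R n _ _ PB _ sg mZ lZ (fun i u => pw (alpha i) (u + - y 0%R i))); last 2 first.
  - by move=> i; exact: measurable_pw_shift.
  - by move=> i u; exact: pw_ge0.
  rewrite (_ : (\prod_(i < n) _)%E = (\prod_(i < n) Ex (nl sg) (fun u => pw (alpha i) (u - y 0%R i)))%:E); last first.
    rewrite -prod_EFin; apply: eq_bigr => i _; have /andP[a0 a1] := al i.
    by have [l _ _] := nl_pw (- y 0 i) a0 a1 sg0; rewrite -Ex_EFin.
  rewrite lee_fin.
  apply: (@le_trans _ _ (\prod_(i < n) (sg `^ (- alpha i) * pw_const (alpha i) 2))).
    apply: ler_prod => i _; have /andP[a0 a1] := al i.
    rewrite Ex_ge0/=; last by move=> u; exact: pw_ge0.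
    by have [_ l _] := nl_pw (- y 0 i) a0 a1 sg0.
  rewrite big_split /= mulrC ler_wpM2l// le_eqVlt; apply/orP; left; apply/eqP.
  have -> : \prod_(i < n) sg `^ (- alpha i) = sg `^ (- sal).
    rewrite /sal; elim/big_rec2 : _ => [|i a b _ ->]; first by rewrite oppr0 powRr0.
    by rewrite opprD powRD// (gt_eqF sg0) implybT.
  rewrite /sg -powR12_sqrt; last by rewrite subr_ge0 ltW.
  by rewrite -powRrM; congr (_ `^ _); field.
have L : L1 PB (fun w => rho (B s w - B r w - y)).
  apply: L1_ge0 => //; first by move=> w; exact: riesz_ge0.
  by apply: le_lt_trans E _; rewrite ltry.
by split => //; rewrite -lee_fin Ex_EFin.
Qed.

Lemma increment_neq (s r : R) (y : R) i : 0 <= r -> r < s ->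
  PB [set w | (B s w - B r w) 0 i = y] = 0%E.
Proof.
move=> r0 rs.
have -> : [set w | (B s w - B r w) 0 i = y] =
    \bigcap_j [set w | (if j == i then [set y] else setT) ((B s w - B r w) 0 j)].
  apply/seteqP; split => w /=.
    by move=> h j _ /=; case: eqP => // ->.
  by move=> /(_ i Logic.I) /=; rewrite eqxx.
rewrite (bm_normal bm r0 rs (A := fun j => if j == i then [set y] else setT)); last first.
  by move=> j; case: ifP.
rewrite (bigD1 i)//= eqxx (_ : normal_prob _ _ _ = 0%E) ?mul0e//.
apply: (@normal_prob_dominates R 0 _ [set y]) => //.
by apply/measure0_null_setP => //; exact: lebesgue_measure_set1.
Qed.

Lemma rieszN z : rho (- z) = rho z.
Proof. by rewrite !riesz_productE; apply: eq_bigr => i _; rewrite mxE pwN. Qed.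

Hypothesis n0 : (0 < n)%N.

(** A consequence of the convention that [0] to a nonzero power is 0; it makes the bounds below
    valid also at equal times. *)
Lemma riesz0 : rho 0 = 0.
Proof.
rewrite riesz_productE (bigD1 (Ordinal n0))//= mxE /pw normr0 powR0 ?mul0r//.
by rewrite oppr_eq0; have /andP[a0 _] := al (Ordinal n0); rewrite gt_eqF.
Qed.

Lemma diag_riesz (s r : R) : L1 PB (fun w => rho (B `|s| w - B `|r| w)) /\
  Ex PB (fun w => rho (B `|s| w - B `|r| w)) <= Cst * pw (sal / 2) (`|s| - `|r|).
Proof.
have [sr|rs|sr] := ltgtP `|s| `|r|.
- have [l b] := increment_riesz 0 (normr_ge0 s) sr.
  have E : (fun w => rho (B `|s| w - B `|r| w)) = (fun w => rho (B `|r| w - B `|s| w - 0)).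
    by apply/funext => w; rewrite subr0 -rieszN opprB.
  rewrite E; split => //; apply: (le_trans b).
  by rewrite /pw distrC (@gtr0_norm _ (`|r| - `|s|)) ?subr_gt0.
- have [l b] := increment_riesz 0 (normr_ge0 r) rs.
  have E : (fun w => rho (B `|s| w - B `|r| w)) = (fun w => rho (B `|s| w - B `|r| w - 0)).
    by apply/funext => w; rewrite subr0.
  rewrite E; split => //; apply: (le_trans b).
  by rewrite /pw (@gtr0_norm _ (`|s| - `|r|)) ?subr_gt0.
- have E : (fun w => rho (B `|s| w - B `|r| w)) = (fun=> 0).
    by apply/funext => w; rewrite sr subrr riesz0.
  by rewrite E Ex0; split; [exact: L10|rewrite mulr_ge0// pw_ge0].
Qed.

Let path_riesz (s : R) (y : 'rV[R]_n) : 0 < s ->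
  L1 PB (fun w => rho (B s w - y)) /\ Ex PB (fun w => rho (B s w - y)) <= Cst * pw (sal / 2) s.
Proof.
move=> s0; have [l b] := increment_riesz y (lexx 0) s0.
have E : (fun w => rho (B s w - y)) = (fun w => rho (B s w - B 0 w - y)).
  by apply/funext => w; rewrite (bm_start bm) subr0.
by rewrite E; split => //; rewrite subr0 in b; apply: (le_trans b); rewrite /pw gtr0_norm.
Qed.

Let mdiff : measurable_fun setT (fun q : (R * R) * (TB * TB) => rho (B `|q.1.1| q.2.1 - B `|q.1.2| q.2.2)).
Proof.
have f11 := measurableT_comp (@measurable_fst _ _ R R) (@measurable_fst _ _ (R * R)%type (TB * TB)%type).
have f12 := measurableT_comp (@measurable_snd _ _ R R) (@measurable_fst _ _ (R * R)%type (TB * TB)%type).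
have f21 := measurableT_comp (@measurable_fst _ _ TB TB) (@measurable_snd _ _ (R * R)%type (TB * TB)%type).
have f22 := measurableT_comp (@measurable_snd _ _ TB TB) (@measurable_snd _ _ (R * R)%type (TB * TB)%type).
have m1 := measurableT_comp measurable_brownian (measurable_fun_pair f11 f21).
have m2 := measurableT_comp measurable_brownian (measurable_fun_pair f12 f22).
apply: (measurableT_comp (measurable_riesz alpha)).
apply: measurable_fun_rV => i; under eq_fun do rewrite !mxE.
by apply: measurable_funB; apply: (measurableT_comp (@measurable_rV_coord R n i)).
Qed.

Lemma off_riesz (s r : R) : L1 (pp PB PB) (fun p => rho (B `|s| p.1 - B `|r| p.2)) /\
  Ex (pp PB PB) (fun p => rho (B `|s| p.1 - B `|r| p.2)) <=
  Cst * (pw (sal / 2) s + pw (sal / 2) r).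
Proof.
have pn (u : R) : pw (sal / 2) `|u| = pw (sal / 2) u by rewrite /pw normr_id.
have mp : measurable_fun setT (fun p : TB * TB => rho (B `|s| p.1 - B `|r| p.2)).
  exact: (measurableT_comp mdiff (measurable_pair1 (s, r))).
have [s0|s0] := eqVneq s 0; last first.
  have sp : 0 < `|s| by rewrite normr_gt0.
  have I : L1 (pp PB PB) (fun p => rho (B `|s| p.1 - B `|r| p.2)).
    apply: pp_tonelli2 => // [w'|]; first by have [] := path_riesz (B `|r| w') sp.
    apply: (@L1_bnd _ _ _ PB _ (Cst * pw (sal / 2) `|s|)) => [|w'].
      exact: (measurable_Ex1 PB (measurableT_comp (@normr_measurable R setT) mp)).
    rewrite ger0_norm; last by apply: Ex_ge0 => w; rewrite normr_ge0.
    have [l b] := path_riesz (B `|r| w') sp; apply: le_trans b.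
    by apply: Ex_le (L1_norm l) l _ => w; rewrite ger0_norm// riesz_ge0.
  split => //; have [l ->] := pp_fubini2 I.
  apply: Ex_le_cst => // w'; have [_ b] := path_riesz (B `|r| w') sp; apply: (le_trans b).
  by rewrite pn ler_wpM2l// lerDl pw_ge0.
have [r0|r0] := eqVneq r 0.
  have E : (fun p : TB * TB => rho (B `|s| p.1 - B `|r| p.2)) = (fun=> 0).
    by apply/funext => p; rewrite s0 r0 normr0 !(bm_start bm) subrr riesz0.
  by rewrite E Ex0; split; [exact: L10|rewrite mulr_ge0// addr_ge0 ?pw_ge0].
have rp : 0 < `|r| by rewrite normr_gt0.
have [l b] := path_riesz 0 rp.
have E : (fun p : TB * TB => rho (B `|s| p.1 - B `|r| p.2)) = (fun p => rho (B `|r| p.2 - 0)).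
  by apply/funext => p; rewrite s0 normr0 (bm_start bm) sub0r subr0 rieszN.
rewrite E; have [l2 ->] := @Ex_snd _ _ _ _ _ PB PB _ l.
by split => //; apply: (le_trans b); rewrite pn ler_wpM2l// lerDr pw_ge0.
Qed.
End brownian.

Lemma ae_impl2 d (T : measurableType d) (R : realType) (mu : {measure set T -> \bar R})
    (P Q S : T -> Prop) : {ae mu, forall x, P x} -> {ae mu, forall x, Q x} ->
  (forall x, P x -> Q x -> S x) -> {ae mu, forall x, S x}.
Proof. by move=> aP aQ PQ; apply: filterS2 aP aQ. Qed.

Section uniform_time.
Context {R : realType} (t : R) (t0 : 0 < t).
Local Notation leb := (@lebesgue_measure R).

Definition unif (t0 : 0 < t) : probability (measurableTypeR R) R := @uniform_prob R 0 t t0.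
Local Notation U := (unif t0).

Lemma uniform_pdf_nneg u : 0 <= uniform_pdf 0 t u.
Proof. by rewrite /uniform_pdf; case: ifP => // _; rewrite subr0 invr_ge0 ltW. Qed.

Lemma unif_Ex (h : R -> R) : measurable_fun setT h ->
  (L1 U h <-> L1 leb (fun u => h u * uniform_pdf 0 t u)) /\
  Ex U h = Ex leb (fun u => h u * uniform_pdf 0 t u).
Proof.
move=> mh; split.
  by apply: (@L1_density _ _ _ leb U (uniform_pdf 0 t)) => //; [exact: measurable_uniform_pdf|exact: uniform_pdf_nneg].
by apply: (@Ex_density _ _ _ leb U (uniform_pdf 0 t)) => //; [exact: measurable_uniform_pdf|exact: uniform_pdf_nneg].
Qed.

Lemma unif_pw (a z : R) : 0 < a -> a < 1 ->
  L1 U (fun u => pw a (u + z)) /\ Ex U (fun u => pw a (u + z)) <= t `^ (- a) * pw_const a 1.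
Proof.
move=> a0 a1; have [i e] := unif_Ex (measurable_pw_shift a z).
have one : @measurable_fun _ _ R R setT (cst 1) by exact: measurable_cst.
have [i1 e1] := unif_Ex one.
have E1 : (fun u : R => cst 1 u * uniform_pdf 0 t u) = uniform_pdf 0 t.
  by apply/funext => u; rewrite mul1r.
rewrite E1 in i1 e1.
have Lp : L1 leb (uniform_pdf 0 t) by apply/i1; exact: L1_cst.
have Ep : Ex leb (uniform_pdf 0 t) = 1 by rewrite -e1 Ex_cst.
have ub u : `|u + z| <= t / 2 -> uniform_pdf 0 t u <= 1 / t.
  by move=> _; rewrite /uniform_pdf subr0 mul1r; case: ifP => // _; rewrite invr_ge0 ltW.
have [l b] := Ex_pw_le a0 a1 t0 ler01 uniform_pdf_nneg Lp Ep ub.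
have E : (fun u => pw a (u + z) * uniform_pdf 0 t u) = (fun u => uniform_pdf 0 t u * pw a (u + z)).
  by apply/funext => u; rewrite mulrC.
by rewrite i e E.
Qed.

Lemma unif_ae_neq (z : R) : {ae U, forall u, u != z}.
Proof.
exists [set z]; split => //; last by move=> u /= /negP; rewrite negbK => /eqP.
apply: (@dominates_uniform_prob R 0 t t0 [set z]) => //.
by apply/measure0_null_setP => //; exact: lebesgue_measure_set1.
Qed.

Lemma L1_unif_sum (a : R) : 0 < a -> a < 1 -> L1 (pp U U) (fun p => pw a p.1 + pw a p.2).
Proof.
move=> a0 a1; have [l _] := unif_pw 0 a0 a1.
have E : (fun u => pw a (u + 0)) = pw a by apply/funext => u; rewrite addr0.
rewrite E in l; apply: L1D.
  exact: (@Ex_fst _ _ _ _ _ U U _ l).1.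
exact: (@Ex_snd _ _ _ _ _ U U _ l).1.
Qed.

(** Up to sign, [|s| - |r|] is [s - r] or [s + r], so the integrand is at most the sum of two
    powers, each integrable in [s] uniformly in [r]. *)
Lemma L1_unif_diff (a : R) : 0 < a -> a < 1 -> L1 (pp U U) (fun p => pw a (`|p.1| - `|p.2|)).
Proof.
move=> a0 a1.
have mpw (e : R) : measurable_fun setT (fun p : R * R => pw a (p.1 + e * p.2)).
  apply: (measurableT_comp (measurable_pw a)); apply: measurable_funD => //.
  by apply: measurable_funM => //; exact: measurable_cst.
have L e : L1 (pp U U) (fun p => pw a (p.1 + e * p.2)).
  apply: pp_tonelli2; [exact: mpw|by move=> y; exact: (unif_pw (e * y) a0 a1).1|].
  apply: (@L1_bnd _ _ _ U _ (t `^ (- a) * pw_const a 1)) => [|y].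
    exact: (measurable_Ex1 U (measurableT_comp (@normr_measurable R setT) (mpw e))).
  rewrite ger0_norm; last by apply: Ex_ge0 => u; rewrite normr_ge0.
  have [l b] := unif_pw (e * y) a0 a1.
  by apply: le_trans b; apply: Ex_le (L1_norm l) l _ => u; rewrite ger0_norm// pw_ge0.
apply: (L1_le _ _ (L1D (L (-1)) (L 1))).
  apply: (measurableT_comp (measurable_pw a)).
  by apply: measurable_funB; apply: (measurableT_comp (@normr_measurable R setT)).
move=> p; rewrite ger0_norm ?pw_ge0// mulN1r mul1r.
have P (y : R) : 0 <= pw a y by exact: pw_ge0.
case: (ger0P p.1) => _; case: (ger0P p.2) => _.
- by rewrite lerDl.
- by rewrite opprK lerDr.
- by rewrite -[pw a (- p.1 - p.2)]pwN opprD !opprK lerDr.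
- by rewrite opprK -[pw a (- p.1 + p.2)]pwN opprD opprK lerDl.
Qed.
End uniform_time.

(** * Time averages of dominated kernels along paths *)

Section path_kernels.
Context {R : realType} {n : nat} (alpha : 'I_n -> R) (t : R) (t0 : 0 < t).
Local Notation rho := (riesz_product alpha).
Local Notation U := (unif t0).
Local Notation UU := (pp (unif t0) (unif t0)).

(** [riesz_product] is 0 instead of infinite where a coordinate vanishes. The last field says that
    the path almost never meets those hyperplanes, so bounds and limits valid off them suffice. *)
Record good_path d (Om : measurableType d) (P : probability Om R)
    (Z : (measurableTypeR R * measurableTypeR R) * Om -> 'rV[R]_n) : Prop := {
  gp_meas : measurable_fun setT Z ;
  gp_L1 : L1 (pp UU P) (fun q => rho (Z q)) ;
  gp_ae : {ae pp UU P, forall q, forall i, Z q 0 i != 0} }.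

Definition dominated_kernel (K : 'rV[R]_n -> R) (C : R) :=
  measurable_fun setT K /\ forall z : 'rV[R]_n, (forall i, z 0 i != 0) -> `|K z| <= C * rho z.

Section average.
Context d (Om : measurableType d) (P : probability Om R) (Z : (measurableTypeR R * measurableTypeR R) * Om -> 'rV[R]_n).
Hypothesis gZ : good_path P Z.

Definition time_avg (K : 'rV[R]_n -> R) (om : Om) := Ex UU (fun q => K (Z (q, om))).

Lemma L1_kernel K C : dominated_kernel K C -> L1 (pp UU P) (fun q => K (Z q)).
Proof.
move=> [mK bK].
have mKZ := measurableT_comp mK (gp_meas gZ).
have ae : {ae pp UU P, forall q, `|K (Z q)| <= C * rho (Z q)}.
  by apply: (ae_impl (gp_ae gZ)) => q; exact: bK.
exact: (L1_le_ae mKZ ae (L1Z C (gp_L1 gZ))).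
Qed.

Lemma L1_time_avg K C : dominated_kernel K C -> L1 P (time_avg K).
Proof. by move=> dK; have [] := pp_fubini2 (L1_kernel dK). Qed.

Lemma time_avg_dist K C K' C' : dominated_kernel K C -> dominated_kernel K' C' ->
  Ex P (fun om => `|time_avg K om - time_avg K' om|) <=
  Ex (pp UU P) (fun q => `|K (Z q) - K' (Z q)|).
Proof.
move=> dK dK'; have l := L1_kernel dK; have l' := L1_kernel dK'.
have lB := L1_norm (L1B l l').
have [lf ->] := pp_fubini2 lB.
have a1 := L1_ae2 l; have a2 := L1_ae2 l'.
apply: Ex_le_ae => //; first by apply: L1_norm; apply: L1B; [exact: L1_time_avg dK|exact: L1_time_avg dK'].
apply: (ae_impl2 a1 a2) => om h1 h2.
by rewrite /time_avg -(ExB h1 h2); apply: Ex_norm; exact: L1B.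
Qed.

(** Dominated convergence on the product of times and paths; a multiple of the Riesz product along
    the path is the dominating function. *)
Lemma time_avg_cvg (K : nat -> 'rV[R]_n -> R) C K0 C0 :
  (forall k, dominated_kernel (K k) C) -> dominated_kernel K0 C0 ->
  (forall z : 'rV[R]_n, (forall i, z 0 i != 0) -> K k z @[k --> \oo] --> K0 z) ->
  Ex P (fun om => `|time_avg (K k) om - time_avg K0 om|) @[k --> \oo] --> 0.
Proof.
move=> dK dK0 cK.
apply: (@cvg0_le _ _ (fun k => Ex (pp UU P) (fun q => `|K k (Z q) - K0 (Z q)|))).
- by move=> k; apply: Ex_ge0 => om; exact: normr_ge0.
- by move=> k; exact: time_avg_dist (dK k) dK0.
have mD k : measurable_fun setT (fun q => `|K k (Z q) - K0 (Z q)|).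
  exact: (L1_meas (L1_norm (L1B (L1_kernel (dK k)) (L1_kernel dK0)))).
have := @Ex_dom _ _ _ (pp UU P) (fun k q => `|K k (Z q) - K0 (Z q)|) (fun=> 0)
  (fun q => C * rho (Z q) + C0 * rho (Z q)) mD (measurable_cst _).
case.
- apply: (ae_impl (gp_ae gZ)) => q hq; have c := cK _ hq.
  have := cvg_norm_seq (cvgB_seq c (cvg_cst (K0 (Z q)))).
  by rewrite subrr normr0; apply.
- by apply: L1D; apply: L1Z; exact: gp_L1 gZ.
- move=> k; apply: (ae_impl (gp_ae gZ)) => q hq; rewrite normr_id.
  apply: (le_trans (ler_normB _ _)); apply: lerD; [exact: (dK k).2|exact: dK0.2].
by move=> _; rewrite Ex0.
Qed.
End average.
End path_kernels.

Section brownian_paths.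
Context {R : realType} {n : nat} {dB : measure_display} {TB : measurableType dB}.
Variables (PB : probability TB R) (B : R -> TB -> 'rV[R]_n).
Hypothesis bm : brownian_motion PB B.
Variable alpha : 'I_n -> R.
Hypothesis al : forall i, 0 < alpha i < 1.
Hypothesis sal : 0 < \sum_(i < n) alpha i < 2.
Hypothesis n0 : (0 < n)%N.
Context (t : R) (t0 : 0 < t).
Local Notation U := (unif t0).
Local Notation UU := (pp (unif t0) (unif t0)).
Local Notation rho := (riesz_product alpha).

(* Increments along one path, and between two independent paths. *)
Definition Zd (q : (measurableTypeR R * measurableTypeR R) * TB) := B `|q.1.1| q.2 - B `|q.1.2| q.2.
Definition Zo (q : (measurableTypeR R * measurableTypeR R) * (TB * TB)) := B `|q.1.1| q.2.1 - B `|q.1.2| q.2.2.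

Lemma measurable_rVB d (T : measurableType d) (f g : T -> 'rV[R]_n) :
  measurable_fun setT f -> measurable_fun setT g -> measurable_fun setT (fun x => f x - g x).
Proof.
move=> mf mg; apply: measurable_fun_rV => i; under eq_fun do rewrite !mxE.
by apply: measurable_funB; apply: (measurableT_comp (@measurable_rV_coord R n i)).
Qed.

Lemma measurable_Zd : measurable_fun setT Zd.
Proof.
have mB := measurable_brownian bm.
have f1 := measurableT_comp (@measurable_fst _ _ R R) (@measurable_fst _ _ (R * R)%type TB).
have f2 := measurableT_comp (@measurable_snd _ _ R R) (@measurable_fst _ _ (R * R)%type TB).
have m1 := measurableT_comp mB (measurable_fun_pair f1 (@measurable_snd _ _ (R * R)%type TB)).
have m2 := measurableT_comp mB (measurable_fun_pair f2 (@measurable_snd _ _ (R * R)%type TB)).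
exact: measurable_rVB m1 m2.
Qed.

Lemma measurable_Zo : measurable_fun setT Zo.
Proof.
have mB := measurable_brownian bm.
have f11 := measurableT_comp (@measurable_fst _ _ R R) (@measurable_fst _ _ (R * R)%type (TB * TB)%type).
have f12 := measurableT_comp (@measurable_snd _ _ R R) (@measurable_fst _ _ (R * R)%type (TB * TB)%type).
have f21 := measurableT_comp (@measurable_fst _ _ TB TB) (@measurable_snd _ _ (R * R)%type (TB * TB)%type).
have f22 := measurableT_comp (@measurable_snd _ _ TB TB) (@measurable_snd _ _ (R * R)%type (TB * TB)%type).
have m1 := measurableT_comp mB (measurable_fun_pair f11 f21).
have m2 := measurableT_comp mB (measurable_fun_pair f12 f22).
exact: measurable_rVB m1 m2.
Qed.

Let hs0 : 0 < (\sum_(i < n) alpha i) / 2. Proof. by have /andP[h _] := sal; rewrite divr_gt0. Qed.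
Let hs1 : (\sum_(i < n) alpha i) / 2 < 1. Proof. by have /andP[_ h] := sal; rewrite ltr_pdivrMr// mul1r. Qed.

Lemma measurable_nonzero d (T : measurableType d) (f : T -> 'rV[R]_n) :
  measurable_fun setT f -> measurable [set q | forall i, f q 0 i != 0].
Proof.
move=> mf; rewrite (_ : [set _ | _] = \bigcap_(i : 'I_n) (fun q => f q 0 i) @^-1` (~` [set 0])).
  apply: fin_bigcap_measurable => [|i _]; first exact: finite_finset.
  rewrite -[X in measurable X]setTI; apply: (measurableT_comp (@measurable_rV_coord R n i) mf) => //.
  exact: measurableC.
apply/seteqP; split => q /=.
  by move=> h i _ /=; apply/eqP; exact: h.
by move=> h i; apply/eqP; exact: (h i Logic.I).
Qed.

Lemma ae_increment (s r : R) : `|s| != `|r| ->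
  {ae PB, forall w, forall i, (B `|s| w - B `|r| w) 0 i != 0}.
Proof.
move=> sr; apply: filter_forall => i.
wlog : s r sr / `|r| < `|s|.
  move=> H; case: (ltgtP `|r| `|s|) => [rs|rs|rs]; first exact: H.
    apply: filterS (H r s _ rs); last by rewrite eq_sym.
    by move=> w; rewrite !mxE subr_eq0 eq_sym -subr_eq0.
  by rewrite rs eqxx in sr.
move=> rs; exists [set w | (B `|s| w - B `|r| w) 0 i = 0]; split.
- rewrite -[X in measurable X]setTI.
  have mB u : 0 <= u -> measurable_fun setT (B u) := bm_measurable bm (s := u).
  have mc := measurableT_comp (@measurable_rV_coord R n i) (measurable_rVB (mB _ (normr_ge0 s)) (mB _ (normr_ge0 r))).
  exact: (mc measurableT [set 0] (measurable_set1 _)).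
- exact: (increment_neq bm).
- by move=> w /= /negP; rewrite negbK => /eqP.
Qed.

(** This is where the total exponent being less than 2 matters: the mean of the kernel is at most a
    multiple of the time gap to the power [- alpha / 2], which is integrable over pairs of times. *)
Lemma good_diag : good_path alpha t0 PB Zd.
Proof.
have mZ := measurable_Zd.
have mr := measurableT_comp (measurable_riesz alpha) mZ.
split => //.
- apply: pp_tonelli1 => // [[s r]|]; first by have [] := diag_riesz bm al n0 s r.
  pose Cst := \prod_(i < n) pw_const (alpha i) 2.
  apply: (L1_le _ _ (L1Z Cst (L1_unif_diff t0 hs0 hs1))).
    exact: (measurable_Ex2 PB (measurableT_comp (@normr_measurable R setT) mr)).
  move=> [s r]; have [l b] := diag_riesz bm al n0 s r.
  rewrite ger0_norm; last by apply: Ex_ge0 => w; rewrite normr_ge0.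
  by apply: le_trans b; apply: Ex_le (L1_norm l) l _ => w; rewrite ger0_norm// riesz_ge0.
- apply: ae_product; first exact: measurable_nonzero.
  have ae : {ae UU, forall q, `|q.1| != `|q.2|}.
    apply: (@ae_product _ _ _ _ _ U U (fun q => `|q.1| != `|q.2|)).
      have m1 := measurableT_comp (@normr_measurable R setT) (@measurable_fst _ _ R R).
      have m2 := measurableT_comp (@normr_measurable R setT) (@measurable_snd _ _ R R).
      have := measurable_funB m1 m2; move=> /(_ measurableT (~` [set 0])) h.
      rewrite (_ : [set _ | _] = setT `&` (fun q : R * R => `|q.1| - `|q.2|) @^-1` (~` [set 0])).
        by apply: h; exact: measurableC.
      by rewrite setTI; apply/seteqP; split => q /=; rewrite -subr_eq0 => /eqP.
    apply: aeW => s; apply: (ae_impl2 (unif_ae_neq t0 `|s|) (unif_ae_neq t0 (- `|s|))) => r h1 h2.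
    apply/eqP => sr; move: h1 h2; rewrite sr; case: (ger0P r) => _; rewrite ?eqxx//.
    by rewrite opprK eqxx.
  by apply: (ae_impl ae) => -[s r] /= sr; exact: ae_increment.
Qed.

Lemma good_off : good_path alpha t0 (pp PB PB) Zo.
Proof.
have mZ := measurable_Zo.
have mr := measurableT_comp (measurable_riesz alpha) mZ.
split => //.
- apply: pp_tonelli1 => // [[s r]|]; first by have [] := off_riesz bm al n0 s r.
  pose Cst := \prod_(i < n) pw_const (alpha i) 2.
  apply: (L1_le _ _ (L1Z Cst (L1_unif_sum t0 hs0 hs1))).
    exact: (measurable_Ex2 (pp PB PB) (measurableT_comp (@normr_measurable R setT) mr)).
  move=> [s r]; have [l b] := off_riesz bm al n0 s r.
  rewrite ger0_norm; last by apply: Ex_ge0 => w; rewrite normr_ge0.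
  by apply: le_trans b; apply: Ex_le (L1_norm l) l _ => w; rewrite ger0_norm// riesz_ge0.
- apply: ae_product; first exact: measurable_nonzero.
  (* Given the first path, a coordinate of the difference vanishes only if the second path hits a
     prescribed value, an event of probability 0 at any nonzero time. *)
  have ae : {ae UU, forall q, q.2 != 0}.
    apply: (@ae_product _ _ _ _ _ U U (fun q => q.2 != 0)).
      have := (@measurable_snd _ _ R R) measurableT (~` [set 0]); rewrite setTI => h.
      rewrite (_ : [set _ | _] = snd @^-1` (~` [set 0])); first by apply: h; exact: measurableC.
      by apply/seteqP; split => q /= /eqP.
    by apply: aeW => s; exact: unif_ae_neq.
  apply: (ae_impl ae) => -[s r] /= r0.
  have mZsr : measurable_fun setT (fun p : TB * TB => Zo ((s, r), p)).
    exact: (measurableT_comp mZ (measurable_pair1 (s, r))).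
  apply: ae_product; first exact: measurable_nonzero.
  apply: aeW => w; apply: filter_forall => i.
  have rp : 0 < `|r| by rewrite normr_gt0.
  exists [set w' | (B `|r| w' - B 0 w') 0 i = B `|s| w 0 i]; split.
  + have mB u : 0 <= u -> measurable_fun setT (B u) := bm_measurable bm (s := u).
    rewrite -[X in measurable X]setTI.
    have mc := measurableT_comp (@measurable_rV_coord R n i) (measurable_rVB (mB _ (normr_ge0 r)) (mB _ (lexx 0))).
    exact: (mc measurableT [set B `|s| w 0 i] (measurable_set1 _)).
  + exact: (increment_neq bm).
  + move=> w' /= /negP; rewrite negbK /Zo /= (bm_start bm) subr0 !mxE subr_eq0 => /eqP ->.
    by [].
Qed.
End brownian_paths.

(** * Averages of a random field along a Brownian path *)

Section path_averages.
Context {R : realType} {n : nat} {dB dT : measure_display}.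
Context {TB : measurableType dB} {T : measurableType dT}.
Variables (PB : probability TB R) (P : probability T R) (B : R -> TB -> 'rV[R]_n).
Hypothesis bm : brownian_motion PB B.
Context (t : R) (t0 : 0 < t) (x : 'rV[R]_n).
Local Notation U := (unif t0).
Local Notation UU := (pp (unif t0) (unif t0)).

(* [U] is uniform on [0, t]; the absolute value keeps the path in the range
   of times where [B] is meaningful. *)
Definition path_avg (F : 'rV[R]_n * T -> R) (p : T * TB) : R :=
  Ex U (fun s => F (x + B `|s| p.2, p.1)).

Record field (F : 'rV[R]_n * T -> R) : Prop := {
  fd_meas : measurable_fun setT F ;
  fd_L2 : forall z, L2 P (fun w => F (z, w)) ;
  fd_bnd : exists c : R, forall z, Ex P (fun w => F (z, w) ^+ 2) <= c }.

Definition field_cov (F F' : 'rV[R]_n * T -> R) (K : 'rV[R]_n -> R) :=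
  forall z z', Ex P (fun w => F (z, w) * F' (z', w)) = K (z - z').

Let mpos : measurable_fun setT (fun p : (T * TB) * measurableTypeR R => (x + B `|p.2| p.1.2, p.1.1)).
Proof.
have g1 := measurableT_comp (@measurable_snd _ _ T TB) (@measurable_fst _ _ (T * TB)%type (measurableTypeR R)).
have g2 := measurableT_comp (@measurable_fst _ _ T TB) (@measurable_fst _ _ (T * TB)%type (measurableTypeR R)).
have g3 := @measurable_snd _ _ (T * TB)%type (measurableTypeR R).
have mb := measurableT_comp (measurable_brownian bm) (measurable_fun_pair g3 g1).
apply: measurable_fun_pair => //.
apply: measurable_fun_rV => i; under eq_fun do rewrite !mxE.
apply: measurable_funD; first exact: measurable_cst.
exact: (measurableT_comp (@measurable_rV_coord R n i) mb).
Qed.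

Lemma measurable_path_integrand (F : 'rV[R]_n * T -> R) : measurable_fun setT F ->
  measurable_fun setT (fun p : (T * TB) * measurableTypeR R => F (x + B `|p.2| p.1.2, p.1.1)).
Proof. by move=> mF; exact: (measurableT_comp mF mpos). Qed.

Lemma measurable_path_avg (F : 'rV[R]_n * T -> R) : measurable_fun setT F -> measurable_fun setT (path_avg F).
Proof. by move=> mF; exact: (measurable_Ex2 U (measurable_path_integrand mF)). Qed.

Let H (F : 'rV[R]_n * T -> R) (w : TB) (p : T * measurableTypeR R) := F (x + B `|p.2| w, p.1).

Let mH F w : measurable_fun setT F -> measurable_fun setT (H F w).
Proof.
move=> mF.
have g1 := measurable_fun_pair (@measurable_fst _ _ T (measurableTypeR R)) (@measurable_cst _ _ (T * measurableTypeR R)%type TB setT w).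
have g := measurable_fun_pair g1 (@measurable_snd _ _ T (measurableTypeR R)).
exact: (measurableT_comp (measurable_path_integrand mF) g).
Qed.

Let HL2 F w (fF : field F) (s : measurableTypeR R) : L2 P (fun o => H F w (o, s)) :=
  fd_L2 fF (x + B `|s| w).

Let Hb F w c (bc : forall z, Ex P (fun w => F (z, w) ^+ 2) <= c) (s : measurableTypeR R) :
  Ex P (fun o => H F w (o, s) ^+ 2) <= c := bc (x + B `|s| w).

Lemma path_avg_L2_section F : field F ->
  exists c : R, forall w, L2 P (fun o => path_avg F (o, w)) /\
    Ex P (fun o => path_avg F (o, w) ^+ 2) <= c.
Proof.
move=> fF; have [c bc] := fd_bnd fF; exists c => w.
exact: (L2_pmean U (mH w (fd_meas fF)) (HL2 w fF) (Hb w bc)).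
Qed.

Lemma L2_path_avg F : field F -> L2 (pp P PB) (path_avg F).
Proof.
move=> fF; have [c bc] := path_avg_L2_section fF.
have m := measurable_path_avg (fd_meas fF).
have m2 : measurable_fun setT (fun p => path_avg F p ^+ 2) by exact: measurable_funX.
split => //; apply: pp_tonelli2 => //; first by move=> w; exact: (bc w).1.2.
apply: (@L1_bnd _ _ _ PB _ c) => [|w].
  exact: (measurable_Ex1 P (measurableT_comp (@normr_measurable R setT) m2)).
rewrite ger0_norm; last by apply: Ex_ge0 => o; rewrite normr_ge0.
have [[_ l] b] := bc w; apply: le_trans b.
by apply: Ex_le (L1_norm l) l _ => o; rewrite ger0_norm// sqr_ge0.
Qed.

Section covariance.
Variables (F F' : 'rV[R]_n * T -> R) (K : 'rV[R]_n -> R).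
Hypotheses (fF : field F) (fF' : field F') (cK : field_cov F F' K).

Lemma measurable_field_cov : measurable_fun setT K.
Proof.
have E z : K z = Ex P (fun w => F (z, w) * F' (0, w)) by rewrite cK subr0.
rewrite (funext E).
have m : measurable_fun setT (fun p : 'rV[R]_n * T => F p * F' (0, p.2)).
  apply: measurable_funM; first exact: fd_meas fF.
  have m0 : measurable_fun setT (fun _ : 'rV[R]_n * T => (0 : 'rV[R]_n)) by exact: measurable_cst.
  exact: (measurableT_comp (fd_meas fF') (measurable_fun_pair m0 (@measurable_snd _ _ 'rV[R]_n T))).
exact: (measurable_Ex2 P m).
Qed.

Lemma field_cov_bounded : exists C : R, forall z, `|K z| <= C.
Proof.
have [c bc] := fd_bnd fF; have [c' bc'] := fd_bnd fF'.
exists (Num.sqrt c * Num.sqrt c') => z.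
have -> : K z = Ex P (fun w => F (z, w) * F' (0, w)) by rewrite cK subr0.
apply: le_trans (Ex_normM_le (fd_L2 fF z) (fd_L2 fF' 0)) _.
by apply: ler_pM; rewrite ?sqrtr_ge0// ler_wsqrtr.
Qed.

(** Two exchanges of means, each by [pmean_inner], turn the covariance of time averages into a
    double time average of the covariance kernel; the starting point [x] cancels in the difference
    of positions. *)
Lemma cv_path_avg w w' : cv P (path_avg F) (path_avg F') (w, w') = time_avg t0 (Zo B) K (w, w').
Proof.
have [c bc] := fd_bnd fF; have [c' bc'] := fd_bnd fF'.
have [cc lc] := path_avg_L2_section fF.
have [_ E] := pmean_inner U (mH w' (fd_meas fF')) (HL2 w' fF') (Hb w' bc') (lc w).1.
rewrite /cv /= [LHS]E.
have [C bC] := field_cov_bounded.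
have mZ : measurable_fun setT (fun q => Zo B (q, (w, w'))).
  exact: (measurableT_comp (measurable_Zo bm) (measurable_pair2 (w, w'))).
have L : L1 UU (fun q => K (Zo B (q, (w, w')))).
  apply: (@L1_bnd _ _ _ UU _ C) => [|q]; last exact: bC.
  exact: (measurableT_comp measurable_field_cov mZ).
rewrite /time_avg; have [_ ->] := pp_fubini2 L.
apply: eq_Ex => r.
have [_ E2] := pmean_inner U (mH w (fd_meas fF)) (HL2 w fF) (Hb w bc) (fd_L2 fF' (x + B `|r| w')).
rewrite (@eq_Ex _ _ _ P _ (fun o => F' (x + B `|r| w', o) * pmean U (H F w) o)); last first.
  by move=> o; rewrite mulrC.
rewrite E2; apply: eq_Ex => s.
rewrite (@eq_Ex _ _ _ P _ (fun o => F (x + B `|s| w, o) * F' (x + B `|r| w', o))); last first.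
  by move=> o; rewrite mulrC.
by rewrite cK /Zo /=; congr K; rewrite opprD addrACA subrr add0r.
Qed.

(** With both frozen indices equal to [w], the increment [Zo] between two paths becomes the
    increment [Zd] along one path by computation. *)
Lemma Ex_path_avgM w : Ex P (fun o => path_avg F (o, w) * path_avg F' (o, w)) = time_avg t0 (Zd B) K w.
Proof. exact: (cv_path_avg w w). Qed.
End covariance.

Section gaussian.
Variables (I : Type) (Xi : I -> T -> R).
Hypothesis gXi : centered_gaussian_process P Xi.

Lemma gaussian_path_avg F : field F -> (forall z, gauss_cl P Xi (fun w => F (z, w))) ->
  gaussian_family P PB (gauss_cl P Xi) (path_avg F).
Proof.
move=> fF gF; split; [exact: measurable_path_avg (fd_meas fF)| |exact: L2_path_avg].
move=> w; have [c bc] := fd_bnd fF.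
have gH (s : measurableTypeR R) : gauss_cl P Xi (fun o => H F w (o, s)) := gF (x + B `|s| w).
exact: (@gauss_cl_pmean _ _ _ P I Xi gXi _ _ U (H F w) c (mH w (fd_meas fF)) gH (Hb w bc)).
Qed.
End gaussian.

Variable alpha : 'I_n -> R.
Hypothesis al : forall i, 0 < alpha i < 1.
Hypothesis sal : 0 < \sum_(i < n) alpha i < 2.
Hypothesis n0 : (0 < n)%N.
Let gd := good_diag bm al sal n0 t0.

(** Expanding the square gives [K11 - 2 K12 + K22], from which the common kernel [K0] may be
    subtracted termwise since [1 - 2 + 1 = 0]. Closeness of the three kernels to [K0] thus makes the
    averages close before any limit is known to exist. *)
Lemma path_avg_dist F F' K11 K12 K22 K0 C C0 : field F -> field F' ->
  field_cov F F K11 -> field_cov F F' K12 -> field_cov F' F' K22 ->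
  dominated_kernel alpha K11 C -> dominated_kernel alpha K12 C -> dominated_kernel alpha K22 C ->
  dominated_kernel alpha K0 C0 ->
  Ex (pp P PB) (fun p => (path_avg F p - path_avg F' p) ^+ 2) <=
  Ex PB (fun w => `|time_avg t0 (Zd B) K11 w - time_avg t0 (Zd B) K0 w|) +
  2 * Ex PB (fun w => `|time_avg t0 (Zd B) K12 w - time_avg t0 (Zd B) K0 w|) +
  Ex PB (fun w => `|time_avg t0 (Zd B) K22 w - time_avg t0 (Zd B) K0 w|).
Proof.
move=> fF fF' c11 c12 c22 d11 d12 d22 d0.
have [_ l] := L2B (L2_path_avg fF) (L2_path_avg fF').
have [lo ->] := pp_fubini2 l.
have lK K c (d : dominated_kernel alpha K c) := L1_time_avg gd d.
have lN K c (d : dominated_kernel alpha K c) := L1_norm (L1B (lK _ _ d) (lK _ _ d0)).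
have s1 := lN _ _ d11; have s2 := L1Z 2 (lN _ _ d12); have s3 := lN _ _ d22.
rewrite -(ExZ 2 (lN _ _ d12)) -(ExD s1 s2) -(ExD (L1D s1 s2) s3).
apply: Ex_le => //; first by apply: L1D => //; exact: L1D.
move=> w.
have [c bc] := path_avg_L2_section fF; have [c' bc'] := path_avg_L2_section fF'.
have [lw _] := bc w; have [lw' _] := bc' w.
rewrite (@eq_Ex _ _ _ P _ (fun o => path_avg F (o, w) * path_avg F (o, w) +
   (-2) * (path_avg F (o, w) * path_avg F' (o, w)) + path_avg F' (o, w) * path_avg F' (o, w))); last first.
  by move=> o; ring.
have m1 := L2_mul lw lw; have m2 := L1Z (-2) (L2_mul lw lw'); have m3 := L2_mul lw' lw'.
rewrite (ExD (L1D m1 m2) m3) (ExD m1 m2) (ExZ (-2) (L2_mul lw lw')).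
rewrite (Ex_path_avgM fF fF c11) (Ex_path_avgM fF fF' c12) (Ex_path_avgM fF' fF' c22).
move: (time_avg t0 (Zd B) K11 w) (time_avg t0 (Zd B) K12 w) (time_avg t0 (Zd B) K22 w) (time_avg t0 (Zd B) K0 w) => A A' A'' A0.
have := ler_norm (A - A0); have := ler_norm (- (A' - A0)); have := ler_norm (A'' - A0).
by rewrite normrN; lra.
Qed.
End path_averages.

Section junk_integrals.
Context d (T : measurableType d) (R : realType) (mu : {measure set T -> \bar R}).

(* [fine] sends an infinite integral to 0, so the scaling law survives without
   integrability. *)
Lemma Ex_not_L1 (f : T -> R) : measurable_fun setT f -> ~ L1 mu f -> Ex mu f = 0.
Proof.
move=> mf nf; rewrite /Ex /Rintegral.
have [h|] := boolP ((\int[mu]_x (f x)%:E)%E \is a fin_num); last first.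
  by case: (\int[mu]_x (f x)%:E)%E.
exfalso; apply: nf; move: h; rewrite integralE fin_numB => /andP[h1 h2].
have mF : measurable_fun setT (EFin \o f) by exact/measurable_EFinP.
apply/integrableP; split => //.
have -> : (fun x => `|(EFin \o f) x|)%E = ((EFin \o f)^\+ \+ (EFin \o f)^\-)%E by rewrite -fune_abse.
rewrite ge0_integralD//; last 2 first.
- exact: measurable_funepos.
- exact: measurable_funeneg.
rewrite lte_add_pinfty//; rewrite -ge0_fin_numE//; exact: integral_ge0.
Qed.

Lemma ExZ_measurable (c : R) (f : T -> R) : measurable_fun setT f ->
  Ex mu (fun x => c * f x) = c * Ex mu f.
Proof.
move=> mf; have [lf|nf] := pselect (L1 mu f); first exact: ExZ.
rewrite (Ex_not_L1 mf nf) mulr0.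
have [->|c0] := eqVneq c 0; first by under eq_Ex do rewrite mul0r; rewrite Ex0.
apply: Ex_not_L1; first by apply: measurable_funM => //; exact: measurable_cst.
move=> l; apply: nf; have := L1Z c^-1 l.
by under eq_fun do rewrite mulrA mulVf// mul1r.
Qed.
End junk_integrals.

Section path_average_algebra.
Context {R : realType} {n : nat} {dB dT : measure_display}.
Context {TB : measurableType dB} {T : measurableType dT}.
Variables (PB : probability TB R) (P : probability T R) (B : R -> TB -> 'rV[R]_n).
Hypothesis bm : brownian_motion PB B.
Context (t : R) (t0 : 0 < t) (x : 'rV[R]_n).
Local Notation U := (unif t0).

Let mH (F : 'rV[R]_n * T -> R) w : measurable_fun setT F ->
  measurable_fun setT (fun p : T * measurableTypeR R => F (x + B `|p.2| w, p.1)).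
Proof.
move=> mF.
have g1 := measurable_fun_pair (@measurable_fst _ _ T (measurableTypeR R)) (@measurable_cst _ _ (T * measurableTypeR R)%type TB setT w).
have g := measurable_fun_pair g1 (@measurable_snd _ _ T (measurableTypeR R)).
exact: (measurableT_comp (measurable_path_integrand bm x mF) g).
Qed.

Lemma measurable_path_section (F : 'rV[R]_n * T -> R) p : measurable_fun setT F ->
  measurable_fun setT (fun s : measurableTypeR R => F (x + B `|s| p.2, p.1)).
Proof.
move=> mF.
have g := measurable_fun_pair (@measurable_cst _ _ (measurableTypeR R) T setT p.1) (@measurable_id _ (measurableTypeR R) setT).
exact: (measurableT_comp (mH p.2 mF) g).
Qed.

Lemma ae_L1_path (F : 'rV[R]_n * T -> R) w : field P F ->
  {ae P, forall o, L1 U (fun s => F (x + B `|s| w, o))}.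
Proof.
move=> fF; have mF := fd_meas fF; have [c hc] := fd_bnd fF.
have l := L1_sqr_process U (mH w mF) (fun s => fd_L2 fF (x + B `|s| w)) (fun s => hc (x + B `|s| w)).
apply: (ae_impl (L1_ae1 l)) => om lo; apply: L2_L1; split => //.
exact: (measurable_path_section (om, w) mF).
Qed.

(** Additivity may fail at an exceptional [o] where a trajectory is not integrable, so it is stated
    almost everywhere. Scaling in [path_avgZ] holds everywhere, thanks to the default value of the
    integral. *)
Lemma path_avgD (F F1 F2 : 'rV[R]_n * T -> R) w : field P F1 -> field P F2 ->
  (forall p, F p = F1 p + F2 p) ->
  {ae P, forall o, path_avg B t0 x F (o, w) = path_avg B t0 x F1 (o, w) + path_avg B t0 x F2 (o, w)}.
Proof.
move=> f1 f2 e; apply: (ae_impl2 (ae_L1_path w f1) (ae_L1_path w f2)) => om l1 l2.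
by rewrite /path_avg /= -(ExD l1 l2); apply: eq_Ex => s; exact: e.
Qed.

Lemma path_avgZ (c : R) (F : 'rV[R]_n * T -> R) p : measurable_fun setT F ->
  path_avg B t0 x (fun q => c * F q) p = c * path_avg B t0 x F p.
Proof. by move=> mF; exact: (ExZ_measurable U c (measurable_path_section p mF)). Qed.

(** Lebesgue measure on [[0, t]] is [t] times the uniform law; the factor is moved into the field,
    so that all time integrals become means. *)
Lemma path_integralE (F : 'rV[R]_n * T -> R) (p : T * TB) : measurable_fun setT F ->
  \int[lebesgue_measure]_(s in `[0, t]) F (x + B s p.2, p.1) = path_avg B t0 x (fun q => t * F q) p.
Proof.
move=> mF; rewrite Rintegral_mkcond.
have mtF : measurable_fun setT (fun q => t * F q) by apply: measurable_funM => //; exact: measurable_cst.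
have [_ e] := unif_Ex t0 (measurable_path_section p mtF).
rewrite /path_avg [RHS]e /Ex; congr fine; apply: eq_integral => s _; congr EFin.
rewrite patchE /uniform_pdf subr0 mem_setE in_itv /=.
case: ifP => [/andP[s0 _]|_]; last by rewrite mulr0.
by rewrite ger0_norm// mulrC mulrA mulVf ?mul1r ?gt_eqF.
Qed.
End path_average_algebra.

Lemma cvgM_seq (R : realType) (f g : R^nat) (l l' : R) :
  f k @[k --> \oo] --> l -> g k @[k --> \oo] --> l' -> f k * g k @[k --> \oo] --> l * l'.
Proof. by move=> cf cg; exact: cvgM. Qed.

(** * L2 norms, and convergence of frozen variances and covariances *)

Section L2_convergence.
Context d (T : measurableType d) (R : realType) (P : probability T R).

Lemma Lnorm2E (f : T -> R) : L2 P f -> 'N[P]_2%:E[EFin \o f]%E = (Num.sqrt (Ex P (fun w => f w ^+ 2)))%:E.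
Proof.
move=> [mf lf]; rewrite Lnorm.unlock /=.
rewrite (eq_integral (fun w => (f w ^+ 2)%:E)); last first.
  by move=> w _; rewrite /= -real_normK ?num_real// powR_mulrn.
rewrite -(Ex_EFin lf) /= powR12_sqrt//; apply: Ex_ge0 => w; exact: sqr_ge0.
Qed.

Lemma Lfun2P (f : T -> R) : f \in Lfun P 2%:E <-> L2 P f.
Proof.
split=> [h|h].
  split; last exact: Lfun2_integrable_sqr h.
  by move: h; rewrite inE => /andP[]; rewrite inE.
rewrite inE; apply/andP; split; first by rewrite inE; exact: h.1.
by rewrite inE /= /finite_norm; have := Lnorm2E h => /= ->; rewrite ltry.
Qed.

Lemma L2_triangle (f g h : T -> R) : L2 P f -> L2 P g -> L2 P h ->
  Ex P (fun w => (f w - h w) ^+ 2) <=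
  2 * Ex P (fun w => (f w - g w) ^+ 2) + 2 * Ex P (fun w => (g w - h w) ^+ 2).
Proof.
move=> lf lg lh; apply: le_trans (minkowski2 (L2B lf lg) (L2B lg lh)).
by rewrite le_eqVlt; apply/orP; left; apply/eqP; apply: eq_Ex => w; congr (_ ^+ 2); ring.
Qed.

(** By Markov's inequality, the event that every [D k] exceeds [1 / (m + 1)] has probability at most
    [m + 1] times the mean of [D k], for each [k], hence 0. Membership in an L2 closure asks only
    for one good index per tolerance, so no subsequence is extracted. *)
Lemma ae_small_values (D : nat -> T -> R) : (forall k w, 0 <= D k w) -> (forall k, L1 P (D k)) ->
  Ex P (D k) @[k --> \oo] --> 0 -> {ae P, forall w, forall e, 0 < e -> exists k, D k w <= e}.
Proof.
move=> D0 lD cD.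
have key (m : nat) : {ae P, forall w, exists k, D k w <= m.+1%:R^-1}.
  pose A := ~` \bigcup_k [set w | D k w <= m.+1%:R^-1].
  have mA : measurable A.
    apply: measurableC; apply: bigcup_measurable => k _; rewrite -[X in measurable X]setTI.
    by apply: measurable_fun_le => //; exact: L1_meas (lD k).
  exists A; split => //; last first.
    by move=> w /= h [k _ hk]; apply: h; exists k.
  have lA : L1 P (\1_A : T -> R).
    apply: (@L1_bnd _ _ _ P _ 1) => [|w]; first exact: measurable_indic.
    by rewrite indicE ger0_norm// lern1 leq_b1.
  have E : (Ex P (\1_A : T -> R))%:E = P A by rewrite Ex_EFin// integral_indic// setIT.
  rewrite -E; congr EFin; apply/eqP; rewrite eq_le Ex_ge0 ?andbT; last by move=> w; rewrite indicE.
  have le k : Ex P (\1_A : T -> R) <= m.+1%:R * Ex P (D k).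
    rewrite -ExZ//; apply: Ex_le => //; first exact: L1Z.
    move=> w; rewrite indicE; case: (boolP (w \in A)) => [|_]; last by rewrite mulr_ge0.
    rewrite inE => hA; rewrite -ler_pdivrMl ?ltr0n// mulr1 leNgt; apply/negP => h.
    by apply: hA; exists k => //=; exact: ltW.
  have c := cvgZ_seq (c := m.+1%:R) cD; rewrite mulr0 in c.
  rewrite -(cvg_lim _ c)//; apply: limr_ge; first by apply/cvg_ex; exists 0.
  by apply: nearW.
have /ae_foralln h := key.
apply: (ae_impl h) => w hw e e0.
have [m hm] : exists m : nat, m.+1%:R^-1 <= e.
  have e1 : 0 < e^-1 by rewrite invr_gt0.
  exists (Num.bound e^-1); rewrite -[leRHS]invrK lef_pV2 ?posrE//.
  by apply: (le_trans (ltW (archi_boundP (ltW e1)))); rewrite ler_nat.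
by have [k hk] := hw m; exists k; exact: le_trans hm.
Qed.
End L2_convergence.

Section variance_distance.
Context d dD dE (T : measurableType d) (D : measurableType dD) (E : measurableType dE).
Context (R : realType) (P : probability T R) (Q : probability D R) (PE : probability E R).

(** Factor [Y ^ 2 - Y' ^ 2] as a product of difference and sum, then apply Cauchy-Schwarz on the
    product space. *)
Lemma vr_dist (Y Y' : T * D -> R) : L2 (pp P Q) Y -> L2 (pp P Q) Y' ->
  Ex Q (fun u => `|vr P Y u - vr P Y' u|) <=
  Num.sqrt (Ex (pp P Q) (fun p => (Y p - Y' p) ^+ 2)) *
  Num.sqrt (Ex (pp P Q) (fun p => (Y p + Y' p) ^+ 2)).
Proof.
move=> lY lY'; have lm := L2B lY lY'; have lp := L2D lY lY'.
apply: le_trans (cauchy_schwarz_sqrt lm lp).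
have l := L1_norm (L2_mul lm lp).
have [lo ->] := pp_fubini2 l.
apply: Ex_le_ae => //; first by apply: L1_norm; apply: L1B; exact: L1_vr.
apply: (ae_impl2 (L1_ae2 lY.2) (L1_ae2 lY'.2)) => u l1 l2.
rewrite /vr -(ExB l1 l2); apply: (le_trans (Ex_norm (L1B l1 l2))).
by rewrite le_eqVlt; apply/orP; left; apply/eqP; apply: eq_Ex => w; congr `| _ |; ring.
Qed.

(** Cauchy-Schwarz is used in the medium at almost every pair of frozen indices, and then once more
    in each index. *)
Lemma Ex_cv_norm (Y : T * D -> R) (X : T * E -> R) : L2 (pp P Q) Y -> L2 (pp P PE) X ->
  L1 (pp Q PE) (cv P Y X) /\
  Ex (pp Q PE) (fun p => `|cv P Y X p|) <=
  Num.sqrt (Ex (pp P Q) (fun p => Y p ^+ 2)) * Num.sqrt (Ex (pp P PE) (fun p => X p ^+ 2)).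
Proof.
move=> lY lX; have mY := lY.1; have mX := lX.1.
have [lv ev] := pp_fubini2 lY.2; have [lw ew] := pp_fubini2 lX.2.
have sq (u : R) : 0 <= u -> Num.sqrt u ^+ 2 = u by move=> ?; rewrite sqr_sqrtr.
have l2 dU (U : measurableType dU) (PU : probability U R) (Z : T * U -> R) : measurable_fun setT Z ->
    L1 PU (vr P Z) -> L2 PU (fun u => Num.sqrt (vr P Z u)).
  move=> mZ l; split.
    apply: measurableT_comp; last exact: measurable_vr.
    by apply: continuous_measurable_fun; exact: sqrt_continuous.
  by under eq_fun do rewrite sqr_sqrtr ?vr_ge0//.
have lY2 := l2 _ _ Q _ mY lv; have lX2 := l2 _ _ PE _ mX lw.
have lT := pp_tensor (L2_L1 lY2) (L2_L1 lX2).
have mc : measurable_fun setT (cv P Y X) by exact: measurable_cv.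
have b : {ae pp Q PE, forall p, `|cv P Y X p| <= Num.sqrt (vr P Y p.1) * Num.sqrt (vr P X p.2)}.
  apply: ae_product.
    rewrite -[X in measurable X]setTI; apply: measurable_fun_le => //.
      exact: measurableT_comp.
    exact: L1_meas lT.
  apply: (ae_impl (L1_ae2 lY.2)) => u lu; apply: (ae_impl (L1_ae2 lX.2)) => v lv2.
  apply: (@Ex_normM_le _ _ _ P (fun t => Y (t, u)) (fun t => X (t, v))).
    by split => //; exact: measurable_section.
  by split => //; exact: measurable_section.
have lc : L1 (pp Q PE) (cv P Y X) by exact: L1_le_ae mc b lT.
split => //; apply: (le_trans (Ex_le_ae (L1_norm lc) lT b)).
have [_ ->] := pp_fubini1 lT.
rewrite (@eq_Ex _ _ _ Q _ (fun u => Ex PE (fun v => Num.sqrt (vr P X v)) * Num.sqrt (vr P Y u))); last first.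
  by move=> u /=; rewrite mulrC; exact: ExZ (L2_L1 lX2).
rewrite ExZ; last exact: L2_L1.
have le dU (U : measurableType dU) (PU : probability U R) (Z : T * U -> R) :
    L2 PU (fun u => Num.sqrt (vr P Z u)) ->
    0 <= Ex PU (fun u => Num.sqrt (vr P Z u)) /\
    Ex PU (fun u => Num.sqrt (vr P Z u)) <= Num.sqrt (Ex PU (vr P Z)).
  move=> l; have p0 : 0 <= Ex PU (fun u => Num.sqrt (vr P Z u)).
    by apply: Ex_ge0 => u; exact: sqrtr_ge0.
  split => //; rewrite -(ger0_norm p0) -sqrtr_sqr ler_wsqrtr//.
  apply: (le_trans (Ex_sqr_le l)); rewrite le_eqVlt; apply/orP; left; apply/eqP.
  by apply: eq_Ex => u; rewrite sqr_sqrtr ?vr_ge0.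
have [p1 q1] := le _ _ _ _ lY2; have [p2 q2] := le _ _ _ _ lX2.
by rewrite mulrC ev ew; exact: ler_pM.
Qed.

Lemma cv_dist (Y Y' : T * D -> R) (X X' : T * E -> R) :
  L2 (pp P Q) Y -> L2 (pp P Q) Y' -> L2 (pp P PE) X -> L2 (pp P PE) X' ->
  Ex (pp Q PE) (fun p => `|cv P Y X p - cv P Y' X' p|) <=
  Num.sqrt (Ex (pp P Q) (fun p => (Y p - Y' p) ^+ 2)) * Num.sqrt (Ex (pp P PE) (fun p => X p ^+ 2)) +
  Num.sqrt (Ex (pp P Q) (fun p => Y' p ^+ 2)) * Num.sqrt (Ex (pp P PE) (fun p => (X p - X' p) ^+ 2)).
Proof.
move=> lY lY' lX lX'.
have [l1 b1] := Ex_cv_norm (L2B lY lY') lX; have [l2 b2] := Ex_cv_norm lY' (L2B lX lX').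
have [l3 _] := Ex_cv_norm lY lX; have [l4 _] := Ex_cv_norm lY' lX'.
apply: (le_trans _ (lerD b1 b2)); rewrite -ExD; try exact: L1_norm.
apply: Ex_le_ae; [exact: L1_norm (L1B l3 l4)|by apply: L1D; exact: L1_norm|].
apply: ae_product.
  rewrite -[X in measurable X]setTI; apply: measurable_fun_le => //.
    exact: L1_meas (L1_norm (L1B l3 l4)).
  exact: L1_meas (L1D (L1_norm l1) (L1_norm l2)).
apply: (ae_impl2 (L1_ae2 lY.2) (L1_ae2 lY'.2)) => u h1 h2.
apply: (ae_impl2 (L1_ae2 lX.2) (L1_ae2 lX'.2)) => v h3 h4.
have s1 : L2 P (fun t => Y (t, u)) by split => //; exact: measurable_section lY.1.
have s2 : L2 P (fun t => Y' (t, u)) by split => //; exact: measurable_section lY'.1.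
have s3 : L2 P (fun t => X (t, v)) by split => //; exact: measurable_section lX.1.
have s4 : L2 P (fun t => X' (t, v)) by split => //; exact: measurable_section lX'.1.
apply: le_trans (ler_normD _ _); rewrite le_eqVlt; apply/orP; left; apply/eqP; congr `| _ |.
rewrite /cv /= -(ExB (L2_mul s1 s3) (L2_mul s2 s4)) -(ExD (L2_mul (L2B s1 s2) s3) (L2_mul s2 (L2B s3 s4))).
by apply: eq_Ex => t; ring.
Qed.

Lemma cvg_sqrt_seq (u : R^nat) (l : R) : u @ \oo --> l -> Num.sqrt (u k) @[k --> \oo] --> Num.sqrt l.
Proof. by move=> cu; have := continuous_cvg _ (@sqrt_continuous R l) cu; apply. Qed.

Lemma L2_seq_bound (Y_ : (T * D -> R)^nat) (Y : T * D -> R) k : L2 (pp P Q) (Y_ k) -> L2 (pp P Q) Y ->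
  Ex (pp P Q) (fun p => Y_ k p ^+ 2) <=
  2 * Ex (pp P Q) (fun p => (Y_ k p - Y p) ^+ 2) + 2 * Ex (pp P Q) (fun p => Y p ^+ 2).
Proof.
move=> l lY; apply: le_trans (minkowski2 (L2B l lY) lY).
by rewrite le_eqVlt; apply/orP; left; apply/eqP; apply: eq_Ex => w; rewrite subrK.
Qed.

Lemma vr_cvg (Y_ : (T * D -> R)^nat) (Y : T * D -> R) : (forall k, L2 (pp P Q) (Y_ k)) ->
  L2 (pp P Q) Y -> Ex (pp P Q) (fun p => (Y_ k p - Y p) ^+ 2) @[k --> \oo] --> 0 ->
  Ex Q (fun u => `|vr P (Y_ k) u - vr P Y u|) @[k --> \oo] --> 0.
Proof.
move=> lY_ lY c; pose D_ k := Ex (pp P Q) (fun p => (Y_ k p - Y p) ^+ 2).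
pose b := Ex (pp P Q) (fun p => Y p ^+ 2).
have cstR (u : R) : (fun _ : nat => u) @ \oo --> u by exact: cvg_cst.
have c2 := cvgD_seq (cvgZ_seq (c := 4) c) (cstR (6 * b)).
have c3 := cvgM_seq (cvg_sqrt_seq c) (cvg_sqrt_seq c2); rewrite sqrtr0 mul0r in c3.
apply: (@cvg0_le _ _ _ _ _ c3) => k; first by apply: Ex_ge0 => u; exact: normr_ge0.
apply: (le_trans (vr_dist (lY_ k) lY)); apply: ler_wpM2l; first exact: sqrtr_ge0.
apply: ler_wsqrtr; apply: (le_trans (minkowski2 (lY_ k) lY)).
have aux (u v w : R) : u <= 2 * v + 2 * w -> 2 * u + 2 * w <= 4 * v + 6 * w by lra.
exact: aux (L2_seq_bound (lY_ k) lY).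
Qed.
End variance_distance.

Section covariance_limit.
Context d dD (T : measurableType d) (D : measurableType dD).
Context (R : realType) (P : probability T R) (Q : probability D R).

Lemma cv_cvg (Y_ : (T * D -> R)^nat) (Y : T * D -> R) : (forall k, L2 (pp P Q) (Y_ k)) ->
  L2 (pp P Q) Y -> Ex (pp P Q) (fun p => (Y_ k p - Y p) ^+ 2) @[k --> \oo] --> 0 ->
  Ex (pp Q Q) (fun p => `|cv P (Y_ k) (Y_ k) p - cv P Y Y p|) @[k --> \oo] --> 0.
Proof.
move=> lY_ lY c; pose b := Ex (pp P Q) (fun p => Y p ^+ 2).
have cstR (u : R) : (fun _ : nat => u) @ \oo --> u by exact: cvg_cst.
have c2 := cvgD_seq (cvgZ_seq (c := 2) c) (cstR (2 * b)).
have c3 := cvgM_seq (cvg_sqrt_seq c) (cvg_sqrt_seq c2); rewrite sqrtr0 mul0r in c3.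
have c4 := cvgZ_seq (c := Num.sqrt b) (cvg_sqrt_seq c).
have c5 := cvgD_seq c3 c4; rewrite sqrtr0 mulr0 addr0 in c5.
apply: (@cvg0_le _ _ _ _ _ c5) => k; first by apply: Ex_ge0 => u; exact: normr_ge0.
apply: (le_trans (cv_dist (lY_ k) lY (lY_ k) lY)); apply: lerD => //.
apply: ler_wpM2l; first exact: sqrtr_ge0.
by apply: ler_wsqrtr; exact: L2_seq_bound (lY_ k) lY.
Qed.
End covariance_limit.

(** * The noise along a Brownian path *)

Section noise_path_integral.
Context {R : realType} {n : nat} {dB dW : measure_display}.
Context {TB : measurableType dB} {TW : measurableType dW}.
Variables (PB : probability TB R) (PW : probability TW R) (B : R -> TB -> 'rV[R]_n).
Variables (alpha : 'I_n -> R) (W : ('rV[R]_n -> R) -> TW -> R).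
Hypothesis bm : brownian_motion PB B.
Hypothesis nW : gaussian_noise alpha PW W.
Hypothesis al : forall i, 0 < alpha i < 1.
Hypothesis sal : 0 < \sum_(i < n) alpha i < 2.
Hypothesis n0 : (0 < n)%N.
Context (t : R) (t0 : 0 < t) (x : 'rV[R]_n).
Local Notation U := (unif t0).
Local Notation Q := (pp PW PB).
Local Notation leb := (@lebesgue_measure R).
Local Notation Xi := (fun phi : {phi | noise_test alpha phi} => W (sval phi)).
Local Notation G := (gauss_cl PW Xi).
Let gXi := noise_gaussian nW.
Let gG : gaussian_space PW G := gaussian_space_cl gXi.

Lemma gauss_noise phi : noise_test alpha phi -> G (W phi).
Proof. by move=> h; exact: (@gauss_cl_process _ _ _ PW _ Xi gXi (exist _ phi h)). Qed.

Lemma Ex_noiseM phi psi : noise_test alpha phi -> noise_test alpha psi ->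
  (Ex PW (fun w => W phi w * W psi w))%:E = noise_covariance alpha phi psi.
Proof.
move=> h1 h2; rewrite -(noise_cov nW h1 h2) expectation.unlock Ex_EFin//.
by apply: L2_mul; apply: (gs_L2 gG); exact: gauss_noise.
Qed.

(** The factor [t] compensates for the uniform law, so that the path average is the integral over
    [[0, t]]. *)
Definition mollified_noise (eta : R) (p : 'rV[R]_n * TW) : R :=
  t * W (fun y => heat_kernel eta (y - p.1)) p.2.
Local Notation M eta := (path_avg B t0 x (mollified_noise eta)).

Lemma gauss_mollified eta z : 0 < eta -> G (fun w => mollified_noise eta (z, w)).
Proof. by move=> e0; exact: (@gauss_clZ _ _ _ PW _ Xi gXi t _ (gauss_noise (noise_test_hk al z e0))). Qed.

Lemma field_cov_mollified eta eta' : 0 < eta -> 0 < eta' ->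
  field_cov PW (mollified_noise eta) (mollified_noise eta') (fun z => t ^+ 2 * Kap alpha eta eta' z).
Proof.
move=> e0 e0' z z'; have h := noise_test_hk al z e0; have h' := noise_test_hk al z' e0'.
have E := Ex_noiseM h h'; rewrite noise_covariance_hk// in E; case: E => <-.
rewrite -ExZ; last by apply: L2_mul; apply: (gs_L2 gG); exact: gauss_noise.
by apply: eq_Ex => w; rewrite /mollified_noise /=; ring.
Qed.

Lemma field_mollified eta : 0 < eta -> field PW (mollified_noise eta).
Proof.
move=> e0; split.
- exact: (measurable_funM (measurable_cst t) (noise_measurable nW e0)).
- by move=> z; apply: (gs_L2 gG); exact: gauss_mollified.
exists (t ^+ 2 * Kap alpha eta eta 0) => z.
by rewrite -(subrr z) -(field_cov_mollified e0 e0).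
Qed.

Lemma mollified_path_integralE eta (p : TW * TB) : 0 < eta ->
  mollified_path_integral W B t x eta p = M eta p.
Proof.
move=> e0; rewrite -(path_integralE bm t0 x p (noise_measurable nW e0)).
by apply: eq_Rintegral => s _ /=; congr W; apply/funext => y; rewrite opprD addrA.
Qed.

Lemma noise_kernel_dominated : exists2 C : R, 0 <= C & forall eta eta', 0 < eta -> 0 < eta' ->
  dominated_kernel alpha (fun z => t ^+ 2 * Kap alpha eta eta' z) C.
Proof.
have [C C0 hC] := Kap_le_riesz al; exists (t ^+ 2 * C); first by rewrite mulr_ge0// sqr_ge0.
move=> eta eta' e0 e0'; split.
  by apply: measurable_funM; [exact: measurable_cst|exact: measurable_Kap].
move=> z z0; rewrite ger0_norm; last by rewrite mulr_ge0 ?sqr_ge0// Kap_ge0.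
by rewrite -mulrA ler_wpM2l ?sqr_ge0//; exact: hC.
Qed.

Definition noise_kernel (z : 'rV[R]_n) : R := t ^+ 2 * riesz_product alpha z.
Local Notation K0 := noise_kernel.

Lemma dominated_noise_kernel : dominated_kernel alpha K0 (t ^+ 2).
Proof.
split; first by apply: measurable_funM; [exact: measurable_cst|exact: measurable_riesz].
by move=> z _; rewrite ger0_norm// mulr_ge0 ?sqr_ge0// riesz_ge0.
Qed.

Section sequences.
Variables (eta eta' : R^nat).
Hypotheses (e0 : forall k, 0 < eta k) (e0' : forall k, 0 < eta' k).
Hypotheses (ce : eta @ \oo --> 0) (ce' : eta' @ \oo --> 0).

Lemma noise_kernel_cvg d (Om : measurableType d) (P : probability Om R) Z : good_path alpha t0 P Z ->
  Ex P (fun om => `|time_avg t0 Z (fun z => t ^+ 2 * Kap alpha (eta k) (eta' k) z) om - time_avg t0 Z K0 om|)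
  @[k --> \oo] --> 0.
Proof.
move=> gZ; have [C C0 hC] := noise_kernel_dominated.
apply: (@time_avg_cvg _ _ alpha _ t0 _ _ P Z gZ (fun k z => t ^+ 2 * Kap alpha (eta k) (eta' k) z) C K0 (t ^+ 2)).
- by move=> k; exact: hC.
- exact: dominated_noise_kernel.
- by move=> z z0; apply: cvgZ_seq; exact: (Kap_cvg al e0 e0' ce ce' z0).
Qed.
End sequences.

Let gd := good_diag bm al sal n0 t0.
Let go := good_off bm al sal n0 t0.

Lemma mollified_dist_cvg (eta eta' : R^nat) : (forall k, 0 < eta k) -> (forall k, 0 < eta' k) ->
  eta @ \oo --> 0 -> eta' @ \oo --> 0 ->
  Ex Q (fun p => (M (eta k) p - M (eta' k) p) ^+ 2) @[k --> \oo] --> 0.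
Proof.
move=> e0 e0' ce ce'; have [C C0 hC] := noise_kernel_dominated.
have c1 := noise_kernel_cvg e0 e0 ce ce gd; have c2 := noise_kernel_cvg e0 e0' ce ce' gd.
have c3 := noise_kernel_cvg e0' e0' ce' ce' gd.
have c := cvgD_seq (cvgD_seq c1 (cvgZ_seq (c := 2) c2)) c3; rewrite mulr0 !addr0 in c.
apply: (@cvg0_le _ _ _ _ _ c) => k; first by apply: Ex_ge0 => p; exact: sqr_ge0.
have f1 := field_mollified (e0 k); have f2 := field_mollified (e0' k).
exact: (path_avg_dist bm t0 x al sal n0 f1 f2 (field_cov_mollified (e0 k) (e0 k))
  (field_cov_mollified (e0 k) (e0' k)) (field_cov_mollified (e0' k) (e0' k))
  (hC _ _ (e0 k) (e0 k)) (hC _ _ (e0 k) (e0' k)) (hC _ _ (e0' k) (e0' k)) dominated_noise_kernel).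
Qed.

Lemma L2_mollified eta : 0 < eta -> L2 Q (M eta).
Proof. by move=> e0; apply: L2_path_avg => //; exact: field_mollified. Qed.

(** If it failed, bad pairs chosen below [1 / (k + 1)] would give two sequences tending to 0 and
    contradicting [mollified_dist_cvg]. Kernel estimates are thus needed along sequences only. *)
Lemma mollified_cauchy e : 0 < e -> exists2 r, 0 < r & forall eta eta', 0 < eta < r -> 0 < eta' < r ->
  Ex Q (fun p => (M eta p - M eta' p) ^+ 2) <= e.
Proof.
move=> e0; apply: contrapT => h.
have {}h (k : nat) : exists s : R * R, [/\ 0 < s.1 < k.+1%:R^-1, 0 < s.2 < k.+1%:R^-1 &
    e < Ex Q (fun p => (M s.1 p - M s.2 p) ^+ 2)].
  apply: contrapT => /forallNP hk; apply: h; exists k.+1%:R^-1; first by rewrite invr_gt0.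
  move=> u v hu hv; rewrite leNgt; apply/negP => huv; exact: (hk (u, v)).
have [s hs] := choice h.
have c (u : R^nat) : (forall k, 0 < u k < k.+1%:R^-1) -> u @ \oo --> 0.
  move=> hu; apply: (@cvg0_le _ _ (fun k : nat => k.+1%:R^-1)).
  - by move=> k; have /andP[/ltW] := hu k.
  - by move=> k; have /andP[_ /ltW] := hu k.
  - exact: cvg_harmonic.
have e1 k : 0 < (s k).1 by have [/andP[]] := hs k.
have e2 k : 0 < (s k).2 by have [_ /andP[]] := hs k.
have c1 : (fun k => (s k).1) @ \oo --> 0 by apply: c => k; have [] := hs k.
have c2 : (fun k => (s k).2) @ \oo --> 0 by apply: c => k; have [] := hs k.
have /cvgr_lt /(_ e e0) [N _ /(_ N (leqnn N)) /=] := mollified_dist_cvg e1 e2 c1 c2.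
by have [_ _] := hs N => /ltW h1 /lt_geF; rewrite h1.
Qed.

Let eta0 (k : nat) : R := k.+1%:R^-1.
Let eta0_gt0 k : 0 < eta0 k. Proof. by rewrite invr_gt0. Qed.
Let eta0_cvg : eta0 @ \oo --> 0. Proof. exact: cvg_harmonic. Qed.

(** Completeness provides the limit along [1 / (k + 1)], and the Cauchy property extends it to all
    small [eta], since the path integral is defined as a limit along the filter of all [eta > 0]. *)
Lemma mollified_limit : exists X, L2 Q X /\ forall e, 0 < e -> exists2 r, 0 < r & forall eta, 0 < eta < r ->
  Ex Q (fun p => (M eta p - X p) ^+ 2) <= e.
Proof.
have [|X [lX cX]] := @L2_complete _ _ _ Q (fun k => M (eta0 k)) (fun k => L2_mollified (eta0_gt0 k)).
  move=> e e0; have [r r0 hr] := mollified_cauchy e0.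
  have /cvgr_lt /(_ r r0) [N _ hN] := eta0_cvg; exists N => k l Nk Nl.
  by apply: hr; rewrite eta0_gt0 /=; exact: hN.
exists X; split => // e e0; have e4 : 0 < e / 4 by rewrite divr_gt0.
have [r r0 hr] := mollified_cauchy e4; exists r => // eta he.
have /cvgr_lt /(_ r r0) [N _ hN] := eta0_cvg.
have /cvgr_lt /(_ _ e4) [N' _ hN'] := cX.
pose k := maxn N N'; have h1 := hN k (leq_maxl _ _); have /ltW h2 := hN' k (leq_maxr _ _).
have ek : 0 < eta0 k < r by rewrite eta0_gt0.
have h3 := hr _ _ he ek; have /andP[eta_gt0 _] := he.
have lM := L2_mollified eta_gt0; have lk := L2_mollified (eta0_gt0 k).
have aux (a b c u : R) : c <= 2 * a + 2 * b -> a <= u / 4 -> b <= u / 4 -> c <= u by lra.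
exact: (aux _ _ _ _ (L2_triangle lM lk lX) h3 h2).
Qed.

Local Notation path_int := (path_integral PW PB W B t x).

Lemma is_path_integralP X : is_path_integral PW PB W B t x X <-> L2 Q X /\
  Num.sqrt (Ex Q (fun p => (M eta p - X p) ^+ 2)) @[eta --> 0^'+] --> 0.
Proof.
rewrite /is_path_integral; split=> -[].
- move=> /Lfun2P lX c; split => //.
  have/fine_cvgP[_ h] := c; apply: cvg_trans h; apply: near_eq_cvg.
  near=> eta; have e0 : 0 < eta by near: eta; exact: nbhs_right_gt.
  rewrite /=; have := Lnorm2E (L2B (L2_mollified e0) lX).
  rewrite (_ : EFin \o (mollified_path_integral W B t x eta \- X)%R = EFin \o (fun p => M eta p - X p)); last first.
    by apply/funext => p; rewrite /= mollified_path_integralE.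
  by move=> ->.
- move=> lX c; split; first exact/Lfun2P.
  apply: cvg_trans (cvg_EFin _ (f := EFin \o _) c); last by near=> eta.
  apply: near_eq_cvg.
  near=> eta; have e0 : 0 < eta by near: eta; exact: nbhs_right_gt.
  rewrite /=; have := Lnorm2E (L2B (L2_mollified e0) lX).
  rewrite (_ : EFin \o (mollified_path_integral W B t x eta \- X)%R = EFin \o (fun p => M eta p - X p)); last first.
    by apply/funext => p; rewrite /= mollified_path_integralE.
  by move=> ->.
Unshelve. all: by end_near. Qed.

(** Once a limit exists, the choice operator in [path_integral] returns a genuine L2 limit and not
    its default 0. *)
Lemma path_integral_L2 : L2 Q path_int /\
  Ex Q (fun p => (M (eta0 k) p - path_int p) ^+ 2) @[k --> \oo] --> 0.
Proof.
have [X [lX hX]] := mollified_limit.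
have iX : is_path_integral PW PB W B t x X.
  apply/is_path_integralP; split => //; apply/cvgrPdist_le => e e0.
  have e2 : 0 < e ^+ 2 by rewrite exprn_gt0.
  have [r r0 hr] := hX _ e2; near=> eta.
  rewrite sub0r normrN ger0_norm ?sqrtr_ge0// -(gtr0_norm e0) -sqrtr_sqr ler_wsqrtr//; apply: hr.
  by apply/andP; split; near: eta; [exact: nbhs_right_gt|exact: nbhs_right_lt].
have /is_path_integralP[lY cY] : is_path_integral PW PB W B t x path_int.
  by apply: (@xgetPex _ (fun=> 0) [set X | is_path_integral PW PB W B t x X]); exists X.
split => //; apply/cvgrPdist_le => e e0.
have e1 : 0 < Num.sqrt e by rewrite sqrtr_gt0.
have : \forall k \near \oo, Num.sqrt (Ex Q (fun p => (M (eta0 k) p - path_int p) ^+ 2)) < Num.sqrt e.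
  have /cvg_at_rightP/(_ eta0 (conj eta0_gt0 eta0_cvg)) /cvgr_lt /(_ _ e1) := cY.
  by apply: filterS.
apply: filterS => k hk; rewrite sub0r normrN ger0_norm; last by apply: Ex_ge0 => p; exact: sqr_ge0.
by move: hk; rewrite ltr_sqrt// => /ltW.
Unshelve. all: by end_near. Qed.

Let le_cvg0 (a : R) (u : R^nat) : 0 <= a -> (forall k, a <= u k) -> u @ \oo --> 0 -> a = 0.
Proof.
move=> a0 h c; apply/eqP; rewrite eq_le a0 andbT -(cvg_lim _ c)//.
by apply: limr_ge; [apply/cvg_ex; exists 0|exact: nearW].
Qed.

Let Mk k := M (eta0 k).
Let gMk k : gaussian_family PW PB G (Mk k).
Proof.
apply: (gaussian_path_avg bm t0 x gXi); first exact: field_mollified.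
by move=> z; exact: gauss_mollified.
Qed.

(* On a null set of paths the limit chosen in [path_integral] need not be a
   Gaussian variable; [Y] replaces it by 0 there. *)
Lemma path_integral_family : exists Y : TW * TB -> R,
  [/\ gaussian_family PW PB G Y, {ae PB, forall w, forall o, path_int (o, w) = Y (o, w)},
    Ex PB (fun w => `|vr PW Y w - time_avg t0 (Zd B) K0 w|) = 0 &
    Ex (pp PB PB) (fun p => `|cv PW Y Y p - time_avg t0 (Zo B) K0 p|) = 0].
Proof.
have [lY cY] := path_integral_L2.
have lM k : L2 Q (Mk k) by exact: L2_mollified.
have lD k := (L2B (lM k) lY).2.
have cD : Ex PB (fun w => Ex PW (fun o => (Mk k (o, w) - path_int (o, w)) ^+ 2)) @[k --> \oo] --> 0.
  by apply: cvg_trans cY; apply: near_eq_cvg; apply: nearW => k; exact: (pp_fubini2 (lD k)).2.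
have aeD := ae_small_values (fun k w => Ex_ge0 PW (fun o => sqr_ge0 (Mk k (o, w) - path_int (o, w))))
  (fun k => (pp_fubini2 (lD k)).1) cD.
have [N [mN N0 sN]] := ae_impl2 aeD (L1_ae2 lY.2) (fun w h1 h2 => conj h1 h2).
pose Y (p : TW * TB) := \1_(~` N) p.2 * path_int p.
have YN w o : ~ N w -> Y (o, w) = path_int (o, w).
  by move=> h; rewrite /Y /= indicE mem_set// mul1r.
have Y0 w o : N w -> Y (o, w) = 0.
  by move=> h; rewrite /Y /= indicE memNset ?mul0r//= => /(_ h).
have mY : measurable_fun setT Y.
  apply: measurable_funM lY.1.
  exact: (measurableT_comp (measurable_indic (measurableC mN)) (@measurable_snd _ _ TW TB)).
have l : L2 Q Y.
  apply: (L2_le mY _ lY) => p; rewrite /Y indicE normrM ler_piMl//.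
  by case: (_ \in _); rewrite ?normr1 ?normr0.
have aeN : {ae PB, forall w, ~ N w} by exists N; split => // w /= /contrapT.
have aeY : {ae Q, forall p, Y p = path_int p}.
  exists (setT `*` N); split; first exact: measurableX.
    by have h := product_measure1E PW PB measurableT mN; rewrite N0 mule0 in h; exact: h.
  by move=> [om w] /= h; split => //=; apply: contrapT => nN; apply: h; exact: YN.
have cYk : Ex Q (fun p => (Mk k p - Y p) ^+ 2) @[k --> \oo] --> 0.
  apply: cvg_trans cY; apply: near_eq_cvg; apply: nearW => k.
  apply: Ex_ae_eq; [exact: L1_meas (lD k)|exact: L1_meas (L2B (lM k) l).2|].
  by apply: (ae_impl aeY) => p ->.
exists Y; split.
- split => // w; have [Nw|Nw] := pselect (N w).
    by rewrite (_ : (fun o => Y (o, w)) = fun=> 0); [exact: gs_zero gG|apply/funext => o; exact: Y0].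
  rewrite (_ : (fun o => Y (o, w)) = fun o => path_int (o, w)); last by apply/funext => o; exact: YN.
  have [h1 h2] : (forall e, 0 < e -> exists k, Ex PW (fun o => (Mk k (o, w) - path_int (o, w)) ^+ 2) <= e) /\
      L1 PW (fun o => path_int (o, w) ^+ 2) by apply: contrapT => h; apply: Nw; exact: sN.
  apply: (gauss_cl_closed gXi); first by split => //; exact: measurable_section lY.1.
  move=> e e0; have [k hk] := h1 e e0; exists (fun o => Mk k (o, w)); first exact: gf_in (gMk k) w.
  apply: le_trans hk; rewrite le_eqVlt; apply/orP; left; apply/eqP.
  by apply: eq_Ex => o; rewrite -sqrrN opprB.
- by apply: (ae_impl aeN) => w Nw o; rewrite YN.
- have c1 := vr_cvg lM l cYk.
  have c2 := noise_kernel_cvg eta0_gt0 eta0_gt0 eta0_cvg eta0_cvg gd.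
  have c3 := cvgD_seq c1 c2; rewrite addr0 in c3.
  apply: (le_cvg0 _ _ c3) => [|k]; first by apply: Ex_ge0 => w; exact: normr_ge0.
  have e w : vr PW (Mk k) w = time_avg t0 (Zd B) (fun z => t ^+ 2 * Kap alpha (eta0 k) (eta0 k) z) w.
    have f := field_mollified (eta0_gt0 k).
    by rewrite -(Ex_path_avgM bm t0 x f f (field_cov_mollified (eta0_gt0 k) (eta0_gt0 k))); apply: eq_Ex.
  have lv : L1 PB (vr PW (Mk k)) by exact: L1_vr.
  have lv0 : L1 PB (vr PW Y) by exact: L1_vr.
  have lt : L1 PB (time_avg t0 (Zd B) K0) := L1_time_avg gd dominated_noise_kernel.
  rewrite (@eq_Ex _ _ _ PB (fun om => `|time_avg t0 (Zd B) (fun z => t ^+ 2 * Kap alpha (eta0 k) (eta0 k) z) om -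
    time_avg t0 (Zd B) K0 om|) (fun w => `|vr PW (Mk k) w - time_avg t0 (Zd B) K0 w|)); last by move=> w; rewrite e.
  rewrite -(ExD (L1_norm (L1B lv lv0)) (L1_norm (L1B lv lt))).
  apply: Ex_le; [exact: L1_norm (L1B lv0 lt)|exact: (L1D (L1_norm (L1B lv lv0)) (L1_norm (L1B lv lt)))|].
  by move=> w; rewrite (distrC (vr PW (Mk k) w)); exact: ler_distD.
- have c1 := cv_cvg lM l cYk.
  have c2 := noise_kernel_cvg eta0_gt0 eta0_gt0 eta0_cvg eta0_cvg go.
  have c3 := cvgD_seq c1 c2; rewrite addr0 in c3.
  apply: (le_cvg0 _ _ c3) => [|k]; first by apply: Ex_ge0 => w; exact: normr_ge0.
  have e p : cv PW (Mk k) (Mk k) p = time_avg t0 (Zo B) (fun z => t ^+ 2 * Kap alpha (eta0 k) (eta0 k) z) p.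
    have f := field_mollified (eta0_gt0 k).
    by case: p => w w'; exact: (cv_path_avg bm t0 x f f (field_cov_mollified (eta0_gt0 k) (eta0_gt0 k))).
  have lv : L1 (pp PB PB) (cv PW (Mk k) (Mk k)) := (Ex_cv_norm (lM k) (lM k)).1.
  have lv0 : L1 (pp PB PB) (cv PW Y Y) := (Ex_cv_norm l l).1.
  have lt : L1 (pp PB PB) (time_avg t0 (Zo B) K0) := L1_time_avg go dominated_noise_kernel.
  rewrite (@eq_Ex _ _ _ (pp PB PB) (fun om => `|time_avg t0 (Zo B) (fun z => t ^+ 2 * Kap alpha (eta0 k) (eta0 k) z) om -
    time_avg t0 (Zo B) K0 om|) (fun w => `|cv PW (Mk k) (Mk k) w - time_avg t0 (Zo B) K0 w|)); last by move=> w; rewrite e.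
  rewrite -(ExD (L1_norm (L1B lv lv0)) (L1_norm (L1B lv lt))).
  apply: Ex_le; [exact: L1_norm (L1B lv0 lt)|exact: (L1D (L1_norm (L1B lv lv0)) (L1_norm (L1B lv lt)))|].
  by move=> w; rewrite (distrC (cv PW (Mk k) (Mk k) w)); exact: ler_distD.
Qed.
End noise_path_integral.

(** * The random medium and its scaling limit *)

Section stationary_pairs.
Context d (T : measurableType d) (R : realType) (P : probability T R) (n : nat).
Variable g : 'rV[R]_n -> T -> R.
Hypothesis mg : forall z, measurable_fun setT (g z).
Hypothesis sg : stationary P g.

(** Stationarity at the points [z - z'] and 0, with shift [z'], equates the laws of the two pairs on
    rectangles, and rectangles determine a law on the plane. *)
Lemma stationary_pair (h : R * R -> R) z z' : measurable_fun setT h ->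
  Ex P (fun w => h (g z w, g z' w)) = Ex P (fun w => h (g (z - z') w, g 0 w)).
Proof.
move=> mh.
pose Z1 w := (g z w, g z' w); pose Z2 w := (g (z - z') w, g 0 w).
have mZ1 : measurable_fun setT Z1 by exact: measurable_fun_pair.
have mZ2 : measurable_fun setT Z2 by exact: measurable_fun_pair.
pose nu1 := [the measure _ _ of pushforward P Z1]; pose nu2 := [the measure _ _ of pushforward P Z2].
have law A : measurable A -> nu2 mZ2 A = nu1 mZ1 A.
  move=> mA.
  pose rect := [set C : set (R * R) | exists2 A, measurable A & exists2 B, measurable B & A `*` B = C].
  have H C : rect C -> nu2 mZ2 C = nu1 mZ1 C.
    move=> [A1 mA1 [A2 mA2 <-]]; rewrite /nu1 /nu2 /= /pushforward.
    have := @sg 2 (fun j => if j == ord0 then z - z' else 0) z' (fun j => if j == ord0 then A1 else A2).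
    have mm (j : 'I_2) : measurable (if j == ord0 then A1 else A2) by case: ifP.
    move=> /(_ mm) e; apply: esym; move: e.
    have cap (u v : T -> R) (q : 'I_2 -> T -> R) : q ord0 = u -> q ord_max = v ->
        \bigcap_j [set w | (if j == ord0 then A1 else A2) (q j w)] = (fun w => (u w, v w)) @^-1` (A1 `*` A2).
      move=> <- <-; apply/seteqP; split => w /=.
        by move=> h1; split; [exact: (h1 ord0 Logic.I)|exact: (h1 ord_max Logic.I)].
      move=> [h1 h2] j _ /=; case: ifPn => [/eqP->//|].
      by case: j => -[//|[|//]] i _; rewrite (_ : Ordinal i = ord_max)//; exact: val_inj.
    rewrite (cap (g z) (g z') (fun j => g ((if j == ord0 then z - z' else 0) + z'))) /= ?subrK ?add0r//.
    by rewrite (cap (g (z - z')) (g 0) (fun j => g (if j == ord0 then z - z' else 0))).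
  have gen : @measurable _ (R * R)%type = <<s rect >> by exact: measurable_prod_measurableType.
  apply: (@measure_unique _ R (R * R)%type rect (fun=> setT) gen _ _ _ (nu2 mZ2) (nu1 mZ1) H _ A mA).
  - move=> _ _ [A1 mA1 [B1 mB1 <-]] [A2 mA2 [B2 mB2 <-]].
    exists (A1 `&` A2); first exact: measurableI.
    by exists (B1 `&` B2); [exact: measurableI|rewrite setXI].
  - by move=> _; exists setT => //; exists setT => //; exact: setXTT.
  - by rewrite bigcup_const//; exists 0%N.
  - by move=> _; rewrite /nu1 /nu2 /= /pushforward preimage_setT probability_setT ltry.
have e1 := @Ex_image _ _ _ _ _ P (nu2 mZ2) Z1 mZ1 law h mh.
have e2 := @Ex_image _ _ _ _ _ P (nu2 mZ2) Z2 mZ2 (fun _ _ => erefl) h mh.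
by rewrite -[LHS]e1 e2.
Qed.
End stationary_pairs.

Section gaussian_field.
Context d (T : measurableType d) (R : realType) (P : probability T R) (n : nat).
Variable g : 'rV[R]_n -> T -> R.
Hypothesis gg : centered_gaussian_process P g.
Hypothesis sg : stationary P g.
Hypothesis vg : forall x, 'V_P[g x]%E = 1%E.
Local Notation Rg := (autocov P g).

Lemma gaussian_pair a b z z' : centered_normal P (fun w => a * g z w + b * g z' w).
Proof.
have := gg (fun j : 'I_2 => if j == ord0 then a else b) (fun j => if j == ord0 then z else z').
by under eq_fun do rewrite big_ord_recl big_ord1 /=.
Qed.

Lemma gaussian_one z : centered_normal P (g z).
Proof.
have := gaussian_pair 1 0 z z.
by rewrite (_ : (fun _ => _) = g z)//; apply/funext => w; rewrite mul1r mul0r addr0.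
Qed.

Lemma L2_field z : L2 P (g z). Proof. by have [] := centered_normalP (gaussian_one z). Qed.

Lemma measurable_field z : measurable_fun setT (g z). Proof. exact: (L2_field z).1. Qed.

Lemma Ex_field z : Ex P (g z) = 0. Proof. by have [] := centered_normalP (gaussian_one z). Qed.

Lemma Ex_field_sqr z : Ex P (fun w => g z w ^+ 2) = 1.
Proof.
have l := L2_field z; have := vg z; rewrite varianceE; last exact/Lfun2P.
rewrite expectation.unlock -(Ex_EFin (L2_L1 l)) Ex_field expe2 mule0 sube0 => h.
by have := Ex_EFin l.2 => /= e; apply: EFin_inj; rewrite e; exact: h.
Qed.

(** Unit variance excludes the Dirac case of [centered_normal] and forces the standard deviation to
    be 1. *)
Lemma field_law z A : measurable A -> nl 1 A = P (g z @^-1` A).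
Proof.
move=> mA; have [mX [s s0 law]] := gaussian_one z.
have v := Ex_field_sqr z.
have [s00|s1] := eqVneq s 0.
  have ae : {ae P, forall w, g z w = 0}.
    by apply: normal0_ae0 => // A' mA'; rewrite law// s00 eqxx.
  have : Ex P (fun w => g z w ^+ 2) = Ex P (fun=> 0).
    apply: Ex_ae_eq => //; [exact: measurable_funX mX|].
    by apply: (ae_impl ae) => w ->; rewrite expr0n.
  by rewrite v Ex0 => /eqP; rewrite oner_eq0.
move: law; rewrite (negbTE s1) => law.
have m2 : measurable_fun setT (fun x : R => x ^+ 2) by exact: measurable_funX.
have [_ e] := normal_image_Ex mX m2 law; rewrite v Ex_sqr_npdf// in e.
move/esym/eqP: e; rewrite sqrf_eq1 => /orP[|] /eqP s1'; first by rewrite law// s1'.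
by move: s0; rewrite s1' oppr_ge0 ler10.
Qed.

Lemma field_autocov z z' : Ex P (fun w => g z w * g z' w) = Rg (z - z').
Proof.
have mm : measurable_fun setT (fun p : R * R => p.1 * p.2) by exact: measurable_funM.
rewrite (stationary_pair measurable_field sg z z' mm) /= /autocov expectation.unlock.
by apply: eq_Ex => w; rewrite mulrC.
Qed.

Lemma autocov_le1 z : `|Rg z| <= 1.
Proof.
have -> : Rg z = Ex P (fun w => g z w * g 0 w) by rewrite field_autocov subr0.
apply: le_trans (Ex_normM_le (L2_field z) (L2_field 0)) _.
by rewrite !Ex_field_sqr sqrtr1 mulr1.
Qed.

Lemma field_rank_two (F : R -> R) z z' : L2 (nl 1) F -> Ex (nl 1) F = 0 ->
  Ex (nl 1) (fun x => x * F x) = 0 ->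
  `|Ex P (fun w => F (g z w) * F (g z' w))| <= Rg (z - z') ^+ 2 * Ex (nl 1) (fun x => F x ^+ 2).
Proof.
move=> lF F0 F1.
have v a b : Ex P (fun w => (a * g z w + b * g z' w) ^+ 2) = a ^+ 2 + 2 * a * b * Rg (z - z') + b ^+ 2.
  have l1 := (L2_field z).2; have l2 := L2_mul (L2_field z) (L2_field z'); have l3 := (L2_field z').2.
  rewrite (@eq_Ex _ _ _ P _ (fun w => a ^+ 2 * g z w ^+ 2 + (2 * a * b) * (g z w * g z' w) + b ^+ 2 * g z' w ^+ 2)); last first.
    by move=> w; ring.
  rewrite ExD; [|by apply: L1D; exact: L1Z|exact: L1Z].
  by rewrite ExD; [rewrite !ExZ// !Ex_field_sqr field_autocov !mulr1|exact: L1Z|exact: L1Z].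
have hc a b : Ex P (fun w => cos (a * g z w + b * g z' w)) =
    expR (- ((a ^+ 2 + b ^+ 2 + 2 * Rg (z - z') * a * b) / 2)).
  have [_ _ -> _] := centered_normalP (gaussian_pair a b z z').
  by rewrite v; congr (expR (- (_ / 2))); ring.
have hs a b : Ex P (fun w => sin (a * g z w + b * g z' w)) = 0.
  by have [_ _ _ ->] := centered_normalP (gaussian_pair a b z z').
exact: (rank_two_correlation (measurable_field z) (measurable_field z') (@field_law z)
  (@field_law z') (autocov_le1 (z - z')) hc hs lF F0 F1).2.
Qed.
End gaussian_field.

Section hermite_remainder.
Context {R : realType}.

Lemma hermite0E (x : R) : hermite 0 x = 1.
Proof. by rewrite /hermite expr0 mul1r /= -expRD subrr expR0. Qed.

Lemma hermite1E (x : R) : hermite 1 x = x.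
Proof.
have d : is_derive x (1 : R) (fun y : R => expR (- (y ^+ 2 / 2))) (- x * expR (- (x ^+ 2 / 2))).
  apply: (@is_derive_comp_fun R expR (fun y => - (y ^+ 2 / 2)) x (expR (- (x ^+ 2 / 2))) (- x)).
    by apply: is_derive_eq; rewrite !scaler1 /GRing.scale /=; field.
  by rewrite mulrC.
rewrite /hermite expr1 /= derive1E (@derive_val _ _ _ _ _ _ _ d).
have : expR (x ^+ 2 / 2) * expR (- (x ^+ 2 / 2)) = 1 by rewrite -expRD subrr expR0.
move: (expR _) (expR _) => a b ab; transitivity (x * (b * a)); [by ring|by rewrite ab mulr1].
Qed.

Context d (T : measurableType d) (P : probability T R) (n : nat).
Variable g : 'rV[R]_n -> T -> R.
Hypothesis gg : centered_gaussian_process P g.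
Hypothesis sg : stationary P g.
Hypothesis vg : forall x, 'V_P[g x]%E = 1%E.
Variable Phi : R -> R.
Hypothesis hPhi : hermite_rank_one P Phi (g 0).
Local Notation V1 := (hermite_coef P Phi (g 0) 1).

Lemma field_Ex (F : R -> R) z : measurable_fun setT F -> Ex (nl 1) F = Ex P (fun w => F (g z w)).
Proof.
move=> mF.
have mF' : @measurable_fun _ _ (measurableTypeR R) R setT F by exact: mF.
have h := @Ex_image _ _ T (measurableTypeR R) R P (nl 1) (g z) (measurable_field gg z) (@field_law _ _ _ _ _ g gg vg z) F mF'.
exact: h.
Qed.

Lemma L2_Phi : L2 (nl 1) Phi.
Proof.
have [mPhi fin _ _] := hPhi; split => //.
have m2 : measurable_fun setT (fun x : R => Phi x ^+ 2) by exact: measurable_funX.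
have [i _] := nl_Ex 1 m2; apply/i; apply: L1_ge0.
- by apply: measurable_funM => //; exact: measurable_npdf.
- by move=> u; rewrite mulr_ge0 ?npdf_ge0 ?sqr_ge0.
apply: le_lt_trans fin; rewrite le_eqVlt; apply/orP; left; apply/eqP; apply: eq_integral => y _.
rewrite npdfE ?oner_eq0// /normal_peak expr1n mul1r -[pi *+ 2]mulr_natl; congr EFin.
by rewrite mulrC mulrA.
Qed.

(** What is left of [Phi] after its first-order Hermite term; by [remainder_facts] its coefficients
    of order 0 and 1 vanish, as [rank_two_correlation] requires. *)
Definition remainder (x : R) : R := Phi x - V1 * x.

Lemma measurable_Phi : measurable_fun setT Phi. Proof. by have [] := hPhi. Qed.

Lemma remainder_facts : [/\ L2 (nl 1) remainder, Ex (nl 1) remainder = 0 &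
  Ex (nl 1) (fun x => x * remainder x) = 0].
Proof.
have [mPhi _ V0 _] := hPhi; have lP := L2_Phi; have li := @L2_id_gam R.
have mid : measurable_fun setT (fun x : R => x) by exact: measurable_id.
have lR : L2 (nl 1) remainder := L2B lP (L2Z V1 li).
have E1 : Ex (@nl R 1) id = 0 by exact: (etrans (field_Ex 0 mid) (Ex_field gg 0)).
have E2 : Ex (@nl R 1) (fun x => x ^+ 2) = 1.
  have m2 : measurable_fun setT (fun x : R => x ^+ 2) by exact: measurable_funX.
  exact: (etrans (field_Ex 0 m2) (Ex_field_sqr gg vg 0)).
have E3 : Ex (nl 1) Phi = 0.
  apply: (etrans (field_Ex 0 mPhi)); rewrite -V0 /hermite_coef expectation.unlock.
  by apply: eq_Ex => w /=; rewrite hermite0E mulr1.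
have E4 : Ex (nl 1) (fun x => x * Phi x) = V1.
  have mx : measurable_fun setT (fun x : R => x * Phi x) by exact: measurable_funM.
  apply: (etrans (field_Ex 0 mx)); rewrite /hermite_coef expectation.unlock.
  by apply: eq_Ex => w /=; rewrite hermite1E mulrC.
split => //.
- rewrite /remainder (ExB (L2_L1 lP) (L1Z V1 (L2_L1 li))) (ExZ V1 (L2_L1 li)).
  by rewrite E1 E3 mulr0 subrr.
- have l2 : L1 (nl 1) (fun x => x ^+ 2) := li.2.
  rewrite (@eq_Ex _ _ _ (nl 1) _ (fun x => x * Phi x - V1 * x ^+ 2)); last first.
    by move=> x; rewrite /remainder; ring.
  by rewrite (ExB (L2_mul li lP) (L1Z V1 l2)) (ExZ V1 l2) E2 E4 mulr1 subrr.
Qed.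
End hermite_remainder.

Section rescaled_fields.
Context {R : realType} {n : nat} {dT : measure_display} {T : measurableType dT}.
Variables (P : probability T R) (g : 'rV[R]_n -> T -> R).
Hypothesis mg : measurable_fun setT (fun p : 'rV[R]_n * T => g p.1 p.2).
Hypothesis gg : centered_gaussian_process P g.
Hypothesis sg : stationary P g.
Hypothesis vg : forall x, 'V_P[g x]%E = 1%E.
Local Notation Rg := (autocov P g).

Definition rescaled (c r : R) (F : R -> R) (p : 'rV[R]_n * T) : R := c * F (g (r *: p.1) p.2).

Lemma measurable_rescaled c r F : measurable_fun setT F -> measurable_fun setT (rescaled c r F).
Proof.
move=> mF; apply: measurable_funM; first exact: measurable_cst.
apply: (measurableT_comp mF).
have mr : measurable_fun setT (fun p : 'rV[R]_n * T => r *: p.1).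
  apply: measurable_fun_rV => i; under eq_fun do rewrite mxE.
  apply: measurable_funM; first exact: measurable_cst.
  exact: (measurableT_comp (@measurable_rV_coord R n i) (@measurable_fst _ _ 'rV[R]_n T)).
exact: (measurableT_comp mg (measurable_fun_pair mr (@measurable_snd _ _ 'rV[R]_n T))).
Qed.

Lemma field_rescaled c r F : L2 (nl 1) F -> field P (rescaled c r F).
Proof.
move=> lF; have L z := L2_law (measurable_field gg z) (@field_law _ _ _ P _ g gg vg z) lF.
split; first exact: measurable_rescaled lF.1.
  by move=> z; apply: L2Z; exact: (L (r *: z)).1.
exists (c ^+ 2 * Ex (nl 1) (fun u => F u ^+ 2)) => z.
have [l <-] := L (r *: z); rewrite -(ExZ (c ^+ 2) l.2) le_eqVlt; apply/orP; left; apply/eqP.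
by apply: eq_Ex => w; rewrite /rescaled /= exprMn.
Qed.

Lemma field_cov_rescaled_id c r : field_cov P (rescaled c r id) (rescaled c r id)
  (fun z => c ^+ 2 * Rg (r *: z)).
Proof.
move=> z z'; rewrite scalerBr -(field_autocov gg sg).
rewrite -(ExZ _ (L2_mul (L2_field gg (r *: z)) (L2_field gg (r *: z')))).
by apply: eq_Ex => w; rewrite /rescaled /=; ring.
Qed.

(** Stationarity allows the kernel to be defined as the correlation with the value at the origin,
    without a formula for it; bounds come separately from [rem_kernel_bound]. *)
Lemma field_cov_rescaled c r F : measurable_fun setT F ->
  field_cov P (rescaled c r F) (rescaled c r F)
    (fun z => Ex P (fun w => rescaled c r F (z, w) * rescaled c r F (0, w))).
Proof.
move=> mF z z'.
have mh : measurable_fun setT (fun p : R * R => (c * F p.1) * (c * F p.2)).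
  apply: measurable_funM; apply: measurable_funM; try exact: measurable_cst.
  - exact: (measurableT_comp mF measurable_fst).
  - exact: (measurableT_comp mF measurable_snd).
have := stationary_pair (measurable_field gg) sg (r *: z) (r *: z') mh.
by rewrite /rescaled /= -scalerBr scaler0.
Qed.
End rescaled_fields.

(** * Scaling limit of the covariance kernel *)

Section riesz_scaling.
Context {R : realType} {n : nat} (alpha : 'I_n -> R).
Local Notation rho := (riesz_product alpha).
Local Notation a := (\sum_(i < n) alpha i).
Hypothesis a0 : 0 < a.

Lemma powR_sum (I : Type) (s : seq I) (e : R) (u : I -> R) : 0 < e ->
  e `^ (\sum_(i <- s) u i) = \prod_(i <- s) e `^ u i.
Proof.
move=> e0; elim: s => [|i s IH]; first by rewrite !big_nil powRr0.
by rewrite !big_cons powRD ?IH// (gt_eqF e0) implybT.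
Qed.

Lemma riesz_scale (e : R) (z : 'rV[R]_n) : 0 < e -> rho (e^-1 *: z) = e `^ a * rho z.
Proof.
move=> e0; rewrite /riesz_product powR_sum// -big_split /=; apply: eq_bigr => i _.
have i0 : 0 <= e^-1 by rewrite invr_ge0 ltW.
rewrite mxE normrM (ger0_norm i0) powRM//; congr (_ * _).
by rewrite -(powR_inv1 (ltW e0)) -powRrM mulN1r opprK.
Qed.

Lemma riesz_gt0 (z : 'rV[R]_n) : (forall i, z 0 i != 0) -> 0 < rho z.
Proof. by move=> z0; apply: prodr_gt0 => i _; rewrite powR_gt0// normr_gt0. Qed.

Lemma truncated_riesz_le (z : 'rV[R]_n) : (forall i, z 0 i != 0) ->
  0 <= truncated_riesz_product alpha z <= rho z.
Proof.
move=> z0; apply/andP; split.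
  by apply: prodr_ge0 => i _; case: ifP => // _; rewrite le_min ler01 powR_ge0.
apply: ler_prod => i _; rewrite (negbTE (z0 i)) le_min ler01 powR_ge0 /=.
by rewrite ge_min lexx orbT.
Qed.

(** The origin of the exponent in the equation: the covariance of the rescaled potential carries the
    square of [e ^ (- a / 2)], which exactly undoes the factor [e ^ a] of [riesz_scale]. *)
Lemma scale_sqr (e : R) : 0 < e -> (e `^ (- (a / 2))) ^+ 2 * e `^ a = 1.
Proof.
move=> e0; rewrite expr2 -!powRD ?(gt_eqF e0) ?implybT//.
by rewrite (_ : _ + _ = 0) ?powRr0//; field.
Qed.

Variables (K : 'rV[R]_n -> R) (C cd : R).
Hypothesis hC : forall z, `|K z| <= C * truncated_riesz_product alpha z.
Hypothesis cd0 : 0 < cd.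
Hypothesis Kasy : forall delta, 0 < delta -> exists M, forall z : 'rV[R]_n,
  (forall i, M <= `|z 0 i|) -> `|K z / (cd * rho z) - 1| < delta.

Lemma kernel_le_riesz (z : 'rV[R]_n) : (forall i, z 0 i != 0) -> `|K z| <= `|C| * rho z.
Proof.
move=> z0; have /andP[t0 t1] := truncated_riesz_le z0.
apply: (le_trans (hC z)); apply: (le_trans (ler_wpM2r t0 (ler_norm C))).
exact: ler_wpM2l.
Qed.

Lemma scale_neq0 (e : R) (z : 'rV[R]_n) : 0 < e -> (forall i, z 0 i != 0) -> forall i, (e^-1 *: z) 0 i != 0.
Proof. by move=> e0 z0 i; rewrite mxE mulf_neq0 ?invr_eq0// gt_eqF. Qed.

Lemma rescaled_kernel_bound e (z : 'rV[R]_n) : 0 < e -> (forall i, z 0 i != 0) ->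
  (e `^ (- (a / 2))) ^+ 2 * `|K (e^-1 *: z)| <= `|C| * rho z.
Proof.
move=> e0 z0; have h := kernel_le_riesz (scale_neq0 e0 z0).
apply: (le_trans (ler_wpM2l (sqr_ge0 _) h)); rewrite riesz_scale//.
have aux (u v c r : R) : u * v = 1 -> u * (c * (v * r)) = c * r.
  by move=> uv; transitivity ((u * v) * (c * r)); [ring|rewrite uv mul1r].
by rewrite (aux _ _ _ _ (scale_sqr e0)).
Qed.

Variable eps : R^nat.
Hypotheses (e0 : forall k, 0 < eps k) (ce : eps @ \oo --> 0).

Lemma rescaled_kernel_cvg (z : 'rV[R]_n) : (forall i, z 0 i != 0) ->
  (eps k `^ (- (a / 2))) ^+ 2 * K ((eps k)^-1 *: z) @[k --> \oo] --> cd * rho z.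
Proof.
move=> z0; have r0 := riesz_gt0 z0; have c0 : 0 < cd * rho z by rewrite mulr_gt0.
apply/cvgrPdist_lt => e ep; have d0 : 0 < e / (cd * rho z) by rewrite divr_gt0.
have [M hM] := Kasy d0.
(* For a fixed [z] without zero coordinate, dividing by a small [eps k] makes all coordinates large
   at once, as the assumed asymptotics require. *)
have far : \forall k \near \oo, forall i, M <= `|((eps k)^-1 *: z) 0 i|.
  apply: filter_forall => i; have z1 : 0 < `|z 0 i| by rewrite normr_gt0.
  have q0 : 0 < `|z 0 i| / (`|M| + 1) by rewrite divr_gt0// ltr_wpDl.
  move/cvgr_lt : ce => /(_ _ q0); apply: filterS => k hk.
  rewrite mxE normrM gtr0_norm ?invr_gt0// mulrC ler_pdivlMr//.
  rewrite ltr_pdivlMr ?ltr_wpDl// in hk.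
  apply: (le_trans _ (ltW hk)); rewrite mulrC; apply: ler_wpM2l; first exact: ltW.
  by apply: (le_trans (ler_norm M)); rewrite lerDl.
move: far; apply: filterS => k /hM; rewrite riesz_scale// => h.
have s := scale_sqr (e0 k).
have p0 : 0 < eps k `^ a by exact: powR_gt0.
set y := K _ in h *; set sc := _ ^+ 2 in s *.
have -> : cd * rho z - sc * y = - ((cd * rho z) * (y / (cd * (eps k `^ a * rho z)) - 1)).
  have -> : sc = (eps k `^ a)^-1 by apply: (mulIf (lt0r_neq0 p0)); rewrite s mulVf ?gt_eqF.
  by field; rewrite !gt_eqF.
by rewrite normrN normrM gtr0_norm// mulrC -ltr_pdivlMr.
Qed.

(** One factor [K] is compensated by the prefactor; the other contributes the vanishing power
    [eps ^ a]. *)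
Lemma rescaled_square_cvg (z : 'rV[R]_n) : (forall i, z 0 i != 0) ->
  (eps k `^ (- (a / 2))) ^+ 2 * K ((eps k)^-1 *: z) ^+ 2 @[k --> \oo] --> 0.
Proof.
move=> z0; have r0 := ltW (riesz_gt0 z0).
have p : eps k `^ a @[k --> \oo] --> 0.
  by have /cvg_at_rightP h := powR_cvg0 a0; exact: h.
have c := cvgZ_seq (c := (`|C| * rho z) ^+ 2) p; rewrite mulr0 in c.
apply: (@cvg0_le _ _ _ _ _ c) => k; first by rewrite mulr_ge0 ?sqr_ge0.
have h1 := rescaled_kernel_bound (e0 k) z0.
have h2 := kernel_le_riesz (scale_neq0 (e0 k) z0); rewrite riesz_scale// in h2.
rewrite -[K _ ^+ 2]real_normK ?num_real// [X in _ * X]expr2 mulrA.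
apply: (le_trans (ler_pM _ _ h1 h2)) => //; first by rewrite mulr_ge0 ?sqr_ge0.
by rewrite expr2 le_eqVlt; apply/orP; left; apply/eqP; ring.
Qed.
End riesz_scaling.

Section medium.
Context {R : realType} {n : nat} {dT dB : measure_display}.
Context {T : measurableType dT} {TB : measurableType dB}.
Variables (P : probability T R) (PB : probability TB R).
Variables (g : 'rV[R]_n -> T -> R) (B : R -> TB -> 'rV[R]_n) (alpha : 'I_n -> R) (C cd : R) (Phi : R -> R).
Hypothesis mg : measurable_fun setT (fun p : 'rV[R]_n * T => g p.1 p.2).
Hypothesis gg : centered_gaussian_process P g.
Hypothesis sg : stationary P g.
Hypothesis vg : forall x, 'V_P[g x]%E = 1%E.
Hypothesis al : forall i, 0 < alpha i < 1.
Hypothesis sal : 0 < \sum_(i < n) alpha i < 2.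
Hypothesis n0 : (0 < n)%N.
Hypothesis hC : forall z, `|autocov P g z| <= C * truncated_riesz_product alpha z.
Hypothesis cd0 : 0 < cd.
Hypothesis asy : forall delta, 0 < delta -> exists M, forall z : 'rV[R]_n,
  (forall i, M <= `|z 0 i|) -> `|autocov P g z / (cd * riesz_product alpha z) - 1| < delta.
Hypothesis hPhi : hermite_rank_one P Phi (g 0).
Hypothesis bm : brownian_motion PB B.
Context (t : R) (t0 : 0 < t) (x : 'rV[R]_n).
Variable eps : R^nat.
Hypotheses (e0 : forall k, 0 < eps k) (ce : eps @ \oo --> 0).
Local Notation a := (\sum_(i < n) alpha i).
Local Notation rho := (riesz_product alpha).
Local Notation V1 := (hermite_coef P Phi (g 0) 1).
Local Notation sc k := (eps k `^ (- (a / 2))).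
Local Notation Rg := (autocov P g).
Local Notation Rem := (remainder P g Phi).
Local Notation Q := (pp P PB).
Let gd := good_diag bm al sal n0 t0.
Let go := good_off bm al sal n0 t0.
Let a0 : 0 < a. Proof. by case/andP: sal. Qed.
Let R1 := autocov_le1 gg sg vg.

(** The rescaled potential [full_part] is the sum of [linear_part] and [rem_part]; the factor [t]
    compensates for the uniform law of the time. *)
Definition linear_part k := rescaled g (V1 * t * sc k) (eps k)^-1 id.
Definition rem_part k := rescaled g (t * sc k) (eps k)^-1 Rem.
Definition full_part k := rescaled g (t * sc k) (eps k)^-1 Phi.
Local Notation X k := (path_avg B t0 x (linear_part k)).
Local Notation Xfull k := (path_avg B t0 x (full_part k)).

Let fL k : field P (linear_part k). Proof. exact: field_rescaled (L2_id_gam). Qed.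
Let lRem : L2 (nl 1) Rem. Proof. by have [] := remainder_facts gg vg hPhi. Qed.
Let fR k : field P (rem_part k). Proof. exact: field_rescaled lRem. Qed.
Let fF k : field P (full_part k). Proof. by apply: field_rescaled => //; exact: (L2_Phi hPhi). Qed.

Definition linear_kernel k (z : 'rV[R]_n) := (V1 * t * sc k) ^+ 2 * Rg ((eps k)^-1 *: z).
Definition rem_kernel k (z : 'rV[R]_n) := Ex P (fun w => rem_part k (z, w) * rem_part k (0, w)).

Let cL k : field_cov P (linear_part k) (linear_part k) (linear_kernel k).
Proof. exact: field_cov_rescaled_id. Qed.
Let cR k : field_cov P (rem_part k) (rem_part k) (rem_kernel k).
Proof. exact: (field_cov_rescaled gg sg _ _ lRem.1). Qed.

Definition limit_kernel (z : 'rV[R]_n) := V1 ^+ 2 * cd * noise_kernel alpha t z.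

Lemma dominated_limit_kernel : dominated_kernel alpha limit_kernel (V1 ^+ 2 * cd * t ^+ 2).
Proof.
have [m b] := dominated_noise_kernel alpha t; split.
  by apply: measurable_funM m; exact: measurable_cst.
have p : 0 <= V1 ^+ 2 * cd by rewrite mulr_ge0 ?sqr_ge0// ltW.
move=> z z0; rewrite normrM (ger0_norm p) -mulrA; exact: ler_wpM2l (b z z0).
Qed.

Lemma dominated_linear_kernel k : dominated_kernel alpha (linear_kernel k) (V1 ^+ 2 * t ^+ 2 * `|C|).
Proof.
split; first exact: measurable_field_cov (fL k) (fL k) (cL k).
move=> z z0; have h := rescaled_kernel_bound hC (e0 k) z0.
have p : 0 <= V1 ^+ 2 * t ^+ 2 by rewrite mulr_ge0 ?sqr_ge0.
have q : 0 <= V1 ^+ 2 * t ^+ 2 * sc k ^+ 2 by rewrite mulr_ge0 ?sqr_ge0.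
rewrite /linear_kernel !exprMn normrM (ger0_norm q).
by rewrite -[leRHS]mulrA -[leLHS]mulrA; exact: ler_wpM2l.
Qed.

Lemma linear_kernel_cvg (z : 'rV[R]_n) : (forall i, z 0 i != 0) -> linear_kernel k z @[k --> \oo] --> limit_kernel z.
Proof.
move=> z0; have c := rescaled_kernel_cvg cd0 asy e0 ce z0.
apply: eq_cvg_seq (cvgZ_seq (c := V1 ^+ 2 * t ^+ 2) c) => [k|].
  by rewrite /linear_kernel; ring.
by rewrite /limit_kernel /noise_kernel; ring.
Qed.

Let c2 := Ex (nl 1) (fun u => Rem u ^+ 2).
Let c20 : 0 <= c2. Proof. by apply: Ex_ge0 => u; exact: sqr_ge0. Qed.

Lemma rem_kernel_bound k z : `|rem_kernel k z| <= t ^+ 2 * c2 * (sc k ^+ 2 * Rg ((eps k)^-1 *: z) ^+ 2).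
Proof.
have [_ r0 r1] := remainder_facts gg vg hPhi.
have h := field_rank_two gg sg vg ((eps k)^-1 *: z) 0 lRem r0 r1; rewrite subr0 in h.
have l : L1 P (fun w => Rem (g ((eps k)^-1 *: z) w) * Rem (g 0 w)).
  have L y := (L2_law (measurable_field gg y) (@field_law _ _ _ P _ g gg vg y) lRem).1.
  exact: L2_mul (L _) (L _).
have -> : rem_kernel k z = (t * sc k) ^+ 2 * Ex P (fun w => Rem (g ((eps k)^-1 *: z) w) * Rem (g 0 w)).
  by rewrite -(ExZ _ l); apply: eq_Ex => w; rewrite /rem_part /rescaled /= scaler0; ring.
rewrite normrM ger0_norm ?sqr_ge0//; apply: (le_trans (ler_wpM2l (sqr_ge0 _) h)).
by rewrite le_eqVlt; apply/orP; left; apply/eqP; rewrite /c2; ring.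
Qed.

(** For domination, one factor of [Rg ^ 2] is discarded because correlations are at most 1 in
    absolute value; both factors are kept for the limit in [rem_kernel_cvg]. *)
Lemma dominated_rem_kernel k : dominated_kernel alpha (rem_kernel k) (t ^+ 2 * c2 * `|C|).
Proof.
split; first exact: measurable_field_cov (fR k) (fR k) (cR k).
move=> z z0; have h := rescaled_kernel_bound hC (e0 k) z0.
apply: (le_trans (rem_kernel_bound k z)); rewrite -[leRHS]mulrA.
apply: ler_wpM2l; first by rewrite mulr_ge0 ?sqr_ge0.
apply: le_trans h; apply: ler_wpM2l; first exact: sqr_ge0.
rewrite -real_normK ?num_real// expr2 ler_piMr//; exact: R1.
Qed.

Lemma rem_kernel_cvg (z : 'rV[R]_n) : (forall i, z 0 i != 0) -> rem_kernel k z @[k --> \oo] --> 0.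
Proof.
move=> z0; have c := rescaled_square_cvg a0 hC e0 ce z0.
have c' := cvgZ_seq (c := t ^+ 2 * c2) c; rewrite mulr0 in c'.
apply/norm_cvg0P; apply: (@cvg0_le _ _ _ _ _ c') => k; first exact: normr_ge0.
exact: rem_kernel_bound.
Qed.

(** The squared distance is the mean over paths of the variance of the remainder, that is, of a
    double time average of [rem_kernel] along one path; domination and pointwise convergence send it
    to 0. *)
Lemma remainder_vanishes : Ex Q (fun p => (Xfull k p - X k p) ^+ 2) @[k --> \oo] --> 0.
Proof.
have d0 : dominated_kernel alpha (fun _ : 'rV[R]_n => 0 : R) 0.
  by split => [|z _]; [exact: measurable_cst|rewrite normr0 mul0r].
have c := time_avg_cvg gd dominated_rem_kernel d0 rem_kernel_cvg.
apply: cvg_trans c; apply: near_eq_cvg; apply: nearW => k.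
have l := (L2B (L2_path_avg bm t0 x (fF k)) (L2_path_avg bm t0 x (fL k))).2.
have [_ ->] := pp_fubini2 l; apply: eq_Ex => w.
have -> : time_avg t0 (Zd B) (fun=> 0 : R) w = 0 by exact: Ex0.
rewrite subr0.
rewrite -(Ex_path_avgM bm t0 x (fR k) (fR k) (cR k)).
have [c hc] := path_avg_L2_section bm t0 x (fR k); have [lw _] := hc w.
have -> : Ex P (fun o => path_avg B t0 x (rem_part k) (o, w) * path_avg B t0 x (rem_part k) (o, w)) =
    Ex P (fun o => path_avg B t0 x (rem_part k) (o, w) ^+ 2) by [].
rewrite ger0_norm; last by apply: Ex_ge0 => o; exact: sqr_ge0.
apply: Ex_ae_eq.
- by apply: measurable_funX; exact: lw.1.
- have [c' hc'] := path_avg_L2_section bm t0 x (fF k); have [c'' hc''] := path_avg_L2_section bm t0 x (fL k).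
  exact: L1_meas (L2B (hc' w).1 (hc'' w).1).2.
have e p : full_part k p = linear_part k p + rem_part k p.
  by rewrite /full_part /linear_part /rem_part /rescaled /remainder /=; ring.
apply: (ae_impl (path_avgD bm t0 x w (fL k) (fR k) e)) => om ->.
by congr (_ ^+ 2); ring.
Qed.

Section limit.
Context {dW : measure_display} {TW : measurableType dW} (PW : probability TW R).
Variables (G2 : set (TW -> R)) (Y : TW * TB -> R).
Hypothesis gZ : forall (c : R) f, G2 f -> G2 (fun w => c * f w).
Hypothesis gY : gaussian_family PW PB G2 Y.
Hypothesis vY : Ex PB (fun w => `|vr PW Y w - time_avg t0 (Zd B) (noise_kernel alpha t) w|) = 0.
Hypothesis cY : Ex (pp PB PB) (fun p => `|cv PW Y Y p - time_avg t0 (Zo B) (noise_kernel alpha t) p|) = 0.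

Definition limit_path (p : TW * TB) : R := V1 * Num.sqrt cd * Y p.

Let gLP : gaussian_family PW PB G2 limit_path.
Proof.
split; first by apply: measurable_funM (gf_meas gY); exact: measurable_cst.
- by move=> w; apply: gZ; exact: gf_in gY w.
- exact: L2Z (gf_L2 gY).
Qed.

Let gX k : gaussian_family P PB (gauss_cl P g) (X k).
Proof.
apply: (gaussian_path_avg bm t0 x gg (fL k)) => z.
exact: (@gauss_clZ _ _ _ P _ g gg (V1 * t * sc k) _ (@gauss_cl_process _ _ _ P _ g gg ((eps k)^-1 *: z))).
Qed.

Let lam2 : (V1 * Num.sqrt cd) ^+ 2 = V1 ^+ 2 * cd.
Proof. by rewrite exprMn sqr_sqrtr// ltW. Qed.

Let limit_avg d (Om : measurableType d) (Z : (measurableTypeR R * measurableTypeR R) * Om -> 'rV[R]_n) om :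
  measurable_fun setT Z ->
  time_avg t0 Z limit_kernel om = V1 ^+ 2 * cd * time_avg t0 Z (noise_kernel alpha t) om.
Proof.
move=> mZ; rewrite /time_avg -ExZ_measurable//.
have m := measurableT_comp mZ (measurable_pair2 om).
exact: (measurableT_comp (dominated_noise_kernel alpha t).1 m).
Qed.

(** The limit is first obtained with [v], while [w] is at L1 distance 0 from it; the triangle
    inequality replaces one by the other without handling null sets. *)
Let cvg_L1 d (Om : measurableType d) (Pr : probability Om R) (u : (Om -> R)^nat) (v w : Om -> R) (c : R) :
  (forall k, L1 Pr (u k)) -> L1 Pr v -> L1 Pr w ->
  Ex Pr (fun om => `|u k om - c * v om|) @[k --> \oo] --> 0 ->
  Ex Pr (fun om => `|w om - v om|) = 0 ->
  Ex Pr (fun om => `|u k om - c * w om|) @[k --> \oo] --> 0.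
Proof.
move=> lu lv lw h e; have lc := L1Z c lv; have lcw := L1Z c lw.
apply: (@cvg0_le _ _ _ _ _ h) => k; first by apply: Ex_ge0 => om; exact: normr_ge0.
have l1 := L1_norm (L1B (lu k) lc); have l2 := L1_norm (L1B lw lv).
have -> : Ex Pr (fun om => `|u k om - c * v om|) =
    Ex Pr (fun om => `|u k om - c * v om| + `|c| * `|w om - v om|).
  by rewrite (ExD l1 (L1Z `|c| l2)) (ExZ _ l2) e mulr0 addr0.
apply: Ex_le; [exact: L1_norm (L1B (lu k) lcw)|exact: L1D l1 (L1Z _ l2)|].
move=> om; rewrite -normrM.
have -> : u k om - c * w om = (u k om - c * v om) - c * (w om - v om) by ring.
exact: ler_normB.
Qed.

(** At a frozen path, the variance of the linear phase is the time average of [linear_kernel] and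
    that of the limit is [V1 ^ 2 cd] times the one of the noise. Kernels converge along a single
    path here, and along two independent paths in [cvg_cov_limit]. *)
Lemma cvg_family_limit : cvg_family P PW (gauss_cl P g) G2 PB (fun k => X k) limit_path.
Proof.
split; [exact: gX|exact: gLP|].
have lX k : L1 PB (vr P (X k)) := L1_vr (gf_L2 (gX k)).
have c := time_avg_cvg gd dominated_linear_kernel dominated_limit_kernel linear_kernel_cvg.
have lt : L1 PB (time_avg t0 (Zd B) (noise_kernel alpha t)) := L1_time_avg gd (dominated_noise_kernel alpha t).
have h := @cvg_L1 _ _ PB (fun k => vr P (X k)) _ (vr PW Y) (V1 ^+ 2 * cd) lX lt (L1_vr (gf_L2 gY)) _ vY.
apply: eq_cvg_seq (h _) => [k||].
- apply: eq_Ex => w; congr `|_ - _|; rewrite /vr -ExZ_measurable; last first.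
    by apply: measurable_funX; exact: measurable_section (gf_meas gY).
  by apply: eq_Ex => o; rewrite /limit_path exprMn lam2.
- by [].
apply: eq_cvg_seq c => [k|//]; apply: eq_Ex => w.
rewrite limit_avg; last exact: (measurable_Zd bm).
by rewrite -(Ex_path_avgM bm t0 x (fL k) (fL k) (cL k)).
Qed.

Lemma cvg_cov_limit : cvg_cov P PW PB PB (fun k => X k) limit_path (fun k => X k) limit_path.
Proof.
have lX k : L1 (pp PB PB) (cv P (X k) (X k)) := (Ex_cv_norm (gf_L2 (gX k)) (gf_L2 (gX k))).1.
have lY : L1 (pp PB PB) (cv PW Y Y) := (Ex_cv_norm (gf_L2 gY) (gf_L2 gY)).1.
have c := time_avg_cvg go dominated_linear_kernel dominated_limit_kernel linear_kernel_cvg.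
have lt : L1 (pp PB PB) (time_avg t0 (Zo B) (noise_kernel alpha t)) := L1_time_avg go (dominated_noise_kernel alpha t).
have h := @cvg_L1 _ _ (pp PB PB) (fun k => cv P (X k) (X k)) _ (cv PW Y Y) (V1 ^+ 2 * cd) lX lt lY _ cY.
apply: eq_cvg_seq (h _) => [k||].
- apply: eq_Ex => -[u v]; congr `|_ - _|; rewrite /cv /= -ExZ_measurable; last first.
    by apply: measurable_funM; exact: measurable_section (gf_meas gY).
  by apply: eq_Ex => o; rewrite /limit_path -lam2; ring.
- by [].
apply: eq_cvg_seq c => [k|//]; apply: eq_Ex => -[u v].
rewrite limit_avg; last exact: (measurable_Zo bm).
by rewrite -(cv_path_avg bm t0 x (fL k) (fL k) (cL k)).
Qed.
End limit.
End medium.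

(** * Conclusion *)

Section continuity.
Context {R : realType}.

Lemma complex_modulus_le (x y e : R) : `|x| < e / 2 -> `|y| < e / 2 -> `|Complex x y| < (e%:C)%C.
Proof.
move=> hx hy; have e0 : 0 <= e / 2 by rewrite ltW// (le_lt_trans _ hx).
rewrite normc_def ltcE /= eqxx /=; have -> : e = Num.sqrt (e ^+ 2).
  by rewrite sqrtr_sqr ger0_norm//; lra.
have q u : `|u| < e / 2 -> u ^+ 2 < (e / 2) ^+ 2.
  by move=> h; rewrite -real_normK ?num_real// ltr_pXn2r// nnegrE.
have := q _ hx; have := q _ hy; have := sqr_ge0 (e / 2).
have e1 : 0 < e by have := le_lt_trans (normr_ge0 x) hx; lra.
rewrite ltr_sqrt ?exprn_gt0//.
rewrite [in e ^+ 2](splitr e); move: (e / 2) (x ^+ 2) (y ^+ 2) => u v w h1 h2 h3.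
have -> : (u + u) ^+ 2 = u ^+ 2 + u ^+ 2 + (u ^+ 2 + u ^+ 2) by ring.
lra.
Qed.

Lemma continuous_complex_fun (h : R[i]^o -> R) : continuous h ->
  forall x y e : R, 0 < e -> exists2 r : R, 0 < r & forall x' y', `|x - x'| < r -> `|y - y'| < r ->
    `|h (Complex x y) - h (Complex x' y')| <= e.
Proof.
move=> ch x y e e0; have /cvgrPdist_le /(_ _ e0) := ch (Complex x y).
move=> /nbhs_ballP[r /= r0 hr]; have : 0 < complex.Re r by move: r0; rewrite ltcE => /andP[].
have rE : r = ((complex.Re r)%:C)%C.
  by move: r0; rewrite ltcE => /andP[/eqP /= i0 _]; case: r i0 {hr} => a b /= ->.
move=> q0; exists (complex.Re r / 2); first by rewrite divr_gt0.
move=> x' y' hx hy; apply: hr; rewrite -ball_normE /= rE.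
exact: (complex_modulus_le hx hy).
Qed.

Lemma continuous_rV_complex n (f : 'rV[R]_n -> R[i]^o) : continuous f ->
  forall (x : 'rV[R]_n) (e : R), 0 < e -> exists2 r : R, 0 < r & forall y : 'rV[R]_n, (forall i, `|x 0 i - y 0 i| < r) ->
    `|f x - f y : R[i]| <= (e%:C)%C.
Proof.
move=> cf x e e0; have e1 : 0 < (e%:C)%C :> R[i] by rewrite ltcE /= eqxx.
have /cvgrPdist_le /(_ _ e1) := cf x.
move=> /nbhs_ballP[r /= r0 hr]; exists r => // y hy; apply: hr; split => // i j.
by rewrite (ord1 i) -ball_normE /=.
Qed.

Definition grid n (m : nat) (x : 'rV[R]_n) : 'rV[R]_n :=
  \row_i ((Num.floor (m.+1%:R * x 0 i))%:~R / m.+1%:R).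

Lemma grid_dist n m (x : 'rV[R]_n) i : `|x 0 i - grid m x 0 i| <= m.+1%:R^-1.
Proof.
rewrite mxE; set k := Num.floor _; have := floor_itv (m.+1%:R * x 0 i); rewrite -/k intrD => /andP[h1 h2].
have m0 : (0 : R) < m.+1%:R by rewrite ltr0n.
have -> : x 0 i - k%:~R / m.+1%:R = (m.+1%:R * x 0 i - k%:~R) / m.+1%:R by field; rewrite gt_eqF.
rewrite normrM [X in _ * X]gtr0_norm ?invr_gt0// ler_piMl ?invr_ge0 ?ltW//.
rewrite ger0_norm; lra.
Qed.

(* The grid takes countably many values and its fibres are boxes. *)
Lemma measurable_grid n m (F : 'rV[R]_n -> R) : measurable_fun setT (F \o grid m).
Proof.
move=> _ Y mY; rewrite setTI.
pose pt (q : 'rV[int]_n) : 'rV[R]_n := \row_i ((q 0 i)%:~R / m.+1%:R).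
pose fib (q : 'rV[int]_n) := [set x : 'rV[R]_n | Y (F (pt q)) /\ forall i, Num.floor (m.+1%:R * x 0 i) = q 0 i].
have -> : (F \o grid m) @^-1` Y = \bigcup_q fib q.
  apply/seteqP; split => x /=.
    move=> h; exists (\row_i Num.floor (m.+1%:R * x 0 i)) => //; split; last by move=> i; rewrite mxE.
    by rewrite (_ : pt _ = grid m x)//; apply/rowP => i; rewrite !mxE.
  move=> [q _ [h e]]; rewrite (_ : grid m x = pt q)//.
  by apply/rowP => i; rewrite !mxE e.
apply: countable_bigcupT_measurable => [|q]; first exact: countableP.
have [h|h] := pselect (Y (F (pt q))); last first.
  by rewrite (_ : fib q = set0) -?subset0// => x /= [].
pose A i := [set u : R | Num.floor (m.+1%:R * u) = q 0 i].
have mA i : measurable (A i).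
  have -> : A i = (fun u => m.+1%:R * u) @^-1` `[(q 0 i)%:~R, (q 0 i + 1)%:~R[%classic.
    apply/seteqP; split => u /=; rewrite in_itv /=; first by rewrite /A /= => <-; exact: floor_itv.
    exact: floor_def.
  rewrite -[X in measurable X]setTI; apply: measurable_funM => //; exact: measurable_cst.
rewrite (_ : fib q = [set x : 'rV[R]_n | forall i, A i (x 0 i)]); first exact: measurable_rV_box.
by apply/seteqP; split => x /=; [case|].
Qed.

(** The sigma-algebra is generated by the coordinates, so measurability of a continuous function has
    to be derived: it is the pointwise limit of its compositions with roundings to a grid. *)
Lemma measurable_rV_continuous n (F : 'rV[R]_n -> R) :
  (forall (x : 'rV[R]_n) e, 0 < e -> exists2 r, 0 < r & forall y : 'rV[R]_n, (forall i, `|x 0 i - y 0 i| < r) ->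
    `|F x - F y| <= e) -> measurable_fun setT F.
Proof.
move=> cF; apply: (@measurable_fun_cvg _ _ _ _ (fun m => F \o grid m)) => [m|x _]; first exact: measurable_grid.
apply/cvgrPdist_le => e e0; have [r r0 hr] := cF x e e0.
have h : (fun m : nat => m.+1%:R^-1 : R) @ \oo --> 0 by exact: cvg_harmonic.
move/cvgr_lt : h => /(_ _ r0); apply: filterS => m hm; apply: hr => i.
exact: le_lt_trans (grid_dist m x i) hm.
Qed.

Lemma bounded_continuous_complex n (f : 'rV[R]_n -> R[i]^o) : continuous f ->
  (exists M, forall x, `|f x| <= M) ->
  [/\ measurable_fun setT (fun x => complex.Re (f x)), measurable_fun setT (fun x => complex.Im (f x)) &
    exists2 M : R, 0 < M & forall x, `|complex.Re (f x)| <= M /\ `|complex.Im (f x)| <= M].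
Proof.
move=> cf [M hM].
have re (z : R[i]) : `|complex.Re z| <= complex.Re `|z|.
  by have := normc_ge_Re z; rewrite lecE => /andP[].
have im (z : R[i]) : `|complex.Im z| <= complex.Re `|z|.
  rewrite normc_def /= -sqrtr_sqr ler_wsqrtr// lerDr; exact: sqr_ge0.
have c (u : R[i] -> R) : (forall z, `|u z| <= complex.Re `|z|) -> (forall z w, u (z - w) = u z - u w) ->
    measurable_fun setT (fun x => u (f x)).
  move=> hu lu; apply: measurable_rV_continuous => x e e0.
  have [r r0 hr] := continuous_rV_complex cf x e0; exists r => // y /hr.
  by rewrite lecE -lu => /andP[_]; exact: le_trans.
split.
- by apply: (c (@complex.Re R) re) => -[? ?] [? ?].
- by apply: (c (@complex.Im R) im) => -[? ?] [? ?].
exists (Num.max 1 (complex.Re M)); first by rewrite lt_max ltr01.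
move=> x; have := hM x; rewrite lecE => /andP[_ h].
by split; rewrite le_max; apply/orP; right; [exact: le_trans (re _) h|exact: le_trans (im _) h].
Qed.
End continuity.

(** * From the linear phase to the full phase *)

Section monomials.
Context {R : realType} (N : R) (N0 : 0 <= N).

Lemma pow_lipschitz p : exists2 c : R, 0 <= c & forall u u', `|u| <= N -> `|u'| <= N ->
  `|u ^+ p - u' ^+ p| <= c * `|u - u'|.
Proof.
elim: p => [|p [c c0 hc]]; first by exists 0 => // u u' _ _; rewrite !expr0 subrr normr0 mul0r.
exists (N * c + N ^+ p); first by rewrite addr_ge0 ?mulr_ge0 ?exprn_ge0.
move=> u u' hu hu'; have -> : u ^+ p.+1 - u' ^+ p.+1 = u * (u ^+ p - u' ^+ p) + (u - u') * u' ^+ p.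
  by rewrite !exprS; ring.
apply: (le_trans (ler_normD _ _)); rewrite [leRHS]mulrDl !normrM; apply: lerD.
  by rewrite -mulrA; apply: ler_pM => //; exact: hc.
rewrite mulrC; apply: ler_wpM2r => //; rewrite normrX; exact: lerXn2r.
Qed.

(** Carries convergence of moments from the linear phase to the full phase, whose trigonometric
    means are bounded and close in L1. *)
Lemma monomial_lipschitz p q : exists2 c : R, 0 <= c & forall u u' v v', `|u| <= N -> `|u'| <= N ->
  `|v| <= N -> `|v'| <= N -> `|u ^+ p * v ^+ q - u' ^+ p * v' ^+ q| <= c * (`|u - u'| + `|v - v'|).
Proof.
have [c c0 hc] := pow_lipschitz p; have [c' c0' hc'] := pow_lipschitz q.
have Np k : 0 <= N ^+ k by exact: exprn_ge0.
exists (c * N ^+ q + N ^+ p * c'); first by rewrite addr_ge0 ?mulr_ge0.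
move=> u u' v v' hu hu' hv hv'.
have -> : u ^+ p * v ^+ q - u' ^+ p * v' ^+ q = u ^+ p * (v ^+ q - v' ^+ q) + (u ^+ p - u' ^+ p) * v' ^+ q.
  by ring.
have X (k : nat) w : `|w| <= N -> `|w ^+ k| <= N ^+ k by move=> hw; rewrite normrX; exact: lerXn2r.
have h1 : `|u ^+ p * (v ^+ q - v' ^+ q)| <= N ^+ p * (c' * `|v - v'|).
  by rewrite normrM; apply: ler_pM => //; [exact: X|exact: hc'].
have h2 : `|(u ^+ p - u' ^+ p) * v' ^+ q| <= (c * `|u - u'|) * N ^+ q.
  by rewrite normrM; apply: ler_pM => //; [exact: hc|exact: X].
apply: (le_trans (ler_normD _ _)); apply: (le_trans (lerD h1 h2)).
have g1 : 0 <= c * N ^+ q * `|v - v'| by rewrite !mulr_ge0.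
have g2 : 0 <= N ^+ p * c' * `|u - u'| by rewrite !mulr_ge0.
move: (N ^+ p) (N ^+ q) (`|u - u'|) (`|v - v'|) g1 g2 => a b r s; clear; lra.
Qed.
End monomials.

Section trig_mean_distance.
Context d dD (T : measurableType d) (D : measurableType dD).
Context (R : realType) (P : probability T R) (Q : probability D R).

Lemma trig_mean_le (Y : T * D -> R) (A B : D -> R) (M : R) t : measurable_fun setT Y ->
  measurable_fun setT A -> measurable_fun setT B -> (forall u, `|A u| <= M) -> (forall u, `|B u| <= M) ->
  `|trig_mean Q Y (A, B) t| <= 2 * M.
Proof.
move=> mY mA mB hA hB.
have [m _] := trig_integrand_bound mY (conj mA (ex_intro _ M hA)) (conj mB (ex_intro _ M hB)).
apply: Ex_norm_cst; first exact: (measurable_sectionr t m).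
move=> u /=; apply: (le_trans (ler_normD _ _)); rewrite !normrM.
have h1 : `|A u| * `|cos (Y (t, u))| <= M.
  by apply: (le_trans _ (hA u)); rewrite ler_piMr// cos_max.
have h2 : `|B u| * `|sin (Y (t, u))| <= M.
  by apply: (le_trans _ (hB u)); rewrite ler_piMr// sin_max.
by move: h1 h2; lra.
Qed.

(** Cosine and sine are 1-Lipschitz, so the distance is at most [2 M] times the L1 distance of the
    phases, itself at most their L2 distance. *)
Lemma Ex_trig_mean_dist (Y Y' : T * D -> R) (A B : D -> R) (M : R) : L2 (pp P Q) Y -> L2 (pp P Q) Y' ->
  measurable_fun setT A -> measurable_fun setT B -> (forall u, `|A u| <= M) -> (forall u, `|B u| <= M) ->
  Ex P (fun t => `|trig_mean Q Y (A, B) t - trig_mean Q Y' (A, B) t|) <=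
  2 * M * Num.sqrt (Ex (pp P Q) (fun p => (Y p - Y' p) ^+ 2)).
Proof.
move=> lY lY' mA mB hA hB; have mY := lY.1; have mY' := lY'.1.
have bA : bounded_mfun A by split => //; exists M.
have bB : bounded_mfun B by split => //; exists M.
have M0 : 0 <= M by apply: le_trans (hA point).
have [m1 [N1 b1]] := trig_integrand_bound mY bA bB; have [m2 [N2 b2]] := trig_integrand_bound mY' bA bB.
have l := L1_norm (L2_L1 (L2B lY lY')); have lM := L1Z (2 * M) l.
have [lo e] := pp_fubini1 lM.
have [mt1 [K1 k1]] := trig_mean_bound Q mY bA bB; have [mt2 [K2 k2]] := trig_mean_bound Q mY' bA bB.
have lt1 : L1 P (trig_mean Q Y (A, B)) by exact: (@L1_bnd _ _ _ P _ K1).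
have lt2 : L1 P (trig_mean Q Y' (A, B)) by exact: (@L1_bnd _ _ _ P _ K2).
apply: (le_trans _ (ler_wpM2l _ (Ex_norm_sqrt (L2B lY lY')))); last by rewrite mulr_ge0.
rewrite -(ExZ (2 * M) l) e; apply: (Ex_le_ae (L1_norm (L1B lt1 lt2)) lo).
apply: (ae_impl (L1_ae1 lM)) => t lt.
have s1 : L1 Q (fun u => A u * cos (Y (t, u)) + B u * sin (Y (t, u))).
  by apply: (@L1_bnd _ _ _ Q _ N1) => [|u]; [exact: (measurable_sectionr t m1)|exact: (b1 (t, u))].
have s2 : L1 Q (fun u => A u * cos (Y' (t, u)) + B u * sin (Y' (t, u))).
  by apply: (@L1_bnd _ _ _ Q _ N2) => [|u]; [exact: (measurable_sectionr t m2)|exact: (b2 (t, u))].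
rewrite /trig_mean /= -(ExB s1 s2); apply: (Ex_norm_le (L1B s1 s2) lt) => u.
have -> : A u * cos (Y (t, u)) + B u * sin (Y (t, u)) - (A u * cos (Y' (t, u)) + B u * sin (Y' (t, u))) =
    A u * (cos (Y (t, u)) - cos (Y' (t, u))) + B u * (sin (Y (t, u)) - sin (Y' (t, u))) by ring.
apply: (le_trans (ler_normD _ _)); rewrite !normrM.
have h1 := ler_pM (normr_ge0 _) (normr_ge0 _) (hA u) (lipschitz_cos (Y (t, u)) (Y' (t, u))).
have h2 := ler_pM (normr_ge0 _) (normr_ge0 _) (hB u) (lipschitz_sin (Y (t, u)) (Y' (t, u))).
apply: (le_trans (lerD h1 h2)); rewrite le_eqVlt; apply/orP; left; apply/eqP; ring.
Qed.
End trig_mean_distance.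

Section moments_limit.
Context d1 d2 dE (T1 : measurableType d1) (T2 : measurableType d2) (E : measurableType dE).
Context (R : realType) (P1 : probability T1 R) (P2 : probability T2 R) (PE : probability E R).
Variables (G1 : set (T1 -> R)) (G2 : set (T2 -> R)).
Hypotheses (gG1 : gaussian_space P1 G1) (gG2 : gaussian_space P2 G2).
Variables (X : (T1 * E -> R)^nat) (X0 : T2 * E -> R).
Hypotheses (fX : cvg_family P1 P2 G1 G2 PE X X0) (cX : cvg_cov P1 P2 PE PE X X0 X X0).
Variable Xf : (T1 * E -> R)^nat.
Hypotheses (lXf : forall k, L2 (pp P1 PE) (Xf k)).
Hypothesis dX : Ex (pp P1 PE) (fun p => (Xf k p - X k p) ^+ 2) @[k --> \oo] --> 0.
Variables (A B : E -> R) (M : R).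
Hypotheses (mA : measurable_fun setT A) (mB : measurable_fun setT B).
Hypotheses (M0 : 0 < M) (hA : forall u, `|A u| <= M) (hB : forall u, `|B u| <= M).

Let NB u : `|- B u| <= M. Proof. by rewrite normrN. Qed.
Let mNB : measurable_fun setT (fun u => - B u). Proof. exact: measurableT_comp. Qed.
Let c1 := (A, fun u => - B u).
Let c2 := (B, A).
Let bA : bounded_mfun A. Proof. by split => //; exists M. Qed.
Let bB : bounded_mfun B. Proof. by split => //; exists M. Qed.
Let bNB : bounded_mfun (fun u => - B u). Proof. by split => //; exists M. Qed.

Lemma prod_nseq2 (T : Type) (F : T -> R) p q (u v : T) :
  \prod_(c <- nseq p u ++ nseq q v) F c = F u ^+ p * F v ^+ q.
Proof.
have h k w : \prod_(c <- nseq k w) F c = F w ^+ k.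
  by elim: k => [|k IH]; rewrite ?big_nil// big_cons IH exprS.
by rewrite big_cat /= !h.
Qed.

(** For the linear phase, the product of [p] real and [q] imaginary parts converges by the replica
    argument; replacing it by the full phase changes the mean by at most a multiple of the L2 norm
    of the remainder. *)
Lemma trig_moments_cvg p q :
  Ex P1 (fun t => trig_mean PE (Xf k) c1 t ^+ p * trig_mean PE (Xf k) c2 t ^+ q) @[k --> \oo] -->
  Ex P2 (fun t => trig_mean PE X0 c1 t ^+ p * trig_mean PE X0 c2 t ^+ q).
Proof.
have lX k : L2 (pp P1 PE) (X k) := gf_L2 (cf_fam fX k).
have base := @cvg_Ex_prod_trig_mean _ _ _ _ _ _ _ P1 P2 PE G1 G2 gG1 gG2 X X0 fX cX (nseq p c1 ++ nseq q c2).
have {}base := base _.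
have base' : Ex P1 (fun t => trig_mean PE (X k) c1 t ^+ p * trig_mean PE (X k) c2 t ^+ q) @[k --> \oo] -->
    Ex P2 (fun t => trig_mean PE X0 c1 t ^+ p * trig_mean PE X0 c2 t ^+ q).
  apply: eq_cvg_seq (base _) => [k||i].
  - by apply: eq_Ex => t; rewrite prod_nseq2.
  - by apply: eq_Ex => t; rewrite prod_nseq2.
  rewrite size_cat !size_nseq nth_cat size_nseq !nth_nseq => h.
  have bc1 : bounded_pair c1 by []. have bc2 : bounded_pair c2 by [].
  case: ifP => // ip; rewrite ifT//.
  by rewrite -(ltn_add2l p) subnKC// leqNgt ip.
have N0 : 0 <= 2 * M by rewrite mulr_ge0// ltW.
have [c c0 hc] := monomial_lipschitz N0 p q.
pose D k := Num.sqrt (Ex (pp P1 PE) (fun z => (Xf k z - X k z) ^+ 2)).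
have cD : (2 * c * (2 * M)) * D k @[k --> \oo] --> 0.
  by have := cvgZ_seq (c := 2 * c * (2 * M)) (cvg_sqrt0 dX); rewrite mulr0; apply.
pose m (Z : T1 * E -> R) t := trig_mean PE Z c1 t ^+ p * trig_mean PE Z c2 t ^+ q.
have tb d (T : measurableType d) Z : measurable_fun setT Z -> [/\ measurable_fun setT (@trig_mean _ _ T _ _ PE Z c1), measurable_fun setT (trig_mean PE Z c2),
    (forall t, `|trig_mean PE Z c1 t| <= 2 * M) & (forall t, `|trig_mean PE Z c2 t| <= 2 * M)].
  move=> mZ; have [m1 _] := trig_mean_bound PE mZ bA bNB; have [m2 _] := trig_mean_bound PE mZ bB bA.
  by split => // t; exact: trig_mean_le.
have lm Z : measurable_fun setT Z -> L1 P1 (m Z).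
  move=> /tb[m1 m2 h1 h2]; apply: (@L1_bnd _ _ _ P1 _ ((2 * M) ^+ p * (2 * M) ^+ q)) => [|t].
    by apply: measurable_funM; exact: measurable_funX.
  by rewrite normrM !normrX ler_pM ?exprn_ge0// lerXn2r// nnegrE.
have bnd k : `|Ex P1 (m (Xf k)) - Ex P1 (m (X k))| <= (2 * c * (2 * M)) * D k.
  have [m1 m2 h1 h2] := tb _ _ _ (lXf k).1; have [n1 n2 g1 g2] := tb _ _ _ (lX k).1.
  have l1 := lm _ (lXf k).1; have l2 := lm _ (lX k).1.
  have L (Z : T1 -> R) : measurable_fun setT Z -> (forall t, `|Z t| <= 2 * M) -> L1 P1 Z.
    by move=> mZ hZ; exact: (@L1_bnd _ _ _ P1 _ (2 * M)).
  have k1 := L1_norm (L1B (L _ m1 h1) (L _ n1 g1)); have k2 := L1_norm (L1B (L _ m2 h2) (L _ n2 g2)).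
  rewrite -(ExB l1 l2); apply: (le_trans (Ex_norm_le (L1B l1 l2) (L1Z c (L1D k1 k2)) _)).
    by move=> t; exact: hc.
  rewrite (ExZ _ (L1D k1 k2)) (ExD k1 k2).
  have e1 := Ex_trig_mean_dist (lXf k) (lX k) mA mNB hA NB.
  have e2 := Ex_trig_mean_dist (lXf k) (lX k) mB mA hB hA.
  have aux (u v w r s : R) : 0 <= u -> v <= r * s -> w <= r * s -> u * (v + w) <= 2 * u * r * s.
    move=> u0 v1 w1; apply: (le_trans (ler_wpM2l u0 (lerD v1 w1))).
    by rewrite le_eqVlt; apply/orP; left; apply/eqP; ring.
  exact: aux c0 e1 e2.
have z : (Ex P1 (m (Xf k)) - Ex P1 (m (X k))) @[k --> \oo] --> 0.
  by apply/norm_cvg0P; apply: (@cvg0_le _ _ _ _ _ cD).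
apply: eq_cvg_seq (cvgD_seq z base') => [k|]; last by rewrite add0r.
by rewrite /m subrK.
Qed.

Lemma trig_pair_cvg (h : R -> R -> R) K : (forall x y, `|h x y| <= K) ->
  (forall x y e, 0 < e -> exists2 r, 0 < r & forall x' y', `|x - x'| < r -> `|y - y'| < r ->
     `|h x y - h x' y'| <= e) ->
  Ex P1 (fun t => h (trig_mean PE (Xf k) c1 t) (trig_mean PE (Xf k) c2 t)) @[k --> \oo] -->
  Ex P2 (fun t => h (trig_mean PE X0 c1 t) (trig_mean PE X0 c2 t)).
Proof.
have tb d (T : measurableType d) Z : measurable_fun setT Z ->
    [/\ measurable_fun setT (@trig_mean _ _ T _ _ PE Z c1), measurable_fun setT (@trig_mean _ _ T _ _ PE Z c2),
    (forall t, `|trig_mean PE Z c1 t| <= 2 * M) & (forall t, `|trig_mean PE Z c2 t| <= 2 * M)].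
  move=> mZ; have [m1 _] := trig_mean_bound PE mZ bA bNB; have [m2 _] := trig_mean_bound PE mZ bB bA.
  by split => // t; exact: trig_mean_le.
have m0 := gf_meas (cf_fam0 fX).
have [u1 u2 u3 u4] := tb _ _ _ m0.
apply: (@moment_cvg _ _ _ _ _ P1 P2 (fun k => trig_mean PE (Xf k) c1) (fun k => trig_mean PE (Xf k) c2)
  (trig_mean PE X0 c1) (trig_mean PE X0 c2) (2 * M)).
- by move=> k; have [] := tb _ _ _ (lXf k).1.
- by move=> k; have [] := tb _ _ _ (lXf k).1.
- exact: u1.
- exact: u2.
- by move=> k; have [] := tb _ _ _ (lXf k).1.
- by move=> k; have [] := tb _ _ _ (lXf k).1.
- exact: u3.
- exact: u4.
- exact: trig_moments_cvg.
- by rewrite mulr_gt0.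
Qed.
End moments_limit.

Lemma measurable_pair_continuous d (T : measurableType d) (R : realType) (h : R -> R -> R) (U V : T -> R) :
  (forall x y e, 0 < e -> exists2 r, 0 < r & forall x' y', `|x - x'| < r -> `|y - y'| < r ->
     `|h x y - h x' y'| <= e) ->
  measurable_fun setT U -> measurable_fun setT V -> measurable_fun setT (fun t => h (U t) (V t)).
Proof.
move=> ch mU mV; pose F (z : 'rV[R]_2) := h (z 0 ord0) (z 0 ord_max).
pose Z t : 'rV[R]_2 := \row_i if i == ord0 then U t else V t.
have mF : measurable_fun setT F.
  apply: measurable_rV_continuous => z e e0; have [r r0 hr] := ch (z 0 ord0) (z 0 ord_max) e e0.
  by exists r => // y hy; apply: hr; exact: hy.
have mZ : measurable_fun setT Z.
  apply: measurable_fun_rV => i; rewrite (_ : (fun w => Z w 0 i) = if i == ord0 then U else V).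
    by case: ifP.
  by apply/funext => w; rewrite mxE; case: ifP.
rewrite (_ : (fun t => _) = F \o Z); first exact: measurableT_comp.
by apply/funext => t; rewrite /F /= !mxE.
Qed.

Theorem theorem2p11 (R : realType) (n : nat)
    (dg dB dW : measure_display)
    (Tg : measurableType dg) (TB : measurableType dB) (TW : measurableType dW)
    (Pg : probability Tg R) (PB : probability TB R) (PW : probability TW R)
    (g : 'rV[R]_n -> Tg -> R)
    (alpha : 'I_n -> R) (C cd : R) (Phi : R -> R)
    (f : 'rV[R]_n -> R[i]^o)
    (B : R -> TB -> 'rV[R]_n)
    (W : ('rV[R]_n -> R) -> TW -> R) :
  (3 <= n)%N ->
  measurable_fun setT (fun p : 'rV[R]_n * Tg => g p.1 p.2) ->
  centered_gaussian_process Pg g ->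
  stationary Pg g ->
  (forall x, 'V_Pg[g x]%E = 1%E) ->
  (forall i, 0 < alpha i < 1) ->
  0 < \sum_(i < n) alpha i < 2 ->
  (forall z, `|autocov Pg g z| <= C * truncated_riesz_product alpha z) ->
  0 < cd ->
  (forall delta, 0 < delta -> exists M, forall z : 'rV[R]_n,
     (forall i, M <= `|z 0 i|) ->
     `|autocov Pg g z / (cd * riesz_product alpha z) - 1| < delta) ->
  hermite_rank_one Pg Phi (g 0) ->
  continuous f -> (exists M, forall x, `|f x| <= M) ->
  brownian_motion PB B ->
  gaussian_noise alpha PW W ->
  forall (t : R) (x : 'rV[R]_n), 0 < t ->
  cvg_in_distribution Pg PW
    (fun eps wg =>
       u_eps PB B f (\sum_(i < n) alpha i) eps (fun y => Phi (g y wg)) t x)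
    0^'+
    (u_spde PB B f PW W (hermite_coef Pg Phi (g 0) 1 * Num.sqrt cd) t x).
Proof.
move=> n3 mg gg sg vg al sal hC cd0 asy hPhi cf bf bm nW t x t0 h ch [K hK].
have n0 : (0 < n)%N by exact: leq_trans n3.
have [mRe mIm [M M0 hM]] := bounded_continuous_complex cf bf.
have mBt : measurable_fun setT (fun w => x + B t w).
  apply: measurable_fun_rV => i; under eq_fun do rewrite mxE.
  apply: measurable_funD; first exact: measurable_cst.
  exact: (measurableT_comp (@measurable_rV_coord R n i) (bm_measurable bm (ltW t0))).
pose A w := complex.Re (f (x + B t w)); pose D w := complex.Im (f (x + B t w)).
have mA : measurable_fun setT A by exact: (measurableT_comp mRe mBt).
have mD : measurable_fun setT D by exact: (measurableT_comp mIm mBt).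
have hA w : `|A w| <= M by exact: (hM _).1.
have hD w : `|D w| <= M by exact: (hM _).2.
pose a := \sum_(i < n) alpha i.
have [Y [gY eY vY cY]] := path_integral_family bm nW al sal n0 t0 x.
have lY := gf_L2 gY.
have [lP _] := path_integral_L2 bm nW al sal n0 t0 x.
pose lam := hermite_coef Pg Phi (g 0) 1 * Num.sqrt cd.
pose Z := limit_path Pg g cd Phi Y.
(* The phase of [u_eps] written as a path average: the prefactor and the length [t] of the time
   interval are moved into the rescaled field. *)
pose Xf (e : R) := path_avg B t0 x (rescaled g (t * e `^ (- (a / 2))) e^-1 Phi).
have mPhi := measurable_Phi hPhi.
have expiE (u v th : R) : complex.Re (Complex u v * expi th) = u * cos th + - v * sin th /\
    complex.Im (Complex u v * expi th) = v * cos th + u * sin th.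
  by split; rewrite /= ?mulNr// addrC.
have uE e o : u_eps PB B f a e (fun y => Phi (g y o)) t x =
    Complex (trig_mean PB (Xf e) (A, fun w => - D w) o) (trig_mean PB (Xf e) (D, A) o).
  have phase w : e `^ (- (a / 2)) * \int[lebesgue_measure]_(s in `[0, t]) Phi (g (e^-1 *: (x + B s w)) o) = Xf e (o, w).
    have m1 := measurable_rescaled mg 1 e^-1 mPhi.
    rewrite (_ : \int[_]_(s in _) _ = \int[lebesgue_measure]_(s in `[0, t]) rescaled g 1 e^-1 Phi (x + B s w, o)); last first.
      by apply: eq_Rintegral => s _; rewrite /rescaled mul1r.
    rewrite (path_integralE bm t0 x (o, w) m1) -(path_avgZ bm t0 x); last first.
      by apply: measurable_funM => //; exact: measurable_cst.
    by apply: eq_Ex => s; rewrite /rescaled /=; ring.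
  rewrite /u_eps /complex_expectation expectation.unlock; congr Complex; apply: eq_Ex => w;
    rewrite phase /A /D /=; case: (f _) => u v; have [e1 e2] := expiE u v (Xf e (o, w)).
  - exact: e1.
  - exact: e2.
(* For almost every path, [Y] equals the chosen path integral simultaneously for all [o]; the
   identity therefore holds at every realization of the noise. *)
have vE o : u_spde PB B f PW W lam t x o =
    Complex (trig_mean PB Z (A, fun w => - D w) o) (trig_mean PB Z (D, A) o).
  have mp := measurable_funM (measurable_cst lam) (measurable_sectionr o lP.1).
  have mZ := measurable_funM (measurable_cst lam) (measurable_sectionr o lY.1).
  have mc := measurableT_comp (@measurable_cosR R) mp; have ms := measurableT_comp (@measurable_sinR R) mp.
  have mc' := measurableT_comp (@measurable_cosR R) mZ; have ms' := measurableT_comp (@measurable_sinR R) mZ.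
  rewrite /u_spde /complex_expectation expectation.unlock; congr Complex.
    transitivity (Ex PB (fun w => A w * cos (lam * path_integral PW PB W B t x (o, w)) + - D w * sin (lam * path_integral PW PB W B t x (o, w)))).
      by apply: eq_Ex => w; rewrite /A /D /=; case: (f _) => u v; exact: (expiE u v _).1.
    apply: Ex_ae_eq.
    - by apply: measurable_funD; apply: measurable_funM => //; exact: measurableT_comp.
    - by apply: measurable_funD; apply: measurable_funM => //; exact: measurableT_comp.
    - by apply: (ae_impl eY) => w ->.
  transitivity (Ex PB (fun w => D w * cos (lam * path_integral PW PB W B t x (o, w)) + A w * sin (lam * path_integral PW PB W B t x (o, w)))).
    by apply: eq_Ex => w; rewrite /A /D /=; case: (f _) => u v; exact: (expiE u v _).2.
  apply: Ex_ae_eq.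
  - by apply: measurable_funD; apply: measurable_funM.
  - by apply: measurable_funD; apply: measurable_funM.
  - by apply: (ae_impl eY) => w ->.
have hc := continuous_complex_fun ch.
pose h2 u v := h (Complex u v).
(* The expectations in the definition of convergence are extended reals; boundedness of the test
   function makes them finite and equal to [Ex]. *)
have EE d (T : measurableType d) (P : probability T R) (F : T * TB -> R) (u : T -> R[i]) : measurable_fun setT F ->
    (forall o, u o = Complex (trig_mean PB F (A, fun w => - D w) o) (trig_mean PB F (D, A) o)) ->
    'E_P[h \o u]%E = (Ex P (fun o => h2 (trig_mean PB F (A, fun w => - D w) o) (trig_mean PB F (D, A) o)))%:E.
  move=> mF e; have bA : bounded_mfun A by split => //; exists M.
  have bD : bounded_mfun D by split => //; exists M.
  have bN : bounded_mfun (fun w => - D w) by split; [exact: measurableT_comp|exists M => w; rewrite normrN].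
  have [m1 _] := trig_mean_bound PB mF bA bN; have [m2 _] := trig_mean_bound PB mF bD bA.
  rewrite expectation.unlock Ex_EFin; first by apply: eq_integral => o _; rewrite /= e.
  apply: (@L1_bnd _ _ _ P _ K) => [|o]; last exact: hK.
  exact: (measurable_pair_continuous hc m1 m2).
have mZ : measurable_fun setT Z.
  by apply: measurable_funM lY.1; exact: measurable_cst.
rewrite (EE _ _ _ _ _ mZ vE).
have mX e : measurable_fun setT (Xf e).
  exact: (measurable_path_avg bm t0 x (measurable_rescaled mg _ _ mPhi)).
rewrite (_ : (fun e => _) = EFin \o (fun e => Ex Pg (fun o => h2 (trig_mean PB (Xf e) (A, fun w => - D w) o) (trig_mean PB (Xf e) (D, A) o)))); last first.
  by apply/funext => e; rewrite /= (EE _ _ Pg _ _ (mX e) (uE e)).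
apply: cvg_EFin; first exact: nearW.
(* The limit from the right at 0 is checked along arbitrary positive sequences, for which dominated
   convergence is available. *)
apply/cvg_at_rightP => eps [e0 ce].
have gZ (c : R) f' : gauss_cl PW _ f' -> _ := @gauss_clZ _ _ _ PW _ _ (noise_gaussian nW) c f'.
have fX := cvg_family_limit Phi mg gg sg vg al sal n0 hC cd0 asy bm x e0 ce gZ gY vY.
have cX := cvg_cov_limit Phi mg gg sg vg al sal n0 hC cd0 asy bm x e0 ce gY cY.
have dX := remainder_vanishes mg gg sg vg al sal n0 hC hPhi bm t0 x e0 ce.
have lXf k : L2 (pp Pg PB) (Xf (eps k)).
  by apply: (L2_path_avg bm t0 x); apply: field_rescaled => //; exact: (L2_Phi hPhi).
exact: (trig_pair_cvg (gaussian_space_cl gg) (gaussian_space_cl (noise_gaussian nW)) fX cX lXf dX mA mD M0 hA hD (fun u v => hK _) hc).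
Qed.
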